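(* Let $\kappa$ be a weakly compact cardinal, let $f:\kappa\to\kappa$ be any partial function whose domain is unbounded in $\kappa$, and let $G$ be $V$-generic for the lottery preparation of $\kappa$ relative to $f$. Then $\kappa$ is weakly compact in $V[G]$.
   Context: The lottery sum of a collection $A$ of posets is $\oplus A=\{\langle\mathbb{Q},p\rangle:\mathbb{Q}\in A,\ p\in\mathbb{Q}\}\cup\{1\}$, with $1$ above everything and $\langle\mathbb{Q},p\rangle\le\langle\mathbb{Q}',q\rangle$ iff $\mathbb{Q}=\mathbb{Q}'$ and $p\le_{\mathbb{Q}}q$. A poset is ${<}\delta$-strategically closed if in the game where two players alternately play a descending sequence of conditions of length $\delta$ (the second player playing at limit stages), the second player has a strategy ensuring the play can always be continued. A poset is allowed at stage $\gamma$ if it is ${<}\delta$-strategically closed for every $\delta<\gamma$. The lottery preparation of $\kappa$ relative to $f$ is the reverse Easton support iteration of length $\kappa$ (direct limits at inaccessible limit stages, inverse limits elsewhere) in which the stage $\gamma$ forcing is nontrivial only when $\gamma\in\mathrm{dom}(f)$ and $f``\gamma\subseteq\gamma$; at such stages the forcing is the lottery sum, in $V^{\mathbb{P}_\gamma}$, of all posets in $H(f(\gamma)^+)$ allowed at stage $\gamma$. *)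

(* Defs.v *)
Set Implicit Arguments.
Unset Strict Implicit.

(** * Well-founded models of ZFC *)

(* First-order formulas with de Bruijn indices; they only serve to state the
   axiom schemas in [zfc_model]. *)
Inductive form : Set :=
| FMem (i j : nat) | FEq (i j : nat) | FBot | FImp (a b : form) | FAll (a : form).

Definition scons (X : Type) (x : X) (e : nat -> X) (n : nat) : X :=
  match n with O => x | S m => e m end.

Fixpoint holds (X : Type) (E : X -> X -> Prop) (e : nat -> X) (a : form) : Prop :=
  match a with
  | FMem i j => E (e i) (e j)
  | FEq i j => e i = e j
  | FBot => False
  | FImp b c => holds E e b -> holds E e c
  | FAll b => forall x : X, holds E (scons x e) b
  end.

(* Up to isomorphism (Mostowski collapse), these are the transitive models. *)
Record zfc_model : Type := ZfcModel {
  set :> Type;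
  mem : set -> set -> Prop;
  zfc_wf : well_founded mem;
  zfc_ext : forall x y, (forall z, mem z x <-> mem z y) -> x = y;
  zfc_pair : forall x y, exists z, forall w, mem w z <-> w = x \/ w = y;
  zfc_union : forall a, exists u, forall x, mem x u <-> exists2 y, mem x y & mem y a;
  zfc_power : forall a, exists p, forall x,
    mem x p <-> (forall z, mem z x -> mem z a);
  zfc_infinity : exists w,
    (exists2 o, mem o w & forall z, ~ mem z o) /\
    (forall x, mem x w -> exists2 y, mem y w & forall z, mem z y <-> mem z x \/ z = x);
  zfc_separation : forall (phi : form) (e : nat -> set) (a : set),
    exists b, forall x, mem x b <-> mem x a /\ holds mem (scons x e) phi;
  zfc_replacement : forall (phi : form) (e : nat -> set) (a : set),
    (forall x, mem x a -> exists! y, holds mem (scons x (scons y e)) phi) ->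
    exists b, forall y,
      mem y b <-> exists2 x, mem x a & holds mem (scons x (scons y e)) phi;
  zfc_choice : forall a,
    (forall x, mem x a -> exists z, mem z x) ->
    (forall x y z, mem x a -> mem y a -> mem z x -> mem z y -> x = y) ->
    exists c, forall x, mem x a -> exists! z, mem z x /\ mem z c
}.

Notation "x ∊ y" := (mem x y) (at level 70, no associativity).

(** * The language of set theory *)

(* Higher-order abstract syntax with parameters in [X]. The same formulas are
   interpreted in [V], forced over [V], and interpreted in [V[G]]. *)
Inductive fml (X : Type) : Type :=
| Mem (x y : X) | Eq (x y : X) | Bot
| And (a b : fml X) | Imp (a b : fml X) | All (F : X -> fml X).

Arguments Bot {X}.

Definition Neg X (a : fml X) := Imp a Bot.
Definition Or X (a b : fml X) := Imp (Neg a) b.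
Definition Iff X (a b : fml X) := And (Imp a b) (Imp b a).
Definition Ex X (F : X -> fml X) := Neg (All (fun x => Neg (F x))).

Declare Scope fml_scope.
Delimit Scope fml_scope with fml.
Bind Scope fml_scope with fml.

Notation "x ∈ y" := (Mem x y) (at level 70, no associativity) : fml_scope.
Notation "x ≈ y" := (Eq x y) (at level 70, no associativity) : fml_scope.
Notation "¬ a" := (Neg a) (at level 75, right associativity) : fml_scope.
Notation "a ∧ b" := (And a b) (at level 80, right associativity) : fml_scope.
Notation "a ∨ b" := (Or a b) (at level 85, right associativity) : fml_scope.
Notation "a ⇒ b" := (Imp a b) (at level 90, right associativity) : fml_scope.
Notation "a ⇔ b" := (Iff a b) (at level 95, no associativity) : fml_scope.
Notation "∀ x .. y , F" := (All (fun x => .. (All (fun y => F%fml)) ..))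
  (at level 200, x binder, y binder, right associativity) : fml_scope.
Notation "∃ x .. y , F" := (Ex (fun x => .. (Ex (fun y => F%fml)) ..))
  (at level 200, x binder, y binder, right associativity) : fml_scope.
Notation "'∀[' x ∈ a ] F" := (All (fun x => Imp (Mem x a) F%fml))
  (at level 200, x name, a at level 69, right associativity) : fml_scope.
Notation "'∃[' x ∈ a ] F" := (Ex (fun x => And (Mem x a) F%fml))
  (at level 200, x name, a at level 69, right associativity) : fml_scope.

Local Open Scope fml_scope.

Fixpoint sat (X : Type) (memX eqX : X -> X -> Prop) (a : fml X) : Prop :=
  match a with
  | Mem x y => memX x y
  | Eq x y => eqX x y
  | Bot => False
  | And b c => sat memX eqX b /\ sat memX eqX c
  | Imp b c => sat memX eqX b -> sat memX eqX c
  | All F => forall x : X, sat memX eqX (F x)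
  end.

Definition models (V : zfc_model) (a : fml V) : Prop := sat (@mem V) (@eq V) a.

Notation "'⊨' a" := (models a%fml) (at level 100).

(** ** Basic notions *)

Definition is_empty X (x : X) : fml X := ∀ z, ¬ z ∈ x.
Definition subset X (x y : X) : fml X := ∀[z ∈ x] z ∈ y.
Definition is_upair X (z x y : X) : fml X := ∀ w, w ∈ z ⇔ (w ≈ x ∨ w ≈ y).
Definition is_pair X (z x y : X) : fml X :=
  ∃ a b, is_upair a x x ∧ is_upair b x y ∧ is_upair z a b.
Definition pair_in X (x y r : X) : fml X := ∃[z ∈ r] is_pair z x y.
Definition is_power X (y x : X) : fml X := ∀ z, z ∈ y ⇔ subset z x.

Definition functional X (g : X) : fml X :=
  ∀ x y y', pair_in x y g ⇒ pair_in x y' g ⇒ y ≈ y'.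
Definition function_on X (g a : X) : fml X :=
  (∀[z ∈ g] ∃[x ∈ a] ∃ y, is_pair z x y)
  ∧ (∀[x ∈ a] ∃ y, pair_in x y g) ∧ functional g.
Definition maps X (g a b : X) : fml X :=
  function_on g a ∧ (∀ x y, pair_in x y g ⇒ y ∈ b).
Definition is_restriction X (t s a : X) : fml X :=
  ∀ z, z ∈ t ⇔ (z ∈ s ∧ ∃[x ∈ a] ∃ y, is_pair z x y).
Definition injects X (a b : X) : fml X :=
  ∃ g, maps g a b ∧ (∀ x x' y, pair_in x y g ⇒ pair_in x' y g ⇒ x ≈ x').

(** ** Ordinals and cardinals *)

Definition transitive X (x : X) : fml X := ∀[y ∈ x] subset y x.
Definition ordinal X (x : X) : fml X := transitive x ∧ ∀[y ∈ x] transitive y.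
Definition is_succ X (y x : X) : fml X := ∀ z, z ∈ y ⇔ (z ∈ x ∨ z ≈ x).
Definition limit X (x : X) : fml X :=
  ordinal x ∧ ¬ is_empty x ∧ ∀[y ∈ x] ¬ is_succ x y.
Definition is_omega X (x : X) : fml X := limit x ∧ ∀[y ∈ x] ¬ limit y.
Definition cardinal X (x : X) : fml X := ordinal x ∧ ∀[a ∈ x] ¬ injects x a.
Definition uncountable_cardinal X (x : X) : fml X :=
  cardinal x ∧ ∃[w ∈ x] is_omega w.
Definition is_succ_cardinal X (th l : X) : fml X :=
  cardinal th ∧ l ∈ th ∧ ∀ n, cardinal n ∧ l ∈ n ⇒ subset th n.

Definition regular X (k : X) : fml X :=
  ∀[a ∈ k] ∀ g, maps g a k ⇒ ∃[b ∈ k] ∀ x y, pair_in x y g ⇒ y ∈ b.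
Definition strong_limit X (k : X) : fml X :=
  ∀[a ∈ k] ∀ y, is_power y a ⇒ ∃[b ∈ k] injects y b.
Definition inaccessible X (k : X) : fml X :=
  uncountable_cardinal k ∧ regular k ∧ strong_limit k.

(* The partition property: [k] is uncountable and every colouring of the
   two-element subsets of [k] with two colours has a homogeneous set of size
   [k]. The pair [{a < b}] has the first colour iff [(a, b)] is in [c]. *)
Definition weakly_compact X (k : X) : fml X :=
  uncountable_cardinal k ∧
  ∀ c, ∃ h, subset h k ∧ injects k h ∧
    ((∀[b ∈ h] ∀[a ∈ h] a ∈ b ⇒ pair_in a b c)
     ∨ (∀[b ∈ h] ∀[a ∈ h] a ∈ b ⇒ ¬ pair_in a b c)).

(* [x] is in H(th): some transitive superset of [x], hence its transitive
   closure, has size less than [th]. *)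
Definition in_H X (x th : X) : fml X :=
  ∃ t, transitive t ∧ subset x t ∧ ∃[a ∈ th] injects t a.

(** ** Posets, strategic closure, lottery sums *)

Definition is_poset X (q A r : X) : fml X :=
  is_pair q A r
  ∧ (∀[z ∈ r] ∃[x ∈ A] ∃[y ∈ A] is_pair z x y)
  ∧ (∀[x ∈ A] pair_in x x r)
  ∧ (∀ x y z, pair_in x y r ⇒ pair_in y z r ⇒ pair_in x z r)
  ∧ (∀ x y, pair_in x y r ⇒ pair_in y x r ⇒ x ≈ y).

(* [E] is the set of stages below [d] at which the second player moves: the
   first player opens, the players alternate at successor stages, and the second
   player moves at (nonzero) limit stages. *)
Definition second_player_turns X (E d : X) : fml X :=
  ∀[a ∈ d]
    (is_empty a ⇒ ¬ a ∈ E)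
    ∧ (limit a ⇒ a ∈ E)
    ∧ (∀[b ∈ a] is_succ a b ⇒ (a ∈ E ⇔ ¬ b ∈ E)).

(* [s] is a play of length [a] in which the second player followed [sg]. *)
Definition play X (A r E sg s a : X) : fml X :=
  maps s a A
  ∧ (∀[b ∈ a] ∀[c ∈ b] ∀ x y, pair_in b x s ⇒ pair_in c y s ⇒ pair_in x y r)
  ∧ (∀[b ∈ a] b ∈ E ⇒
       ∃ t x, is_restriction t s b ∧ pair_in b x s ∧ pair_in t x sg).

(* Only the second player's moves need attention: the first player can always
   repeat the previous condition. *)
Definition strategically_closed X (A r d : X) : fml X :=
  ∃ E sg, second_player_turns E d ∧ functional sg ∧
    ∀[a ∈ d] a ∈ E ⇒ ∀ s, play A r E sg s a ⇒
      ∃[p ∈ A] pair_in s p sg ∧ ∀ b q, pair_in b q s ⇒ pair_in p q r.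

Definition allowed X (A r g : X) : fml X := ∀[d ∈ g] strategically_closed A r d.

(* The collection of all posets [q = (A, r)] in H(l^+) allowed at stage [g]. *)
Definition stage_collection X (g l : X) (q A r : X) : fml X :=
  is_poset q A r ∧ (∃ th, is_succ_cardinal th l ∧ in_H q th) ∧ allowed A r g.

(* [(S, R)] is the lottery sum of the collection [C] of posets [q = (A, r)].
   The element 1 is the empty set, which is not an ordered pair. *)
Definition lottery_sum X (C : X -> X -> X -> fml X) (S R : X) : fml X :=
  (∀ z, z ∈ S ⇔ (is_empty z ∨ ∃ q A r, C q A r ∧ ∃[p ∈ A] is_pair z q p))
  ∧ (∀ w, w ∈ R ⇔ ∃[x ∈ S] ∃[y ∈ S] is_pair w x y ∧
       (is_empty y
        ∨ ∃ q A r p p', C q A r ∧ is_pair x q p ∧ is_pair y q p' ∧ pair_in p p' r)).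

(** * Forcing over [V] *)

(* A forcing notion is given by its set [A] of conditions and a set [L]
   containing the pairs [(p, q)] with [p <= q]. *)
Definition below (V : zfc_model) (A L p q : V) : Prop :=
  p ∊ A /\ q ∊ A /\ (⊨ pair_in p q L).

(* Every set is treated as a name; only its elements of the form [(t, p)]
   with [p] a condition matter. *)
Definition elem (V : zfc_model) (t p s : V) : Prop := ⊨ pair_in t p s.

(* The least, hence by well-foundedness of [V] the only, relation satisfying the
   usual recursion for "p forces s = t". *)
Inductive forces_eq (V : zfc_model) (A L : V) : V -> V -> V -> Prop :=
| Forces_eq p s t :
    (forall s' a, elem s' a s -> forall q, below A L q p -> below A L q a ->
       exists r t' b, below A L r q /\ elem t' b t /\ below A L r b /\
                      forces_eq A L r s' t') ->
    (forall t' b, elem t' b t -> forall q, below A L q p -> below A L q b ->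
       exists r s' a, below A L r q /\ elem s' a s /\ below A L r a /\
                      forces_eq A L r s' t') ->
    forces_eq A L p s t.

Fixpoint forces (V : zfc_model) (A L p : V) (a : fml V) : Prop :=
  match a with
  | Mem s t => forall q, below A L q p ->
      exists r t' b, below A L r q /\ elem t' b t /\ below A L r b /\
                     forces_eq A L r s t'
  | Eq s t => forces_eq A L p s t
  | Bot => False
  | And b c => forces A L p b /\ forces A L p c
  | Imp b c => forall q, below A L q p -> forces A L q b -> forces A L q c
  | All F => forall s : V, forces A L p (F s)
  end.

Definition forced (V : zfc_model) (A L : V) (a : fml V) : Prop :=
  forall p : V, p ∊ A -> forces A L p a.

(* [c] is the canonical name of [x], in the form {(y', p) : y in x, p in A} where
   [y'] is the canonical name of [y]; this avoids choosing a greatest condition. *)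
Inductive check_name (V : zfc_model) (A : V) : V -> V -> Prop :=
| Check_name c x :
    (forall z, z ∊ c -> exists y y' p,
       y ∊ x /\ check_name A y' y /\ p ∊ A /\ (⊨ is_pair z y' p)) ->
    (forall y, y ∊ x -> exists y', check_name A y' y /\
       (forall p, p ∊ A -> elem y' p c)) ->
    check_name A c x.

Record generic (V : zfc_model) (A L : V) (G : V -> Prop) : Prop := Generic {
  generic_sub : forall p, G p -> p ∊ A;
  generic_nonempty : exists p, G p;
  generic_up : forall p q, G p -> below A L p q -> G q;
  generic_dir : forall p q, G p -> G q ->
    exists r, G r /\ below A L r p /\ below A L r q;
  generic_dense : forall D : V, (forall d, d ∊ D -> d ∊ A) ->
    (forall p, p ∊ A -> exists d, d ∊ D /\ below A L d p) ->
    exists d, d ∊ D /\ G d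
}.

(* [V[G]] is presented on names: [ext_eq] is equality and [ext_mem] membership of
   the evaluations by [G], where val(t) = {val(s) : (s, p) in t, p in G}. *)
Inductive ext_eq (V : zfc_model) (G : V -> Prop) : V -> V -> Prop :=
| Ext_eq s t :
    (forall s' a, elem s' a s -> G a ->
       exists t' b, elem t' b t /\ G b /\ ext_eq G s' t') ->
    (forall t' b, elem t' b t -> G b ->
       exists s' a, elem s' a s /\ G a /\ ext_eq G s' t') ->
    ext_eq G s t.

Definition ext_mem (V : zfc_model) (G : V -> Prop) (s t : V) : Prop :=
  exists t' b, elem t' b t /\ G b /\ ext_eq G s t'.

Definition ext_models (V : zfc_model) (G : V -> Prop) (a : fml V) : Prop :=
  sat (ext_mem G) (ext_eq G) a.

(** * The lottery preparation *)

Definition partial_function (V : zfc_model) (f k : V) : Prop :=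
  (forall z, z ∊ f -> exists x y, x ∊ k /\ y ∊ k /\ (⊨ is_pair z x y)) /\
  (⊨ functional f).

Definition unbounded_domain (V : zfc_model) (f k : V) : Prop :=
  forall a, a ∊ k -> exists b l, b ∊ k /\ a ∊ b /\ (⊨ pair_in b l f).

(* The restriction of [h] to [k] is an element of [V]. *)
Definition internal (V : zfc_model) (k : V) (h : V -> V) : Prop :=
  exists s : V, forall x, x ∊ k -> forall y, (⊨ pair_in x y s) <-> y = h x.

(* The forcing P_g has conditions [cond g] and order [order g]. The stage [g]
   forcing is given by the P_g-names [stage g] and [stage_order g], and [names g]
   is a set of names representing, up to forced equality, all names of its
   elements. *)
Record iteration (V : zfc_model) : Type := Iteration {
  cond : V -> V;
  order : V -> V;
  names : V -> V;
  stage : V -> V;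
  stage_order : V -> V
}.

(* Stage [g] is nontrivial, with [l = f(g)]. *)
Definition active (V : zfc_model) (f g l : V) : Prop :=
  (⊨ pair_in g l f) /\
  (forall b y, b ∊ g -> (⊨ pair_in b y f) -> y ∊ g).

Record lottery_preparation (V : zfc_model) (k f : V) (P : iteration V) : Prop :=
LotteryPreparation {
  lp_internal : internal k (cond P) /\ internal k (order P) /\
    internal k (names P) /\ internal k (stage P) /\ internal k (stage_order P);

  lp_active : forall g l g' l', g ∊ k -> active f g l ->
    check_name (cond P g) g' g -> check_name (cond P g) l' l ->
    forced (cond P g) (order P g)
      (lottery_sum (stage_collection g' l') (stage P g) (stage_order P g));

  (* The lottery sum of the empty collection is the trivial forcing {1}. *)
  lp_trivial : forall g, g ∊ k -> ~ (exists l, active f g l) ->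
    forced (cond P g) (order P g)
      (lottery_sum (fun _ _ _ => Bot) (stage P g) (stage_order P g));

  lp_names : forall g s, g ∊ k -> s ∊ names P g ->
    forced (cond P g) (order P g) (s ∈ stage P g);

  lp_full : forall g t, g ∊ k ->
    forced (cond P g) (order P g) (t ∈ stage P g) ->
    exists s, s ∊ names P g /\ forced (cond P g) (order P g) (s ≈ t);

  (* Inverse limits everywhere, except that at inaccessible stages all but
     boundedly many coordinates are forced to be 1. *)
  lp_cond : forall g p, g ∊ k \/ g = k ->
    (p ∊ cond P g <->
      (⊨ function_on p g) /\
      (forall b, b ∊ g ->
        (exists t, (⊨ is_restriction t p b) /\ t ∊ cond P b) /\
        (exists s, (⊨ pair_in b s p) /\ s ∊ names P b)) /\
      ((⊨ inaccessible g) ->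
        exists a, a ∊ g /\
          forall b s, b ∊ g -> ~ b ∊ a -> (⊨ pair_in b s p) ->
            forced (cond P b) (order P b) (is_empty s)));

  lp_order : forall g p q, g ∊ k \/ g = k -> p ∊ cond P g -> q ∊ cond P g ->
    ((⊨ pair_in p q (order P g)) <->
      forall b t s u, b ∊ g -> (⊨ is_restriction t p b) ->
        (⊨ pair_in b s p) -> (⊨ pair_in b u q) ->
        forces (cond P b) (order P b) t (pair_in s u (stage_order P b)))
}.

(* Main.v *)
Require Import Defs.
From mathcomp Require filter.
From Stdlib Require Transitive_Closure Relation_Operators.
From Stdlib Require Import ssreflect Classical ClassicalEpsilon FunctionalExtensionality PropExtensionality Arith Lia.
Unset SsrOldRewriteGoalsOrder.
Unset Asymmetric Patterns.
Set Implicit Arguments.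
Unset Strict Implicit.
Unset Printing Implicit Defensive.
Set Bullet Behavior "None".

(* Write P_d for the iteration up to [d]. Dividing the class of names by an ultrafilter of conditions gives a
   (possibly ill-founded) model of ZFC, so every first-order theorem of ZFC transfers to the forcing relation; facts
   about lottery sums, strategies and weak compactness in the extension are proved in an arbitrary such model.

   Let [c] be a name of a colouring. For inaccessible [d < k] there is a condition [r] which is trivial below [d] and
   such that for every [b < d] densely many [q] in P_d decide, together with [r], whether [(b, d)] is in [c]: at the
   stages [d] and [d + 1] the lottery opts for a one-point poset, and from there on [r] is built in [d] steps along
   names of winning strategies. Since P_k has a dense set of size [k] enumerated in such a way that P_d is enumerated
   below [d] for many [d], the decisions are coded by [k] many regressive functions on [k]. By weak compactness they
   are all eventually constant on one unbounded set of inaccessibles, and the limiting decisions define a name [A].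
   With the chain condition of P_k it is forced that for all [a, t < k] there is [d > t] with
   [b in A <-> (b, d) in c] for all [b < a]. In a model of ZFC, the existence of such an [A] for every [c] makes [k]
   regular, and then a homogeneous set is obtained greedily inside [A] or its complement. *)

(** The classical argument lifts an elementary embedding [j] with critical point [k] and asks for
    which [b] the pair [(b, k)] is in [j(c)]. Here that set is obtained as a limit of the columns
    [d < k] of [c], so nothing beyond [P_k] has to be constructed. A decision about [(b, d)] below
    the [x]-th condition is recorded as the least index [z < d] of a stronger condition whose
    restriction to [d], joined with [r], forces membership; as an index below [d] it is a regressive
    function of [d].

    The stages [d] and [d + 1] are exceptional because a poset allowed at stage [b] has strategies
    only for lengths less than [b]. Answering a descending sequence of length [d] at its limit takes
    a strategy for length [d + 1], which is available when [d + 1 < b]. At the two remaining stages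
    of the tail a minimal condition is played from the start.

    Generic filters over [V] need not exist below every condition of every [P_b], so first-order
    facts about these forcings cannot simply be checked in generic extensions; the ultrafilter
    quotients take their place. *)

(** * Models of ZFC with the foundation scheme *)

(* [zfc_model] without external well-foundedness: quotients of the class of names by an ultrafilter
   are models in this sense, but need not be well-founded. *)
Record zf : Type := Zf {
  car :> Type;
  E : car -> car -> Prop;
  zf_ind : forall (phi : form) (e : nat -> car),
    (forall x, (forall y, E y x -> holds E (scons y e) phi) -> holds E (scons x e) phi) ->
    forall x, holds E (scons x e) phi;
  zf_ext : forall x y, (forall z, E z x <-> E z y) -> x = y;
  zf_pair : forall x y, exists z, forall w, E w z <-> w = x \/ w = y;
  zf_union : forall a, exists u, forall x, E x u <-> exists2 y, E x y & E y a;
  zf_power : forall a, exists p, forall x, E x p <-> (forall z, E z x -> E z a);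
  zf_infinity : exists w,
    (exists2 o, E o w & forall z, ~ E z o) /\
    (forall x, E x w -> exists2 y, E y w & forall z, E z y <-> E z x \/ z = x);
  zf_separation : forall (phi : form) (e : nat -> car) (a : car),
    exists b, forall x, E x b <-> E x a /\ holds E (scons x e) phi;
  zf_replacement : forall (phi : form) (e : nat -> car) (a : car),
    (forall x, E x a -> exists! y, holds E (scons x (scons y e)) phi) ->
    exists b, forall y, E y b <-> exists2 x, E x a & holds E (scons x (scons y e)) phi;
  zf_choice : forall a,
    (forall x, E x a -> exists z, E z x) ->
    (forall x y z, E x a -> E y a -> E z x -> E z y -> x = y) ->
    exists c, forall x, E x a -> exists! z, E z x /\ E z c
}.

Notation "x 'ε' y" := (E x y) (at level 70, no associativity).

Lemma zfc_ind (V : zfc_model) (phi : form) (e : nat -> V) :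
  (forall x, (forall y, mem y x -> holds (@mem V) (scons y e) phi) ->
     holds (@mem V) (scons x e) phi) ->
  forall x, holds (@mem V) (scons x e) phi.
Proof. move=> H x; elim: (zfc_wf x) => {}x _ IH; exact: H. Qed.

Canonical zf_of (V : zfc_model) : zf :=
  @Zf V (@mem V) (@zfc_ind V) (@zfc_ext V) (@zfc_pair V) (@zfc_union V) (@zfc_power V)
    (@zfc_infinity V) (@zfc_separation V) (@zfc_replacement V) (@zfc_choice V).

(** * Definability *)

Definition up (f : nat -> nat) n := match n with O => O | S m => S (f m) end.

Fixpoint ren (f : nat -> nat) (a : form) : form :=
  match a with
  | FMem i j => FMem (f i) (f j)
  | FEq i j => FEq (f i) (f j)
  | FBot => FBot
  | FImp a b => FImp (ren f a) (ren f b)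
  | FAll a => FAll (ren (up f) a)
  end.

Lemma holds_env (X : Type) (R : X -> X -> Prop) a : forall e e',
  (forall n, e n = e' n) -> (holds R e a <-> holds R e' a).
Proof. by move=> e e' H; have -> : e = e' by exact: functional_extensionality. Qed.

Lemma holds_ren (X : Type) (R : X -> X -> Prop) a : forall f e,
  holds R e (ren f a) <-> holds R (fun n => e (f n)) a.
Proof.
  elim: a => //= [a IHa b IHb|a IHa] f e; first by rewrite IHa IHb.
  have Q x : (fun n => scons x e (up f n)) = scons x (fun n => e (f n)).
    by apply: functional_extensionality; case.
  by split=> H x; move: (H x); rewrite IHa Q.
Qed.

(** Variables sit at the even places and parameters at the odd ones. Both supplies are infinite, so
    no bound on the free variables of a formula has to be tracked. *)
Fixpoint mix (X : Type) (e c : nat -> X) (n : nat) : X :=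
  match n with
  | O => e O
  | S O => c O
  | S (S m) => mix (fun i => e (S i)) (fun i => c (S i)) m
  end.

Lemma mix_l X (e c : nat -> X) i : mix e c (i + i) = e i.
Proof. by elim: i e c => //= i IH e c; rewrite -plus_n_Sm /= IH. Qed.
Lemma mix_r X (e c : nat -> X) i : mix e c (S (i + i)) = c i.
Proof.
  elim: i e c => // i IH e c.
  have -> : S (S i + S i) = S (S (S (i + i))) by lia.
  exact: IH.
Qed.

Lemma parity n : (exists i, n = i + i) \/ (exists i, n = S (i + i)).
Proof. by elim: n => [|n [[i ->]|[i ->]]]; [left; exists 0|right; exists i|left; exists (S i); lia]. Qed.

Lemma half_double i : Nat.div2 (i + i) = i.
Proof. by elim: i => //= i IH; rewrite -plus_n_Sm /= IH. Qed.
Lemma half_double1 i : Nat.div2 (S (i + i)) = i.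
Proof. by elim: i => //= i IH; rewrite -plus_n_Sm /= -[in RHS]IH. Qed.
Lemma odd_double i : Nat.odd (i + i) = false.
Proof. by elim: i => //= i IH; rewrite -plus_n_Sm. Qed.
Lemma odd_double1 i : Nat.odd (S (i + i)) = true.
Proof. by elim: i => //= i IH; rewrite -plus_n_Sm. Qed.

Definition pick (f g : nat -> nat) n := if Nat.odd n then g (Nat.div2 n) else f (Nat.div2 n).

Lemma pick_l f g i : pick f g (i + i) = f i.
Proof. by rewrite /pick odd_double half_double. Qed.
Lemma pick_r f g i : pick f g (S (i + i)) = g i.
Proof. by rewrite /pick odd_double1 half_double1. Qed.

Section Definability.
Variable M : zf.
Implicit Types (e c : nat -> M).

(** Definability with parameters as a semantic property of predicates on environments: separation,
    replacement and induction then apply to Rocq predicates, and closure lemmas replace the writing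
    of formulas. *)
Definition Def (R : (nat -> M) -> Prop) : Prop :=
  exists phi c, forall e, R e <-> holds (@E M) (mix e c) phi.

(** A term is definable through its graph; place 0 holds the value, which shifts the arguments by
    one. *)
Definition DTerm (t : (nat -> M) -> M) : Prop :=
  Def (fun e => e 0 = t (fun n => e (S n))).

Lemma Def_ext (R Q : (nat -> M) -> Prop) : (forall e, R e <-> Q e) -> Def R -> Def Q.
Proof. by move=> H [phi [c K]]; exists phi, c => e; rewrite -H. Qed.

Lemma Def_bot : Def (fun _ => False).
Proof. by exists FBot, (fun n => epsilon (let: ex_intro _ w _ := zf_infinity M in inhabits w) (fun _ => True)). Qed.

Lemma Def_true : Def (fun _ => True).
Proof. by case: Def_bot => phi [c _]; exists (FImp FBot FBot), c => e /=; tauto. Qed.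

Lemma Def_imp (R Q : (nat -> M) -> Prop) : Def R -> Def Q -> Def (fun e => R e -> Q e).
Proof.
  move=> [a [c Ha]] [b [d Hb]].
  exists (FImp (ren (pick (fun i => i + i) (fun i => S ((i+i)+(i+i)))) a)
            (ren (pick (fun i => i + i) (fun i => S (S (i + i) + S (i + i)))) b)), (mix c d) => e /=.
  rewrite !holds_ren Ha Hb.
  have -> : (fun n => mix e (mix c d) (pick (fun i => i + i) (fun i => S ((i+i)+(i+i))) n)) = mix e c.
    apply: functional_extensionality => n; case: (parity n) => -[i ->];
    by rewrite ?pick_l ?pick_r ?mix_l ?mix_r ?mix_l.
  have -> // : (fun n => mix e (mix c d) (pick (fun i => i + i) (fun i => S (S (i + i) + S (i + i))) n)) = mix e d.
  apply: functional_extensionality => n; case: (parity n) => -[i ->];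
    by rewrite ?pick_l ?pick_r ?mix_l ?mix_r ?mix_r.
Qed.

(** Under a binder the environment is [scons x (mix e c)]. This renaming reads it as
    [mix (scons x e) c]: the bound variable joins the variables and leaves the parameters alone. *)
Definition gsh : nat -> nat :=
  pick (fun i => match i with O => O | S j => S (j + j) end) (fun i => S (S (i + i))).

Lemma gshP (x : M) e c : (fun n => scons x (mix e c) (gsh n)) = mix (scons x e) c.
Proof.
  apply: functional_extensionality => n; rewrite /gsh; case: (parity n) => -[i ->].
  - rewrite pick_l mix_l; case: i => //= i; exact: mix_l.
  - by rewrite pick_r mix_r; exact: mix_r.
Qed.

Lemma Def_all (R : (nat -> M) -> M -> Prop) :
  Def (fun e => R (fun n => e (S n)) (e 0)) -> Def (fun e => forall x, R e x).
Proof.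
  move=> [a [c Ha]]; exists (FAll (ren gsh a)), c => e /=.
  split=> H x; first by rewrite holds_ren gshP -Ha; exact: H.
  by move: (H x); rewrite holds_ren gshP -Ha.
Qed.

Lemma Def_eqv i j : Def (fun e => e i = e j).
Proof. by case: Def_bot => _ [c _]; exists (FEq (i+i) (j+j)), c => e /=; rewrite !mix_l. Qed.
Lemma Def_memv i j : Def (fun e => e i ε e j).
Proof. by case: Def_bot => _ [c _]; exists (FMem (i+i) (j+j)), c => e /=; rewrite !mix_l. Qed.
Lemma Def_eqc i a : Def (fun e => e i = a).
Proof. by exists (FEq (i+i) 1), (fun _ => a) => e /=; rewrite !mix_l. Qed.

Lemma Def_not (R : (nat -> M) -> Prop) : Def R -> Def (fun e => ~ R e).
Proof. by move=> H; apply: Def_imp => //; exact: Def_bot. Qed.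
Lemma Def_and (R Q : (nat -> M) -> Prop) : Def R -> Def Q -> Def (fun e => R e /\ Q e).
Proof.
  move=> H K; apply: (@Def_ext (fun e => ~ (R e -> ~ Q e))) => [e|]; first tauto.
  by apply: Def_not; apply: Def_imp => //; exact: Def_not.
Qed.
Lemma Def_or (R Q : (nat -> M) -> Prop) : Def R -> Def Q -> Def (fun e => R e \/ Q e).
Proof.
  move=> H K; apply: (@Def_ext (fun e => ~ R e -> Q e)) => [e|]; first tauto.
  by apply: Def_imp => //; exact: Def_not.
Qed.
Lemma Def_iff (R Q : (nat -> M) -> Prop) : Def R -> Def Q -> Def (fun e => R e <-> Q e).
Proof. by move=> H K; apply: Def_and; exact: Def_imp. Qed.
Lemma Def_ex (R : (nat -> M) -> M -> Prop) :
  Def (fun e => R (fun n => e (S n)) (e 0)) -> Def (fun e => exists x, R e x).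
Proof.
  move=> H; apply: (@Def_ext (fun e => ~ forall x, ~ R e x)) => [e|].
    split=> [K|[x Hx] K]; [by apply: NNPP => K'; apply: K => x Hx; apply: K'; exists x|exact: K Hx].
  by apply: Def_not; apply: Def_all; exact: Def_not.
Qed.

Lemma Def_subst (R : (nat -> M) -> M -> Prop) t :
  DTerm t -> Def (fun e => R (fun n => e (S n)) (e 0)) -> Def (fun e => R e (t e)).
Proof.
  move=> Ht HR; apply: (@Def_ext (fun e => exists x, x = t e /\ R e x)) => [e|].
    by split=> [[x [-> //]]|H]; exists (t e).
  by apply: Def_ex; apply: Def_and.
Qed.

Lemma Def_mapenv (R : (nat -> M) -> Prop) (f : nat -> nat) :
  Def R -> Def (fun e => R (fun n => e (f n))).
Proof.
  move=> [a [c Ha]].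
  exists (ren (pick (fun i => f i + f i) (fun i => S (i + i))) a), c => e.
  rewrite Ha holds_ren; apply: holds_env => n; case: (parity n) => -[i ->].
  - by rewrite pick_l !mix_l.
  - by rewrite pick_r !mix_r.
Qed.

Lemma DTerm_var i : DTerm (fun e => e i).
Proof. exact: Def_eqv. Qed.
Lemma DTerm_const a : DTerm (fun _ => a).
Proof. exact: Def_eqc. Qed.

Lemma DTerm_lift t : DTerm t -> DTerm (fun e => t (fun n => e (S n))).
Proof. exact: (@Def_mapenv _ (fun n => match n with O => O | S n => S (S n) end)). Qed.
Lemma DTerm_mapenv t f : DTerm t -> DTerm (fun e => t (fun n => e (f n))).
Proof. exact: (@Def_mapenv _ (fun n => match n with O => O | S n => S (f n) end)). Qed.

Lemma Def_1 (R : M -> Prop) t : Def (fun e => R (e 0)) -> DTerm t -> Def (fun e => R (t e)).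
Proof. by move=> H Ht; apply: (Def_subst (R := fun _ => R) Ht). Qed.
Lemma Def_2 (R : M -> M -> Prop) t u :
  Def (fun e => R (e 0) (e 1)) -> DTerm t -> DTerm u -> Def (fun e => R (t e) (u e)).
Proof.
  move=> H Ht Hu; apply: (Def_subst (R := fun e x => R x (u e)) Ht) => /=.
  apply: (@Def_subst (fun e y => R (e 0) y) _ (DTerm_lift Hu)) => /=.
  exact: (Def_mapenv (fun n => match n with O => 1 | S O => 0 | n => n end) H).
Qed.
Lemma Def_3 (R : M -> M -> M -> Prop) t u v :
  Def (fun e => R (e 0) (e 1) (e 2)) -> DTerm t -> DTerm u -> DTerm v ->
  Def (fun e => R (t e) (u e) (v e)).
Proof.
  move=> H Ht Hu Hv; apply: (Def_subst (R := fun e x => R x (u e) (v e)) Ht) => /=.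
  apply: (@Def_subst (fun e y => R (e 0) y (v (fun n => e (S n)))) _ (DTerm_lift Hu)) => /=.
  apply: (@Def_subst (fun e y => R (e 1) (e 0) y) _ (DTerm_lift (DTerm_lift Hv))) => /=.
  exact: (Def_mapenv (fun n => match n with O => 2 | S O => 1 | S (S O) => 0 | n => n end) H).
Qed.
Lemma Def_4 (R : M -> M -> M -> M -> Prop) t u v w :
  Def (fun e => R (e 0) (e 1) (e 2) (e 3)) -> DTerm t -> DTerm u -> DTerm v -> DTerm w ->
  Def (fun e => R (t e) (u e) (v e) (w e)).
Proof.
  move=> H Ht Hu Hv Hw; apply: (Def_subst (R := fun e x => R x (u e) (v e) (w e)) Ht) => /=.
  apply: (@Def_subst (fun e y => R (e 0) y (v (fun n => e (S n))) (w (fun n => e (S n)))) _ (DTerm_lift Hu)) => /=.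
  apply: (@Def_subst (fun e y => R (e 1) (e 0) y (w (fun n => e (S (S n))))) _ (DTerm_lift (DTerm_lift Hv))) => /=.
  apply: (@Def_subst (fun e y => R (e 2) (e 1) (e 0) y) _ (DTerm_lift (DTerm_lift (DTerm_lift Hw)))) => /=.
  exact: (Def_mapenv (fun n => match n with O => 3 | S O => 2 | S (S O) => 1 | S (S (S O)) => 0 | n => n end) H).
Qed.
Lemma Def_5 (R : M -> M -> M -> M -> M -> Prop) t u v w z :
  Def (fun e => R (e 0) (e 1) (e 2) (e 3) (e 4)) ->
  DTerm t -> DTerm u -> DTerm v -> DTerm w -> DTerm z ->
  Def (fun e => R (t e) (u e) (v e) (w e) (z e)).
Proof.
  move=> H Ht Hu Hv Hw Hz; apply: (Def_subst (R := fun e x => R (t e) (u e) (v e) (w e) x) Hz) => /=.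
  have L (s : (nat -> M) -> M) : DTerm s -> DTerm (fun e => s (fun n => e (S n))) by exact: DTerm_lift.
  apply: (@Def_subst (fun e x => R (t (fun n => e (S n))) (u (fun n => e (S n))) (v (fun n => e (S n))) x (e 0)) _ (L _ Hw)) => /=.
  apply: (@Def_subst (fun e x => R (t (fun n => e (S (S n)))) (u (fun n => e (S (S n)))) x (e 0) (e 1)) _ (L _ (L _ Hv))) => /=.
  apply: (@Def_subst (fun e x => R (t (fun n => e (S (S (S n))))) x (e 0) (e 1) (e 2)) _ (L _ (L _ (L _ Hu)))) => /=.
  exact: (@Def_subst (fun e x => R x (e 0) (e 1) (e 2) (e 3)) _ (L _ (L _ (L _ (L _ Ht)))) H).
Qed.

Lemma Def_mem t u : DTerm t -> DTerm u -> Def (fun e => t e ε u e).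
Proof. apply: (Def_2 (R := @E M)); exact: Def_memv. Qed.
Lemma Def_eq t u : DTerm t -> DTerm u -> Def (fun e => t e = u e).
Proof. apply: (Def_2 (R := @eq M)); exact: Def_eqv. Qed.

Lemma DTerm_1 (f : M -> M) t : DTerm (fun e => f (e 0)) -> DTerm t -> DTerm (fun e => f (t e)).
Proof.
  move=> Hf Ht; apply: (Def_2 (R := fun y x => y = f x)) => //; first exact: DTerm_var.
  exact: DTerm_lift.
Qed.
Lemma DTerm_2 (f : M -> M -> M) t u :
  DTerm (fun e => f (e 0) (e 1)) -> DTerm t -> DTerm u -> DTerm (fun e => f (t e) (u e)).
Proof.
  move=> Hf Ht Hu; apply: (Def_3 (R := fun y x z => y = f x z)) => //; first exact: DTerm_var.
  exact: DTerm_lift. exact: DTerm_lift.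
Qed.
Lemma DTerm_3 (f : M -> M -> M -> M) t u v :
  DTerm (fun e => f (e 0) (e 1) (e 2)) -> DTerm t -> DTerm u -> DTerm v ->
  DTerm (fun e => f (t e) (u e) (v e)).
Proof.
  move=> Hf Ht Hu Hv; apply: (Def_4 (R := fun y x z w => y = f x z w)) => //; first exact: DTerm_var.
  exact: DTerm_lift. exact: DTerm_lift. exact: DTerm_lift.
Qed.

Lemma zf_empty : exists o : M, forall z, ~ z ε o.
Proof. by case: (zf_infinity M) => w [[o _ Ho] _]; exists o. Qed.

Definition empty : M := epsilon (let: ex_intro _ o _ := zf_empty in inhabits o) (fun o => forall z, ~ z ε o).
Lemma in_empty z : ~ z ε empty.
Proof. by move: z; rewrite /empty; apply: epsilon_spec zf_empty. Qed.

(* The unique [x] with [P x], and [empty] if there is none or more than one. *)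
Definition iota (P : M -> Prop) : M :=
  epsilon (inhabits empty)
    (fun x => (P x /\ forall y, P y -> y = x) \/ (~ (exists z, P z /\ forall y, P y -> y = z)) /\ x = empty).

Lemma iota_alt P : (P (iota P) /\ forall y, P y -> y = iota P) \/
  (~ (exists z, P z /\ forall y, P y -> y = z)) /\ iota P = empty.
Proof.
  apply: (epsilon_spec (inhabits empty) (fun x => (P x /\ forall y, P y -> y = x) \/ (~ (exists z, P z /\ forall y, P y -> y = z)) /\ x = empty)).
  case: (classic (exists z, P z /\ forall y, P y -> y = z)) => [[z H]|H]; first by exists z; left.
  by exists empty; right.
Qed.

Lemma iotaP P : (exists x, P x) -> (forall x y, P x -> P y -> x = y) -> P (iota P).
Proof.
  move=> [x Px] U; case: (iota_alt P) => [[//]|[N _]].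
  by case: N; exists x; split=> // y Py; exact: U.
Qed.
Lemma iota_eq P x : P x -> (forall y, P y -> y = x) -> iota P = x.
Proof. move=> Px U; apply: (U); apply: iotaP => [|y z /U -> /U -> //]; by exists x. Qed.

Lemma DTerm_iota (P : (nat -> M) -> M -> Prop) :
  Def (fun e => P (fun n => e (S n)) (e 0)) -> DTerm (fun e => iota (P e)).
Proof.
  move=> H.
  apply: (@Def_ext (fun e => let P := P (fun n => e (S n)) in let x := e 0 in (P x /\ forall y, P y -> y = x) \/
      (~ (exists z, P z /\ forall y, P y -> y = z)) /\ x = empty)) => [e /=|/=].
    set Q := P _; split=> [[[a b]|[a b]]|->]; last exact: iota_alt.
    - by rewrite (iota_eq a b).
    - by case: (iota_alt Q) => [[c d]|[_ -> //]]; case: a; exists (iota Q).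
  have D0 : Def (fun e => forall y, P (fun n => e (S n)) y -> y = e 0).
    apply: Def_all; apply: Def_imp; last exact: Def_eqv.
    exact: (Def_mapenv (fun n => match n with O => O | S n => S (S n) end) H).
  apply: Def_or; first exact: Def_and.
  apply: Def_and; last exact: Def_eqc.
  apply: Def_not; apply: Def_ex; apply: Def_and.
    exact: (Def_mapenv (fun n => match n with O => O | S n => S (S n) end) H).
  exact: (Def_mapenv (fun n => match n with O => O | S n => S (S n) end) D0).
Qed.

Lemma separation (P : M -> Prop) a : Def (fun e => P (e 0)) ->
  exists b, forall x, x ε b <-> x ε a /\ P x.
Proof.
  move=> [phi [c H]]; case: (zf_separation (ren gsh phi) (mix (fun _ => a) c) a) => b Hb.
  by exists b => x; rewrite Hb holds_ren gshP -H.
Qed.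

Lemma replacement (F : M -> M) a : DTerm (fun e => F (e 0)) ->
  exists b, forall y, y ε b <-> exists x, x ε a /\ y = F x.
Proof.
  move=> [phi [c H]].
  pose psi := ren (fun n => match n with O => 1 | S O => O | n => n end) (ren (up gsh) (ren gsh phi)).
  have K x y : y = F x <-> holds (@E M) (scons x (scons y (mix (fun _ => a) c))) psi.
    move: (H (scons y (scons x (fun _ => a)))) => /= ->; rewrite /psi !holds_ren.
    rewrite -gshP; apply: holds_env => n; case: (gsh n) => [//|m].
    rewrite -gshP /=; case: (gsh m) => //.
  case: (zf_replacement (phi := psi) (e := mix (fun _ => a) c) (a := a)) => [x xa|b Hb].
    by exists (F x); split=> [|y]; rewrite -K.
  exists b => y; rewrite Hb; split=> [[x xa /K]|[x [xa /K]]]; by exists x.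
Qed.

Lemma ind (P : M -> Prop) : Def (fun e => P (e 0)) ->
  (forall x, (forall y, y ε x -> P y) -> P x) -> forall x, P x.
Proof.
  move=> [phi [c H]] K x.
  have Q y : P y <-> holds (@E M) (scons y (mix (fun _ => x) c)) (ren gsh phi).
    by rewrite holds_ren gshP -H.
  rewrite Q; apply: zf_ind => y IH; rewrite -Q; apply: K => z zy; rewrite Q; exact: IH.
Qed.

End Definability.
Arguments empty {M}.
Arguments Def {M}.
Arguments DTerm {M}.

(** Hooks, refilled by [::=] each time closure lemmas for new operations are proved, so that the
    tactic [def] grows with the vocabulary. *)
Ltac def_ext1 := fail.
Ltac def_ext2 := fail.
Ltac def_ext3 := fail.
Ltac def_ext4 := fail.
Ltac def_ext5 := fail.
Ltac def_ext6 := fail.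
Ltac def_ext := first [def_ext1 | def_ext2 | def_ext3 | def_ext4 | def_ext5 | def_ext6].
Ltac defstep :=
  cbv beta;
  lazymatch goal with
  | |- DTerm _ =>
      first [ assumption | apply DTerm_var | apply DTerm_const | def_ext
            | match goal with H : DTerm _ |- _ => apply (DTerm_1 H) | H : DTerm _ |- _ => apply (DTerm_2 H)
              | H : DTerm _ |- _ => apply (DTerm_3 H) end ]
  | |- Def _ =>
      first [ assumption | def_ext | apply Def_mem | apply Def_eq | apply Def_and | apply Def_or
            | apply Def_ex | apply Def_imp | apply Def_all | apply Def_bot | apply Def_true
            | match goal with H : Def _ |- _ => apply (Def_1 H) | H : Def _ |- _ => apply (Def_2 H)
              | H : Def _ |- _ => apply (Def_3 H) | H : Def _ |- _ => apply (Def_4 H) end ]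
  end.
Ltac def := solve [repeat defstep].

Definition ssub (M : zf) (a b : M) := forall x, x ε a -> x ε b.
Notation "a ⊆ b" := (ssub a b) (at level 70, no associativity).

(** * Set operations *)

Section Sets.
Variable M : zf.
Implicit Types (a b x y z : M).

Lemma sext a b : (forall z, z ε a <-> z ε b) -> a = b.
Proof. exact: zf_ext. Qed.
Lemma sub_anti a b : a ⊆ b -> b ⊆ a -> a = b.
Proof. by move=> H K; apply: sext => z; split; [exact: H|exact: K]. Qed.

Definition comp (P : M -> Prop) : M := iota (fun z => forall w, w ε z <-> P w).

Lemma in_comp (P : M -> Prop) : (exists z, forall w, w ε z <-> P w) -> forall w, w ε comp P <-> P w.
Proof.
  move=> H; apply: (@iotaP _ (fun z => forall w, w ε z <-> P w)) => // x y Hx Hy.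
  by apply: sext => z; rewrite Hx Hy.
Qed.
Lemma DTerm_comp (P : (nat -> M) -> M -> Prop) :
  Def (fun e => P (fun n => e (S n)) (e 0)) -> DTerm (fun e => comp (P e)).
Proof.
  move=> H; apply: DTerm_iota; apply: Def_all; apply: Def_iff; first exact: Def_memv.
  exact: (Def_mapenv (fun n => match n with O => O | S n => S (S n) end) H).
Qed.

Definition sep a (P : M -> Prop) : M := comp (fun x => x ε a /\ P x).
Lemma in_sep a (P : M -> Prop) : Def (fun e => P (e 0)) -> forall x, x ε sep a P <-> x ε a /\ P x.
Proof. by move=> H; apply: in_comp; exact: separation. Qed.
Lemma DTerm_sep (a : (nat -> M) -> M) (P : (nat -> M) -> M -> Prop) :
  DTerm a -> Def (fun e => P (fun n => e (S n)) (e 0)) -> DTerm (fun e => sep (a e) (P e)).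
Proof.
  move=> Ha H; apply: DTerm_comp; apply: Def_and H; apply: Def_mem; [exact: DTerm_var|exact: DTerm_lift].
Qed.

Definition img a (F : M -> M) : M := comp (fun y => exists x, x ε a /\ y = F x).
Lemma in_img a (F : M -> M) : DTerm (fun e => F (e 0)) ->
  forall y, y ε img a F <-> exists x, x ε a /\ y = F x.
Proof. by move=> H; apply: in_comp; exact: replacement. Qed.
Lemma DTerm_img (a : (nat -> M) -> M) (F : (nat -> M) -> M -> M) :
  DTerm a -> DTerm (fun e => F (fun n => e (S n)) (e 0)) -> DTerm (fun e => img (a e) (F e)).
Proof.
  move=> Ha H; apply: DTerm_comp; apply: Def_ex; apply: Def_and.
    by apply: Def_mem; [exact: DTerm_var|exact: (DTerm_mapenv (fun n => S (S n)) Ha)].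
  apply: Def_eq; first exact: DTerm_var.
  exact: (DTerm_mapenv (fun n => match n with O => O | S n => S (S n) end) H).
Qed.

Definition upair x y : M := comp (fun w => w = x \/ w = y).
Lemma in_upair x y w : w ε upair x y <-> w = x \/ w = y.
Proof. apply: in_comp; exact: zf_pair. Qed.
Definition union a : M := comp (fun x => exists y, y ε a /\ x ε y).
Lemma in_union a x : x ε union a <-> exists y, y ε a /\ x ε y.
Proof.
  apply: in_comp; case: (zf_union a) => u Hu; exists u => w; rewrite Hu.
  by split=> [[y]|[y []]]; exists y.
Qed.
Definition pow a : M := comp (fun x => x ⊆ a).
Lemma in_pow a x : x ε pow a <-> x ⊆ a.
Proof. apply: in_comp; exact: zf_power. Qed.

Definition sing x := upair x x.
Lemma in_sing x w : w ε sing x <-> w = x.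
Proof. by rewrite in_upair; tauto. Qed.
Definition cup a b := union (upair a b).
Lemma in_cup a b x : x ε cup a b <-> x ε a \/ x ε b.
Proof.
  rewrite in_union; split=> [[y [/in_upair [->|->]]]|[H|H]]; [by left|by right| |].
  by exists a; rewrite in_upair; auto. by exists b; rewrite in_upair; auto.
Qed.
Definition pair x y := upair (sing x) (upair x y).
Lemma upair_inj x y x' y' : upair x y = upair x' y' -> (x = x' /\ y = y') \/ (x = y' /\ y = x').
Proof.
  move=> H.
  have A : x ε upair x' y' by rewrite -H in_upair; left.
  have B : y ε upair x' y' by rewrite -H in_upair; right.
  have C : x' ε upair x y by rewrite H in_upair; left.
  have D : y' ε upair x y by rewrite H in_upair; right.
  move: A B C D; rewrite !in_upair; intuition (subst; auto).
Qed.
Lemma pair_inj x y x' y' : pair x y = pair x' y' -> x = x' /\ y = y'.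
Proof.
  case/upair_inj => -[] /upair_inj H /upair_inj K; intuition (subst; auto).
Qed.
Definition suc x := cup x (sing x).
Lemma in_suc x z : z ε suc x <-> z ε x \/ z = x.
Proof. by rewrite in_cup in_sing. Qed.
Lemma suc_self x : x ε suc x. Proof. by rewrite in_suc; right. Qed.
Definition diff a b := sep a (fun x => ~ x ε b).
Lemma in_diff a b x : x ε diff a b <-> x ε a /\ ~ x ε b.
Proof. by apply: in_sep; apply: Def_not; apply: Def_mem; [exact: DTerm_var|exact: DTerm_const]. Qed.
End Sets.
Global Opaque comp sep img upair union pow.

Section DSets.
Variable M : zf.
Lemma D_upair (t u : (nat -> M) -> M) : DTerm t -> DTerm u -> DTerm (fun e => upair (t e) (u e)).
Proof.
  apply: (DTerm_2 (f := @upair M)); apply: DTerm_comp.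
  apply: Def_or; exact: Def_eqv.
Qed.
Lemma D_union (t : (nat -> M) -> M) : DTerm t -> DTerm (fun e => union (t e)).
Proof. apply: (DTerm_1 (f := @union M)); apply: DTerm_comp; apply: Def_ex; apply: Def_and; exact: Def_memv. Qed.
Lemma D_pow (t : (nat -> M) -> M) : DTerm t -> DTerm (fun e => pow (t e)).
Proof. apply: (DTerm_1 (f := @pow M)); apply: DTerm_comp; apply: Def_all; apply: Def_imp; exact: Def_memv. Qed.
Lemma D_sing (t : (nat -> M) -> M) : DTerm t -> DTerm (fun e => sing (t e)).
Proof. by move=> H; exact: D_upair. Qed.
Lemma D_pair (t u : (nat -> M) -> M) : DTerm t -> DTerm u -> DTerm (fun e => pair (t e) (u e)).
Proof. by move=> H K; apply: D_upair; [exact: D_sing|exact: D_upair]. Qed.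
Lemma D_cup (t u : (nat -> M) -> M) : DTerm t -> DTerm u -> DTerm (fun e => cup (t e) (u e)).
Proof. by move=> H K; apply: D_union; exact: D_upair. Qed.
Lemma D_suc (t : (nat -> M) -> M) : DTerm t -> DTerm (fun e => suc (t e)).
Proof. by move=> H; apply: D_cup => //; exact: D_sing. Qed.
Lemma D_diff (t u : (nat -> M) -> M) : DTerm t -> DTerm u -> DTerm (fun e => diff (t e) (u e)).
Proof.
  move=> H K; apply: DTerm_sep => //; apply: Def_not; apply: Def_mem; [exact: DTerm_var|exact: DTerm_lift].
Qed.
End DSets.
Global Opaque iota sing cup pair suc diff.
Ltac def_ext1 ::= first [ apply D_pair | apply D_sing | apply D_cup | apply D_suc | apply D_diff | apply D_upair
  | apply D_union | apply D_pow | apply DTerm_sep | apply DTerm_img | apply DTerm_comp | apply DTerm_iota ].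

(** * Relations and functions *)

Section Functions.
Variable M : zf.
Implicit Types (a b c f g x y z : M).

Definition dom f : M := sep (union (union f)) (fun x => exists y, pair x y ε f).
Definition ran f : M := sep (union (union f)) (fun y => exists x, pair x y ε f).
Transparent pair.
Lemma pair_in_uu f x y : pair x y ε f -> x ε union (union f) /\ y ε union (union f).
Proof.
  move=> H; split; rewrite in_union; exists (upair x y); rewrite in_upair in_union; split; auto;
  exists (pair x y); split=> //; rewrite /pair in_upair; auto.
Qed.
Lemma in_dom f x : x ε dom f <-> exists y, pair x y ε f.
Proof. by rewrite in_sep; [def|split=> [[]|[y /[dup] /pair_in_uu []]] //; split=> //; exists y]. Qed.
Lemma in_ran f y : y ε ran f <-> exists x, pair x y ε f.
Proof. by rewrite in_sep; [def|split=> [[]|[x /[dup] /pair_in_uu []]] //; split=> //; exists x]. Qed.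

Definition prod a b : M :=
  sep (pow (pow (cup a b))) (fun z => exists x y, x ε a /\ y ε b /\ z = pair x y).
Lemma in_prod a b z : z ε prod a b <-> exists x y, x ε a /\ y ε b /\ z = pair x y.
Proof.
  rewrite in_sep; first def.
  split=> [[]|[x [y [xa [yb ->]]]]] //; split; last by exists x, y.
  rewrite in_pow /pair => w; rewrite in_upair in_pow => -[->|->] v; rewrite ?in_sing ?in_upair in_cup.
    by move=> ->; left. by move=> [->|->]; auto.
Qed.
Opaque pair.
Lemma pair_prod a b x y : pair x y ε prod a b <-> x ε a /\ y ε b.
Proof.
  rewrite in_prod; split=> [[x' [y' [H [K /pair_inj [-> ->]]]]]|[H K]] //; by exists x, y.
Qed.

Definition app f x : M := iota (fun y => pair x y ε f).
Definition isfun f a : Prop :=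
  (forall z, z ε f -> exists x y, x ε a /\ z = pair x y) /\
  (forall x, x ε a -> exists y, pair x y ε f) /\
  (forall x y y', pair x y ε f -> pair x y' ε f -> y = y').
Definition into f a b : Prop := isfun f a /\ forall x, x ε a -> app f x ε b.
Definition inj f a : Prop := forall x x', x ε a -> x' ε a -> app f x = app f x' -> x = x'.
Definition injs a b : Prop := exists f, into f a b /\ inj f a.
Definition lam a (F : M -> M) : M := img a (fun x => pair x (F x)).
Definition restr f a : M := sep f (fun z => exists x y, x ε a /\ z = pair x y).

Lemma app_eq f a x y : isfun f a -> pair x y ε f -> app f x = y.
Proof. by move=> [_ [_ H]] K; apply: iota_eq => // z Hz; exact: H Hz K. Qed.
Lemma app_in f a x : isfun f a -> x ε a -> pair x (app f x) ε f.
Proof. by move=> H K; case: (H) => _ [/(_ _ K) [y Hy] _]; rewrite (app_eq H Hy). Qed.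
Lemma fun_in f a x y : isfun f a -> (pair x y ε f <-> x ε a /\ y = app f x).
Proof.
  move=> H; split=> [K|[K ->]]; last exact: (app_in H K).
  rewrite (app_eq H K); split=> //; case: (H) => /(_ _ K) [x' [y' [Hx /pair_inj [-> _]]]] //.
Qed.
Lemma fun_ext f g a : isfun f a -> isfun g a -> (forall x, x ε a -> app f x = app g x) -> f = g.
Proof.
  have W f1 g1 : isfun f1 a -> isfun g1 a -> (forall x, x ε a -> app f1 x = app g1 x) -> f1 ⊆ g1.
    move=> Hf Hg H z zf; case: (Hf) => /(_ _ zf) [x [y [xa E1]]]; subst.
    move: zf; rewrite !(fun_in _ _ Hf) (fun_in _ _ Hg) => -[_ ->]; split=> //; exact: H.
  by move=> Hf Hg H; apply: sub_anti; apply: W => // x xa; rewrite H.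
Qed.

Lemma D_pairlam (F : M -> M) : DTerm (fun e => F (e 0)) -> DTerm (fun e => pair (e 0) (F (e 0))).
Proof. move=> H; def. Qed.
Lemma in_lam a F : DTerm (fun e => F (e 0)) -> forall z, z ε lam a F <-> exists x, x ε a /\ z = pair x (F x).
Proof. by move=> H; apply: in_img; exact: D_pairlam. Qed.
Lemma pair_lam a F x y : DTerm (fun e => F (e 0)) -> (pair x y ε lam a F <-> x ε a /\ y = F x).
Proof.
  move=> H; rewrite in_lam //; split=> [[x' [K /pair_inj [-> ->]]]|[K ->]] //; by exists x.
Qed.
Lemma lam_fun a F : DTerm (fun e => F (e 0)) -> isfun (lam a F) a.
Proof.
  move=> H; split; [|split].
  - by move=> z; rewrite in_lam // => -[x [K ->]]; exists x, (F x).
  - by move=> x K; exists (F x); rewrite pair_lam.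
  - by move=> x y y'; rewrite !pair_lam // => -[_ ->] [_ ->].
Qed.
Lemma app_lam a F x : DTerm (fun e => F (e 0)) -> x ε a -> app (lam a F) x = F x.
Proof. by move=> H K; apply: (app_eq (lam_fun a H)); rewrite pair_lam. Qed.
Lemma lam_ext a F G : DTerm (fun e => F (e 0)) -> DTerm (fun e => G (e 0)) ->
  (forall x, x ε a -> F x = G x) -> lam a F = lam a G.
Proof.
  move=> HF HG H; apply: (fun_ext (lam_fun a HF) (lam_fun a HG)) => x xa; by rewrite !app_lam ?H.
Qed.
End Functions.
Global Opaque pair dom ran prod app lam restr.

Section DFunctions.
Variable M : zf.
Transparent dom ran prod app lam restr.
Lemma D_dom (t : (nat -> M) -> M) : DTerm t -> DTerm (fun e => dom (t e)).
Proof. apply: (DTerm_1 (f := @dom M)); rewrite /dom; def. Qed.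
Lemma D_ran (t : (nat -> M) -> M) : DTerm t -> DTerm (fun e => ran (t e)).
Proof. apply: (DTerm_1 (f := @ran M)); rewrite /ran; def. Qed.
Lemma D_prod (t u : (nat -> M) -> M) : DTerm t -> DTerm u -> DTerm (fun e => prod (t e) (u e)).
Proof. apply: (DTerm_2 (f := @prod M)); rewrite /prod; def. Qed.
Lemma D_app (t u : (nat -> M) -> M) : DTerm t -> DTerm u -> DTerm (fun e => app (t e) (u e)).
Proof. apply: (DTerm_2 (f := @app M)); rewrite /app; def. Qed.
Lemma D_restr (t u : (nat -> M) -> M) : DTerm t -> DTerm u -> DTerm (fun e => restr (t e) (u e)).
Proof. apply: (DTerm_2 (f := @restr M)); rewrite /restr; def. Qed.
Lemma D_lam (a : (nat -> M) -> M) (F : (nat -> M) -> M -> M) :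
  DTerm a -> DTerm (fun e => F (fun n => e (S n)) (e 0)) -> DTerm (fun e => lam (a e) (F e)).
Proof. move=> Ha H; apply: DTerm_img => //; apply: D_pair => //; def. Qed.
End DFunctions.
Ltac def_ext2 ::= first [ apply D_app | apply D_restr | apply D_lam | apply D_dom | apply D_ran | apply D_prod ].

Section Functions2.
Variable M : zf.
Implicit Types (a b c f g x y z : M).
Transparent restr.
Lemma in_restr f a z : z ε restr f a <-> z ε f /\ exists x y, x ε a /\ z = pair x y.
Proof. rewrite in_sep //; def. Qed.
Opaque restr.
Lemma pair_restr f a x y : pair x y ε restr f a <-> pair x y ε f /\ x ε a.
Proof.
  rewrite in_restr; split=> [[H [x' [y' [K /pair_inj [E1 E2]]]]]|[H K]]; first by subst.
  by split=> //; exists x, y.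
Qed.
Lemma restr_fun f a b : isfun f a -> b ⊆ a -> isfun (restr f b) b.
Proof.
  move=> [H1 [H2 H3]] S; split; [|split].
  - by move=> z /in_restr [].
  - by move=> x xb; case: (H2 _ (S _ xb)) => y Hy; exists y; rewrite pair_restr.
  - by move=> x y y' /pair_restr [K _] /pair_restr [K' _]; exact: H3 K K'.
Qed.
Lemma app_restr f a b x : isfun f a -> b ⊆ a -> x ε b -> app (restr f b) x = app f x.
Proof.
  move=> H S K; apply: (app_eq (restr_fun H S)); rewrite pair_restr; split=> //.
  by apply: (app_in H); exact: S.
Qed.
Lemma restr_restr f a b : b ⊆ a -> restr (restr f a) b = restr f b.
Proof.
  move=> S; apply: sext => z; rewrite !in_restr; split.
    by move=> [[H _] K]. move=> [H [x [y [K E1]]]]; split; last by exists x, y.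
  by split=> //; exists x, y; split=> //; exact: S.
Qed.
Lemma restr_all f a : isfun f a -> restr f a = f.
Proof.
  by move=> [H _]; apply: sext => z; rewrite in_restr; split=> [[]//|K]; split=> //; exact: H.
Qed.
Lemma restr_lam a b F : DTerm (fun e => F (e 0)) -> b ⊆ a -> restr (lam a F) b = lam b F.
Proof.
  move=> D S; apply: (@fun_ext _ _ _ b); [exact: restr_fun (lam_fun a D) S|exact: lam_fun|].
  by move=> x xb; rewrite (app_restr (lam_fun a D) S xb) !app_lam //; exact: S.
Qed.

Lemma injs_refl a : injs a a.
Proof.
  have D : DTerm (fun e : nat -> M => e 0) by def.
  exists (lam a (fun x => x)); split; first (split; first exact: lam_fun).
    by move=> x xa; rewrite (app_lam D).
  by move=> x x' xa xa'; rewrite !(app_lam D).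
Qed.
Lemma injs_lam a b (F : M -> M) : DTerm (fun e => F (e 0)) -> (forall x, x ε a -> F x ε b) ->
  (forall x x', x ε a -> x' ε a -> F x = F x' -> x = x') -> injs a b.
Proof.
  move=> D H I; exists (lam a F); split; first (split; first exact: lam_fun).
    by move=> x xa; rewrite (app_lam D) //; exact: H.
  by move=> x x' xa xa'; rewrite !(app_lam D) //; exact: I.
Qed.
Lemma injs_trans a b c : injs a b -> injs b c -> injs a c.
Proof.
  move=> [f [[Hf If] Jf]] [g [[Hg Ig] Jg]].
  apply: (@injs_lam _ _ (fun x => app g (app f x))); first def.
    by move=> x xa; apply: Ig; exact: If.
  by move=> x x' xa xa' H; apply: Jf => //; apply: Jg => //; exact: If.
Qed.
Lemma injs_sub a b : a ⊆ b -> injs a b.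
Proof. by move=> S; apply: (@injs_lam _ _ (fun x => x)) => //; def. Qed.
End Functions2.

(** * Ordinals and recursion *)

Section Ordinals.
Variable M : zf.
Implicit Types (a b c x y z T : M).

Definition trans a : Prop := forall x, x ε a -> x ⊆ a.
Definition ord a : Prop := trans a /\ forall x, x ε a -> trans x.

Lemma exists_min (P : M -> Prop) : Def (fun e => P (e 0)) -> (exists x, P x) ->
  exists x, P x /\ forall y, y ε x -> ~ P y.
Proof.
  move=> D [x Px]; apply: NNPP => N.
  apply: (@ind _ (fun x => ~ P x)) (Px); first def.
  by move=> y IH Py; apply: N; exists y.
Qed.
Lemma mem_irr x : ~ x ε x.
Proof. move: x; apply: ind; first def. by move=> x IH H; exact: (IH x). Qed.
Lemma mem_asym x y : x ε y -> ~ y ε x.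
Proof. by move: x y; apply: ind; [def|move=> x IH y H K; exact: (IH _ K _ K H)]. Qed.

Lemma ord_in a x : ord a -> x ε a -> ord x.
Proof. by move=> [T1 T2] xa; split=> [|y yx]; apply: T2 => //; exact: T1 yx. Qed.
Lemma ord_trans a x y : ord a -> x ε a -> y ε x -> y ε a.
Proof. by move=> [H _] K; exact: H. Qed.
Lemma ord_subs a x : ord a -> x ε a -> x ⊆ a.
Proof. by move=> H K y; exact: ord_trans. Qed.

Lemma ord_tot a b : ord a -> ord b -> a ε b \/ a = b \/ b ε a.
Proof.
  move: a b; apply: (@ind _ (fun a => forall b, ord a -> ord b -> a ε b \/ a = b \/ b ε a)); first def.
  move=> a IHa; apply: (@ind _ (fun b => ord a -> ord b -> a ε b \/ a = b \/ b ε a)); first def.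
  move=> b IHb oa ob; case: (classic (a ε b \/ b ε a)) => [|N]; first tauto.
  right; left; apply: sub_anti => x H.
  - case: (IHa x H b (ord_in oa H) ob) => [//|[K|K]]; case: N; right; first by rewrite -K.
    exact: ord_trans H K.
  - case: (IHb x H oa (ord_in ob H)) => [K|[K|//]]; case: N; left; last by rewrite K.
    exact: ord_trans H K.
Qed.
Lemma ord_sub a b : ord a -> ord b -> a ⊆ b -> a ε b \/ a = b.
Proof. move=> oa ob S; case: (ord_tot oa ob) => [|[|/S /mem_irr []]]; auto. Qed.
Lemma ord_nin a b : ord a -> ord b -> ~ a ε b -> b ⊆ a.
Proof. by move=> oa ob N; case: (ord_tot oa ob) => [//|[-> //|K]]; exact: ord_subs. Qed.
Lemma ord_suc a : ord a -> ord (suc a).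
Proof.
  move=> oa; split=> x; rewrite in_suc => -[xa|->].
  - by move=> y yx; rewrite in_suc; left; exact: ord_trans yx.
  - by move=> y ya; rewrite in_suc; left.
  - exact: (proj1 (ord_in oa xa)).
  - exact: (proj1 oa).
Qed.
Lemma ord_union a : (forall x, x ε a -> ord x) -> ord (union a).
Proof.
  move=> H; split=> x /in_union [y [ya xy]]; last exact: (proj1 (ord_in (H _ ya) xy)).
  by move=> z zx; rewrite in_union; exists y; split=> //; exact: ord_trans (H _ ya) xy zx.
Qed.
Lemma union_ub a x : x ε a -> x ⊆ union a.
Proof. by move=> H y K; rewrite in_union; exists x. Qed.
Lemma ord_empty : ord (@empty M).
Proof. by split=> x /in_empty. Qed.
Lemma ord_least (P : M -> Prop) : Def (fun e => P (e 0)) -> (exists a, ord a /\ P a) ->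
  exists a, ord a /\ P a /\ forall b, b ε a -> ~ P b.
Proof.
  move=> D H; case: (@exists_min (fun a => ord a /\ P a)) => // [|a [[oa Pa] K]]; first def.
  by exists a; split=> //; split=> // b ba Pb; apply: (K b ba); split=> //; exact: ord_in ba.
Qed.
Lemma not_all_ord a : exists b, ord b /\ ~ b ε a.
Proof.
  pose o := sep a ord.
  have D : Def (fun e : nat -> M => ord (e 0)) by def.
  have oo : ord (union o) by apply: ord_union => x; rewrite (in_sep _ D) => -[].
  exists (suc (union o)); split; first exact: ord_suc.
  move=> H; apply: (@mem_irr (union o)).
  apply: (@union_ub o (suc (union o))); last exact: suc_self.
  by rewrite (in_sep _ D); split=> //; exact: ord_suc.
Qed.
Lemma suc_inj a b : suc a = suc b -> a = b.
Proof.
  move=> H; have : a ε suc b by rewrite -H; exact: suc_self.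
  have : b ε suc a by rewrite H; exact: suc_self.
  rewrite !in_suc => -[K|-> //] [L|-> //]; by case: (mem_asym K).
Qed.
Lemma union_suc a : ord a -> union (suc a) = a.
Proof.
  move=> oa; apply: sext => x; rewrite in_union; split=> [[y [/in_suc [ya|->] //]]|xa].
    exact: ord_trans.
  by exists a; split=> //; exact: suc_self.
Qed.
Lemma suc_in a b : ord a -> b ε a -> suc b ε a \/ suc b = a.
Proof.
  move=> oa ba; have ob := ord_in oa ba.
  apply: ord_sub => //; first exact: ord_suc.
  by move=> x /in_suc [xb|->] //; exact: ord_trans xb.
Qed.
Lemma suc_mono a b : ord b -> a ε b -> suc a ε suc b.
Proof. by move=> ob H; rewrite in_suc; apply: suc_in. Qed.

(** This closure contains [x] as an element, which gives a name and its hereditary subnames a common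
    transitive set. *)
Definition is_tcl x T : Prop := trans T /\ x ε T /\ forall T', trans T' -> x ε T' -> T ⊆ T'.
Definition tcl x : M := iota (is_tcl x).
Lemma tcl_ex x : is_tcl x (tcl x).
Proof.
  have U y : (exists T, is_tcl y T) -> is_tcl y (tcl y).
    move=> H; apply: iotaP => // T T' [A [B C]] [A' [B' C']].
    by apply: sub_anti; [exact: C|exact: C'].
  apply: (U); move: x; apply: (@ind _ (fun x => exists T, is_tcl x T)); first def.
  have D : DTerm (fun e : nat -> M => tcl (e 0)) by rewrite /tcl; def.
  move=> x IH; exists (cup (union (img x tcl)) (sing x)); split; [|split].
  - move=> y; rewrite in_cup in_union in_sing => -[[z [/(in_img _ D) [w [wx ->]] yz]]|->] v vy;
      rewrite in_cup; left; rewrite in_union.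
    + exists (tcl w); split; first by rewrite (in_img _ D); exists w.
      by case: (U w (IH w wx)) => T1 _; exact: T1 vy.
    + exists (tcl v); split; first by rewrite (in_img _ D); exists v.
      by case: (U v (IH v vy)) => _ [].
  - by rewrite in_cup in_sing; right.
  - move=> T' T1 xT y; rewrite in_cup in_union in_sing => -[[z [/(in_img _ D) [w [wx ->]] yz]]|->] //.
    case: (U w (IH w wx)) => _ [_ Q]; apply: (Q T') => //; exact: T1 wx.
Qed.
Lemma tcl_trans x : trans (tcl x). Proof. by case: (tcl_ex x). Qed.
Lemma tcl_self x : x ε tcl x. Proof. by case: (tcl_ex x) => _ []. Qed.
Lemma tcl_min x T : trans T -> x ε T -> tcl x ⊆ T.
Proof. by case: (tcl_ex x) => _ [_]; apply. Qed.
Lemma D_tcl0 : DTerm (fun e : nat -> M => tcl (e 0)).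
Proof. rewrite /tcl; def. Qed.
Lemma tcl_elem x z : z ε tcl x -> z = x \/ exists y, y ε x /\ z ε tcl y.
Proof.
  have D := D_tcl0.
  move=> H; have : z ε cup (sing x) (union (img x tcl)); last first.
    rewrite in_cup in_sing in_union => -[->|[y [/(in_img _ D) [w [wx ->]] zw]]]; first by left.
    by right; exists w.
  apply: tcl_min H; last by rewrite in_cup in_sing; left.
  move=> y; rewrite in_cup in_sing in_union => K v vy; rewrite in_cup; right; rewrite in_union.
  case: K => [E1|[w [/(in_img _ D) [u [ux ->]] yu]]]; subst.
    exists (tcl v); split; last exact: tcl_self. by rewrite (in_img _ D); exists v.
  exists (tcl u); split; last exact: (tcl_trans yu). by rewrite (in_img _ D); exists u.
Qed.
Lemma tcl_nin x y : y ε x -> ~ x ε tcl y.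
Proof.
  have D := D_tcl0.
  move: x y; apply: (@ind _ (fun x => forall y, y ε x -> ~ x ε tcl y)); first def.
  move=> x IH y yx /tcl_elem [E1|[u [uy xu]]]; first by subst; exact: (mem_irr yx).
  apply: (IH y yx u uy); exact: (tcl_trans xu).
Qed.
End Ordinals.
Global Opaque tcl.

Section DOrd.
Variable M : zf.
Transparent tcl.
Lemma D_tcl (t : (nat -> M) -> M) : DTerm t -> DTerm (fun e => tcl (t e)).
Proof. apply: (DTerm_1 (f := @tcl M)); rewrite /tcl; def. Qed.
End DOrd.

Section Recursion.
Variable M : zf.
Variable G : M -> M -> M.

Definition approx (h T : M) : Prop :=
  trans T /\ isfun h T /\ forall x, x ε T -> app h x = G x (restr h x).
(** The value is read off from any approximation through [iota], so a recursively defined function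
    is again definable, even when [G] depends on parameters. *)
Definition rec (x : M) : M := iota (fun y => exists h T, approx h T /\ x ε T /\ y = app h x).

Hypothesis DG : DTerm (fun e => G (e 0) (e 1)).

Lemma D_rec0 : DTerm (fun e : nat -> M => rec (e 0)).
Proof. rewrite /rec; def. Qed.

Lemma approx_unique h T h' T' x :
  approx h T -> approx h' T' -> x ε T -> x ε T' -> app h x = app h' x.
Proof.
  move=> [tT [fh Hh]] [tT' [fh' Hh']]; move: x.
  apply: (@ind _ (fun x => x ε T -> x ε T' -> app h x = app h' x)); first def.
  move=> x IH xT xT'; rewrite Hh // Hh' //; congr (G x _).
  have S := tT x xT; have S' := tT' x xT'.
  apply: (@fun_ext _ _ _ x); [exact: restr_fun fh S|exact: restr_fun fh' S'|].
  move=> y yx; rewrite (app_restr fh S yx) (app_restr fh' S' yx); apply: IH => //; [exact: S|exact: S'].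
Qed.
Lemma rec_approx h T x : approx h T -> x ε T -> rec x = app h x.
Proof.
  move=> H K; apply: iota_eq; first by exists h, T.
  by move=> y [h' [T' [H' [K' ->]]]]; exact: approx_unique H' H K' K.
Qed.
Lemma approx_ex x : exists h T, approx h T /\ x ε T.
Proof.
  have D1 : DTerm (fun e : nat -> M => tcl (e 0)) by apply: D_tcl; def.
  have DR := D_rec0.
  move: x; apply: (@ind _ (fun x => exists h T, approx h T /\ x ε T)); first def.
  move=> x IH; pose T0 := union (img x (@tcl M)).
  have T0P z : z ε T0 -> exists y, y ε x /\ z ε tcl y.
    by rewrite in_union => -[w [/(in_img _ D1) [y [yx ->]] zy]]; exists y.
  have xT0 : x ⊆ T0.
    move=> y yx; rewrite in_union; exists (tcl y); split; last exact: tcl_self.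
    by rewrite (in_img _ D1); exists y.
  have tT0 : trans T0.
    move=> z /T0P [y [yx zy]] w wz; rewrite in_union; exists (tcl y); split.
      by rewrite (in_img _ D1); exists y.
    exact: (tcl_trans zy).
  have R z : z ε T0 -> rec z = G z (lam z rec).
    move=> /T0P [y [yx zy]]; case: (IH y yx) => h [T [A yT]].
    have zT : z ε T by case: (A) => tT _; exact: (tcl_min tT yT).
    rewrite (rec_approx A zT); case: (A) => tT [fh ->] //; congr (G z _).
    have S := tT z zT.
    apply: (@fun_ext _ _ _ z); [exact: restr_fun fh S|exact: lam_fun|] => w wz.
    by rewrite (app_restr fh S wz) (app_lam DR wz); symmetry; exact: (rec_approx A (S _ wz)).
  (* On [T0] the function [rec] already has the right values; since [x] is not in [T0], its value
     can be added by a case distinction. *)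
  pose F z := iota (fun y => (z = x /\ y = G x (lam x rec)) \/ (z <> x /\ y = rec z)).
  have DF : DTerm (fun e => F (e 0)) by rewrite /F; def.
  have F1 : F x = G x (lam x rec) by apply: iota_eq => [|y [[_ ->]|[N _]] //]; left.
  have F2 z : z <> x -> F z = rec z by move=> N; apply: iota_eq => [|y [[/N //]|[_ ->]]]; [right|].
  have NT z : z ε T0 -> z <> x.
    by move=> /T0P [y [yx zy]] E1; subst; exact: (tcl_nin yx).
  pose T := cup T0 (sing x).
  have SF z : z ε T -> z ⊆ T0.
    rewrite in_cup in_sing => -[/tT0 //|->]; exact: xT0.
  exists (lam T F), T; split; last by rewrite in_cup in_sing; right.
  split; [|split; first exact: lam_fun].
  - by move=> z zT w wz; rewrite in_cup; left; exact: SF zT w wz.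
  - move=> z zT; rewrite (app_lam DF zT) restr_lam //; first by move=> w wz; rewrite in_cup; left; exact: SF zT w wz.
    have -> : lam z F = lam z rec.
      apply: lam_ext => // w wz; apply: F2; apply: NT; exact: SF zT w wz.
    move: zT; rewrite in_cup in_sing => -[zT|-> //].
    by rewrite F2; [exact: NT|exact: R].
Qed.
Lemma rec_eq x : rec x = G x (lam x rec).
Proof.
  case: (approx_ex x) => h [T [A xT]]; rewrite (rec_approx A xT).
  case: (A) => tT [fh ->] //; congr (G x _); have S := tT x xT.
  apply: (@fun_ext _ _ _ x); [exact: restr_fun fh S|apply: lam_fun; exact: D_rec0|] => y yx.
  rewrite (app_restr fh S yx) (app_lam D_rec0 yx); symmetry; exact: (rec_approx A (S _ yx)).
Qed.
End Recursion.

Lemma Def_subst2 (M : zf) (R : (nat -> M) -> M -> M -> Prop) t u : DTerm t -> DTerm u ->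
  Def (fun e => R (fun n => e (S (S n))) (e 0) (e 1)) -> Def (fun e => R e (t e) (u e)).
Proof.
  move=> Ht Hu H; apply: (Def_subst (R := fun e x => R e x (u e)) Ht) => /=.
  apply: (@Def_subst _ (fun e y => R (fun n => e (S n)) (e 0) y) _ (DTerm_lift Hu)) => /=.
  exact: (Def_mapenv (fun n => match n with O => 1 | S O => 0 | n => n end) H).
Qed.
(** The step function has parameters of its own, read beyond place [m], where [m] counts the binders
    under which it is used. *)
Lemma DTerm_G (M : zf) (G : (nat -> M) -> M -> M -> M) m t u :
  DTerm (fun e => G (fun n => e (S (S n))) (e 0) (e 1)) -> DTerm t -> DTerm u ->
  DTerm (fun e => G (fun n => e (m + n)) (t e) (u e)).
Proof.
  move=> H Ht Hu.
  apply: (@Def_subst2 _ (fun e x y => e 0 = G (fun n => e (S (m + n))) x y) _ _ (DTerm_lift Ht) (DTerm_lift Hu)).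
  exact: (Def_mapenv (fun n => match n with O => 2 | S O => 0 | S (S O) => 1 | S (S (S n)) => S (S (S (m + n))) end) H).
Qed.
Lemma D_rec (M : zf) (G : (nat -> M) -> M -> M -> M) t :
  DTerm (fun e => G (fun n => e (S (S n))) (e 0) (e 1)) -> DTerm t -> DTerm (fun e => rec (G e) (t e)).
Proof.
  move=> H Ht; rewrite /rec /approx.
  have L m : DTerm (fun e => t (fun n => e (m + n))) by exact: DTerm_mapenv.
  have L3 := L 3; have HG u v := @DTerm_G _ G 4 u v H.
  by repeat (apply: HG || exact: L3 || defstep).
Qed.
Global Opaque rec.
Ltac def_ext3 ::= first [ apply D_tcl | apply D_rec ].

(** * Choice, well-orderings, collection *)

Section Choice.
Variable M : zf.
Implicit Types (a b c x y z X : M).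

(** The axiom of choice speaks of disjoint families; replacing each [y] by [{y} × y] makes any
    family disjoint. *)
Lemma choice_function X : exists ch, forall y, y ⊆ X -> (exists x, x ε y) -> app ch y ε y.
Proof.
  pose B := sep (pow X) (fun y => exists x, x ε y).
  have DB : Def (fun e : nat -> M => exists x, x ε e 0) by def.
  have DP : DTerm (fun e : nat -> M => prod (sing (e 0)) (e 0)) by def.
  have [c Hc] : exists c, forall x, x ε img B (fun y => prod (sing y) y) -> exists! z, z ε x /\ z ε c.
    apply: zf_choice.
    - move=> x /(in_img _ DP) [y [/(in_sep _ DB) [_ [w wy]] ->]]; exists (pair y w).
      by rewrite pair_prod in_sing.
    - move=> x y z /(in_img _ DP) [x' [_ ->]] /(in_img _ DP) [y' [_ ->]] /in_prod [u [v [/in_sing -> [_ ->]]]].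
      by rewrite pair_prod in_sing => -[-> _].
  have D : DTerm (fun e : nat -> M => iota (fun x => x ε e 0 /\ pair (e 0) x ε c)) by def.
  exists (lam (pow X) (fun y => iota (fun x => x ε y /\ pair y x ε c))) => y yX ne.
  rewrite (app_lam D); first by rewrite in_pow.
  have yB : y ε B by rewrite (in_sep _ DB) in_pow.
  case: (Hc (prod (sing y) y)) => [|z [[zy zc] U]]; first by rewrite (in_img _ DP); exists y.
  move: zy zc => /in_prod [u [v [/in_sing -> [vy E1]]]]; subst => zc.
  apply: proj1 (iotaP (P := fun x => x ε y /\ pair y x ε c) _ _); first by exists v.
  have Q x : x ε y /\ pair y x ε c -> x = v.
    move=> [xy xc]; have := U (pair y x); rewrite pair_prod in_sing => /(_ (conj (conj eq_refl xy) xc)).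
    by case/pair_inj.
  by move=> x x' /Q -> /Q ->.
Qed.

(** The last clause remembers that [app f i] was picked by [ch] from a set containing everything
    enumerated later. With a rank-minimising [ch] the enumeration therefore follows the rank. *)
Lemma well_order_by X ch : (forall y, y ⊆ X -> (exists x, x ε y) -> app ch y ε y) ->
  exists a f, ord a /\ into f a X /\ inj f a /\ (forall x, x ε X -> exists i, i ε a /\ app f i = x) /\
    forall i, i ε a -> exists Y, Y ⊆ X /\ app f i = app ch Y /\ forall j, j ε a -> i ε j -> app f j ε Y.
Proof.
  move=> Hch.
  pose G (i h : M) := iota (fun y => ((exists x, x ε diff X (ran h)) /\ y = app ch (diff X (ran h))) \/
     ((~ exists x, x ε diff X (ran h)) /\ y = X)).
  have DG : DTerm (fun e => G (e 0) (e 1)) by rewrite /G; def.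
  pose F := rec G.
  have DF : DTerm (fun e : nat -> M => F (e 0)) by exact: D_rec0.
  have rF i x : x ε ran (lam i F) <-> exists j, j ε i /\ x = F j.
    rewrite in_ran; split=> [[j]|[j [ji ->]]]; first by rewrite (pair_lam _ _ _ DF) => -[]; exists j.
    by exists j; rewrite (pair_lam _ _ _ DF).
  have F0 i : (exists x, x ε diff X (ran (lam i F))) -> F i = app ch (diff X (ran (lam i F))).
    move=> H; rewrite {1}/F (rec_eq DG) -/F.
    by apply: iota_eq => [|y [[_ ->]|[]]] //; left.
  have F1 i : (exists x, x ε diff X (ran (lam i F))) -> F i ε diff X (ran (lam i F)).
    by move=> H; rewrite F0 //; apply: Hch => // x /in_diff [].
  have [a [oa [Ha La]]] : exists a, ord a /\ (~ exists x, x ε diff X (ran (lam a F))) /\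
      forall b, b ε a -> ~ ~ exists x, x ε diff X (ran (lam b F)).
    apply: ord_least; first def.
    (* If [X] is never exhausted, [F] is injective on the ordinals, and by replacement the inverse
       of [F] yields a set containing every ordinal. *)
    apply: NNPP => N.
    have I i j : ord i -> j ε i -> F i <> F j.
      move=> oi ji E1; have : F i ε diff X (ran (lam i F)).
        by apply: F1; apply: NNPP => K; apply: N; exists i.
      by rewrite in_diff rF => -[_]; apply; exists j.
    have J i j : ord i -> ord j -> F i = F j -> i = j.
      move=> oi oj E1; case: (ord_tot oi oj) => [H|[//|H]]; [case: (I _ _ oj H)|case: (I _ _ oi H)]; by rewrite E1.
    have D2 : DTerm (fun e : nat -> M => iota (fun i => ord i /\ F i = e 0)) by def.
    case: (not_all_ord (img X (fun x => iota (fun i => ord i /\ F i = x)))) => b [ob]; apply.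
    rewrite (in_img _ D2); exists (F b); split.
      have : F b ε diff X (ran (lam b F)) by apply: F1; apply: NNPP => K; apply: N; exists b.
      by rewrite in_diff => -[].
    by symmetry; apply: iota_eq => // i [oi]; exact: J.
  have Fa i : i ε a -> F i ε diff X (ran (lam i F)) by move=> ia; apply: F1; apply: NNPP; exact: La.
  exists a, (lam a F); split=> //; split; [|split; [|split]].
  - split; first exact: lam_fun. by move=> i ia; rewrite (app_lam DF ia); case/in_diff: (Fa i ia).
  - move=> i j ia ja; rewrite (app_lam DF ia) (app_lam DF ja) => E1.
    have W i' j' : i' ε a -> j' ε i' -> F i' = F j' -> False.
      by move=> A B C; case/in_diff: (Fa i' A) => _; apply; rewrite rF; exists j'.
    case: (ord_tot (ord_in oa ia) (ord_in oa ja)) => [H|[//|H]]; first by case: (W _ _ ja H).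
    by case: (W _ _ ia H).
  - move=> x xX; case: (classic (x ε ran (lam a F))) => [|N].
      by rewrite rF => -[i [ia ->]]; exists i; rewrite (app_lam DF ia).
    by case: Ha; exists x; rewrite in_diff.
  - move=> i ia; exists (diff X (ran (lam i F))); split; first by move=> x /in_diff [].
    split; first by rewrite (app_lam DF ia); apply: F0; apply: NNPP; exact: La.
    move=> j ja ij; rewrite (app_lam DF ja); case/in_diff: (Fa j ja) => jX N; rewrite in_diff; split=> //.
    by rewrite rF => -[l [li E1]]; apply: N; rewrite rF; exists l; split=> //; exact: ord_trans (ord_in oa ja) ij li.
Qed.

Lemma well_order X : exists a f, ord a /\ into f a X /\ inj f a /\ forall x, x ε X -> exists i, i ε a /\ app f i = x.
Proof.
  case: (choice_function X) => ch Hch; case: (well_order_by Hch) => a [f [H1 [H2 [H3 [H4 _]]]]]; by exists a, f.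
Qed.

Lemma card_ord X : exists a, ord a /\ injs X a /\ injs a X.
Proof.
  case: (well_order X) => a [f [oa [[ff fi] [ij sj]]]]; exists a; split=> //; split; last by exists f.
  have P x : x ε X -> iota (fun i => i ε a /\ app f i = x) ε a /\ app f (iota (fun i => i ε a /\ app f i = x)) = x.
    move=> xX; apply: (iotaP (P := fun i => i ε a /\ app f i = x)); first by case: (sj x xX) => i; exists i.
    by move=> i j [ia <-] [ja E1]; exact: ij.
  apply: (@injs_lam _ _ _ (fun x => iota (fun i => i ε a /\ app f i = x))); first def.
    by move=> x /P [].
  by move=> x x' /P [_ E1] /P [_ E2] E3; rewrite -E1 E3 E2.
Qed.

(** The cumulative hierarchy, with each level the union of the power sets of the earlier ones; this
    treats zero, successors and limits alike. *)
Definition Vs : M -> M := rec (fun a h => union (img a (fun b => pow (app h b)))).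
Lemma D_Vs0 : DTerm (fun e : nat -> M => Vs (e 0)).
Proof. apply: D_rec0; def. Qed.
Lemma in_Vs a x : x ε Vs a <-> exists b, b ε a /\ x ⊆ Vs b.
Proof.
  have D := D_Vs0.
  rewrite {1}/Vs rec_eq; first def. rewrite in_union.
  have DD : DTerm (fun e : nat -> M => pow (app (lam a Vs) (e 0))) by def.
  split=> [[y [/(in_img _ DD) [b [ba ->]]]]|[b [ba H]]].
    by rewrite in_pow (app_lam D ba); exists b.
  exists (pow (Vs b)); rewrite in_pow; split=> //; rewrite (in_img _ DD); exists b.
  by rewrite (app_lam D ba).
Qed.
Lemma Vs_mono a b : a ⊆ b -> Vs a ⊆ Vs b.
Proof. by move=> S x; rewrite !in_Vs => -[c [/S ca H]]; exists c. Qed.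
Lemma Vs_all x : exists a, ord a /\ x ε Vs a.
Proof.
  have D := D_Vs0.
  move: x; apply: (@ind _ (fun x => exists a, ord a /\ x ε Vs a)); first def.
  move=> x IH; pose r (y : M) := iota (fun a => ord a /\ y ε Vs a /\ forall b, b ε a -> ~ y ε Vs b).
  have Dr : DTerm (fun e => r (e 0)) by rewrite /r; def.
  have R y : y ε x -> ord (r y) /\ y ε Vs (r y).
    move=> yx; have [a Ha] : exists a, ord a /\ y ε Vs a /\ forall b, b ε a -> ~ y ε Vs b.
      by apply: ord_least; [def|exact: IH].
    have -> : r y = a; last by move: Ha; tauto.
    apply: iota_eq => // b [ob [Hb Lb]]; move: Ha => [oa [Ha La]].
    by case: (ord_tot oa ob) => [/Lb|[->|/La]].
  have oo : ord (union (img x r)).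
    by apply: ord_union => a /(in_img _ Dr) [y [yx ->]]; case: (R y yx).
  exists (suc (union (img x r))); split; first exact: ord_suc.
  rewrite in_Vs; exists (union (img x r)); split; first exact: suc_self.
  move=> y yx; case: (R y yx) => _; apply: Vs_mono; apply: union_ub.
  by rewrite (in_img _ Dr); exists y.
Qed.

(** Scott's trick: the least level of [Vs] containing a witness is a function of [x], and
    replacement bounds these levels. *)
Lemma collection (R : M -> M -> Prop) a : Def (fun e => R (e 0) (e 1)) ->
  (forall x, x ε a -> exists y, R x y) -> exists B, forall x, x ε a -> exists y, y ε B /\ R x y.
Proof.
  move=> DR H; have D := D_Vs0.
  pose r (x : M) := iota (fun al => ord al /\ (exists y, y ε Vs al /\ R x y) /\
     forall b, b ε al -> ~ (exists y, y ε Vs b /\ R x y)).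
  have Dr : DTerm (fun e => r (e 0)) by rewrite /r; def.
  exists (Vs (union (img a r))) => x xa.
  have [al Hal] : exists al, ord al /\ (exists y, y ε Vs al /\ R x y) /\
     forall b, b ε al -> ~ (exists y, y ε Vs b /\ R x y).
    apply: ord_least; first def.
    by case: (H x xa) => y Rxy; case: (Vs_all y) => al [oal yal]; exists al; split=> //; exists y.
  have E1 : r x = al.
    apply: iota_eq => // b [ob [Hb Lb]]; move: Hal => [oa [Ha La]].
    by case: (ord_tot oa ob) => [/Lb|[->|/La]].
  case: Hal => _ [[y [yal Rxy]] _]; exists y; split=> //.
  apply: Vs_mono yal; rewrite -E1; apply: union_ub; rewrite (in_img _ Dr); by exists x.
Qed.

Lemma choice_map (R : M -> M -> Prop) a : Def (fun e => R (e 0) (e 1)) ->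
  (forall x, x ε a -> exists y, R x y) -> exists f, isfun f a /\ forall x, x ε a -> R x (app f x).
Proof.
  move=> DR H; case: (collection DR H) => B HB; case: (choice_function B) => ch Hch.
  have D : DTerm (fun e : nat -> M => app ch (sep B (R (e 0)))).
    apply: D_app; first def. apply: DTerm_sep; first def. apply: (Def_2 DR); def.
  exists (lam a (fun x => app ch (sep B (R x)))); split; first exact: lam_fun.
  have DR1 x : Def (fun e => R x (e 0)) by apply: (Def_2 DR); def.
  move=> x xa; rewrite (app_lam D xa).
  have : app ch (sep B (R x)) ε sep B (R x).
    apply: Hch => [y|]; first by rewrite (in_sep _ (DR1 x)) => -[].
    by case: (HB x xa) => y Hy; exists y; rewrite (in_sep _ (DR1 x)).
  by rewrite (in_sep _ (DR1 x)) => -[].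
Qed.
End Choice.
Global Opaque Vs.

(** * The natural numbers *)

Section Omega.
Variable M : zf.
Implicit Types (a b c x y z n : M).

(** Natural numbers without recursion: the ordinals such that no ordinal up to and including them is
    a limit. Being definable, they can be separated from the set given by the axiom of infinity. *)
Definition isnat n : Prop := ord n /\ forall m, m ε suc n -> m = empty \/ exists j, m = suc j.
Definition omega : M := comp isnat.
Lemma isnat_in n m : isnat n -> m ε n -> isnat m.
Proof.
  move=> [on H] mn; split=> [|j]; first exact: ord_in mn.
  rewrite in_suc => jm; apply: H; rewrite in_suc; left.
  by case: jm => [jm|->] //; exact: ord_trans jm.
Qed.
Lemma isnat_suc n : isnat n -> isnat (suc n).
Proof.
  move=> [on H]; split; first exact: ord_suc.
  by move=> m; rewrite in_suc => -[/H //|->]; right; exists n.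
Qed.
Lemma isnat0 : isnat empty.
Proof. split; first exact: ord_empty. by move=> m; rewrite in_suc => -[/in_empty|->] //; left. Qed.
Lemma in_omega n : n ε omega <-> isnat n.
Proof.
  apply: in_comp; have [w [[o ow Ho] Hw]] := zf_infinity M.
  have e0 : empty ε w by rewrite (_ : empty = o) //; apply: sext => z; split=> [/in_empty|/Ho].
  have es x : x ε w -> suc x ε w.
    by move=> /Hw [y yw Hy]; rewrite (_ : suc x = y) //; apply: sext => z; rewrite in_suc Hy.
  exists (sep w isnat) => m; rewrite in_sep; first def. split=> [[]|H] //; split=> //.
  move: m H {n}; apply: (@ind _ (fun n => isnat n -> n ε w)); first def.
  move=> n IH H; case: (H) => on /(_ n (suc_self n)) [-> //|[j E1]]; subst.
  by apply: es; apply: IH; [exact: suc_self|apply: isnat_in H _; exact: suc_self].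
Qed.
Lemma omega0 : empty ε omega. Proof. rewrite in_omega; exact: isnat0. Qed.
Lemma omega_suc n : n ε omega -> suc n ε omega.
Proof. rewrite !in_omega; exact: isnat_suc. Qed.
Lemma omega_ord : ord omega.
Proof.
  split=> x; rewrite in_omega => H; last by case: H => -[].
  by move=> y yx; rewrite in_omega; exact: isnat_in yx.
Qed.
Lemma omega_ind (P : M -> Prop) : Def (fun e => P (e 0)) -> P empty ->
  (forall n, n ε omega -> P n -> P (suc n)) -> forall n, n ε omega -> P n.
Proof.
  move=> D H0 HS; apply: (@ind _ (fun n => n ε omega -> P n)); first def.
  move=> n IH; rewrite in_omega => H; case: (H) => on /(_ n (suc_self n)) [-> //|[j E1]]; subst.
  have jo : j ε omega by rewrite in_omega; apply: isnat_in H _; exact: suc_self.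
  by apply: HS => //; apply: IH => //; exact: suc_self.
Qed.
End Omega.
Arguments omega {M}.
Global Opaque omega.

(** * Semantics of the defined formulas *)

Section SatLogic.
Variables (X : Type) (R Q : X -> X -> Prop).
Lemma sat_or a b : sat R Q (Or a b) <-> sat R Q a \/ sat R Q b.
Proof. by rewrite /Or /=; tauto. Qed.
Lemma sat_ex F : sat R Q (Ex F) <-> exists x, sat R Q (F x).
Proof.
  rewrite /Ex /=; split=> [H|[x Hx] K]; last exact: K Hx.
  by apply: NNPP => N; apply: H => x Hx; apply: N; exists x.
Qed.
Lemma sat_and a b : sat R Q (And a b) <-> sat R Q a /\ sat R Q b.
Proof. by []. Qed.
Lemma sat_imp a b : sat R Q (Imp a b) <-> (sat R Q a -> sat R Q b).
Proof. by []. Qed.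
Lemma sat_neg a : sat R Q (Neg a) <-> ~ sat R Q a.
Proof. by []. Qed.
Lemma sat_all F : sat R Q (All F) <-> forall x, sat R Q (F x).
Proof. by []. Qed.
Lemma sat_iff a b : sat R Q (Iff a b) <-> (sat R Q a <-> sat R Q b).
Proof. by []. Qed.
End SatLogic.

Section Semantics.
Variable M : zf.
Implicit Types (a b c f g k l x y z : M).
Notation satM := (sat (@E M) (@eq M)).

Definition limO x : Prop := ord x /\ x <> empty /\ forall y, y ε x -> x <> suc y.
Definition card x : Prop := ord x /\ forall a, a ε x -> ~ injs x a.
Definition reg k : Prop := forall a, a ε k -> forall g, into g a k ->
  exists b, b ε k /\ forall x, x ε a -> app g x ε b.
Definition slim k : Prop := forall a, a ε k -> exists b, b ε k /\ injs (pow a) b.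
Definition inacc k : Prop := (card k /\ omega ε k) /\ reg k /\ slim k.
Definition wcomp k : Prop := (card k /\ omega ε k) /\ forall c, exists h, h ⊆ k /\ injs k h /\
  ((forall b, b ε h -> forall a, a ε h -> a ε b -> pair a b ε c) \/
   (forall b, b ε h -> forall a, a ε h -> a ε b -> ~ pair a b ε c)).

Lemma is_emptyE x : satM (is_empty x) <-> x = empty.
Proof. split=> [H|-> z]; [by apply: sext => z; split=> [/H|/in_empty]|exact: in_empty]. Qed.
Lemma is_upairE z x y : satM (is_upair z x y) <-> z = upair x y.
Proof.
  split=> [H|-> w]; last by move: (in_upair x y w); rewrite /= /Or /=; tauto.
  by apply: sext => w; rewrite in_upair; move: (H w); rewrite /= /Or /=; tauto.
Qed.
Lemma is_pairE z x y : satM (is_pair z x y) <-> z = pair x y.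
Proof.
  rewrite /is_pair sat_ex; split=> [[a]|->].
    rewrite sat_ex => -[b /sat_and [/is_upairE -> [/is_upairE -> /is_upairE ->]]] //.
  exists (upair x x); rewrite sat_ex; exists (upair x y); rewrite ?sat_and; by rewrite !is_upairE.
Qed.
Lemma pair_inE x y r : satM (pair_in x y r) <-> pair x y ε r.
Proof.
  rewrite /pair_in sat_ex; split=> [[z /sat_and [H /is_pairE <-]] //|H].
  by exists (pair x y); rewrite ?sat_and; rewrite is_pairE.
Qed.
Lemma is_powerE y x : satM (is_power y x) <-> y = pow x.
Proof.
  split=> [H|-> z]; last by rewrite /= in_pow.
  by apply: sext => z; rewrite in_pow; exact: (H z).
Qed.
Lemma functionalE g : satM (functional g) <-> forall x y y', pair x y ε g -> pair x y' ε g -> y = y'.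
Proof.
  split=> H x y y' => [/pair_inE A /pair_inE B|]; first exact: (H x y y' A B).
  move=> /pair_inE A /pair_inE B; exact: H A B.
Qed.
Lemma function_onE g a : satM (function_on g a) <-> isfun g a.
Proof.
  rewrite /isfun -functionalE.
  have W1 : satM (∀[z ∈ g] ∃[x ∈ a] ∃ y, is_pair z x y)%fml <->
     (forall z, z ε g -> exists x y, x ε a /\ z = pair x y).
    split=> H z zg.
      have /sat_ex [x [xa Hx]] : satM (∃[x ∈ a] ∃ y, is_pair z x y)%fml := H z zg.
      by have /sat_ex [y /is_pairE E1] : satM (∃ y, is_pair z x y)%fml := Hx; exists x, y.
    case: (H z zg) => x [y [xa E1]]; change (satM (∃[x ∈ a] ∃ y, is_pair z x y)%fml).
    apply/sat_ex; exists x; split=> //; change (satM (∃ y, is_pair z x y)%fml).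
    by apply/sat_ex; exists y; apply/is_pairE.
  have W2 : satM (∀[x ∈ a] ∃ y, pair_in x y g)%fml <-> (forall x, x ε a -> exists y, pair x y ε g).
    split=> H x xa.
      by have /sat_ex [y /pair_inE] : satM (∃ y, pair_in x y g)%fml := H x xa; exists y.
    change (satM (∃ y, pair_in x y g)%fml).
    by apply/sat_ex; case: (H x xa) => y Hy; exists y; apply/pair_inE.
  by rewrite -W1 -W2.
Qed.
Lemma mapsE g a b : satM (maps g a b) <-> into g a b.
Proof.
  rewrite /into -function_onE; split=> -[/[dup] Hg /function_onE fg H]; split=> //.
    by move=> x xa; apply: (H x); apply/pair_inE; exact: app_in fg xa.
  by move=> x y /pair_inE; rewrite (fun_in _ _ fg) => -[xa ->]; exact: H.
Qed.
Lemma is_restrictionE t s a : satM (is_restriction t s a) <-> t = restr s a.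
Proof.
  have W z : satM (∃[x ∈ a] ∃ y, is_pair z x y)%fml <-> exists x y, x ε a /\ z = pair x y.
    rewrite sat_ex; split=> [[x /sat_and [xa /sat_ex [y /is_pairE E1]]]|[x [y [xa E1]]]]; first by exists x, y.
    by exists x; rewrite ?sat_and; split=> //; apply/sat_ex; exists y; rewrite is_pairE.
  split=> [H|-> z]; last by move: (in_restr s a z); rewrite -W.
  by apply: sext => z; rewrite in_restr -W; exact: (H z).
Qed.
Lemma injectsE a b : satM (injects a b) <-> injs a b.
Proof.
  rewrite /injects sat_ex; split=> -[g].
    move=> [/mapsE Hg H]; exists g; split=> //.
    move=> x x' xa xa' E1; apply: (H x x' (app g x)); apply/pair_inE; first exact: app_in (proj1 Hg) xa.
    by rewrite E1; exact: app_in (proj1 Hg) xa'.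
  move=> [Hg H]; exists g; split; first by apply/mapsE.
  move=> x x' y /pair_inE; rewrite (fun_in _ _ (proj1 Hg)) => -[xa ->] /pair_inE.
  rewrite (fun_in _ _ (proj1 Hg)) => -[xa']; exact: H.
Qed.
Lemma ordinalE x : satM (ordinal x) <-> ord x. Proof. by []. Qed.
Lemma is_succE y x : satM (is_succ y x) <-> y = suc x.
Proof.
  split=> [H|-> z]; last by move: (in_suc x z); rewrite /= /Or /=; tauto.
  by apply: sext => z; rewrite in_suc; move: (H z); rewrite /= /Or /=; tauto.
Qed.
Lemma limitE x : satM (limit x) <-> limO x.
Proof.
  split=> -[H1 [H2 H3]]; split=> //; split.
  - by move=> E1; apply: H2; apply/is_emptyE.
  - by move=> y yx E1; apply: (H3 y yx); apply/is_succE.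
  - by move=> /is_emptyE.
  - by move=> y yx /is_succE; exact: H3.
Qed.
Lemma omega_limO : limO omega.
Proof.
  split; first exact: omega_ord. split=> [E1|y /omega_suc H E1]; first by move: (omega0 M); rewrite E1 => /in_empty.
  by move: H; rewrite -E1 => /mem_irr.
Qed.
Lemma nat_cases (n : M) : n ε omega -> n = empty \/ exists j, j ε omega /\ n = suc j.
Proof.
  rewrite in_omega => /[dup] H [_ /(_ n (suc_self n)) [|[j E1]]]; first by left.
  right; exists j; split=> //; rewrite in_omega; apply: isnat_in H _; rewrite E1; exact: suc_self.
Qed.
Lemma is_omegaE x : satM (is_omega x) <-> x = omega.
Proof.
  have W : satM (is_omega x) <-> limO x /\ forall y, y ε x -> ~ limO y.
    split=> -[/limitE H1 H2]; split=> // y yx /limitE; exact: H2.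
  have NL n : n ε omega -> ~ limO n.
    by move=> /nat_cases [->|[j [_ ->]]] [_ [H1 H2]] //; exact: (H2 j (suc_self j)).
  rewrite W; split=> [[[ox [x0 xs]] H]|->]; last by split; [exact: omega_limO|].
  case: (ord_tot ox (omega_ord M)) => [/NL []|[//|/H []]]; [by []|exact: omega_limO].
Qed.
Lemma cardinalE x : satM (cardinal x) <-> card x.
Proof.
  by split=> -[H1 H2]; split=> // a ax /injectsE; exact: H2.
Qed.
Lemma uncountableE x : satM (uncountable_cardinal x) <-> card x /\ omega ε x.
Proof.
  split=> -[/cardinalE H1 H2]; split=> //.
    by have /sat_ex [w [wx /is_omegaE <-]] : satM (∃[w ∈ x] is_omega w)%fml := H2.
  change (satM (∃[w ∈ x] is_omega w)%fml).
  by apply/sat_ex; exists omega; split=> //; apply/is_omegaE.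
Qed.
Lemma regularE k : satM (regular k) <-> reg k.
Proof.
  split=> H a ak g.
    move=> Hg; have /sat_ex [b [bk Hb]] : satM (∃[b ∈ k] ∀ x y, pair_in x y g ⇒ y ∈ b)%fml := H a ak g (proj2 (mapsE g a k) Hg).
    exists b; split=> // x xa; apply: (Hb x); apply/pair_inE; exact: app_in (proj1 Hg) xa.
  move=> /mapsE Hg; case: (H a ak g Hg) => b [bk Hb].
  change (satM (∃[b ∈ k] ∀ x y, pair_in x y g ⇒ y ∈ b)%fml).
  apply/sat_ex; exists b; split=> // x y /pair_inE.
  by rewrite (fun_in _ _ (proj1 Hg)) => -[xa ->]; exact: Hb.
Qed.
Lemma strong_limitE k : satM (strong_limit k) <-> slim k.
Proof.
  split=> H a ak.
    have /sat_ex [b [bk /injectsE Hb]] : satM (∃[b ∈ k] injects (pow a) b)%fml := H a ak (pow a) (proj2 (is_powerE _ _) eq_refl).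
    by exists b.
  move=> y /is_powerE ->; case: (H a ak) => b [bk Hb].
  change (satM (∃[b ∈ k] injects (pow a) b)%fml).
  by apply/sat_ex; exists b; split=> //; apply/injectsE.
Qed.
Lemma inaccessibleE k : satM (inaccessible k) <-> inacc k.
Proof. by rewrite /inacc -uncountableE -regularE -strong_limitE. Qed.
Lemma weakly_compactE k : satM (weakly_compact k) <-> wcomp k.
Proof.
  split=> -[/uncountableE H1 H2]; split=> // c.
    have /sat_ex [h [hk [/injectsE Ih Hh]]] : satM (∃ h, subset h k ∧ injects k h ∧
    ((∀[b ∈ h] ∀[a ∈ h] a ∈ b ⇒ pair_in a b c)
     ∨ (∀[b ∈ h] ∀[a ∈ h] a ∈ b ⇒ ¬ pair_in a b c)))%fml := H2 c.
    exists h; split=> //; split=> //.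
    have /sat_or H0 : satM ((∀[b ∈ h] ∀[a ∈ h] a ∈ b ⇒ pair_in a b c)
     ∨ (∀[b ∈ h] ∀[a ∈ h] a ∈ b ⇒ ¬ pair_in a b c))%fml := Hh.
    case: H0 => H; [left|right] => b bh a ah ab; first by apply/pair_inE; exact: H.
    by move=> /pair_inE; exact: H.
  change (satM (∃ h, subset h k ∧ injects k h ∧
    ((∀[b ∈ h] ∀[a ∈ h] a ∈ b ⇒ pair_in a b c)
     ∨ (∀[b ∈ h] ∀[a ∈ h] a ∈ b ⇒ ¬ pair_in a b c)))%fml).
  case: (H2 c) => h [hk [Ih Hh]]; apply/sat_ex; exists h; split=> //; split; first by apply/injectsE.
  change (satM ((∀[b ∈ h] ∀[a ∈ h] a ∈ b ⇒ pair_in a b c)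
     ∨ (∀[b ∈ h] ∀[a ∈ h] a ∈ b ⇒ ¬ pair_in a b c))%fml).
  apply/sat_or; case: Hh => H; [left|right] => b bh a ah ab; first by apply/pair_inE; exact: H.
  by move=> /pair_inE; exact: H.
Qed.
End Semantics.

(** * Forcing *)

(** A [fml] may contain arbitrary Rocq functions on the universe, for which neither the definability
    of forcing nor the substitution of forced-equal names need hold. This de Bruijn copy isolates
    the genuine formulas. *)
Inductive dfml : Set :=
| DMem (i j : nat) | DEq (i j : nat) | DBot | DAnd (a b : dfml) | DImp (a b : dfml) | DAll (a : dfml).

Fixpoint emb (X : Type) (a : dfml) (e : nat -> X) : fml X :=
  match a with
  | DMem i j => Mem (e i) (e j)
  | DEq i j => Eq (e i) (e j)
  | DBot => Bot
  | DAnd a b => And (emb a e) (emb b e)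
  | DImp a b => Imp (emb a e) (emb b e)
  | DAll a => All (fun x => emb a (scons x e))
  end.

(* A formula over [nat], whose free variables are [0 .. m-1] and whose bound variables are
   represented by the levels [m, m+1, ..], as a [dfml]; [n] is the number of binders passed. *)
Fixpoint deep (m n : nat) (a : fml nat) : dfml :=
  let v x := if Nat.ltb x m then n + x else n + m - S x in
  match a with
  | Mem x y => DMem (v x) (v y)
  | Eq x y => DEq (v x) (v y)
  | Bot => DBot
  | And a b => DAnd (deep m n a) (deep m n b)
  | Imp a b => DImp (deep m n a) (deep m n b)
  | All F => DAll (deep m (S n) (F (m + n)))
  end.

Fixpoint lenv (X : Type) (d : X) (l : list X) : nat -> X :=
  match l with nil => fun _ => d | cons x l => scons x (lenv d l) end.

Section Names.
Variable V : zfc_model.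
Implicit Types (A L p q r s t a b : V).

Lemma elemE t p s : elem t p s <-> pair t p ε s.
Proof. exact: pair_inE. Qed.
Lemma belowE A L p q : below A L p q <-> p ε A /\ q ε A /\ pair p q ε L.
Proof. by rewrite /below; split=> -[? [? /pair_inE]]. Qed.

Transparent pair.
Lemma sing_in_pair (M : zf) (x y : M) : sing x ε pair x y.
Proof. by rewrite /pair in_upair; left. Qed.
Opaque pair.

Lemma name_ind (P : V -> Prop) :
  (forall s, (forall s' a, pair s' a ε s -> P s') -> P s) -> forall s, P s.
Proof.
  move=> H; apply: (well_founded_ind (Transitive_Closure.wf_clos_trans _ _ (@zfc_wf V))) => s IH.
  apply: H => s' a H; apply: IH.
  apply: (Relation_Operators.t_trans _ _ _ (sing s')); first by apply: Relation_Operators.t_step; apply/in_sing.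
  apply: (Relation_Operators.t_trans _ _ _ (pair s' a)); last exact: Relation_Operators.t_step.
  apply: Relation_Operators.t_step; exact: sing_in_pair.
Qed.

Lemma Def_below (A L p q : (nat -> V) -> V) : DTerm A -> DTerm L -> DTerm p -> DTerm q ->
  Def (fun e => below (A e) (L e) (p e) (q e)).
Proof.
  move=> HA HL Hp Hq; apply: (@Def_ext _ (fun e => p e ε A e /\ q e ε A e /\ pair (p e) (q e) ε L e)).
    by move=> e; rewrite belowE.
  def.
Qed.

(** As an inductive predicate of Rocq, [forces_eq] is not visibly definable in [V]. A triple belongs
    to it iff it lies in some set [Z] of triples each of which is justified by one unfolding step
    inside [Z]. This is a first-order condition, and well-foundedness of names makes the least and
    the greatest solution agree. *)
Definition trip p s t : V := pair p (pair s t).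
Definition step A L Z p s t : Prop :=
  (forall s' a, pair s' a ε s -> forall q, below A L q p -> below A L q a ->
     exists r t' b, below A L r q /\ pair t' b ε t /\ below A L r b /\ trip r s' t' ε Z) /\
  (forall t' b, pair t' b ε t -> forall q, below A L q p -> below A L q b ->
     exists r s' a, below A L r q /\ pair s' a ε s /\ below A L r a /\ trip r s' t' ε Z).
Definition coherent A L Z : Prop := forall p s t, trip p s t ε Z -> step A L Z p s t.
Definition FE A L p s t : Prop := exists Z, coherent A L Z /\ trip p s t ε Z.

Lemma feqE A L p s t : forces_eq A L p s t <->
  (forall s' a, pair s' a ε s -> forall q, below A L q p -> below A L q a ->
     exists r t' b, below A L r q /\ pair t' b ε t /\ below A L r b /\ forces_eq A L r s' t') /\
  (forall t' b, pair t' b ε t -> forall q, below A L q p -> below A L q b ->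
     exists r s' a, below A L r q /\ pair s' a ε s /\ below A L r a /\ forces_eq A L r s' t').
Proof.
  split.
  - case=> {}p {}s {}t H1 H2; split.
    + move=> s' a /elemE K q q1 q2; case: (H1 s' a K q q1 q2) => r [t' [b [A1 [/elemE A2 A3]]]].
      by exists r, t', b.
    + move=> s' a /elemE K q q1 q2; case: (H2 s' a K q q1 q2) => r [t' [b [A1 [/elemE A2 A3]]]].
      by exists r, t', b.
  - move=> [H1 H2]; constructor.
    + move=> s' a /elemE K q q1 q2; case: (H1 s' a K q q1 q2) => r [t' [b [A1 [A2 A3]]]].
      by exists r, t', b; rewrite elemE.
    + move=> s' a /elemE K q q1 q2; case: (H2 s' a K q q1 q2) => r [t' [b [A1 [A2 A3]]]].
      by exists r, t', b; rewrite elemE.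
Qed.

Lemma FE_feq A L p s t : FE A L p s t -> forces_eq A L p s t.
Proof.
  move=> [Z [gZ]]; move: s p t; apply: (name_ind (P := fun s => forall p t, trip p s t ε Z -> forces_eq A L p s t)) => s IH p t.
  move=> /gZ [H1 H2]; apply/feqE; split.
  - move=> s' a K q q1 q2; case: (H1 s' a K q q1 q2) => r [t' [b [A1 [A2 [A3 A4]]]]].
    by exists r, t', b; split=> //; split=> //; split=> //; exact: IH K _ _ A4.
  - move=> s' a K q q1 q2; case: (H2 s' a K q q1 q2) => r [t' [b [A1 [A2 [A3 A4]]]]].
    by exists r, t', b; split=> //; split=> //; split=> //; exact: IH A2 _ _ A4.
Qed.

Lemma trip_inj p s t p' s' t' : trip p s t = trip p' s' t' -> p = p' /\ s = s' /\ t = t'.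
Proof. by move=> /pair_inj [-> /pair_inj]. Qed.

Lemma trans_name (T s s' a : V) : trans T -> s ε T -> pair s' a ε s -> s' ε T.
Proof.
  move=> tT sT H; have H1 := tT _ sT _ H; have H2 := tT _ H1 _ (sing_in_pair s' a).
  by apply: (tT _ H2); apply/in_sing.
Qed.

Lemma good_union A L F : (forall Z, Z ε F -> coherent A L Z) -> coherent A L (union F).
Proof.
  move=> H p s t /in_union [Z [ZF K]]; case: (H Z ZF p s t K) => H1 H2; split.
  - move=> s' a Ks q q1 q2; case: (H1 s' a Ks q q1 q2) => r [t' [b [A1 [A2 [A3 A4]]]]].
    by exists r, t', b; rewrite in_union; split=> //; split=> //; split=> //; exists Z.
  - move=> s' a Ks q q1 q2; case: (H2 s' a Ks q q1 q2) => r [t' [b [A1 [A2 [A3 A4]]]]].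
    by exists r, t', b; rewrite in_union; split=> //; split=> //; split=> //; exists Z.
Qed.

(** One step only leads to subnames, so coherence survives the restriction to a transitive set. All
    witnesses can then be taken from one power set and united without choosing among them. *)
Lemma good_sub A L Z T : trans T -> coherent A L Z ->
  coherent A L (sep Z (fun z => exists p s t, p ε A /\ s ε T /\ t ε T /\ z = trip p s t)).
Proof.
  have D : Def (fun e : nat -> V => exists p s t, p ε A /\ s ε T /\ t ε T /\ e 0 = trip p s t).
    by rewrite /trip; def.
  move=> tT gZ p s t /(in_sep _ D) [H [p0 [s0 [t0 [pA [sT [tt /trip_inj [E1 [E2 E3]]]]]]]]]; subst p0 s0 t0.
  case: (gZ p s t H) => H1 H2; split.
  - move=> s' a Ks q q1 q2; case: (H1 s' a Ks q q1 q2) => r [t' [b [A1 [A2 [A3 A4]]]]].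
    exists r, t', b; rewrite (in_sep _ D); do 4 split=> //; exists r, s', t'; split; first by case: A1.
    by split; [exact: trans_name Ks|split=> //; exact: trans_name A2].
  - move=> s' a Ks q q1 q2; case: (H2 s' a Ks q q1 q2) => r [t' [b [A1 [A2 [A3 A4]]]]].
    exists r, t', b; rewrite (in_sep _ D); do 4 split=> //; exists r, t', s'; split; first by case: A1.
    by split; [exact: trans_name A2|split=> //; exact: trans_name Ks].
Qed.

Lemma Def_good (A L Z : (nat -> V) -> V) : DTerm A -> DTerm L -> DTerm Z -> Def (fun e => coherent (A e) (L e) (Z e)).
Proof.
  apply: (Def_3 (R := coherent)); rewrite /coherent /step /trip.
  by repeat (apply: Def_below || defstep).
Qed.

Lemma feq_FE A L p s t : forces_eq A L p s t -> FE A L p s t.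
Proof.
  move: s p t; apply: (name_ind (P := fun s => forall p t, forces_eq A L p s t -> FE A L p s t)) => s IH p t.
  move=> /feqE [H1 H2].
  pose T := tcl (upair s t).
  have tT : trans T by exact: tcl_trans.
  have sT : s ε T by apply: (tT (upair s t)); [exact: tcl_self|apply/in_upair; left].
  have tTT : t ε T by apply: (tT (upair s t)); [exact: tcl_self|apply/in_upair; right].
  have D : Def (fun e : nat -> V => exists p s t, p ε A /\ s ε T /\ t ε T /\ e 0 = trip p s t).
    by rewrite /trip; def.
  pose K : V := prod A (prod T T).
  have D2 : Def (fun e : nat -> V => coherent A L (e 0)) by apply: Def_good; def.
  (* The largest coherent subset of [K]; it contains at once all the triples one level below that
     are needed. *)
  pose Z := union (sep (pow K) (coherent A L)).
  have gZ : coherent A L Z by apply: good_union => Z' /(in_sep _ D2) [].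
  have ZF r s' t' : r ε A -> s' ε T -> t' ε T -> FE A L r s' t' -> trip r s' t' ε Z.
    move=> rA sT' tT' [Z' [gZ' H]]; rewrite in_union.
    exists (sep Z' (fun z => exists p s t, p ε A /\ s ε T /\ t ε T /\ z = trip p s t)); split.
      rewrite (in_sep _ D2) in_pow; split; last exact: good_sub.
      move=> z /(in_sep _ D) [_ [p0 [s0 [t0 [pA [sT0 [tT0 ->]]]]]]]; by rewrite pair_prod pair_prod.
    by rewrite (in_sep _ D); split=> //; exists r, s', t'.
  exists (cup Z (sing (trip p s t))); split; last by rewrite in_cup in_sing; right.
  move=> p0 s0 t0; rewrite in_cup in_sing => -[/gZ [S1 S2]|/trip_inj [-> [-> ->]]]; split.
  - move=> s' a Ks q q1 q2; case: (S1 s' a Ks q q1 q2) => r [t' [b [A1 [A2 [A3 A4]]]]].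
    by exists r, t', b; rewrite in_cup; do 3 split=> //; left.
  - move=> s' a Ks q q1 q2; case: (S2 s' a Ks q q1 q2) => r [t' [b [A1 [A2 [A3 A4]]]]].
    by exists r, t', b; rewrite in_cup; do 3 split=> //; left.
  - move=> s' a Ks q q1 q2; case: (H1 s' a Ks q q1 q2) => r [t' [b [A1 [A2 [A3 A4]]]]].
    exists r, t', b; rewrite in_cup; do 3 split=> //; left; apply: ZF; first by case: A1.
      exact: trans_name Ks. exact: trans_name A2. exact: (IH _ _ Ks _ _ A4).
  - move=> s' a Ks q q1 q2; case: (H2 s' a Ks q q1 q2) => r [t' [b [A1 [A2 [A3 A4]]]]].
    exists r, t', b; rewrite in_cup; do 3 split=> //; left; apply: ZF; first by case: A1.
      exact: trans_name A2. exact: trans_name Ks. exact: (IH _ _ A2 _ _ A4).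
Qed.

Lemma Def_feq (A L p s t : (nat -> V) -> V) : DTerm A -> DTerm L -> DTerm p -> DTerm s -> DTerm t ->
  Def (fun e => forces_eq (A e) (L e) (p e) (s e) (t e)).
Proof.
  move=> HA HL Hp Hs Ht; apply: (@Def_ext _ (fun e => FE (A e) (L e) (p e) (s e) (t e))).
    by move=> e; split; [exact: FE_feq|exact: feq_FE].
  apply: (Def_5 (R := FE)) => //; rewrite /FE /trip.
  by repeat (apply: Def_good || defstep).
Qed.

Lemma Def_forces (a : dfml) : forall (A L p : (nat -> V) -> V) (rho : (nat -> V) -> nat -> V),
  DTerm A -> DTerm L -> DTerm p -> (forall n, DTerm (fun e => rho e n)) ->
  Def (fun e => forces (A e) (L e) (p e) (emb a (rho e))).
Proof.
  elim: a => [i j|i j||a IHa b IHb|a IHa b IHb|a IHa] A L p rho HA HL Hp Hr /=.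
  - apply: (@Def_ext _ (fun e => forall q, below (A e) (L e) q (p e) -> exists r t' b, below (A e) (L e) r q /\
       pair t' b ε rho e j /\ below (A e) (L e) r b /\ forces_eq (A e) (L e) r (rho e i) t')).
      move=> e; split=> H q /H [r [t' [b [A1 [A2 A3]]]]]; exists r, t', b; by move/elemE: A2.
    have HA' m := DTerm_mapenv (fun n => m + n) HA; have HL' m := DTerm_mapenv (fun n => m + n) HL.
    have Hp' m := DTerm_mapenv (fun n => m + n) Hp.
    have Hr' k m := DTerm_mapenv (fun n => m + n) (Hr k).
    apply: Def_all; apply: Def_imp.
      apply: Def_below; [exact: (HA' 1)|exact: (HL' 1)|def|exact: (Hp' 1)].
    do 3 apply: Def_ex; apply: Def_and; first by apply: Def_below; [exact: (HA' 4)|exact: (HL' 4)|def|def].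
    apply: Def_and; first by apply: Def_mem; [def|exact: (Hr' j 4)].
    apply: Def_and; first by apply: Def_below; [exact: (HA' 4)|exact: (HL' 4)|def|def].
    apply: Def_feq; [exact: (HA' 4)|exact: (HL' 4)|def|exact: (Hr' i 4)|def].
  - exact: Def_feq.
  - exact: Def_bot.
  - by apply: Def_and; [exact: IHa|exact: IHb].
  - have L1 (t : (nat -> V) -> V) : DTerm t -> DTerm (fun e : nat -> V => t (fun n => e (S n))) by exact: DTerm_lift.
    apply: Def_all; apply: Def_imp; first by apply: Def_below; [exact: L1|exact: L1|def|exact: L1].
    have D0 : DTerm (fun e : nat -> V => e 0) by def.
    apply: Def_imp; [apply: (IHa _ _ _ (fun e => rho (fun n => e (S n))))|apply: (IHb _ _ _ (fun e => rho (fun n => e (S n))))];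
      (exact: L1 || exact: D0 || (move=> n; exact: L1 (Hr n))).
  - apply: Def_all; apply: (IHa _ _ _ (fun e => scons (e 0) (rho (fun n => e (S n))))); try exact: DTerm_lift.
    move=> -[|n] /=; first def. exact: DTerm_lift (Hr n).
Qed.
End Names.
Ltac def_ext4 ::= first [ apply Def_below | apply Def_feq ].

Definition preorder (V : zfc_model) (A L : V) : Prop :=
  (forall p, p ε A -> below A L p p) /\ (forall p q r, below A L p q -> below A L q r -> below A L p r).

Section Forcing.
Variables (V : zfc_model) (A L : V).
Hypothesis PO : preorder A L.
Notation le := (below A L).
Notation feq := (forces_eq A L).
Notation "p ⊩ a" := (forces A L p a) (at level 100).
Implicit Types (p q r s t u : V) (a b : fml V).

Lemma le_refl p : p ε A -> le p p. Proof. by case: PO => H _; exact: H. Qed.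
Lemma le_trans p q r : le p q -> le q r -> le p r. Proof. by case: PO => _; apply. Qed.
Lemma le_l p q : le p q -> p ε A. Proof. by case. Qed.
Lemma le_r p q : le p q -> q ε A. Proof. by case=> _ []. Qed.
Lemma le_ll p q : le p q -> le p p. Proof. by move=> /le_l /le_refl. Qed.

Lemma feq_mono p q s t : le q p -> feq p s t -> feq q s t.
Proof.
  move=> qp /feqE [H1 H2]; apply/feqE; split=> x c K r r1 r2.
    exact: H1 K r (le_trans r1 qp) r2. exact: H2 K r (le_trans r1 qp) r2.
Qed.
Lemma feq_dense p s t : (forall q, le q p -> exists r, le r q /\ feq r s t) -> feq p s t.
Proof.
  move=> H; apply/feqE; split=> x c K q q1 q2; case: (H q q1) => r [rq /feqE [H1 H2]].
    case: (H1 x c K r (le_ll rq) (le_trans rq q2)) => r' [t' [b [A1 A2]]].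
    by exists r', t', b; split=> //; exact: le_trans rq.
  case: (H2 x c K r (le_ll rq) (le_trans rq q2)) => r' [t' [b [A1 A2]]].
  by exists r', t', b; split=> //; exact: le_trans rq.
Qed.
Lemma feq_refl s : forall p, feq p s s.
Proof.
  move: s; apply: name_ind => s IH p; apply/feqE; split=> x c K q q1 q2; exists q, x, c;
    (split; [exact: le_ll q1|split=> //; split=> //; exact: IH K _]).
Qed.
Lemma feq_sym s : forall p t, feq p s t -> feq p t s.
Proof.
  move: s; apply: (name_ind (P := fun s => forall p t, feq p s t -> feq p t s)) => s IH p t /feqE [H1 H2].
  apply/feqE; split=> x c K q q1 q2.
    case: (H2 x c K q q1 q2) => r [t' [b [A1 [A2 [A3 A4]]]]]; exists r, t', b; do 3 split=> //; exact: IH A2 _ _ A4.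
  case: (H1 x c K q q1 q2) => r [t' [b [A1 [A2 [A3 A4]]]]]; exists r, t', b; do 3 split=> //; exact: IH K _ _ A4.
Qed.
Lemma feq_trans s : forall p t u, feq p s t -> feq p t u -> feq p s u.
Proof.
  move: s; apply: (name_ind (P := fun s => forall p t u, feq p s t -> feq p t u -> feq p s u)) => s IH p t u H K.
  move: (H) (K) => /feqE [H1 H2] /feqE [K1 K2]; apply/feqE; split=> x c Kx q q1 q2.
    case: (H1 x c Kx q q1 q2) => r [t' [b [A1 [A2 [A3 A4]]]]].
    case: (K1 t' b A2 r (le_trans A1 q1) A3) => r' [u' [d [B1 [B2 [B3 B4]]]]].
    exists r', u', d; split; first exact: le_trans A1. do 2 split=> //; apply: (IH x c Kx r' t') => //.
    exact: feq_mono A4.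
  case: (K2 x c Kx q q1 q2) => r [t' [b [A1 [A2 [A3 A4]]]]].
  case: (H2 t' b A2 r (le_trans A1 q1) A3) => r' [u' [d [B1 [B2 [B3 B4]]]]].
  exists r', u', d; split; first exact: le_trans A1. do 2 split=> //; apply: (IH u' d B2 r' t') => //.
  exact: feq_mono A4.
Qed.

Lemma memE p s t : (p ⊩ Mem s t) <->
  forall q, le q p -> exists r t' (b : V), le r q /\ pair t' b ε t /\ le r b /\ feq r s t'.
Proof.
  split=> H q /H [r [t' [b [A1 [/elemE A2 A3]]]]]; by exists r, t', b.
Qed.
Lemma mem_intro p s t (b : V) : pair s b ε t -> le p b -> p ⊩ Mem s t.
Proof.
  move=> H pb; apply/memE => q qp; exists q, s, b; split; first exact: le_ll qp.
  by split=> //; split; [exact: le_trans pb|exact: feq_refl].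
Qed.

Lemma forces_mono a : forall p q, le q p -> (p ⊩ a) -> (q ⊩ a).
Proof.
  elim: a => [s t|s t||a IHa b IHb|a IHa b IHb|F IH] p q qp //=.
  - by move=> H r rq; apply: H; exact: le_trans qp.
  - exact: feq_mono.
  - by move=> [H K]; split; [exact: IHa H|exact: IHb K].
  - by move=> H r rq; apply: H; exact: le_trans qp.
  - by move=> H x; exact: IH (H x).
Qed.
Lemma forces_dense a : forall p, p ε A -> (forall q, le q p -> exists r, le r q /\ (r ⊩ a)) -> p ⊩ a.
Proof.
  elim: a => [s t|s t||a IHa b IHb|a IHa b IHb|F IH] p pA H /=.
  - move=> q /H [r [rq K]]; case: (K r (le_ll rq)) => r' [t' [b [A1 A2]]].
    by exists r', t', b; split=> //; exact: le_trans rq.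
  - exact: feq_dense.
  - by case: (H p (le_refl pA)) => r [].
  - by split; [apply: IHa|apply: IHb] => // q /H [r [rq [K1 K2]]]; exists r.
  - move=> q qp K; apply: IHb; first exact: le_l qp.
    move=> r rq; case: (H r (le_trans rq qp)) => r' [rr' N]; exists r'; split=> //.
    by apply: N; [exact: le_ll rr'|apply: forces_mono K; exact: le_trans rq].
  - by move=> x; apply: IH => // q /H [r [rq K]]; exists r.
Qed.

Lemma mem_congr_l p s s' t : feq p s s' -> (p ⊩ Mem s t) -> p ⊩ Mem s' t.
Proof.
  move=> H /memE K; apply/memE => q qp; case: (K q qp) => r [t' [b [A1 [A2 [A3 A4]]]]].
  exists r, t', b; do 3 split=> //; apply: feq_trans A4; apply: feq_sym; apply: feq_mono H; exact: le_trans qp.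
Qed.
Lemma mem_congr_r p s t t' : feq p t t' -> (p ⊩ Mem s t) -> p ⊩ Mem s t'.
Proof.
  move=> /feqE [H _] /memE K; apply/memE => q qp; case: (K q qp) => r [x [b [A1 [A2 [A3 A4]]]]].
  case: (H x b A2 r (le_trans A1 qp) A3) => r' [y [c [B1 [B2 [B3 B4]]]]].
  exists r', y, c; split; first exact: le_trans A1. do 2 split=> //.
  by apply: feq_trans B4; exact: feq_mono A4.
Qed.

Lemma forces_subst (a : dfml) : forall e e' p, (forall n, feq p (e n) (e' n)) ->
  (p ⊩ emb a e) -> p ⊩ emb a e'.
Proof.
  have W e e' p q : le q p -> (forall n, feq p (e n) (e' n)) -> forall n, feq q (e n) (e' n).
    by move=> qp H n; exact: feq_mono (H n).
  elim: a => [i j|i j||a IHa b IHb|a IHa b IHb|a IHa] e e' p H //=.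
  - by move=> K; apply: (mem_congr_l (H i)); apply: (mem_congr_r (H j)).
  - by move=> K; apply: feq_trans (H j); apply: feq_trans K; apply: feq_sym; exact: H.
  - by move=> [K1 K2]; split; [exact: IHa K1|exact: IHb K2].
  - move=> K q qp Kq; apply: (IHb e); first exact: W H. apply: K => //; apply: (IHa e') Kq => n.
    by apply: feq_sym; exact: W H n.
  - by move=> K x; apply: IHa (K x) => -[|n] //=; exact: feq_refl.
Qed.

Lemma forces_all p (F : V -> fml V) : (p ⊩ All F) <-> forall x, p ⊩ F x.
Proof. by []. Qed.
Lemma forces_imp p a b : (p ⊩ Imp a b) <-> forall q, le q p -> (q ⊩ a) -> (q ⊩ b).
Proof. by []. Qed.
Lemma forces_neg p a : (p ⊩ Neg a) <-> forall q, le q p -> ~ (q ⊩ a).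
Proof. by []. Qed.
Lemma forces_and p a b : (p ⊩ And a b) <-> (p ⊩ a) /\ (p ⊩ b).
Proof. by []. Qed.
Lemma forces_iff p a b : (p ⊩ Iff a b) <-> forall q, le q p -> ((q ⊩ a) <-> (q ⊩ b)).
Proof.
  split=> [[H K] q qp|H]; first by split; [exact: H|exact: K].
  by split=> q qp; case: (H q qp).
Qed.
Lemma forces_eqE p s t : (p ⊩ Eq s t) <-> feq p s t.
Proof. by []. Qed.
Lemma forces_bot p : ~ (p ⊩ Bot).
Proof. by []. Qed.

Lemma forces_ex p (F : V -> fml V) : (p ⊩ Ex F) <->
  forall q, le q p -> exists r x, le r q /\ (r ⊩ F x).
Proof.
  split=> [H q qp|H q qp K].
    apply: NNPP => N; apply: (H q qp) => x r rq K; by apply: N; exists r, x.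
  case: (H q qp) => r [x [rq Kx]]; exact: (K x r rq Kx).
Qed.
Lemma forces_or p a b : (p ⊩ Or a b) <-> forall q, le q p -> exists r, le r q /\ ((r ⊩ a) \/ (r ⊩ b)).
Proof.
  split=> [H q qp|H q qp K].
    case: (classic (exists r, le r q /\ (r ⊩ a))) => [[r [rq Ha]]|N]; first by exists r; auto.
    exists q; split; first exact: le_ll qp. right; apply: H => // r rq Ka; by apply: N; exists r.
  apply: forces_dense; first exact: le_l qp. move=> r rq; case: (H r (le_trans rq qp)) => r' [rr' [Ha|Hb]]; last by exists r'.
  by case: (K r' (le_trans rr' rq) Ha).
Qed.
Lemma forces_decide p a : p ε A -> exists q, le q p /\ ((q ⊩ a) \/ (q ⊩ Neg a)).
Proof.
  move=> pA; case: (classic (exists q, le q p /\ (q ⊩ a))) => [[q [qp H]]|N]; first by exists q; auto.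
  by exists p; split; [exact: le_refl|right=> q qp K; apply: N; exists q].
Qed.
Lemma forces_stable p a : p ε A -> (forall q, le q p -> ~ (q ⊩ Neg a)) -> p ⊩ a.
Proof.
  move=> pA H; apply: forces_dense => // q qp; case: (forces_decide a (le_l qp)) => r [rq [K|K]]; first by exists r.
  by case: (H r (le_trans rq qp) K).
Qed.
Lemma forces_con p a : p ε A -> (p ⊩ a) -> ~ (p ⊩ Neg a).
Proof. by move=> pA H K; apply: (K p (le_refl pA)). Qed.
End Forcing.
Global Opaque forces.

(** * The axioms of ZFC are forced *)

Section DefForces.
Variable V : zfc_model.
Lemma Def_f0 phi (A L q : (nat -> V) -> V) (e0 : nat -> V) :
  DTerm A -> DTerm L -> DTerm q -> Def (fun e => forces (A e) (L e) (q e) (emb phi e0)).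
Proof. by move=> *; apply: (@Def_forces _ phi _ _ _ (fun _ => e0)) => // n; exact: DTerm_const. Qed.
Lemma Def_f1 phi (A L q x : (nat -> V) -> V) (e0 : nat -> V) :
  DTerm A -> DTerm L -> DTerm q -> DTerm x -> Def (fun e => forces (A e) (L e) (q e) (emb phi (scons (x e) e0))).
Proof. by move=> *; apply: (@Def_forces _ phi _ _ _ (fun e => scons (x e) e0)) => // -[|n] //=; exact: DTerm_const. Qed.
Lemma Def_f2 phi (A L q x y : (nat -> V) -> V) (e0 : nat -> V) :
  DTerm A -> DTerm L -> DTerm q -> DTerm x -> DTerm y ->
  Def (fun e => forces (A e) (L e) (q e) (emb phi (scons (x e) (scons (y e) e0)))).
Proof. by move=> *; apply: (@Def_forces _ phi _ _ _ (fun e => scons (x e) (scons (y e) e0))) => // -[|[|n]] //=; exact: DTerm_const. Qed.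
Lemma Def_f3 phi (A L q x y z : (nat -> V) -> V) (e0 : nat -> V) :
  DTerm A -> DTerm L -> DTerm q -> DTerm x -> DTerm y -> DTerm z ->
  Def (fun e => forces (A e) (L e) (q e) (emb phi (scons (x e) (scons (y e) (scons (z e) e0))))).
Proof. by move=> *; apply: (@Def_forces _ phi _ _ _ (fun e => scons (x e) (scons (y e) (scons (z e) e0)))) => // -[|[|[|n]]] //=; exact: DTerm_const. Qed.
Lemma Def_fmem (A L q x y : (nat -> V) -> V) :
  DTerm A -> DTerm L -> DTerm q -> DTerm x -> DTerm y -> Def (fun e => forces (A e) (L e) (q e) (Mem (x e) (y e))).
Proof.
  move=> *; apply: (@Def_forces _ (DMem 0 1) _ _ _ (fun e => scons (x e) (scons (y e) (fun _ => x e)))) => //.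
  by move=> -[|[|n]].
Qed.
End DefForces.
Ltac def_ext5 ::= first [ apply Def_fmem | apply Def_f3 | apply Def_f2 | apply Def_f1 | apply Def_f0 ].

Section ForcedZFC.
Variables (V : zfc_model) (A L : V).
Hypothesis PO : preorder A L.
Notation le := (below A L).
Notation feq := (forces_eq A L).
Notation "p ⊩ a" := (forces A L p a%fml) (at level 100).
Implicit Types (p q r s t u x y z : V).

(** The general shape of the names built below: its value collects the values of those [s] in [X]
    for which [Psi s q] holds with some [q] in the generic filter. *)
Definition nm (X : V) (Psi : V -> V -> Prop) : V :=
  sep (prod X A) (fun z => exists s q, z = pair s q /\ Psi s q).
Lemma in_nm X Psi s q : Def (fun e => Psi (e 0) (e 1)) ->
  (pair s q ε nm X Psi <-> s ε X /\ q ε A /\ Psi s q).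
Proof.
  move=> D; have D1 : Def (fun e : nat -> V => exists s q, e 0 = pair s q /\ Psi s q) by def.
  rewrite (in_sep _ D1) pair_prod; split=> [[[H K] [s' [q' [/pair_inj [E1 E2] N]]]]|[H [K N]]]; first by subst.
  by split=> //; exists s, q.
Qed.
Lemma mem_nm X Psi p w : Def (fun e => Psi (e 0) (e 1)) -> ((p ⊩ w ∈ nm X Psi) <->
  forall q, le q p -> exists r s c, le r q /\ s ε X /\ Psi s c /\ le r c /\ feq r w s).
Proof.
  move=> D; rewrite memE; split=> H q /H.
    move=> [r [s [c [A1 [/(in_nm _ _ _ D) [A2 [A3 A4]] [A5 A6]]]]]]; by exists r, s, c.
  move=> [r [s [c [A1 [A2 [A3 [A4 A5]]]]]]]; exists r, s, c; do 2 split=> //.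
  by apply/(in_nm _ _ _ D); split=> //; split=> //; case: A4 => _ [].
Qed.
Lemma nm_intro X (Psi : V -> V -> Prop) p s : Def (fun e => Psi (e 0) (e 1)) -> p ε A -> s ε X -> Psi s p -> p ⊩ s ∈ nm X Psi.
Proof.
  move=> D pA sX H; apply: (mem_intro PO (b := p)); last exact: le_refl.
  by apply/(in_nm _ _ _ D).
Qed.

Lemma F_ext p x y : (p ⊩ ∀ z, z ∈ x ⇔ z ∈ y) -> feq p x y.
Proof.
  move=> /forces_all H; apply/feqE; split=> s c K q qp qc; have /forces_iff /(_ q qp) [H1 H2] := H s.
    have /memE M1 := H1 (mem_intro PO K qc).
    by case: (M1 q (le_ll PO qp)) => r [t [b M2]]; exists r, t, b.
  have /memE M1 := H2 (mem_intro PO K qc).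
  case: (M1 q (le_ll PO qp)) => r [t [b [B1 [B2 [B3 B4]]]]]; exists r, t, b; do 3 split=> //; exact: feq_sym.
Qed.

Lemma F_pair x y : exists z, forall p, p ε A -> p ⊩ is_upair z x y.
Proof.
  have D : Def (fun e : nat -> V => True) by def.
  exists (nm (upair x y) (fun _ _ => True)) => p pA; rewrite /is_upair; apply/forces_all => w; apply/forces_iff => q qp; split.
    move=> /(mem_nm _ _ _ D) H; apply/(forces_or PO) => q' qq'; case: (H q' qq') => r [s [c [A1 [/in_upair A2 [_ [_ A4]]]]]].
    by exists r; split=> //; case: A2 => E1; subst; [left|right]; apply/forces_eqE.
  move=> /(forces_or PO) H; apply: (forces_dense PO); first exact: le_l qp.
  move=> q' qq'; case: (H q' qq') => r [rq K]; exists r; split=> //.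
  have rA := le_l rq.
  by case: K => /forces_eqE K; (apply: (mem_congr_l PO (feq_sym K)); apply: nm_intro => //; apply/in_upair); [left|right].
Qed.

Lemma F_union a : exists u, forall p, p ε A -> p ⊩ ∀ x, x ∈ u ⇔ ∃ y, x ∈ y ∧ y ∈ a.
Proof.
  pose Psi s r := exists y b c, pair y b ε a /\ pair s c ε y /\ le r b /\ le r c.
  have D : Def (fun e : nat -> V => Psi (e 0) (e 1)) by rewrite /Psi; def.
  exists (nm (tcl a) Psi) => p pA; apply/forces_all => x; apply/forces_iff => q qp; split.
    move=> /(mem_nm _ _ _ D) H; apply/forces_ex => q' qq'.
    case: (H q' qq') => r [s [c [A1 [A2 [[y [b [d [B1 [B2 [B3 B4]]]]]] [A4 A5]]]]]].
    exists r, y; split=> //; apply/forces_and; split; last by apply: (mem_intro PO B1); exact: le_trans B3.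
    apply: (mem_congr_l PO (feq_sym A5)); apply: (mem_intro PO B2); exact: le_trans B4.
  move=> /forces_ex H; apply: (forces_dense PO); first exact: le_l qp.
  move=> q' qq'; case: (H q' qq') => r [y [rq /forces_and [/memE K1 K2]]].
  move: K2 => /memE K2; case: (K2 r (le_ll PO rq)) => r1 [y' [b [B1 [B2 [B3 B4]]]]].
  have : r1 ⊩ x ∈ y' by apply: (mem_congr_r PO B4); apply/memE => z zr; apply: K1; exact: le_trans zr B1.
  move=> /memE /(_ r1 (le_ll PO B1)) [r2 [s [c [C1 [C2 [C3 C4]]]]]].
  exists r2; split; first by apply: (le_trans PO C1); exact: (le_trans PO B1).
  apply: (mem_congr_l PO (feq_sym C4)); apply: (nm_intro D); first exact: le_l C1.
    by apply: (trans_name (@tcl_trans _ a) _ C2); apply: (trans_name (@tcl_trans _ a) _ B2); exact: tcl_self.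
  by exists y', b, c; do 3 split=> //; exact: le_trans C1 B3.
Qed.

Lemma F_sep (phi : dfml) e0 a : exists b, forall p, p ε A -> p ⊩ ∀ x, x ∈ b ⇔ (x ∈ a ∧ emb phi (scons x e0)).
Proof.
  pose Psi s r := (r ⊩ s ∈ a) /\ (r ⊩ emb phi (scons s e0)).
  have D : Def (fun e : nat -> V => Psi (e 0) (e 1)) by rewrite /Psi; def.
  exists (nm (tcl a) Psi) => p pA; apply/forces_all => x; apply/forces_iff => q qp; split.
    move=> /(mem_nm _ _ _ D) H; apply: (forces_dense PO (le_l qp)) => q' qq'.
    case: (H q' qq') => r [s [c [A1 [A2 [[B1 B2] [A4 A5]]]]]]; exists r; split=> //; apply/forces_and; split.
      by apply: (mem_congr_l PO (feq_sym A5)); exact: forces_mono B1.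
    apply: (forces_subst PO (e := scons s e0)); last exact: forces_mono B2.
    by move=> [|n] /=; [exact: feq_sym|exact: feq_refl].
  move=> /forces_and [/memE H1 H2]; apply: (forces_dense PO (le_l qp)) => q' qq'.
  case: (H1 q' qq') => r [s [c [C1 [C2 [C3 C4]]]]]; exists r; split=> //.
  apply: (mem_congr_l PO (feq_sym C4)); apply: (nm_intro D); first exact: le_l C1.
    by apply: (trans_name (@tcl_trans _ a) _ C2); exact: tcl_self.
  split; first exact: (mem_intro PO C2 C3).
  apply: (forces_subst PO (e := scons x e0)); first by move=> [|n] /=; [exact: C4|exact: feq_refl].
  by apply: forces_mono H2 => //; exact: le_trans qq'.
Qed.

(** Below a condition forcing it to be a subset of [a], any [x] is equal to the nice name [x'],
    which uses only first components of elements of [a]. Hence the subsets of [tcl a × A] are enough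
    names. *)
Lemma F_power a : exists u, forall p, p ε A -> p ⊩ ∀ x, x ∈ u ⇔ subset x a.
Proof.
  pose Psi s r := r ⊩ subset s a.
  have D : Def (fun e : nat -> V => Psi (e 0) (e 1)).
    apply: (@Def_forces _ (DAll (DImp (DMem 0 1) (DMem 0 2))) (fun _ => A) (fun _ => L) (fun e => e 1) (fun e => scons (e 0) (scons a (fun _ => a)))); try def.
    by move=> [|[|n]] /=; def.
  exists (nm (pow (prod (tcl a) A)) Psi) => p pA; apply/forces_all => x; apply/forces_iff => q qp; split.
    move=> /(mem_nm _ _ _ D) H; apply: (forces_dense PO (le_l qp)) => q' qq'.
    case: (H q' qq') => r [s [c [A1 [A2 [B1 [A4 A5]]]]]]; exists r; split=> //.
    apply: (@forces_subst _ _ _ PO (DAll (DImp (DMem 0 1) (DMem 0 2))) (scons s (scons a (fun _ => a))) (scons x (scons a (fun _ => a)))); last exact: forces_mono B1.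
    by move=> [|n]; [exact: feq_sym|exact: feq_refl].
  move=> H.
  pose Q s r := (exists b, pair s b ε a) /\ (r ⊩ s ∈ x).
  have DQ : Def (fun e : nat -> V => Q (e 0) (e 1)) by rewrite /Q; def.
  pose x' := nm (tcl a) Q.
  have qA := le_l qp.
  have W : feq q x x'.
    apply: F_ext; apply/forces_all => z; apply/forces_iff => q1 q1q; split.
      move=> Hz; have /forces_imp /(_ q1 q1q Hz) /memE M1 := (proj1 (forces_all _ _ _ _) H) z; apply: (forces_dense PO (le_l q1q)) => q2 q2q.
      case: (M1 q2 q2q) => r [s [c [A1 [A2 [A3 A4]]]]]; exists r; split=> //.
      apply: (mem_congr_l PO (feq_sym A4)); apply: (nm_intro DQ); first exact: le_l A1.
        by apply: (trans_name (@tcl_trans _ a) _ A2); exact: tcl_self.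
      split; first by exists c. apply: (mem_congr_l PO A4); apply: forces_mono Hz => //; exact: le_trans q2q.
    move=> /(mem_nm _ _ _ DQ) H1; apply: (forces_dense PO (le_l q1q)) => q2 q2q.
    case: (H1 q2 q2q) => r [s [c [A1 [A2 [[_ B1] [A4 A5]]]]]]; exists r; split=> //.
    by apply: (mem_congr_l PO (feq_sym A5)); exact: forces_mono B1.
  apply: (mem_congr_l PO (feq_sym W)); apply: (nm_intro D) => //.
    rewrite in_pow => z; rewrite /x' /nm in_sep; first by def. by case.
  apply: (@forces_subst _ _ _ PO (DAll (DImp (DMem 0 1) (DMem 0 2))) (scons x (scons a (fun _ => a))) (scons x' (scons a (fun _ => a)))); last exact: H.
  by move=> [|n]; [exact: W|exact: feq_refl].
Qed.

Lemma F_coll (phi : dfml) e0 a : exists b, forall p, p ε A -> p ⊩ ∀ x, x ∈ a ⇒ (∃ y, emb phi (scons x (scons y e0))) ⇒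
   ∃ y, y ∈ b ∧ emb phi (scons x (scons y e0)).
Proof.
  (* A name and a condition are joined to one index [z]. The premise makes the relation total:
     without a witness any [y] will do. *)
  pose R z y := forall s q, z = pair s q -> (exists y', q ⊩ emb phi (scons s (scons y' e0))) -> (q ⊩ emb phi (scons s (scons y e0))).
  have D : Def (fun e : nat -> V => R (e 0) (e 1)) by rewrite /R; def.
  case: (@collection _ R (prod (tcl a) A) D) => [z zP|B HB].
    case: (classic (exists s q, z = pair s q /\ exists y', q ⊩ emb phi (scons s (scons y' e0)))) => [[s [q [-> [y Hy]]]]|N].
      by exists y => s' q' /pair_inj [<- <-].
    by exists z => s q E1 K; case: N; exists s, q.
  have DT : Def (fun e : nat -> V => True) by def.
  exists (nm B (fun _ _ => True)) => p pA; apply/forces_all => x; apply/forces_imp => q qp /memE Hx; apply/forces_imp => q1 q1q /forces_ex Hy; apply/forces_ex => q2 q2q.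
  case: (Hy q2 q2q) => r [y [rq Ky]].
  case: (Hx r) => [|r1 [s [c [C1 [C2 [C3 C4]]]]]]; first by apply: (le_trans PO rq); exact: (le_trans PO q2q).
  have E1 : r1 ⊩ emb phi (scons s (scons y e0)).
    apply: (forces_subst PO (e := scons x (scons y e0))); last exact: forces_mono Ky.
    by move=> [|n] /=; [exact: C4|exact: feq_refl].
  have sT : s ε tcl a by apply: (trans_name (@tcl_trans _ a) _ C2); exact: tcl_self.
  have r1A := le_l C1.
  case: (HB (pair s r1)) => [|y' [yB /(_ s r1 eq_refl (ex_intro _ y E1)) K]]; first by rewrite pair_prod.
  exists r1, y'; split; first exact: (le_trans PO C1). apply/forces_and; split; first exact: (nm_intro DT).
  apply: (forces_subst PO (e := scons s (scons y' e0))) K.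
  by move=> [|n] /=; [exact: feq_sym|exact: feq_refl].
Qed.

(** Induction on names takes place outside [V], hence is valid for every formula. *)
Lemma F_found (phi : dfml) e0 p : p ε A ->
  (p ⊩ ∀ x, (∀ y, y ∈ x ⇒ emb phi (scons y e0)) ⇒ emb phi (scons x e0)) -> p ⊩ ∀ x, emb phi (scons x e0).
Proof.
  move=> pA /forces_all H; apply/forces_all; apply: name_ind => s IH.
  apply: (proj1 (forces_imp _ _ _ _ _) (H s) p (le_refl PO pA)); apply/forces_all => y; apply/forces_imp => q qp /memE K.
  apply: (forces_dense PO (le_l qp)) => q1 q1q; case: (K q1 q1q) => r [t [b [B1 [B2 [B3 B4]]]]].
  exists r; split=> //; apply: (forces_subst PO (e := scons t e0)).
    by move=> [|n] /=; [exact: feq_sym|exact: feq_refl].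
  apply: (forces_mono PO (p := p)); last exact: IH B2.
  by apply: (le_trans PO B1); exact: (le_trans PO q1q).
Qed.

Lemma rank_name (X : V) : exists o : V, (forall x, x ε X -> ord (app o x)) /\
  forall x y, x ε X -> y ε X -> app o x = app o y -> x = y.
Proof.
  case: (card_ord X) => a [oa [[f [[ff fi] ij]] _]]; exists f; split=> // x xX; exact: ord_in oa (fi x xX).
Qed.

(** The maximum principle without maximal antichains. [sel x q] says that [q] forces the formula of
    [x] and no extension of [q] forces it of a candidate of smaller index. Selected candidates at
    compatible conditions coincide, so [t], glued from the selected ones, is forced equal to [x]
    wherever [x] is selected; and some candidate is selected densely often. *)
Lemma F_max (phi : dfml) e0 : exists t, forall p, p ε A -> (p ⊩ ∃ x, emb phi (scons x e0)) -> p ⊩ emb phi (scons t e0).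
Proof.
  pose R q y := (exists y', q ⊩ emb phi (scons y' e0)) -> q ⊩ emb phi (scons y e0).
  have D : Def (fun e : nat -> V => R (e 0) (e 1)) by rewrite /R; def.
  case: (@collection _ R A D) => [q qA|X HX].
    case: (classic (exists y', q ⊩ emb phi (scons y' e0))) => [[y Hy]|N]; [by exists y|by exists q].
  case: (rank_name X) => o [oo oi].
  pose sel x q := x ε X /\ (q ⊩ emb phi (scons x e0)) /\
     forall x', x' ε X -> app o x' ε app o x -> forall q', le q' q -> ~ (q' ⊩ emb phi (scons x' e0)).
  have Ds : Def (fun e : nat -> V => sel (e 0) (e 1)) by rewrite /sel; def.
  pose Psi y a := exists x b, pair y b ε x /\ le a b /\ sel x a.
  have DP : Def (fun e : nat -> V => Psi (e 0) (e 1)) by rewrite /Psi; def.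
  pose t := nm (tcl X) Psi; exists t => p pA /forces_ex H.
  have W x q : q ε A -> sel x q -> feq q t x.
    move=> qA [xX [Hx Lx]]; apply: F_ext; apply/forces_all => z; apply/forces_iff => q1 q1q; split.
      move=> /(mem_nm _ _ _ DP) K; apply: (forces_dense PO (le_l q1q)) => q2 q2q.
      case: (K q2 q2q) => r [s [c [A1 [A2 [[x' [b [B1 [B2 [B3 [B4 B5]]]]]] [A4 A5]]]]]].
      have rq : le r q by apply: (le_trans PO A1); exact: (le_trans PO q2q).
      have E1 : x' = x.
        apply: oi => //; case: (ord_tot (oo _ B3) (oo _ xX)) => [N|[//|N]].
          by case: (Lx x' B3 N r rq); exact: forces_mono B4.
        by case: (B5 x xX N r A4); exact: forces_mono Hx.
      subst x'; exists r; split=> //; apply: (mem_congr_l PO (feq_sym A5)).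
      by apply: (mem_intro PO B1); exact: le_trans B2.
    move=> /memE K; apply: (forces_dense PO (le_l q1q)) => q2 q2q.
    case: (K q2 q2q) => r [s [b [B1 [B2 [B3 B4]]]]]; exists r; split=> //.
    have rq : le r q by apply: (le_trans PO B1); exact: (le_trans PO q2q).
    apply: (mem_congr_l PO (feq_sym B4)); apply: (nm_intro DP); first exact: le_l B1.
      by apply: (trans_name (@tcl_trans _ X) _ B2); apply: (@tcl_trans _ X X (tcl_self X)).
    exists x, b; do 2 split=> //; split=> //; split; first exact: forces_mono Hx.
    by move=> x' x'X N q' q'r; apply: (Lx x' x'X N); exact: le_trans q'r rq.
  apply: (forces_dense PO pA) => q qp; case: (H q qp) => r [y [rq Ky]].
  case: (HX r (le_l rq)) => y' [yX /(_ (ex_intro _ y Ky)) Ky'].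
  have [al [oal [[x [xX [[r1 [r1q K1]] Eal]]] Lal]]] : exists al, ord al /\
     (exists x, x ε X /\ (exists r1, le r1 q /\ (r1 ⊩ emb phi (scons x e0))) /\ app o x = al) /\
     forall b, b ε al -> ~ (exists x, x ε X /\ (exists r1, le r1 q /\ (r1 ⊩ emb phi (scons x e0))) /\ app o x = b).
    apply: ord_least; first def. exists (app o y'); split; first exact: oo. exists y'; split=> //; split=> //; by exists r.
  exists r1; split=> //.
  have S1 : sel x r1.
    split=> //; split=> // x' x'X N q' q'r K; apply: (Lal (app o x')); first by rewrite -Eal.
    by exists x'; split=> //; split=> //; exists q'; split=> //; exact: le_trans q'r r1q.
  apply: (forces_subst PO (e := scons x e0)) K1 => -[|n] /=; last exact: feq_refl.
  by apply: feq_sym => //; apply: W => //; exact: le_l r1q.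
Qed.

(** The chosen element of [x] is the name of least index forced into it. It does not depend on the
    name used for [x]: if two names of the same set have selected elements at a common condition,
    neither index can be the smaller one. *)
Lemma F_choice a : exists c, forall p, p ε A ->
  (p ⊩ ∀ x, x ∈ a ⇒ ∃ z, z ∈ x) -> (p ⊩ ∀ x y z, x ∈ a ⇒ y ∈ a ⇒ z ∈ x ⇒ z ∈ y ⇒ x ≈ y) ->
  p ⊩ ∀ x, x ∈ a ⇒ ∃ z, (z ∈ x ∧ z ∈ c) ∧ ∀ z', (z' ∈ x ∧ z' ∈ c) ⇒ z ≈ z'.
Proof.
  pose X : V := tcl a; case: (rank_name X) => o [oo oi].
  pose sel x z q := (q ⊩ x ∈ a) /\ (q ⊩ z ∈ x) /\
    forall z', z' ε X -> app o z' ε app o z -> forall q', le q' q -> ~ (q' ⊩ z' ∈ x).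
  pose Psi z q := z ε X /\ exists x, sel x z q.
  have DP : Def (fun e : nat -> V => Psi (e 0) (e 1)) by rewrite /Psi /sel; def.
  have CR x y q : feq q x y -> forall z, (q ⊩ z ∈ x) -> q ⊩ z ∈ y by move=> E1 z; exact: mem_congr_r.
  exists (nm X Psi) => p pA /forces_all NE /forces_all DJ; apply/forces_all => x; apply/forces_imp => q qp Hx.
  have EX r0 : le r0 q -> exists r z, le r r0 /\ z ε X /\ sel x z r.
    move=> r0q; have /forces_imp /(_ q qp Hx) /forces_ex N1 := NE x.
    case: (N1 r0 r0q) => r1 [y [r1q Ky]].
    have /memE Ha := Hx; case: (Ha r1) => [|r2 [x' [b [B1 [B2 [B3 B4]]]]]]; first exact: le_trans r0q.
    have Ky' : r2 ⊩ y ∈ x' by apply: (CR x) => //; exact: forces_mono Ky.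
    move: (Ky') => /memE /(_ r2 (le_ll PO B1)) [r3 [z [c [C1 [C2 [C3 C4]]]]]].
    have zX : z ε X by apply: (trans_name (@tcl_trans _ a) _ C2); apply: (trans_name (@tcl_trans _ a) _ B2); exact: tcl_self.
    have r3q : le r3 r0 by apply: (le_trans PO C1); exact: (le_trans PO B1).
    have Kz : r3 ⊩ z ∈ x.
      apply: (CR x'); first by apply: feq_sym => //; exact: feq_mono B4.
      apply: (mem_congr_l PO C4); exact: forces_mono Ky'.
    have [al [oal [[w [wX [[r4 [r4q K1]] Eal]]] Lal]]] : exists al, ord al /\
       (exists x', x' ε X /\ (exists r1, le r1 r0 /\ (r1 ⊩ x' ∈ x)) /\ app o x' = al) /\
       forall b, b ε al -> ~ (exists x', x' ε X /\ (exists r1, le r1 r0 /\ (r1 ⊩ x' ∈ x)) /\ app o x' = b).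
      apply: ord_least; first def. exists (app o z); split; first exact: oo. exists z; split=> //; split=> //; by exists r3.
    exists r4, w; split=> //; split=> //; split; first by apply: forces_mono Hx => //; exact: le_trans r0q.
    split=> // z' z'X N q' q'r K; apply: (Lal (app o z')); first by rewrite -Eal.
    by exists z'; split=> //; split=> //; exists q'; split=> //; exact: le_trans q'r r4q.
  apply/forces_ex => r0 r0q; case: (EX r0 r0q) => r [z [rr0 [zX Sz]]]; exists r, z; split=> //.
  have rA := le_l rr0; have rq := le_trans PO rr0 r0q; have rp := le_trans PO rq qp.
  apply/forces_and; split; first by apply/forces_and; split; [case: Sz => _ []|apply: (nm_intro DP) => //; split=> //; exists x].
  apply/forces_all => z'; apply/forces_imp => r1 r1r /forces_and [Hz' /(mem_nm _ _ _ DP) Hc].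
  apply/forces_eqE; apply: (feq_dense PO) => r2 r2r.
  case: (Hc r2 r2r) => r3 [w [d [A1 [wX [[_ [x1 [S1 [S2 S3]]]] [A4 A5]]]]]]; exists r3; split=> //.
  have r3r : le r3 r by apply: (le_trans PO A1); exact: (le_trans PO r2r).
  have r3A := le_l A1.
  have wx1 : r3 ⊩ w ∈ x1 by exact: forces_mono S2.
  have wx : r3 ⊩ w ∈ x.
    by apply: (mem_congr_l PO A5); apply: forces_mono Hz' => //; exact: le_trans r2r.
  have r3p := le_trans PO r3r rp.
  have E1 : feq r3 x x1.
    have R3 := le_refl PO r3A.
    have /forces_all /(_ x1) /forces_all /(_ w) /forces_imp /(_ r3 r3p) K := DJ x.
    have /forces_imp /(_ r3 R3) {}K : r3 ⊩ x1 ∈ a ⇒ w ∈ x ⇒ w ∈ x1 ⇒ x ≈ x1.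
      by apply: K; apply: forces_mono Hx => //; exact: (le_trans PO r3r).
    have /forces_imp /(_ r3 R3 wx) /forces_imp /(_ r3 R3 wx1) /forces_eqE // : r3 ⊩ w ∈ x ⇒ w ∈ x1 ⇒ x ≈ x1.
    by apply: K; exact: forces_mono S1.
  have E2 : w = z.
    apply: oi => //; case: (ord_tot (oo _ wX) (oo _ zX)) => [N|[//|N]].
      by case: Sz => _ [_ K]; case: (K w wX N r3 r3r).
    case: (S3 z zX N r3 A4); apply: (mem_congr_r PO E1); case: Sz => _ [K _]; exact: forces_mono K.
  by subst w; apply: feq_sym.
Qed.
End ForcedZFC.

(** * Transfer of theorems to the forcing relation *)

Lemma ultrafilter_ex (X : Type) (F : (X -> Prop) -> Prop) :
  F (fun _ => True) -> (forall P Q, F P -> F Q -> F (fun x => P x /\ Q x)) ->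
  (forall P Q : X -> Prop, (forall x, P x -> Q x) -> F P -> F Q) -> ~ F (fun _ => False) ->
  exists U : (X -> Prop) -> Prop, (forall P, F P -> U P) /\
    (forall P Q, U P -> U Q -> U (fun x => P x /\ Q x)) /\
    (forall P Q : X -> Prop, (forall x, P x -> Q x) -> U P -> U Q) /\
    ~ U (fun _ => False) /\ forall P, U P \/ U (fun x => ~ P x).
Proof.
  move=> F1 F2 F3 F4.
  have PF : filter.ProperFilter (F : classical_sets.set_system X).
    apply: filter.Build_ProperFilter; first exact: F4. split; [exact: F1|move=> P Q; exact: F2|move=> P Q; exact: F3].
  case: (filter.ultraFilterLemma PF) => U [UU FU]; exists U.
  have UF : filter.ProperFilter U by case: UU.
  have FF : filter.Filter U by case: UF.
  split; first exact: FU. split; first by move=> P Q; exact: (@filter.filterI _ U FF).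
  split; first by move=> P Q; exact: (@filter.filterS _ U FF).
  split; first exact: (@filter.filter_not_empty _ U UF).
  move=> P; exact: (@filter.in_ultra_setVsetC _ U P UU).
Qed.

Fixpoint dren (f : nat -> nat) (a : dfml) : dfml :=
  match a with
  | DMem i j => DMem (f i) (f j)
  | DEq i j => DEq (f i) (f j)
  | DBot => DBot
  | DAnd a b => DAnd (dren f a) (dren f b)
  | DImp a b => DImp (dren f a) (dren f b)
  | DAll a => DAll (dren (up f) a)
  end.
Lemma emb_dren (X : Type) a : forall f (e : nat -> X), emb (dren f a) e = emb a (fun n => e (f n)).
Proof.
  elim: a => //= [a IHa b IHb|a IHa b IHb|a IHa] f e; rewrite ?IHa ?IHb //.
  congr All; apply: functional_extensionality => x; rewrite IHa; congr emb.
  by apply: functional_extensionality => -[|n].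
Qed.
Fixpoint d_of (a : form) : dfml :=
  match a with
  | FMem i j => DMem i j | FEq i j => DEq i j | FBot => DBot
  | FImp a b => DImp (d_of a) (d_of b) | FAll a => DAll (d_of a)
  end.
Lemma holds_d_of (X : Type) (R : X -> X -> Prop) a : forall e, holds R e a <-> sat R eq (emb (d_of a) e).
Proof.
  elim: a => //= [a IHa b IHb|a IHa] e; first by rewrite IHa IHb.
  by split=> H x; move: (H x); rewrite IHa.
Qed.

(** * Canonical names of the elements of [V] *)

Section Check.
Variable V : zfc_model.
Implicit Types (A L p q r s t x y z : V).

(** The relation [check_name] is inductive and thus external to [V]; this function is definable by
    recursion, and [check_chk] identifies the two. *)
Definition chk A x : V := rec (fun x h => prod (img x (app h)) A) x.
Lemma D_chk (A x : (nat -> V) -> V) : DTerm A -> DTerm x -> DTerm (fun e => chk (A e) (x e)).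
Proof.
  apply: (DTerm_2 (f := chk)); rewrite /chk.
  apply: (@D_rec _ (fun e x h => prod (img x (app h)) (e 0)) (fun e => e 1)); def.
Qed.
Lemma chk_eq A x : chk A x = prod (img x (chk A)) A.
Proof.
  have D : DTerm (fun e : nat -> V => chk A (e 0)) by apply: D_chk; def.
  pose G (x h : V) : V := prod (img x (app h)) A.
  have DG : DTerm (fun e => G (e 0) (e 1)) by rewrite /G; def.
  have -> : chk A x = G x (lam x (chk A)) := rec_eq DG x.
  have D1 : DTerm (fun e : nat -> V => app (lam x (chk A)) (e 0)) by def.
  rewrite /G; suff -> : img x (app (lam x (chk A))) = img x (chk A) by [].
  apply: sext => z; split.
    by move=> /(in_img _ D1) [y [yx ->]]; apply/(in_img _ D); exists y; rewrite (app_lam D yx).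
  by move=> /(in_img _ D) [y [yx ->]]; apply/(in_img _ D1); exists y; rewrite (app_lam D yx).
Qed.
Opaque chk.
Lemma in_chk A x s p : pair s p ε chk A x <-> p ε A /\ exists y, y ε x /\ s = chk A y.
Proof.
  have D : DTerm (fun e : nat -> V => chk A (e 0)) by apply: D_chk; def.
  by rewrite chk_eq pair_prod (in_img _ D); tauto.
Qed.
Lemma chk_elem A x z : z ε chk A x -> exists y p, y ε x /\ p ε A /\ z = pair (chk A y) p.
Proof.
  have D : DTerm (fun e : nat -> V => chk A (e 0)) by apply: D_chk; def.
  rewrite chk_eq in_prod => -[s [p [/(in_img _ D) [y [yx ->]] [pA ->]]]]; by exists y, p.
Qed.
Lemma chk_check x : forall A, check_name A (chk A x) x.
Proof.
  move: x; apply: (well_founded_ind (@zfc_wf V)) => x IH A; constructor.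
    move=> z /chk_elem [y [p [yx [pA ->]]]]; exists y, (chk A y), p; split=> //; split; first exact: IH.
    by split=> //; apply/is_pairE.
  move=> y yx; exists (chk A y); split; first exact: IH.
  by move=> p pA; apply/elemE; apply/in_chk; split=> //; exists y.
Qed.
Lemma check_inv A c x : check_name A c x ->
  (forall z, z ε c -> exists y y' p, y ε x /\ check_name A y' y /\ p ε A /\ z = pair y' p) /\
  (forall y, y ε x -> exists y', check_name A y' y /\ forall p, p ε A -> pair y' p ε c).
Proof.
  case=> {}c {}x H1 H2; split.
    move=> z /H1 [y [y' [p [yx [H [pA /is_pairE E1]]]]]]; by exists y, y', p.
  by move=> y /H2 [y' [H K]]; exists y'; split=> // p /K /elemE.
Qed.
Lemma check_unique x : forall A c c', check_name A c x -> check_name A c' x -> c = c'.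
Proof.
  move: x; apply: (well_founded_ind (@zfc_wf V)) => x IH A.
  have W c c' : check_name A c x -> check_name A c' x -> (c : zf_of V) ⊆ c'.
    move=> /check_inv [H1 _] /check_inv [_ H2] z /H1 [y [y' [p [yx [Hy [pA ->]]]]]].
    by case: (H2 y yx) => y'' [Hy'' K]; rewrite (IH y yx A y' y'' Hy Hy''); exact: K.
  by move=> c c' H K; apply: sub_anti; exact: W.
Qed.
Lemma check_chk A c x : check_name A c x -> c = chk A x.
Proof. by move=> H; apply: check_unique H _; exact: chk_check. Qed.

Variables (A L : V).
Hypothesis PO : preorder A L.
Notation le := (below A L).
Notation feq := (forces_eq A L).
Notation "p ⊩ a" := (forces A L p a%fml) (at level 100).

Lemma mem_chk p w x : (p ⊩ w ∈ chk A x) <->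
  forall q, le q p -> exists r y, le r q /\ y ε x /\ feq r w (chk A y).
Proof.
  rewrite memE; split=> H q qp; case: (H q qp) => r.
    by move=> [t [b [A1 [/in_chk [A2 [y [yx ->]]] [A3 A4]]]]]; exists r, y.
  move=> [y [A1 [A2 A3]]]; exists r, (chk A y), r; split=> //; split; last by split=> //; exact: (le_ll PO A1).
  by apply/in_chk; split; [exact: le_l A1|exists y].
Qed.
Lemma chk_in p y x : p ε A -> y ε x -> p ⊩ chk A y ∈ chk A x.
Proof.
  move=> pA yx; apply: (mem_intro PO (b := p)); last exact: le_refl.
  by apply/in_chk; split=> //; exists y.
Qed.
Lemma F_succ p n : p ε A -> p ⊩ is_succ (chk A (suc n)) (chk A n).
Proof.
  move=> pA; rewrite /is_succ; apply/forces_all => z; apply/forces_iff => q qp; split.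
    move=> /mem_chk H; apply/(forces_or PO) => q1 /H [r [y [rq [/in_suc yn K]]]]; exists r; split=> //.
    have rA := le_l rq; case: yn => [yn|E1]; [left|right; apply/forces_eqE; by subst].
    by apply: (mem_congr_l PO (feq_sym K)); exact: chk_in.
  move=> /(forces_or PO) H; apply: (forces_dense PO (le_l qp)) => q1 /H [r [rq K]]; exists r; split=> //.
  have rA := le_l rq; case: K => [/mem_chk K|/forces_eqE K].
    apply: (forces_dense PO rA) => q2 /K [r' [y [rr [yn E1]]]]; exists r'; split=> //.
    by apply: (mem_congr_l PO (feq_sym E1)); apply: chk_in; [exact: le_l rr|apply/in_suc; left].
  by apply: (mem_congr_l PO (feq_sym K)); apply: chk_in => //; exact: suc_self.
Qed.
Lemma F_inf p : p ε A -> p ⊩ (∃ o, o ∈ chk A omega ∧ is_empty o) ∧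
  ∀ x, x ∈ chk A omega ⇒ ∃ y, y ∈ chk A omega ∧ is_succ y x.
Proof.
  move=> pA; apply/forces_and; split.
    apply/forces_ex => q qp; have qA := le_l qp; exists q, (chk A empty); split; first exact: (le_ll PO qp).
    apply/forces_and; split; first by apply: chk_in => //; exact: omega0.
    rewrite /is_empty; apply/forces_all => z; apply/forces_neg => r rq /mem_chk /(_ r (le_ll PO rq)) [_ [y [_ [/in_empty]]]] //.
  apply/forces_all => x; apply/forces_imp => q qp /mem_chk H; apply/forces_ex => q1 /H [r [n [rq [no K]]]].
  have rA := le_l rq; exists r, (chk A (suc n)); split=> //; apply/forces_and; split; first by apply: chk_in => //; exact: omega_suc.
  apply: (@forces_subst _ _ _ PO (deep 2 0 (is_succ 0 1)) (lenv x (chk A (suc n) :: chk A n :: nil)%list)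
     (lenv x (chk A (suc n) :: x :: nil)%list)); last exact: F_succ.
  by move=> [|[|m]] /=; [exact: feq_refl|exact: feq_sym|exact: feq_refl].
Qed.
End Check.
Ltac def_ext6 ::= first [ apply D_chk ].

(** * The quotient of the class of names by an ultrafilter of conditions *)

Section Quotient.
Variables (V : zfc_model) (A L : V).
Hypothesis PO : preorder A L.
Variable q0 : V.
Hypothesis q0A : q0 ε A.
Notation le := (below A L).
Notation feq := (forces_eq A L).
Notation "p ⊩ a" := (forces A L p a%fml) (at level 100).

(** The sets of conditions that contain a dense open set below [q0]. An ultrafilter extending this
    filter settles every statement, because the conditions deciding it are dense and open; no
    genericity over [V] is involved. *)
Definition dense_filter (P : V -> Prop) : Prop := exists D : V -> Prop,
  (forall p, le p q0 -> exists r, le r p /\ D r) /\ (forall p r, le r p -> D p -> D r) /\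
  forall p, le p q0 -> D p -> P p.

Lemma dense_ultra : exists U : (V -> Prop) -> Prop, (forall P, dense_filter P -> U P) /\
    (forall P Q, U P -> U Q -> U (fun x => P x /\ Q x)) /\
    (forall P Q : V -> Prop, (forall x, P x -> Q x) -> U P -> U Q) /\
    ~ U (fun _ => False) /\ forall P, U P \/ U (fun x => ~ P x).
Proof.
  apply: ultrafilter_ex.
  - exists (fun _ => True); split=> // p pq; exists p; split=> //; exact: (le_ll PO pq).
  - move=> P Q [D [D1 [D2 D3]]] [D' [D1' [D2' D3']]]; exists (fun p => D p /\ D' p); split; [|split].
    + move=> p pq; case: (D1 p pq) => r [rp Dr]; case: (D1' r (le_trans PO rp pq)) => r' [rr' Dr'].
      by exists r'; split; [exact: le_trans rp|split=> //; exact: D2 Dr].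
    + by move=> p r rp [H K]; split; [exact: D2 H|exact: D2' K].
    + by move=> p pq [H K]; split; [exact: D3|exact: D3'].
  - by move=> P Q H [D [D1 [D2 D3]]]; exists D; split=> //; split=> // p pq Dp; apply: H; exact: D3.
  - by move=> [D [D1 [D2 D3]]]; case: (D1 q0 (le_refl PO q0A)) => r [rq Dr]; exact: (D3 r rq Dr).
Qed.

Definition Ult := proj1_sig (constructive_indefinite_description _ dense_ultra).
Definition Tru (a : fml V) : Prop := Ult (fun p => p ⊩ a).

Lemma U_dense P : dense_filter P -> Ult P.
Proof. by rewrite /Ult; case: constructive_indefinite_description => U /= [H _]; exact: H. Qed.
Lemma U_and P Q : Ult P -> Ult Q -> Ult (fun x => P x /\ Q x).
Proof. by rewrite /Ult; case: constructive_indefinite_description => U /= [_ [H _]]; exact: H. Qed.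
Lemma U_up (P Q : V -> Prop) : (forall x, P x -> Q x) -> Ult P -> Ult Q.
Proof. by rewrite /Ult; case: constructive_indefinite_description => U /= [_ [_ [H _]]]; exact: H. Qed.
Lemma U_bot : ~ Ult (fun _ => False).
Proof. by rewrite /Ult; case: constructive_indefinite_description => U /= [_ [_ [_ [H _]]]]. Qed.
Lemma U_neg P : Ult P \/ Ult (fun x => ~ P x).
Proof. by rewrite /Ult; case: constructive_indefinite_description => U /= [_ [_ [_ [_ H]]]]. Qed.
Lemma U_q0 : Ult (fun p => le p q0).
Proof. by apply: U_dense; exists (fun _ => True); split=> // p pq; exists p; split=> //; exact: (le_ll PO pq). Qed.

Lemma T_mono a b : (forall p, le p q0 -> (p ⊩ a) -> (p ⊩ b)) -> Tru a -> Tru b.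
Proof. by move=> H Ha; apply: U_up (U_and U_q0 Ha) => p [pq]; exact: H. Qed.
Lemma T_mono2 a b c : (forall p, le p q0 -> (p ⊩ a) -> (p ⊩ b) -> (p ⊩ c)) -> Tru a -> Tru b -> Tru c.
Proof. by move=> H Ha Hb; apply: U_up (U_and U_q0 (U_and Ha Hb)) => p [pq []]; exact: H. Qed.
Lemma T_forced a : (q0 ⊩ a) -> Tru a.
Proof. by move=> H; apply: U_up U_q0 => p pq; exact: forces_mono H. Qed.
Lemma T_bot : ~ Tru Bot.
Proof. by move=> H; apply: U_bot; apply: U_up H => p /forces_bot. Qed.
Lemma T_dec a : Tru a \/ Tru (Neg a).
Proof.
  case: (U_neg (fun p => p ⊩ a)) => H; [by left|right].
  have K : Ult (fun p => (p ⊩ a) \/ (p ⊩ Neg a)).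
    apply: U_dense; exists (fun p => (p ⊩ a) \/ (p ⊩ Neg a)); split; [|split] => //.
      by move=> p pq; exact: (forces_decide PO a (le_l pq)).
    by move=> p r rp [K|K]; [left|right]; exact: forces_mono K.
  by apply: U_up (U_and H K) => p [N [|]].
Qed.
Lemma T_imp_e a b : Tru (Imp a b) -> Tru a -> Tru b.
Proof. by apply: T_mono2 => p pq /forces_imp H; apply: H; exact: (le_ll PO pq). Qed.
Lemma T_neg a : Tru (Neg a) <-> ~ Tru a.
Proof.
  split=> [H K|N]; last by case: (T_dec a).
  by apply: T_bot; apply: T_imp_e H K.
Qed.
Lemma T_imp a b : Tru (Imp a b) <-> (Tru a -> Tru b).
Proof.
  split=> [|H]; first exact: T_imp_e.
  case: (T_dec a) => [/H|]; apply: T_mono => p pq K; apply/forces_imp => q qp; first by move=> _; exact: forces_mono K.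
  by move=> Ka; move/forces_neg: K => /(_ q qp).
Qed.
Lemma T_and a b : Tru (And a b) <-> Tru a /\ Tru b.
Proof.
  split=> [H|[H K]]; last by apply: T_mono2 H K => p _ ? ?; apply/forces_and.
  by split; apply: T_mono H => p _ /forces_and [].
Qed.
Lemma T_all_e F x : Tru (All F) -> Tru (F x).
Proof. by apply: T_mono => p _ /forces_all. Qed.
Lemma T_ex_i F x : Tru (F x) -> Tru (Ex F).
Proof.
  by apply: T_mono => p pq K; apply/forces_ex => q qp; exists q, x; split; [exact: (le_ll PO qp)|exact: forces_mono K].
Qed.
(** The existential step of the Łoś argument: the maximum principle gives one name which is a
    witness at all conditions forcing the existential statement. *)
Lemma T_ex phi e : Tru (Ex (fun x => emb phi (scons x e))) -> exists x, Tru (emb phi (scons x e)).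
Proof.
  case: (F_max PO phi e) => t Ht H; exists t; apply: T_mono H => p pq; apply: Ht; exact: le_l pq.
Qed.
Lemma T_all phi e : (forall x, Tru (emb phi (scons x e))) -> Tru (All (fun x => emb phi (scons x e))).
Proof.
  move=> H; case: (T_dec (All (fun x => emb phi (scons x e)))) => // N.
  have [x] : exists x, Tru (emb (DImp phi DBot) (scons x e)); last by move=> /= /T_neg; case.
  apply: T_ex; apply: T_mono N => p pq /forces_neg K; apply/forces_ex => q qp; apply: NNPP => N.
  apply: (K q qp); apply/forces_all => x; apply: (forces_stable PO (le_l qp)) => r rq K'; apply: N.
  by exists r, x; split.
Qed.
Lemma T_iff_e a b : Tru (Iff a b) -> (Tru a <-> Tru b).
Proof. by move=> /T_and [/T_imp H /T_imp K]. Qed.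
Lemma T_refl x : Tru (Eq x x).
Proof. by apply: T_forced; apply/forces_eqE; exact: feq_refl. Qed.
Lemma T_sym x y : Tru (Eq x y) -> Tru (Eq y x).
Proof. by apply: T_mono => p _ /forces_eqE H; apply/forces_eqE; exact: feq_sym. Qed.
Lemma T_trans x y z : Tru (Eq x y) -> Tru (Eq y z) -> Tru (Eq x z).
Proof. by apply: T_mono2 => p _ /forces_eqE H /forces_eqE K; apply/forces_eqE; exact: feq_trans H K. Qed.

(** Classes are represented by chosen members, so that equality in the quotient is equality of Rocq,
    as the extensionality field of [zf] demands. *)
Definition rep (x : V) : V := epsilon (inhabits (empty : V)) (fun y => Tru (Eq x y)).
Lemma repP x : Tru (Eq x (rep x)).
Proof. by apply: (epsilon_spec (inhabits (empty : V)) (fun y => Tru (Eq x y))); exists x; exact: T_refl. Qed.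
Lemma rep_eq x y : Tru (Eq x y) -> rep x = rep y.
Proof.
  move=> H; rewrite /rep; congr epsilon; apply: functional_extensionality => z.
  by apply: propositional_extensionality; split; apply: T_trans => //; exact: T_sym.
Qed.
Definition quo : Type := {x : V | rep x = x}.
Definition cls (x : V) : quo := exist _ (rep x) (eq_sym (rep_eq (repP x))).
Definition memQ (a b : quo) : Prop := Tru (Mem (proj1_sig a) (proj1_sig b)).

Lemma cls_eq x y : cls x = cls y <-> Tru (Eq x y).
Proof.
  split=> [H|H].
    have E1 : rep x = rep y by move: (f_equal (@proj1_sig _ _) H).
    by apply: T_trans (repP x) _; rewrite E1; apply: T_sym; exact: repP.
  rewrite /cls; have E1 := rep_eq H; move: (eq_sym _) (eq_sym _); rewrite E1 => a b.
  by rewrite (proof_irrelevance _ a b).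
Qed.
Lemma cls_val a : cls (proj1_sig a) = a.
Proof.
  case: a => x Hx /=; rewrite /cls; move: (eq_sym _); rewrite Hx => a; by rewrite (proof_irrelevance _ a Hx).
Qed.
Lemma memQ_cls x y : memQ (cls x) (cls y) <-> Tru (Mem x y).
Proof.
  rewrite /memQ /=; have Hx := repP x; have Hy := repP y; split=> H.
    have : Tru (Mem (rep x) y).
      by apply: T_mono2 (T_sym Hy) H => p _ /forces_eqE K; exact: mem_congr_r.
    by apply: T_mono2 (T_sym Hx) => p _ /forces_eqE K; exact: mem_congr_l.
  have : Tru (Mem (rep x) y) by apply: T_mono2 Hx H => p _ /forces_eqE K; exact: mem_congr_l.
  by apply: T_mono2 Hy => p _ /forces_eqE K; exact: mem_congr_r.
Qed.

Lemma memQ_l x y : memQ (cls x) y <-> Tru (Mem x (proj1_sig y)).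
Proof. by rewrite -{1}(cls_val y) memQ_cls. Qed.
Lemma memQ_r x y : memQ x (cls y) <-> Tru (Mem (proj1_sig x) y).
Proof. by rewrite -{1}(cls_val x) memQ_cls. Qed.

Lemma satQ a : forall e (eQ : nat -> quo), (forall n, eQ n = cls (e n)) -> (sat memQ eq (emb a eQ) <-> Tru (emb a e)).
Proof.
  elim: a => [i j|i j||a IHa b IHb|a IHa b IHb|a IHa] e eQ H /=.
  - by rewrite !H memQ_cls.
  - by rewrite !H cls_eq.
  - by split=> // /T_bot.
  - by rewrite (IHa _ _ H) (IHb _ _ H) T_and.
  - by rewrite (IHa _ _ H) (IHb _ _ H) T_imp.
  - split=> [K|K w].
      by apply: T_all => x; apply/(IHa _ (scons (cls x) eQ)) => // -[|n] /=.
    apply/(IHa (scons (proj1_sig w) e)); last exact: (T_all_e _ K).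
    by move=> [|n] //=; rewrite cls_val.
Qed.

Lemma sepQ (psi : dfml) (eQ : nat -> quo) (a : quo) :
  exists b, forall x, memQ x b <-> memQ x a /\ sat memQ eq (emb psi (scons x eQ)).
Proof.
  pose e n := proj1_sig (eQ n).
  case: (F_sep PO psi e (proj1_sig a)) => b Hb; exists (cls b) => x.
  have K := T_iff_e (T_all_e (proj1_sig x) (T_forced (Hb q0 q0A))).
  rewrite memQ_r K T_and.
  rewrite (@satQ psi (scons (proj1_sig x) e)) // => -[|n] /=; by rewrite cls_val.
Qed.

Lemma quo_ext (x y : quo) : (forall z, memQ z x <-> memQ z y) -> x = y.
Proof.
  move=> H; rewrite -(cls_val x) -(cls_val y); apply/cls_eq.
  apply: (@T_mono (emb (deep 2 0 (∀ z, z ∈ 0 ⇔ z ∈ 1)%fml) (lenv (proj1_sig x) (proj1_sig x :: proj1_sig y :: nil)%list))).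
    by move=> p _ K; apply/forces_eqE; exact: F_ext.
  apply/(@satQ _ _ (lenv x (x :: y :: nil)%list)).
    by move=> [|[|n]] /=; rewrite cls_val.
  by move=> z /=; split=> /H.
Qed.
Lemma quo_ind (phi : form) (e : nat -> quo) :
  (forall x, (forall y, memQ y x -> holds memQ (scons y e) phi) -> holds memQ (scons x e) phi) ->
  forall x, holds memQ (scons x e) phi.
Proof.
  move=> H; pose e0 n := proj1_sig (e n); pose d := d_of phi.
  pose psi := DAll (DImp (DAll (DImp (DMem 0 1) (dren (fun n => match n with O => O | S n => S (S n) end) d))) d).
  have : Tru (emb (DAll d) e0).
    apply: (@T_mono (emb psi e0)).
      move=> p pq K; apply: (F_found PO (le_l pq)); move: K; rewrite /psi /=.
      congr (forces A L p (All _)); apply: functional_extensionality => x; congr (Imp (All _) _).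
      by apply: functional_extensionality => y; rewrite emb_dren; congr (Imp _ (emb _ _)); apply: functional_extensionality => -[].
    apply/(@satQ _ _ e); first by move=> n; rewrite cls_val.
    move=> x Hx; apply/holds_d_of; apply: H => y yx; apply/holds_d_of.
    have Hy : sat memQ eq (emb (dren (fun n => match n with O => O | S n => S (S n) end) d) (scons y (scons x e))) := Hx y yx.
    move: Hy; rewrite emb_dren; congr sat; congr emb.
    by apply: functional_extensionality => -[].
  move=> K x; apply/holds_d_of; move: x; apply/(@satQ (DAll d) e0) => // n; by rewrite cls_val.
Qed.

Lemma quo_pair (x y : quo) : exists z, forall w, memQ w z <-> w = x \/ w = y.
Proof.
  case: (F_pair PO (proj1_sig x) (proj1_sig y)) => z Hz; exists (cls z) => w.
  have K := T_iff_e (T_all_e (proj1_sig w) (T_forced (Hz q0 q0A))).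
  rewrite memQ_r K -(cls_val w) -(cls_val x) -(cls_val y) !cls_eq !cls_val.
  rewrite /Or T_imp T_neg; case: (classic (Tru (Eq (proj1_sig w) (proj1_sig x)))); tauto.
Qed.
Lemma quo_union (a : quo) : exists u, forall x, memQ x u <-> exists2 y, memQ x y & memQ y a.
Proof.
  case: (F_union PO (proj1_sig a)) => u Hu; exists (cls u) => x.
  have K := T_iff_e (T_all_e (proj1_sig x) (T_forced (Hu q0 q0A))).
  rewrite memQ_r K; split=> [H|[y]].
    have [y] := @T_ex (DAnd (DMem 1 0) (DMem 0 2)) (scons (proj1_sig x) (fun _ => proj1_sig a)) H.
    by move=> /= /T_and [H1 H2]; exists (cls y); rewrite ?memQ_r ?memQ_l.
  by move=> H1 H2; apply: (@T_ex_i _ (proj1_sig y)); apply/T_and.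
Qed.
Lemma quo_power (a : quo) : exists p, forall x, memQ x p <-> (forall z, memQ z x -> memQ z a).
Proof.
  case: (F_power PO (proj1_sig a)) => u Hu; exists (cls u) => x.
  have K := T_iff_e (T_all_e (proj1_sig x) (T_forced (Hu q0 q0A))).
  rewrite memQ_r K.
  rewrite -(@satQ (deep 2 0 (subset 0 1)) (lenv (proj1_sig x) (proj1_sig x :: proj1_sig a :: nil)%list) (lenv x (x :: a :: nil)%list)) //.
  by move=> [|[|n]] /=; rewrite cls_val.
Qed.
(** Replacement from collection and separation: [F_coll] bounds the values by [b0], from which the
    actual values are separated. *)
Lemma quo_replacement (phi : form) (e : nat -> quo) (a : quo) :
  (forall x, memQ x a -> exists! y, holds memQ (scons x (scons y e)) phi) ->
  exists b, forall y, memQ y b <-> exists2 x, memQ x a & holds memQ (scons x (scons y e)) phi.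
Proof.
  move=> H; pose e0 n := proj1_sig (e n); pose d := d_of phi.
  case: (F_coll PO d e0 (proj1_sig a)) => b0 Hb.
  have S1 x y : sat memQ eq (emb d (scons x (scons y e))) <-> Tru (emb d (scons (proj1_sig x) (scons (proj1_sig y) e0))).
    by apply: satQ => -[|[|n]] /=; rewrite cls_val.
  pose f n := match n with O => 0 | S O => 1 | S (S n) => S (S (S n)) end.
  (* The formula says that some [x] in [a] is related to [y], with the existential quantifier
     spelled out by negations; [a] is inserted at place 2 and [f] makes [phi] skip it. *)
  case: (@sepQ (DImp (DAll (DImp (DAnd (DMem 0 2) (dren f d)) DBot)) DBot) (scons a e) (cls b0)) => b Sb.
  have S2 y : sat memQ eq (emb (DImp (DAll (DImp (DAnd (DMem 0 2) (dren f d)) DBot)) DBot) (scons y (scons a e))) <->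
      exists2 x, memQ x a & holds memQ (scons x (scons y e)) phi.
    have W x : sat memQ eq (emb (dren f d) (scons x (scons y (scons a e)))) <-> holds memQ (scons x (scons y e)) phi.
      rewrite emb_dren holds_d_of; suff -> : (fun n => scons x (scons y (scons a e)) (f n)) = scons x (scons y e) by [].
      by apply: functional_extensionality => -[|[|n]].
    split=> [K|[x xa /W Kx] K]; last by apply: (K x).
    apply: NNPP => N; apply: K => x [xa /W Kx]; by apply: N; exists x.
  exists b => y; rewrite Sb S2; split=> [[]|[x xa Hx]] //; split; last by exists x.
  have /T_imp K := T_all_e (proj1_sig x) (T_forced (Hb q0 q0A)).
  have /T_imp {}K := K xa.
  have Ty : Tru (emb d (scons (proj1_sig x) (scons (proj1_sig y) e0))) by apply/S1; rewrite -holds_d_of.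
  have {}K := K (@T_ex_i (fun y => emb d (scons (proj1_sig x) (scons y e0))) _ Ty).
  pose g n := match n with O => 2 | S O => 0 | S (S n) => S (S (S n)) end.
  have Eg y' : emb (dren g d) (scons y' (scons b0 (scons (proj1_sig x) e0))) = emb d (scons (proj1_sig x) (scons y' e0)).
    by rewrite emb_dren; congr emb; apply: functional_extensionality => -[|[|n]].
  have [y' /=] : exists y', Tru (emb (DAnd (DMem 0 1) (dren g d)) (scons y' (scons b0 (scons (proj1_sig x) e0)))).
    apply: T_ex; apply: T_mono K => p _; congr forces; congr Ex; apply: functional_extensionality => y'.
    by rewrite /= Eg.
  rewrite Eg => /T_and [yb Ty']; case: (H x xa) => y1 [_ U].
  have E1 : y = cls y'.
    rewrite -(U y Hx); apply: U; apply/holds_d_of; apply/(@satQ d (scons (proj1_sig x) (scons y' e0))) => //.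
    by move=> [|[|n]] /=; rewrite ?cls_val.
  by rewrite E1 memQ_cls.
Qed.
Lemma quo_infinity : exists w,
    (exists2 o, memQ o w & forall z, ~ memQ z o) /\
    (forall x, memQ x w -> exists2 y, memQ y w & forall z, memQ z y <-> memQ z x \/ z = x).
Proof.
  pose w := cls (chk A omega); exists w.
  have S1 : sat memQ eq (emb (deep 1 0 ((∃ o, o ∈ 0 ∧ is_empty o) ∧ ∀ x, x ∈ 0 ⇒ ∃ y, y ∈ 0 ∧ is_succ y x)%fml) (fun _ => w)).
    apply/(@satQ _ (fun _ => chk A omega)) => //; apply: T_forced; exact: F_inf.
  have {S1} : sat memQ eq ((∃ o, o ∈ w ∧ is_empty o) ∧ ∀ x, x ∈ w ⇒ ∃ y, y ∈ w ∧ is_succ y x)%fml := S1.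
  move=> /sat_and [/sat_ex [o [ow Ho]] K]; split; first by exists o.
  move=> x xw; have /sat_ex [y [yw Hy]] : sat memQ eq (∃ y, y ∈ w ∧ is_succ y x)%fml := K x xw.
  exists y => // z; have : sat memQ eq (z ∈ y ⇔ (z ∈ x ∨ z ≈ x))%fml := Hy z.
  by rewrite sat_iff sat_or.
Qed.
Lemma quo_choice (a : quo) :
    (forall x, memQ x a -> exists z, memQ z x) ->
    (forall x y z, memQ x a -> memQ y a -> memQ z x -> memQ z y -> x = y) ->
    exists c, forall x, memQ x a -> exists! z, memQ z x /\ memQ z c.
Proof.
  move=> H1 H2; case: (F_choice PO (proj1_sig a)) => c Hc; exists (cls c) => x xa.
  have T1 : Tru (emb (deep 1 0 (∀ x, x ∈ 0 ⇒ ∃ z, z ∈ x)%fml) (fun _ => proj1_sig a)).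
    apply/(@satQ _ _ (fun _ => a)); first by move=> n; rewrite cls_val.
    have Q : sat memQ eq (∀ x, x ∈ a ⇒ ∃ z, z ∈ x)%fml; last exact: Q.
    by apply/sat_all => y; apply/sat_imp => ya; apply/sat_ex; exact: H1.
  have T2 : Tru (emb (deep 1 0 (∀ x y z, x ∈ 0 ⇒ y ∈ 0 ⇒ z ∈ x ⇒ z ∈ y ⇒ x ≈ y)%fml) (fun _ => proj1_sig a)).
    apply/(@satQ _ _ (fun _ => a)); first by move=> n; rewrite cls_val.
    exact (fun y z w => @H2 y z w).
  have {T1 T2} := T_mono2 (fun p pq => Hc p (le_l pq)) T1 T2.
  move=> /(T_all_e (proj1_sig x)) /T_imp /(_ xa) K.
  have [z] := @T_ex (deep 3 0 (And (And (Mem 0 1) (Mem 0 2)) (All (fun z' => Imp (And (Mem z' 1) (Mem z' 2)) (Eq 0 z')))))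
     (scons (proj1_sig x) (scons c (fun _ => c))) K.
  move=> /T_and [/T_and [zx zc] U]; exists (cls z); split.
    by rewrite memQ_l memQ_cls.
  move=> z' [zx' zc']; rewrite -(cls_val z'); apply/cls_eq.
  have /T_imp := T_all_e (proj1_sig z') U; apply; apply/T_and; split=> //.
  by apply/memQ_r.
Qed.

Definition quo_zf : zf := @Zf quo memQ quo_ind quo_ext quo_pair quo_union quo_power quo_infinity
  (fun phi e a => let: ex_intro _ b H := sepQ (d_of phi) e a in
     ex_intro _ b (fun x => iff_trans (H x) (and_iff_compat_l _ (iff_sym (holds_d_of _ _ _)))))
  quo_replacement quo_choice.
End Quotient.

(** If [p] did not force the conclusion, some [q] below it would force the negation, and the
    quotient at [q] would satisfy the hypothesis together with the negated conclusion. *)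
Theorem transfer (phi psi : dfml) :
  (forall (W : zf) (e : nat -> W), sat (@E W) eq (emb phi e) -> sat (@E W) eq (emb psi e)) ->
  forall (V : zfc_model) (A L : V), preorder A L -> forall p e, p ε A ->
    forces A L p (emb phi e) -> forces A L p (emb psi e).
Proof.
  move=> H V A L PO p e pA Hp; apply: (forces_stable PO pA) => q qp Nq.
  have qA := le_l qp.
  have K : Tru PO qA (emb phi e) by apply: T_forced; exact: forces_mono Hp.
  have : Tru PO qA (emb psi e).
    apply/(@satQ _ _ _ PO _ qA psi e (fun n => cls PO qA (e n))) => //.
    by apply: (H (quo_zf PO qA)); apply/(@satQ _ _ _ PO _ qA phi e (fun n => cls PO qA (e n))).
  by apply/T_neg; apply: T_forced.
Qed.

(** * The generic extension *)

Section Truth.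
Variables (V : zfc_model) (A L : V).
Hypothesis PO : preorder A L.
Variable G : V -> Prop.
Hypothesis GG : generic A L G.
Notation le := (below A L).
Notation feq := (forces_eq A L).
Notation "p ⊩ a" := (forces A L p a%fml) (at level 100).
Implicit Types (p q r s t : V).

Lemma ext_eqE s t : ext_eq G s t <->
  (forall s' a, pair s' a ε s -> G a -> exists t' b, pair t' b ε t /\ G b /\ ext_eq G s' t') /\
  (forall t' b, pair t' b ε t -> G b -> exists s' a, pair s' a ε s /\ G a /\ ext_eq G s' t').
Proof.
  split.
  - case=> {}s {}t H1 H2; split.
    + move=> s' a /elemE K Ga; case: (H1 s' a K Ga) => t' [b [/elemE A1 A2]]; by exists t', b.
    + move=> s' a /elemE K Ga; case: (H2 s' a K Ga) => t' [b [/elemE A1 A2]]; by exists t', b.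
  - move=> [H1 H2]; constructor.
    + move=> s' a /elemE K Ga; case: (H1 s' a K Ga) => t' [b [A1 A2]]; by exists t', b; rewrite elemE.
    + move=> s' a /elemE K Ga; case: (H2 s' a K Ga) => t' [b [A1 A2]]; by exists t', b; rewrite elemE.
Qed.

Lemma G_dense (P : V -> Prop) p0 : Def (fun e : nat -> V => P (e 0)) -> G p0 ->
  (forall p, le p p0 -> exists q, le q p /\ P q) -> exists q, G q /\ le q p0 /\ P q.
Proof.
  move=> D G0 H.
  (* Genericity concerns sets that are dense everywhere. Adding the conditions incompatible with
     [p0] achieves this, and [G] meets none of them because it contains [p0]. *)
  pose Q d := (le d p0 /\ P d) \/ forall r, le r d -> ~ le r p0.
  have DQ : Def (fun e : nat -> V => Q (e 0)) by rewrite /Q; def.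
  have [d [/(in_sep _ DQ) [dA Qd] Gd]] : exists d, d ε sep A Q /\ G d.
    apply: (generic_dense GG) => [d /(in_sep _ DQ) []//|p pA].
    case: (classic (exists r, le r p /\ le r p0)) => [[r [rp rp0]]|N].
      case: (H r rp0) => q [qr Pq]; exists q; split; last exact: le_trans rp.
      by apply/(in_sep _ DQ); split; [exact: le_l qr|left; split=> //; exact: le_trans rp0].
    exists p; split; last exact: le_refl. apply/(in_sep _ DQ); split=> //; right=> r rp rp0; by apply: N; exists r.
  case: Qd => [[dp Pd]|N]; first by exists d.
  by case: (generic_dir GG Gd G0) => r [_ [rd rp]]; case: (N r rd rp).
Qed.

Lemma ext_eq_truth s : forall t, ext_eq G s t <-> exists p, G p /\ feq p s t.
Proof.
  move: s; apply: name_ind => s IH t; split.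
    move=> /ext_eqE [H1 H2]; case: (generic_nonempty GG) => p0 G0.
    (* [N1] and [N2] are the two ways to force the names apart: an element of one side is never
       identified with an element of the other by an extension of [q]. *)
    pose N1 q := exists s' a, pair s' a ε s /\ le q a /\ forall t' b, pair t' b ε t -> forall r, le r q -> le r b -> ~ feq r s' t'.
    pose N2 q := exists t' b, pair t' b ε t /\ le q b /\ forall s' a, pair s' a ε s -> forall r, le r q -> le r a -> ~ feq r s' t'.
    case: (@G_dense (fun q => feq q s t \/ N1 q \/ N2 q) p0) => //.
      by rewrite /N1 /N2; def.
    - move=> p pp0; case: (classic (exists q, le q p /\ (N1 q \/ N2 q))) => [[q [qp Hq]]|N].
        by exists q; split=> //; right.
      exists p; split; first exact: (le_ll PO pp0). left; apply/feqE; split=> x a Hx q qp qa; apply: NNPP => K; apply: N; exists q; split=> //.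
        left; exists x, a; do 2 split=> //; move=> t' b Hb r rq rb F; apply: K; by exists r, t', b.
      right; exists x, a; do 2 split=> //; move=> t' b Hb r rq rb F; apply: K; by exists r, t', b.
    - move=> q [Gq [qp [H|[[s' [a [Ha [qa N]]]]|[t' [b [Hb [qb N]]]]]]]]; first by exists q.
        have Ga := generic_up GG Gq qa; case: (H1 s' a Ha Ga) => t' [b [Hb [Gb /(IH s' a Ha) [p [Gp Fp]]]]].
        case: (generic_dir GG Gp Gb) => r1 [G1 [r1p r1b]]; case: (generic_dir GG G1 Gq) => r [Gr [rr1 rq]].
        case: (N t' b Hb r rq (le_trans PO rr1 r1b)); apply: (feq_mono PO _ Fp); exact: le_trans r1p.
      have Gb := generic_up GG Gq qb; case: (H2 t' b Hb Gb) => s' [a [Ha [Ga /(IH s' a Ha) [p [Gp Fp]]]]].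
      case: (generic_dir GG Gp Ga) => r1 [G1 [r1p r1b]]; case: (generic_dir GG G1 Gq) => r [Gr [rr1 rq]].
      case: (N s' a Ha r rq (le_trans PO rr1 r1b)); apply: (feq_mono PO _ Fp); exact: le_trans r1p.
  move=> [p [Gp /feqE [H1 H2]]]; apply/ext_eqE; split.
    move=> s' a Ha Ga; case: (generic_dir GG Gp Ga) => p1 [G1 [p1p p1a]].
    case: (@G_dense (fun r => exists t' b, pair t' b ε t /\ le r b /\ feq r s' t') p1) => //; first def.
      move=> q qp; case: (H1 s' a Ha q (le_trans PO qp p1p) (le_trans PO qp p1a)) => r [t' [b [B1 [B2 [B3 B4]]]]].
      by exists r; split=> //; exists t', b.
    move=> r [Gr [_ [t' [b [B1 [B2 B3]]]]]]; exists t', b; split=> //; split; first exact: generic_up Gr B2.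
    by apply/(IH s' a Ha); exists r.
  move=> t' b Hb Gb; case: (generic_dir GG Gp Gb) => p1 [G1 [p1p p1a]].
  case: (@G_dense (fun r => exists s' a, pair s' a ε s /\ le r a /\ feq r s' t') p1) => //; first def.
    move=> q qp; case: (H2 t' b Hb q (le_trans PO qp p1p) (le_trans PO qp p1a)) => r [s' [a [B1 [B2 [B3 B4]]]]].
    by exists r; split=> //; exists s', a.
  move=> r [Gr [_ [s' [a [B1 [B2 B3]]]]]]; exists s', a; split=> //; split; first exact: generic_up Gr B2.
  by apply/(IH s' a B1); exists r.
Qed.

Lemma truth a : forall e, sat (ext_mem G) (ext_eq G) (emb a e) <-> exists p, G p /\ (p ⊩ emb a e).
Proof.
  elim: a => [i j|i j||a IHa b IHb|a IHa b IHb|a IHa] e /=.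
  - split=> [[t' [b [/elemE Hb [Gb /ext_eq_truth [p [Gp Fp]]]]]]|[p [Gp /memE H]]].
      case: (generic_dir GG Gp Gb) => r [Gr [rp rb]]; exists r; split=> //.
      apply: (mem_congr_l PO (feq_sym (feq_mono PO rp Fp))); exact: (mem_intro PO Hb rb).
    case: (@G_dense (fun r => exists t' b, pair t' b ε e j /\ le r b /\ feq r (e i) t') p) => //; first def.
      by move=> q /H [r [t' [b [B1 B2]]]]; exists r; split=> //; exists t', b.
    move=> r [Gr [_ [t' [b [B1 [B2 B3]]]]]]; exists t', b; rewrite elemE; split=> //; split; first exact: generic_up Gr B2.
    by apply/ext_eq_truth; exists r.
  - rewrite ext_eq_truth; split=> -[p [Gp H]]; exists p; split=> //; by apply/forces_eqE.
  - by split=> // -[p [_ /forces_bot]].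
  - rewrite IHa IHb; split=> [[[p [Gp Hp]] [q [Gq Hq]]]|[p [Gp /forces_and [H K]]]]; last by split; exists p.
    case: (generic_dir GG Gp Gq) => r [Gr [rp rq]]; exists r; split=> //; apply/forces_and.
    by split; [exact: forces_mono Hp|exact: forces_mono Hq].
  - rewrite IHa IHb; split=> [H|[p [Gp /forces_imp H]] [q [Gq Hq]]]; last first.
      case: (generic_dir GG Gp Gq) => r [Gr [rp rq]]; exists r; split=> //; apply: H => //; exact: forces_mono Hq.
    case: (generic_nonempty GG) => p0 G0.
    case: (@G_dense (fun q => (q ⊩ emb a e) \/ (q ⊩ Neg (emb a e))) p0) => //.
    + apply: Def_or; first def. apply: (@Def_f0 _ (DImp a DBot)); def.
    + by move=> p pp0; exact: (forces_decide PO (emb a e) (le_l pp0)).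
    + move=> q [Gq [_ [Ka|/forces_neg Ka]]].
        case: H => [|p [Gp Hp]]; first by exists q. exists p; split=> //; apply/forces_imp => r rp _; exact: forces_mono Hp.
      by exists q; split=> //; apply/forces_imp => r rq /Ka; case.
  - split=> [H|[p [Gp /forces_all H]] x]; last by apply/IHa; exists p.
    case: (generic_nonempty GG) => p0 G0.
    case: (@G_dense (fun q => (q ⊩ emb (DAll a) e) \/ exists x, q ⊩ emb (DImp a DBot) (scons x e)) p0) => //; first def.
    + move=> p pp0; case: (classic (exists q x, le q p /\ (q ⊩ emb (DImp a DBot) (scons x e)))) => [[q [x [qp Hq]]]|N].
        by exists q; split=> //; right; exists x.
      exists p; split; first exact: (le_ll PO pp0). left; apply/forces_all => x; apply: (forces_stable PO (le_l pp0)) => q qp K.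
      by apply: N; exists q, x.
    + move=> q [Gq [_ [Ka|[x Ka]]]]; first by exists q.
      move: (H x) => /IHa [p [Gp Hp]]; case: (generic_dir GG Gp Gq) => r [Gr [rp rq]].
      by move/forces_neg: Ka => /(_ r rq) []; exact: forces_mono Hp.
Qed.
End Truth.

(** * Absoluteness of bounded formulas *)

(** A syntactic test: only quantifiers written as a universal quantifier over an implication from a
    membership count as bounded. Formulas have to be brought into this form before absoluteness
    applies. *)
Fixpoint bdd (a : dfml) : Prop :=
  match a with
  | DAnd a b | DImp a b => bdd a /\ bdd b
  | DAll (DImp (DMem O (S _)) a) => bdd a
  | DAll _ => False
  | _ => True
  end.

Section Absolute.
Variables (V : zfc_model) (A L : V).
Hypothesis PO : preorder A L.
Notation le := (below A L).
Notation feq := (forces_eq A L).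
Notation "p ⊩ a" := (forces A L p a%fml) (at level 100).
Implicit Types (p q r s t x y : V).

Lemma chk_inj x : forall y p, p ε A -> feq p (chk A x) (chk A y) -> x = y.
Proof.
  move: x; apply: (well_founded_ind (@zfc_wf V)) => x IH y p pA /feqE [H1 H2].
  have pp := le_refl PO pA.
  apply: (sext (M := zf_of V)) => z; split=> zx.
    have K : pair (chk A z) p ε chk A x by apply/in_chk; split=> //; exists z.
    case: (H1 _ _ K p pp pp) => r [t [b [B1 [/in_chk [_ [y' [Hy E1]]] [B3 B4]]]]].
    by subst t; rewrite (IH z zx y' r (le_l B1) B4).
  have K : pair (chk A z) p ε chk A y by apply/in_chk; split=> //; exists z.
  case: (H2 _ _ K p pp pp) => r [t [b [B1 [/in_chk [_ [y' [Hy E1]]] [B3 B4]]]]].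
  by subst t; rewrite -(IH y' Hy z r (le_l B1) B4).
Qed.

Lemma bdd_abs a : bdd a -> forall e,
  (sat (@mem V) eq (emb a e) -> forall p, p ε A -> p ⊩ emb a (fun n => chk A (e n))) /\
  (~ sat (@mem V) eq (emb a e) -> forall p, p ε A -> p ⊩ Neg (emb a (fun n => chk A (e n)))).
Proof.
  elim: a => [i j|i j||a IHa b IHb|a IHa b IHb|a IHa].
  - move=> _ e; split=> /= H p pA; first exact: chk_in.
    apply/forces_neg => q qp /(mem_chk PO) /(_ q (le_ll PO qp)) [r [y [rq [yx /(chk_inj (le_l rq)) E1]]]].
    by apply: H; rewrite E1.
  - move=> _ e; split=> /= H p pA; first by apply/forces_eqE; rewrite H; exact: feq_refl.
    by apply/forces_neg => q qp /forces_eqE /(chk_inj (le_l qp)).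
  - by move=> _ e; split=> //= _ p pA; apply/forces_neg => q qp /forces_bot.
  - move=> /= [ba bb] e; case: (IHa ba e) => a1 a2; case: (IHb bb e) => b1 b2; split=> H p pA.
      by apply/forces_and; split; [apply: a1; tauto|apply: b1; tauto].
    apply/forces_neg => q qp /forces_and [K1 K2]; have qA := le_l qp.
    have [N|N] : ~ sat (@mem V) eq (emb a e) \/ ~ sat (@mem V) eq (emb b e) by tauto.
      exact: (forces_con PO qA K1 (a2 N q qA)).
    exact: (forces_con PO qA K2 (b2 N q qA)).
  - move=> /= [ba bb] e; case: (IHa ba e) => a1 a2; case: (IHb bb e) => b1 b2; split=> H p pA.
      apply/forces_imp => q qp K; have qA := le_l qp; case: (classic (sat (@mem V) eq (emb a e))) => N.
        by apply: b1 => //; exact: H.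
      by case: (forces_con PO qA K (a2 N q qA)).
    apply/forces_neg => q qp /forces_imp K; have qA := le_l qp.
    apply: (forces_con PO qA (K q (le_refl PO qA) _)); [apply: a1|apply: b2] => //; tauto.
  - case: a IHa => // -[] // -[] // [//|j] a IHa /= ba e; move: (IHa (conj I ba)) => {}IHa; split.
      move=> H p pA; apply/forces_all => z; apply/forces_imp => q qp Hz; move: (Hz) => /(mem_chk PO) K.
      apply: (forces_dense PO (le_l qp)) => q1 /K [r [y [rq [yx E1]]]]; exists r; split=> //; have rA := le_l rq.
      case: (IHa (scons y e)) => /(_ (H y)) K1 _.
      have /forces_imp /(_ r (le_refl PO rA)) K2 := K1 r rA.
      apply: (forces_subst PO (e := fun n => chk A (scons y e n))); last by apply: K2; exact: chk_in.
      by move=> [|n]; [exact: feq_sym|exact: feq_refl].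
    move=> H p pA; apply/forces_neg => q qp /forces_all K; have qA := le_l qp; apply: H => y.
    case: (IHa (scons y e)) => _ N; apply: NNPP => /N /(_ q qA) /forces_neg /(_ q (le_refl PO qA)); apply.
    have E1 : (fun n => chk A (scons y e n)) = scons (chk A y) (fun n => chk A (e n)).
      by apply: functional_extensionality => -[].
    by rewrite E1; exact: K (chk A y).
Qed.

Definition upn s t : V := prod (upair s t) A.
Definition opn s t : V := upn (upn s s) (upn s t).
Lemma mem_upn p w s t : (p ⊩ w ∈ upn s t) <-> forall q, le q p -> exists r, le r q /\ (feq r w s \/ feq r w t).
Proof.
  rewrite memE; split=> H q /H.
    by move=> [r [x [b [B1 [/pair_prod [/in_upair B2 _] [_ B4]]]]]]; exists r; split=> //; case: B2 => E1; subst; auto.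
  move=> [r [rq K]]; have rA := le_l rq; case: K => K; [exists r, s, r|exists r, t, r]; split=> //; rewrite pair_prod in_upair;
    (split; [auto|split=> //; exact: le_refl]).
Qed.
Lemma F_upn p s t : p ε A -> p ⊩ is_upair (upn s t) s t.
Proof.
  move=> pA; rewrite /is_upair; apply/forces_all => w; apply/forces_iff => q qp; split.
    by move=> /mem_upn H; apply/(forces_or PO) => q1 /H [r [rq K]]; exists r; split=> //.
  by move=> /(forces_or PO) H; apply/mem_upn => q1 /H [r [rq K]]; exists r; split=> //.
Qed.
Lemma F_opn p s t : p ε A -> p ⊩ is_pair (opn s t) s t.
Proof.
  move=> pA; rewrite /is_pair; apply/forces_ex => q qp; have qA := le_l qp; exists q, (upn s s); split; first exact: le_refl.
  apply/forces_ex => r rq; have rA := le_l rq; exists r, (upn s t); split; first exact: le_refl.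
  apply/forces_and; split; first exact: F_upn. by apply/forces_and; split; exact: F_upn.
Qed.
End Absolute.
Lemma D_upn (V : zfc_model) (A s t : (nat -> V) -> V) : DTerm A -> DTerm s -> DTerm t -> DTerm (fun e => upn (A e) (s e) (t e)).
Proof. by move=> HA Hs Ht; rewrite /upn; def. Qed.
Lemma D_opn (V : zfc_model) (A s t : (nat -> V) -> V) : DTerm A -> DTerm s -> DTerm t -> DTerm (fun e => opn (A e) (s e) (t e)).
Proof. by move=> HA Hs Ht; rewrite /opn; repeat apply: D_upn. Qed.
Global Opaque upn opn sat.
Ltac def_ext6 ::= first [ apply D_chk | apply D_opn | apply D_upn ].

(** * Small sets and weakly compact cardinals *)

Section Cardinals.
Variable M : zf.
Implicit Types (a b c f g h k l x y z X I : M).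

(** If [k] were [suc b], it would inject into [b]: send [b] to 0, every natural number to its
    successor, and fix the rest. *)
Lemma card_limit k b : card k -> omega ε k -> b ε k -> suc b ε k.
Proof.
  move=> [ok ck] wk bk; case: (suc_in ok bk) => // E1; case: (ck b bk).
  have wb : omega ⊆ b.
    have oo := omega_ord M; have ob := ord_in ok bk.
    apply: ord_nin => // bw; have : suc b ε omega by exact: omega_suc.
    by rewrite E1 => /(mem_asym wk).
  pose F x := iota (fun y => (x = b /\ y = empty) \/ (x ε omega /\ y = suc x) \/ (x <> b /\ ~ x ε omega /\ y = x)).
  have bw : ~ b ε omega by move=> /wb /mem_irr.
  have DF : DTerm (fun e => F (e 0)) by rewrite /F; def.
  have F1 : F b = empty by apply: iota_eq => [|y [[_ ->]|[[/bw]|[]]]] //; left.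
  have F2 x : x ε omega -> F x = suc x.
    by move=> xw; apply: iota_eq => [|y [[E2 _]|[[_ ->]|[_ []]]]] //; [right; left|subst].
  have F3 x : x <> b -> ~ x ε omega -> F x = x.
    by move=> xb xw; apply: iota_eq => [|y [[]|[[]|[_ [_ ->]]]]] //; right; right.
  apply: (@injs_lam _ _ _ F) => //.
    move=> x; rewrite -E1 in_suc => -[xb|->]; last by rewrite F1; apply: wb; exact: omega0.
    case: (classic (x ε omega)) => xw; first by rewrite F2 //; apply: wb; exact: omega_suc.
    by rewrite F3 // => E2; subst; exact: mem_irr xb.
  have S0 y : suc y <> empty by move=> H; move: (suc_self y); rewrite H => /in_empty.
  have FV x : (x = b /\ F x = empty) \/ (x ε omega /\ F x = suc x) \/ (x <> b /\ ~ x ε omega /\ F x = x).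
    case: (classic (x = b)) => [->|N]; first by left. right; case: (classic (x ε omega)) => K; [left|right]; auto.
  move=> x x' _ _; case: (FV x) => [[-> E2]|[[H1 E2]|[H1 [H2 E2]]]]; case: (FV x') => [[-> E3]|[[K1 E3]|[K1 [K2 E3]]]] //;
    rewrite E2 E3 => Q.
  - by case: (S0 x').
  - by case: K2; rewrite -Q; exact: omega0.
  - by case: (S0 x).
  - exact: suc_inj.
  - by case: K2; rewrite -Q; exact: omega_suc.
  - by case: H2; rewrite Q; exact: omega0.
  - by case: H2; rewrite Q; exact: omega_suc.
  - exact: Q.
Qed.

Definition small k X : Prop := exists b, b ε k /\ injs X b.
Definition unbdd k H : Prop := H ⊆ k /\ forall th, th ε k -> exists d, d ε H /\ th ε d.

Lemma small_not k : card k -> ~ small k k.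
Proof. by move=> [_ H] [b [bk K]]; exact: H K. Qed.
Lemma small_sub k X Y : X ⊆ Y -> small k Y -> small k X.
Proof. by move=> S [b [bk H]]; exists b; split=> //; apply: injs_trans H; exact: injs_sub. Qed.
Lemma small_injs k X Y : injs X Y -> small k Y -> small k X.
Proof. by move=> S [b [bk H]]; exists b; split=> //; exact: injs_trans H. Qed.
Lemma small_elem k b : b ε k -> small k b.
Proof. by move=> H; exists b; split=> //; exact: injs_refl. Qed.

Lemma reg_bound k a (F : M -> M) : reg k -> DTerm (fun e => F (e 0)) -> a ε k ->
  (forall x, x ε a -> F x ε k) -> exists b, b ε k /\ forall x, x ε a -> F x ε b.
Proof.
  move=> H D ak HF; case: (H a ak (lam a F)) => [|b [bk Hb]].
    by split; [exact: lam_fun|move=> x xa; rewrite (app_lam D xa); exact: HF].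
  by exists b; split=> // x xa; move: (Hb x xa); rewrite (app_lam D xa).
Qed.

Lemma injs_inverse X b : injs X b -> exists r, forall x, x ε X -> exists i, i ε b /\ app r i = x.
Proof.
  move=> [f [[ff fi] ij]]; pose F i := iota (fun x => x ε X /\ app f x = i).
  have D : DTerm (fun e => F (e 0)) by rewrite /F; def.
  exists (lam b F) => x xX; exists (app f x); split; first exact: fi. rewrite (app_lam D); first exact: fi.
  by apply: iota_eq => // y [yX E1]; exact: ij.
Qed.

Lemma small_bound k X (F : M -> M) : reg k -> DTerm (fun e => F (e 0)) -> ord k -> small k X ->
  (exists o, o ε k) -> (forall x, x ε X -> F x ε k) -> exists b, b ε k /\ forall x, x ε X -> F x ε b.
Proof.
  move=> rk D ok [b [bk /injs_inverse [r Hr]]] [o oK] HF.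
  pose G i := iota (fun y => (app r i ε X /\ y = F (app r i)) \/ (~ app r i ε X /\ y = o)).
  have DG : DTerm (fun e => G (e 0)) by rewrite /G; def.
  have G1 i : app r i ε X -> G i = F (app r i) by move=> H; apply: iota_eq => [|y [[]|[]]] //; left.
  have G2 i : ~ app r i ε X -> G i = o by move=> H; apply: iota_eq => [|y [[]|[]]] //; right.
  case: (@reg_bound k b G) => // [i ib|c [ck Hc]].
    by case: (classic (app r i ε X)) => H; [rewrite G1 //; exact: HF|rewrite G2].
  exists c; split=> // x xX; case: (Hr x xX) => i [ib E1]; move: (Hc i ib); rewrite G1; by rewrite E1.
Qed.

Lemma injs_pow X Y : injs X Y -> injs (pow X) (pow Y).
Proof.
  move=> [f [[ff fi] ij]]; have D : DTerm (fun e : nat -> M => app f (e 0)) by def.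
  apply: (@injs_lam _ _ _ (fun z => img z (app f))); first def.
    by move=> z /in_pow zX; apply/in_pow => y /(in_img _ D) [x [xz ->]]; apply: fi; exact: zX.
  have W z z' : z ⊆ X -> z' ⊆ X -> img z (app f) = img z' (app f) -> z ⊆ z'.
    move=> zX zX' E1 x xz; have : app f x ε img z' (app f) by rewrite -E1; apply/(in_img _ D); exists x.
    move=> /(in_img _ D) [x' [xz' E2]]; rewrite (ij x x' _ _ E2) //; [exact: zX|exact: zX'].
  by move=> z z' /in_pow zX /in_pow zX' E1; apply: sub_anti; apply: W.
Qed.
Lemma small_pow k X : slim k -> small k X -> small k (pow X).
Proof.
  move=> H [b [bk K]]; case: (H b bk) => c [ck Hc]; exists c; split=> //.
  exact: injs_trans (injs_pow K) Hc.
Qed.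
Lemma ord_max a b : ord a -> ord b -> exists c, (c = a \/ c = b) /\ a ⊆ c /\ b ⊆ c.
Proof.
  move=> oa ob; case: (ord_tot oa ob) => [H|[->|H]]; [exists b|exists b|exists a]; split; auto; split=> //; exact: ord_subs.
Qed.
Lemma max_in k a b : ord k -> a ε k -> b ε k -> exists c, c ε k /\ a ⊆ c /\ b ⊆ c.
Proof.
  move=> ok ak bk; case: (ord_max (ord_in ok ak) (ord_in ok bk)) => c [H [H1 H2]]; exists c; split=> //.
  by case: H => ->.
Qed.
Lemma injs_prod X Y X' Y' : injs X X' -> injs Y Y' -> injs (prod X Y) (prod X' Y').
Proof.
  move=> [f [[ff fi] fj]] [g [[gf gi] gj]].
  pose F z := iota (fun w => exists x y, z = pair x y /\ w = pair (app f x) (app g y)).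
  have D : DTerm (fun e => F (e 0)) by rewrite /F; def.
  have F1 x y : F (pair x y) = pair (app f x) (app g y).
    by apply: iota_eq => [|w [x' [y' [/pair_inj [<- <-]]]]] //; exists x, y.
  apply: (@injs_lam _ _ _ F) => //.
    move=> z /in_prod [x [y [xX [yY ->]]]]; rewrite F1 pair_prod; split; [exact: fi|exact: gi].
  move=> z z' /in_prod [x [y [xX [yY ->]]]] /in_prod [x' [y' [xX' [yY' ->]]]]; rewrite !F1 => /pair_inj [E1 E2].
  by rewrite (fj _ _ xX xX' E1) (gj _ _ yY yY' E2).
Qed.
Transparent prod.
Lemma prod_sub X Y Z : X ⊆ Z -> Y ⊆ Z -> prod X Y ⊆ pow (pow Z).
Proof.
  move=> S1 S2 w; rewrite /prod in_sep; first def. move=> [H _]; move: H; rewrite !in_pow => H v /H.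
  by rewrite !in_pow => K u /K /in_cup [/S1|/S2].
Qed.
Opaque prod.
(** Pairs of elements of an ordinal [c] are elements of [pow (pow c)], so two applications of [slim]
    replace cardinal arithmetic. *)
Lemma small_prod k X Y : ord k -> slim k -> small k X -> small k Y -> small k (prod X Y).
Proof.
  move=> ok sk [a [ak HX]] [b [bk HY]]; apply: (small_injs (injs_prod HX HY)).
  case: (max_in ok ak bk) => c [ck [S1 S2]]; apply: small_sub (prod_sub S1 S2) _.
  by do 2 apply: small_pow => //; exact: small_elem.
Qed.
Lemma injs_img X (F : M -> M) : DTerm (fun e => F (e 0)) -> injs (img X F) X.
Proof.
  move=> D; case: (@choice_map _ (fun y x => x ε X /\ y = F x) (img X F)) => [|y /(in_img _ D)//|f [ff Hf]]; first def.
  exists f; split; first by split=> // y /Hf [].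
  by move=> y y' /Hf [_ E1] /Hf [_ E2] E3; rewrite [LHS]E1 E3 -E2.
Qed.
Lemma small_img k X (F : M -> M) : DTerm (fun e => F (e 0)) -> small k X -> small k (img X F).
Proof. by move=> D; apply: small_injs; exact: injs_img. Qed.

Lemma union_injs_prod X (F : M -> M) b : DTerm (fun e => F (e 0)) ->
  (forall x, x ε X -> injs (F x) b) -> injs (union (img X F)) (prod X b).
Proof.
  move=> D H.
  case: (@choice_map _ (fun x f => into f (F x) b /\ inj f (F x)) X) => [|x xX|J [_ HJ]]; first (rewrite /into /isfun /inj; def).
    by case: (H x xX) => f; exists f.
  case: (@choice_map _ (fun y x => x ε X /\ y ε F x) (union (img X F))) => [|y|r [_ Hr]]; first def.
    by rewrite in_union => -[z [/(in_img _ D) [x [xX ->]] yx]]; exists x.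
  apply: (@injs_lam _ _ _ (fun y => pair (app r y) (app (app J (app r y)) y))); first def.
    move=> y /Hr [rX yr]; rewrite pair_prod; split=> //; case: (HJ _ rX) => -[_ K] _; exact: K.
  move=> y y' /Hr [rX yr] /Hr [rX' yr'] /pair_inj [E1 E2]; case: (HJ _ rX) => _ K; apply: K => //; first by rewrite E1.
  by rewrite E2 E1.
Qed.
Lemma small_union k X (F : M -> M) : ord k -> reg k -> slim k -> DTerm (fun e => F (e 0)) -> small k X ->
  (exists o, o ε k) -> (forall x, x ε X -> small k (F x)) -> small k (union (img X F)).
Proof.
  move=> ok rk sk D sX ne H.
  case: (@choice_map _ (fun x b => b ε k /\ injs (F x) b) X) => [|x /H //|B [_ HB]]; first (rewrite /injs /into /isfun /inj; def).
  case: (@small_bound k X (app B)) => //; first def. by move=> x /HB [].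
  move=> b [bk Hb]; apply: (small_injs (Y := prod X b)); last by apply: small_prod => //; exact: small_elem.
  apply: union_injs_prod => // x xX; case: (HB x xX) => _ K; apply: injs_trans K _; apply: injs_sub.
  exact: ord_subs (ord_in ok bk) (Hb x xX).
Qed.

(* Enumerate by always choosing an element of least rank: the proper initial segments are small. *)
Lemma union_injs k (F : M -> M) : inacc k -> DTerm (fun e => F (e 0)) -> (forall a, a ε k -> small k (F a)) ->
  injs (union (img k F)) k.
Proof.
  move=> [[ck wk] [rk sk]] D H; have ok := proj1 ck; set X := union (img k F).
  pose r x := iota (fun a => a ε k /\ x ε F a /\ forall b, b ε a -> ~ x ε F b).
  have Dr : DTerm (fun e => r (e 0)) by rewrite /r; def.
  have R x : x ε X -> r x ε k /\ x ε F (r x).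
    rewrite in_union => -[z [/(in_img _ D) [a [ak ->]] xa]].
    have [b [ob [[bk xb] Lb]]] : exists b, ord b /\ (b ε k /\ x ε F b) /\ forall c, c ε b -> ~ (c ε k /\ x ε F c).
      by apply: ord_least; [def|exists a; split=> //; exact: ord_in ok ak].
    suff -> : r x = b by [].
    have Lb' c : c ε b -> ~ x ε F c by move=> cb K; apply: (Lb c cb); split=> //; exact: ord_trans cb.
    apply: iota_eq => // c [cK [xc Lc]]; case: (ord_tot ob (ord_in ok cK)) => [/Lc|[->|/Lb']] //.
  case: (choice_function X) => ch0 H0.
  pose mn Y := sep Y (fun x => forall y, y ε Y -> ~ r y ε r x).
  have Dm Y : Def (fun e : nat -> M => forall y, y ε Y -> ~ r y ε r (e 0)) by def.
  have Dc : DTerm (fun e : nat -> M => app ch0 (mn (e 0))) by rewrite /mn; def.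
  pose ch := lam (pow X) (fun Y => app ch0 (mn Y)).
  have Hch Y : Y ⊆ X -> (exists x, x ε Y) -> app ch Y ε mn Y.
    move=> YX [x xY]; rewrite (app_lam Dc); first by rewrite in_pow.
    apply: H0; first by move=> y /(in_sep _ (Dm Y)) [/YX].
    have [b [ob [[y [yY E1]] Lb]]] : exists b, ord b /\ (exists y, y ε Y /\ r y = b) /\ forall c, c ε b -> ~ exists y, y ε Y /\ r y = c.
      apply: ord_least; first def. exists (r x); split; last by exists x. by apply: ord_in ok _; case: (R x (YX x xY)).
    exists y; rewrite (in_sep _ (Dm Y)); split=> // z zY; rewrite E1 => K; apply: (Lb _ K); by exists z.
  case: (@well_order_by _ X ch) => [Y YX ne|a [f [oa [[ff fi] [ij [sj Hf]]]]]].
    by case/(in_sep _ (Dm Y)): (Hch Y YX ne).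
  have ne : exists o, o ε k by exists omega.
  have A1 i : i ε a -> small k i.
    move=> ia; have ri := R _ (fi i ia).
    have sr : suc (r (app f i)) ε k by apply: card_limit => //; case: ri.
    apply: (small_injs (Y := union (img (suc (r (app f i))) F))); last first.
      apply: small_union => //; first exact: small_elem. by move=> b bs; apply: H; exact: ord_trans bs.
    apply: (@injs_lam _ _ _ (app f)); first def.
      move=> j ji; have ja := ord_trans oa ia ji; have rj := R _ (fi j ja).
      rewrite in_union; exists (F (r (app f j))); split; last by case: rj.
      apply/(in_img _ D); exists (r (app f j)); split=> //.
      case: (Hf j ja) => Y [YX [E1 HY]]; have iY := HY i ia ji.
      have : app f j ε mn Y by rewrite E1; apply: Hch => //; exists (app f i).
      move=> /(in_sep _ (Dm Y)) [_ /(_ _ iY) N]; apply/in_suc.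
      case: (ord_tot (ord_in ok (proj1 ri)) (ord_in ok (proj1 rj))) => [//|[->|]]; auto.
    by move=> j j' ji ji'; apply: ij; exact: ord_trans ia _.
  have ak : a ⊆ k.
    apply: ord_nin => // ka; apply: (small_not ck); exact: A1.
  apply: injs_trans (injs_sub ak).
  pose g x := iota (fun i => i ε a /\ app f i = x).
  have P x : x ε X -> g x ε a /\ app f (g x) = x.
    move=> xX; apply: (iotaP (P := fun i => i ε a /\ app f i = x)); first by case: (sj x xX) => i; exists i.
    by move=> i j [ia <-] [ja E1]; exact: ij.
  apply: (@injs_lam _ _ _ g); first by rewrite /g; def.
    by move=> x /P [].
  by move=> x x' /P [_ E1] /P [_ E2] E3; rewrite -E1 E3 E2.
Qed.
End Cardinals.

(** * Weakly compact cardinals: inaccessibility and convergence of sequences *)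

Section WeaklyCompact.
Variable M : zf.
Implicit Types (a b c f g h l x y z X I H D : M).
Variable k : M.
Hypothesis Hk : wcomp k.

Lemma wc_card : card k. Proof. by case: Hk => -[]. Qed.
Lemma wc_omega : omega ε k. Proof. by case: Hk => -[]. Qed.
Lemma wc_ord : ord k. Proof. by case: wc_card. Qed.
Lemma wc_suc b : b ε k -> suc b ε k. Proof. apply: card_limit; [exact: wc_card|exact: wc_omega]. Qed.

Lemma wc_colour (R : M -> M -> Prop) : Def (fun e => R (e 0) (e 1)) -> exists h, h ⊆ k /\ injs k h /\
  ((forall b, b ε h -> forall a, a ε h -> a ε b -> R a b) \/ (forall b, b ε h -> forall a, a ε h -> a ε b -> ~ R a b)).
Proof.
  move=> DR; have D1 : Def (fun e : nat -> M => exists a b, e 0 = pair a b /\ R a b) by def.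
  case: Hk => _ /(_ (sep (prod k k) (fun z => exists a b, z = pair a b /\ R a b))) [h [hk [ih Hh]]]; exists h; do 2 split=> //.
  have W a b : a ε h -> b ε h -> (pair a b ε sep (prod k k) (fun z => exists a b, z = pair a b /\ R a b) <-> R a b).
    move=> ah bh; rewrite (in_sep _ D1) pair_prod; split=> [[_ [a' [b' [/pair_inj [-> ->]]]]]|K] //.
    by split; [split; exact: hk|exists a, b].
  by case: Hh => K; [left|right] => b bh a ah ab; move: (K b bh a ah ab); rewrite W.
Qed.
Lemma wc_hom_unbdd h : h ⊆ k -> injs k h -> unbdd k h.
Proof.
  move=> hk ih; split=> // th tk; apply: NNPP => N.
  apply: (small_not wc_card); apply: (small_injs ih); apply: (small_sub (Y := suc th)); last by apply: small_elem; exact: wc_suc.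
  move=> d dh; rewrite in_suc; case: (ord_tot (ord_in wc_ord (hk _ dh)) (ord_in wc_ord tk)) => [|[|K]]; auto.
  by case: N; exists d.
Qed.

(** For a cofinal [g] on [a < k], let [i al] be the first argument at which [g] exceeds [al], and
    colour a pair by whether [i] agrees on it. A set on which [i] is constant is bounded by a value
    of [g]; a set on which [i] is injective has at most the size of [a]. *)
Lemma wc_reg : reg k.
Proof.
  have ok := wc_ord; move=> a ak g [fg ig]; apply: NNPP => N.
  have U al : al ε k -> exists x, x ε a /\ al ε app g x.
    move=> alk; apply: NNPP => K; apply: N; exists (suc al); split; first exact: wc_suc.
    move=> x xa; rewrite in_suc; case: (ord_tot (ord_in ok (ig x xa)) (ord_in ok alk)) => [|[|L]]; auto.
    by case: K; exists x.
  pose i al := iota (fun x => x ε a /\ al ε app g x /\ forall y, y ε x -> ~ al ε app g y).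
  have Di : DTerm (fun e => i (e 0)) by rewrite /i; def.
  have oa := ord_in ok ak.
  have P al : al ε k -> i al ε a /\ al ε app g (i al).
    move=> alk; have [x [ox [[xa Hx] Lx]]] : exists x, ord x /\ (x ε a /\ al ε app g x) /\ forall y, y ε x -> ~ (y ε a /\ al ε app g y).
      apply: ord_least; first def. by case: (U al alk) => x [xa Hx]; exists x; split=> //; exact: ord_in xa.
    have Lx' y : y ε x -> ~ al ε app g y by move=> yx K; apply: (Lx y yx); split=> //; exact: ord_trans yx.
    suff -> : i al = x by [].
    apply: iota_eq => // y [ya [Hy Ly]]; case: (ord_tot ox (ord_in oa ya)) => [/Ly|[->|/Lx']] //.
  case: (@wc_colour (fun x y => i x = i y)) => [|h [hk [ih [Q|Q]]]]; first def.
  - have [_ /(_ empty) [|d [dh _]]] := wc_hom_unbdd hk ih.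
      by apply: ord_trans ok wc_omega _; exact: omega0.
    apply: (small_not wc_card); apply: (small_injs ih); exists (app g (i d)); split; first by apply: ig; case: (P d (hk d dh)).
    apply: injs_sub => x xh; suff <- : i x = i d by case: (P x (hk x xh)).
    case: (ord_tot (ord_in ok (hk x xh)) (ord_in ok (hk d dh))) => [K|[->|K]] //; first exact: Q.
    by symmetry; exact: Q.
  - apply: (small_not wc_card); apply: (small_injs ih); exists a; split=> //; apply: (@injs_lam _ _ _ i) => //.
      by move=> x /hk /P [].
    move=> x x' xh xh' E1; case: (ord_tot (ord_in ok (hk x xh)) (ord_in ok (hk x' xh'))) => [K|[//|K]].
      by case: (Q x' xh' x xh K). by case: (Q x xh x' xh' K).
Qed.

Lemma wc_uniform a (Q : M -> M -> Prop) : Def (fun e => Q (e 0) (e 1)) -> a ε k ->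
  (forall x, x ε a -> exists th, th ε k /\ Q x th) -> (forall x th th', Q x th -> th ε th' -> th' ε k -> Q x th') ->
  exists th, th ε k /\ forall x, x ε a -> Q x th.
Proof.
  move=> DQ ak Hx mono; case: (@choice_map _ (fun x th => th ε k /\ Q x th) a) => // [|f [_ Hf]]; first def.
  case: (@reg_bound _ k a (app f)) => //; first exact: wc_reg. def. by move=> x /Hf [].
  move=> b [bk Hb]; exists b; split=> // x xa; case: (Hf x xa) => _ K; apply: mono K _ _ => //; exact: Hb.
Qed.

(* Convergence: the lexicographic order of the sequences is monotone on a set of size [k]. *)
Lemma wc_conv I (X : M -> M -> Prop) : Def (fun e => X (e 0) (e 1)) -> injs I k ->
  exists H, unbdd k H /\ forall i, i ε I -> exists th, th ε k /\
    ((forall d, d ε H -> th ε d -> X i d) \/ (forall d, d ε H -> th ε d -> ~ X i d)).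
Proof.
  move=> DX [j [[fj jk] ij]]; have ok := wc_ord.
  pose x xi d := exists i, i ε I /\ app j i = xi /\ X i d.
  have Dx : Def (fun e => x (e 0) (e 1)) by rewrite /x; def.
  pose lex al be := exists xi, xi ε k /\ x xi be /\ ~ x xi al /\ forall ze, ze ε xi -> (x ze al <-> x ze be).
  have Dl : Def (fun e => lex (e 0) (e 1)) by rewrite /lex; def.
  case: (wc_colour Dl) => h [hk [ih Hh]]; exists h; have uh := wc_hom_unbdd hk ih; split=> //.
  pose ev ze th := forall al be, al ε h -> be ε h -> th ε al -> th ε be -> (x ze al <-> x ze be).
  have De : Def (fun e => ev (e 0) (e 1)) by rewrite /ev; def.
  have em ze th th' : ev ze th -> th ε th' -> th' ε k -> ev ze th'.
    move=> K tt tk al be ah bh ta tb; apply: K => //; [exact: ord_trans (ord_in ok (hk al ah)) ta tt|exact: ord_trans (ord_in ok (hk be bh)) tb tt].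
  (* By induction on the coordinate: once all earlier coordinates are constant, lexicographic
     monotonicity makes coordinate [ze] monotone, so that its truth value changes at most once. *)
  have E1 : forall ze, ze ε k -> exists th, th ε k /\ ev ze th.
    apply: (@ind _ (fun ze => ze ε k -> exists th, th ε k /\ ev ze th)); first def.
    move=> ze IH zk.
    have [th0 [tk0 K0]] : exists th, th ε k /\ forall y, y ε ze -> ev y th.
      by apply: wc_uniform => // y yz; apply: IH => //; exact: ord_trans yz.
    have MN : (forall al be, al ε h -> be ε h -> th0 ε al -> al ε be -> x ze al -> x ze be) \/
              (forall al be, al ε h -> be ε h -> th0 ε al -> al ε be -> ~ x ze al -> ~ x ze be).
      have TB al be : be ε h -> th0 ε al -> al ε be -> th0 ε be by move=> bh ta ab; exact: ord_trans (ord_in ok (hk be bh)) ab ta.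
      case: Hh => Q; [left|right] => al be ah bh ta ab Hx.
        case: (Q be bh al ah ab) => xi [xk [X1 [X2 X3]]]; case: (ord_tot (ord_in ok xk) (ord_in ok zk)) => [L|[E2|L]].
        - by case: X2; apply/(K0 xi L al be) => //; exact: TB ab.
        - by rewrite -E2.
        - by apply/(X3 ze L).
      move=> Hy; apply: (Q be bh al ah ab); exists ze; do 3 split=> //; move=> y yz; apply: (K0 y yz) => //; exact: TB ab.
    have W (P : M -> Prop) : (forall al be, al ε h -> be ε h -> th0 ε al -> al ε be -> P al -> P be) ->
       exists th, th ε k /\ forall al be, al ε h -> be ε h -> th ε al -> th ε be -> (P al <-> P be).
      move=> mono; case: (classic (exists al, al ε h /\ th0 ε al /\ P al)) => [[al [ah [ta Pa]]]|N].
        exists al; split; first exact: hk. move=> b c bh ch ab ac; split=> _; exact: (mono al).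
      exists th0; split=> // b c bh ch tb tc; split=> K; case: N; [exists b|exists c]; by [].
    case: MN => mono; [case: (W (fun d => x ze d) mono)|case: (W (fun d => ~ x ze d) mono)] => th [tk K];
      exists th; split=> // al be ah bh ta tb; move: (K al be ah bh ta tb) => // K'.
    by split=> L; apply: NNPP => N; tauto.
  move=> i iI; case: (E1 (app j i) (jk i iI)) => th [tk K]; exists th; split=> //.
  have XX d : x (app j i) d <-> X i d.
    split=> [[i' [iI' [E2 K']]]|K']; last by exists i. by rewrite -(ij _ _ iI' iI E2).
  case: (classic (exists d, d ε h /\ th ε d /\ X i d)) => [[d [dh [td Xd]]]|N]; [left|right] => d' dh' td'.
    by apply/XX; apply/(K d d') => //; apply/XX.
  by move=> Xd; apply: N; exists d'.
Qed.

(** Otherwise there are [k] distinct subsets of some [a < k]. On an unbounded set of indices each of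
    the [a] coordinates is eventually constant, by regularity beyond a common bound, and two
    distinct subsets would coincide. *)
Lemma wc_slim : slim k.
Proof.
  have ok := wc_ord; move=> a ak; apply: NNPP => N; case: (card_ord (pow a)) => o [oo [i1 i2]].
  have ko : k ⊆ o by apply: ord_nin => // K; apply: N; exists o.
  case: (injs_trans (injs_sub ko) i2) => f [[ff fi] ij].
  case: (@wc_conv k (fun xi d => xi ε app f d)) => [||H [[Hk' uH] KH]]; first def. exact: injs_refl.
  have [th [tk K]] : exists th, th ε k /\ forall xi, xi ε a ->
     ((forall d, d ε H -> th ε d -> xi ε app f d) \/ (forall d, d ε H -> th ε d -> ~ xi ε app f d)).
    apply: wc_uniform => //; first def.
      move=> xi xa; apply: KH; exact: ord_trans xa.
    move=> xi t t' [Q|Q] tt tk'; [left|right] => d dH td; apply: Q => //; exact: ord_trans (ord_in ok (Hk' d dH)) td tt.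
  case: (uH th tk) => d [dH td]; case: (uH d (Hk' d dH)) => d' [dH' dd].
  have td' : th ε d' by exact: ord_trans (ord_in ok (Hk' _ dH')) dd td.
  have sub d1 : d1 ε H -> app f d1 ⊆ a by move=> K1; apply/in_pow; apply: fi; exact: Hk'.
  have E1 : d = d'.
    apply: ij; [exact: Hk'|exact: Hk'|]; apply: sext => xi; split=> xd.
      case: (K xi (sub d dH xi xd)) => Q; first exact: Q. by case: (Q d dH td).
    case: (K xi (sub d' dH' xi xd)) => Q; first exact: Q. by case: (Q d' dH' td').
  by move: dd; rewrite E1 => /mem_irr.
Qed.
Lemma wc_inacc : inacc k.
Proof. split; [split; [exact: wc_card|exact: wc_omega]|split; [exact: wc_reg|exact: wc_slim]]. Qed.

Lemma wc_ne : exists o, o ε k. Proof. by exists omega; exact: wc_omega. Qed.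

(* Among the functions obtained from the identity by composing with the [g xi], a minimal one which
   is unbounded modulo the convergent set yields normality. *)
Lemma wc_normal0 (g : M -> M -> M) : DTerm (fun e => g (e 0) (e 1)) ->
  (forall xi al, xi ε k -> al ε k -> al <> empty -> g xi al ε al) -> (forall xi, g xi empty = empty) ->
  exists D, unbdd k D /\ forall xi, xi ε k -> exists th a, th ε k /\ forall al, al ε D -> th ε al -> g xi al = a.
Proof.
  move=> Dg G1 G0; have ok := wc_ord; have ek : empty ε k by apply: ord_trans ok wc_omega _; exact: omega0.
  have Gs xi al : xi ε k -> al ε k -> g xi al ⊆ al.
    move=> xk ak; case: (classic (al = empty)) => [->|N]; first by rewrite G0.
    by apply: ord_subs (ord_in ok ak) _; exact: G1.
  have Gk xi al : xi ε k -> al ε k -> g xi al ε k.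
    move=> xk ak; case: (classic (al = empty)) => [->|N]; first by rewrite G0.
    exact: (ord_trans ok ak (G1 _ _ xk ak N)).
  pose cmp xi v := lam k (fun d => g xi (app v d)).
  have Dc : DTerm (fun e => cmp (e 0) (e 1)) by rewrite /cmp; def.
  have cmpE xi v d : d ε k -> app (cmp xi v) d = g xi (app v d) by move=> dk; apply: (app_lam _ dk); def.
  pose cmp2 z := iota (fun w => exists xi v, z = pair xi v /\ w = cmp xi v).
  have Dc2 : DTerm (fun e => cmp2 (e 0)) by rewrite /cmp2; def.
  have cmp2E xi v : cmp2 (pair xi v) = cmp xi v.
    by apply: iota_eq => [|w [x' [v' [/pair_inj [<- <-]]]]] //; exists xi, v.
  pose idk := lam k (fun d => d).
  have idE d : d ε k -> app idk d = d by move=> dk; apply: (app_lam _ dk); def.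
  (* [R mu n] will consist of the compositions of [n] functions with indices below [mu]. The bound
     [mu] keeps each of these sets small, so that the whole family has size at most [k]. *)
  pose G mu n h := iota (fun Y => (n = empty /\ Y = sing idk) \/ (n <> empty /\ Y = img (prod mu (app h (union n))) cmp2)).
  have DG : DTerm (fun e => G (e 2) (e 0) (e 1)) by rewrite /G; def.
  have DG' mu : DTerm (fun e => G mu (e 0) (e 1)) by rewrite /G; def.
  pose R mu n := rec (G mu) n.
  have DR : DTerm (fun e => R (e 0) (e 1)) by apply: (@D_rec _ (fun e n h => G (e 0) n h) (fun e => e 1)) => //; def.
  have R0 mu : R mu empty = sing idk.
    rewrite /R (rec_eq (DG' mu)); apply: iota_eq => [|Y [[]|[]]] //; by left.
  have RS mu n : n ε omega -> R mu (suc n) = img (prod mu (R mu n)) cmp2.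
    move=> nw; rewrite /R (rec_eq (DG' mu)) -/(R mu n).
    have on : ord n by exact: ord_in (omega_ord M) nw.
    have E1 : app (lam (suc n) (rec (G mu))) (union (suc n)) = R mu n.
      rewrite union_suc // app_lam //; [exact: D_rec0|exact: suc_self].
    have N : suc n <> empty by move=> K; move: (suc_self n); rewrite K => /in_empty.
    apply: iota_eq => [|Y [[]|[_ ->]]] //; rewrite E1 //; by right.
  have Rsm mu : mu ε k -> forall n, n ε omega -> small k (R mu n).
    move=> mk; apply: omega_ind; first (rewrite /small /injs /into /isfun /inj; def).
      rewrite R0; apply: (@small_injs _ _ _ (suc empty)); last by apply: small_elem; exact: wc_suc.
      apply: (@injs_lam _ _ _ (fun _ => empty)); [def|by move=> x _; exact: suc_self|by move=> x x' /in_sing -> /in_sing ->].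
    move=> n nw sn; rewrite RS //; apply: small_img => //; apply: small_prod => //; [exact: wc_slim|exact: small_elem].
  have Rmn mu mu' : mu ⊆ mu' -> forall n, n ε omega -> R mu n ⊆ R mu' n.
    move=> S; apply: omega_ind; first def. by rewrite !R0.
    move=> n nw IH v; rewrite !RS // => /(in_img _ Dc2) [z [/in_prod [xi [w [xm [wR ->]]]] ->]]; apply/(in_img _ Dc2).
    exists (pair xi w); split=> //; apply/pair_prod; split; [exact: S|exact: IH].
  have Rfn mu : mu ε k -> forall n, n ε omega -> forall v, v ε R mu n -> forall d, d ε k -> app v d ε k /\ app v d ⊆ d.
    move=> mk; apply: omega_ind; first def.
      by rewrite R0 => v /in_sing -> d dk; rewrite idE //; split=> // y.
    move=> n nw IH v; rewrite RS // => /(in_img _ Dc2) [z [/in_prod [xi [w [xm [wR ->]]]] ->]] d dk.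
    rewrite cmp2E cmpE //; case: (IH w wR d dk) => A1 A2; have xk := ord_trans ok mk xm.
    by split; [exact: Gk|move=> y /(Gs _ _ xk A1); exact: A2].
  pose Fam mu := union (img omega (R mu)).
  have DRm mu : DTerm (fun e => R mu (e 0)) by def.
  have DFam : DTerm (fun e => Fam (e 0)) by rewrite /Fam; def.
  have FamE mu v : v ε Fam mu <-> exists n, n ε omega /\ v ε R mu n.
    rewrite in_union; split=> [[Y [/(in_img _ (DRm mu)) [n [nw ->]] vn]]|[n [nw vn]]]; first by exists n.
    by exists (R mu n); split=> //; apply/(in_img _ (DRm mu)); exists n.
  pose FF v := exists mu, mu ε k /\ v ε Fam mu.
  have DFF : Def (fun e => FF (e 0)) by rewrite /FF; def.
  have FFfn v : FF v -> forall d, d ε k -> app v d ε k /\ app v d ⊆ d.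
    by move=> [mu [mk /FamE [n [nw vn]]]]; exact: (Rfn mu mk n nw v vn).
  have FFid : FF idk by exists empty; split=> //; apply/FamE; exists empty; split; [exact: omega0|rewrite R0; apply/in_sing].
  have FFc xi v : xi ε k -> FF v -> FF (cmp xi v).
    move=> xk [mu [mk /FamE [n [nw vn]]]]; case: (max_in ok (wc_suc xk) mk) => mu' [mk' [S1 S2]].
    exists mu'; split=> //; apply/FamE; exists (suc n); split; first exact: omega_suc.
    rewrite RS //; apply/(in_img _ Dc2); exists (pair xi v); rewrite cmp2E pair_prod; split=> //.
    by split; [apply: S1; exact: suc_self|exact: (Rmn _ _ S2 n nw)].
  (* An index set for all statements [app v d = i] with [v] in the family, to which convergence is
     applied at once. *)
  pose J := union (img k (fun mu => prod (Fam mu) mu)).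
  have DJ : DTerm (fun e => prod (Fam (e 0)) (e 0)) by def.
  have JK : injs J k.
    apply: union_injs => //; first exact: wc_inacc. move=> mu mk; apply: small_prod => //; [exact: wc_slim| |exact: small_elem].
    apply: small_union => //; [exact: wc_reg|exact: wc_slim|by apply: small_elem; exact: wc_omega|exact: wc_ne|exact: Rsm].
  have inJ v i : FF v -> i ε k -> pair v i ε J.
    move=> [mu [mk /FamE [n [nw vn]]]] ik; case: (max_in ok (wc_suc ik) mk) => mu' [mk' [S1 S2]].
    rewrite in_union; exists (prod (Fam mu') mu'); split; first by apply/(in_img _ DJ); exists mu'.
    rewrite pair_prod; split; last by apply: S1; exact: suc_self.
    by apply/FamE; exists n; split=> //; exact: (Rmn _ _ S2 n nw).
  case: (@wc_conv J (fun z d => exists v i, z = pair v i /\ app v d = i)) => // [|H [[Hk' uH] KH]]; first def.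
  have KH' v i : FF v -> i ε k -> exists th, th ε k /\
      ((forall d, d ε H -> th ε d -> app v d = i) \/ (forall d, d ε H -> th ε d -> app v d <> i)).
    move=> Fv ik; case: (KH _ (inJ v i Fv ik)) => th [tk K]; exists th; split=> //; case: K => K; [left|right] => d dH td.
      by case: (K d dH td) => v' [i' [/pair_inj [-> ->]]].
    by move=> E1; apply: (K d dH td); exists v, i.
  have Hd d th th' : d ε H -> th' ε d -> th ε th' -> th ε d by move=> dH; exact: ord_trans (ord_in ok (Hk' d dH)).
  pose unb v := FF v /\ forall i, i ε k -> exists th, th ε k /\ forall d, d ε H -> th ε d -> i ε app v d.
  have Du : Def (fun e => unb (e 0)) by rewrite /unb; def.
  have alt v : FF v -> unb v \/ exists i th, th ε k /\ forall d, d ε H -> th ε d -> app v d = i.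
    move=> Fv; case: (classic (exists i th, th ε k /\ forall d, d ε H -> th ε d -> app v d = i)) => N; [by right|left].
    split=> // i ik.
    have [th [tk K]] : exists th, th ε k /\ forall j, j ε suc i -> forall d, d ε H -> th ε d -> app v d <> j.
      apply: wc_uniform; [def|exact: wc_suc| |].
        move=> j ji; have jk := ord_trans ok (wc_suc ik) ji.
        by case: (KH' v j Fv jk) => th [tk [K|K]]; [case: N; exists j, th|exists th].
      by move=> j t t' K tt tk' d dH td; apply: K => //; exact: Hd tt.
    exists th; split=> // d dH td; case: (FFfn v Fv d (Hk' d dH)) => vk _.
    case: (ord_tot (ord_in ok ik) (ord_in ok vk)) => [//|[E1|L]].
      by case: (K i (suc_self i) d dH td).
    by case: (K (app v d) _ d dH td) => //; apply/in_suc; left.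
  have uid : unb idk.
    by split=> // i ik; exists i; split=> // d dH id; rewrite idE //; exact: Hk'.
  (* Otherwise a function tending to [k] can be composed again and again without losing this
     property. At one large [d] in [H] the resulting ω-sequence of functions has nonzero values that
     strictly decrease. *)
  have [v [uv mv]] : exists v, unb v /\ forall xi, xi ε k -> ~ unb (cmp xi v).
    apply: NNPP => N.
    have FU : exists Z, forall v, unb v -> v ε Z.
      have DFm : DTerm (fun e : nat -> M => Fam (e 0)) by def.
      exists (union (img k Fam)) => v [[mu [mk vm]] _]; rewrite in_union; exists (Fam mu); split=> //.
      by apply/(in_img _ DFm); exists mu.
    case: FU => Z0 HZ0; pose Z := sep Z0 unb.
    have ZE v : v ε Z <-> unb v by rewrite (in_sep _ Du); split=> [[]|] // K; split=> //; exact: HZ0.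
    case: (@choice_map _ (fun v w => unb w /\ exists xi, xi ε k /\ w = cmp xi v) Z) => [|v /ZE uv|T [_ HT]]; first def.
      apply: NNPP => K; apply: N; exists v; split=> // xi xk uc; apply: K; exists (cmp xi v); split=> //; by exists xi.
    pose GT (n h : M) := iota (fun y => (n = empty /\ y = idk) \/ (n <> empty /\ y = app T (app h (union n)))).
    have DGT : DTerm (fun e => GT (e 0) (e 1)) by rewrite /GT; def.
    pose z := rec GT; have Dz : DTerm (fun e : nat -> M => z (e 0)) by exact: D_rec0.
    have z0 : z empty = idk by rewrite /z (rec_eq DGT); apply: iota_eq => [|y [[]|[]]] //; left.
    have zS n : n ε omega -> z (suc n) = app T (z n).
      move=> nw; rewrite {1}/z (rec_eq DGT) -/z; have on : ord n by exact: ord_in (omega_ord M) nw.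
      have N' : suc n <> empty by move=> K; move: (suc_self n); rewrite K => /in_empty.
      have E1 : app (lam (suc n) z) (union (suc n)) = z n by rewrite union_suc // app_lam //; exact: suc_self.
      apply: iota_eq => [|Y [[]|[_ ->]]] //; rewrite E1 //; by right.
    have zu : forall n, n ε omega -> unb (z n).
      apply: omega_ind; [def|by rewrite z0|]. move=> n nw un; rewrite zS //; by case: (HT (z n)) => //; apply/ZE.
    have [th [tk K]] : exists th, th ε k /\ forall n, n ε omega -> forall d, d ε H -> th ε d -> empty ε app (z n) d.
      apply: wc_uniform; [def|exact: wc_omega|by move=> n nw; case: (zu n nw) => _; apply|].
      by move=> n t t' L tt tk' d dH td; apply: L => //; exact: Hd tt.
    case: (uH th tk) => d [dH td].
    case: (@exists_min _ (fun y => exists n, n ε omega /\ y = app (z n) d)); first def.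
      by exists (app (z empty) d), empty; split=> //; exact: omega0.
    move=> y [[n [nw ->]]] /(_ (app (z (suc n)) d)); apply; last by exists (suc n); split=> //; exact: omega_suc.
    have [_ [xi [xk E1]]] := HT (z n) (proj2 (ZE _) (zu n nw)).
    rewrite zS // E1 cmpE; first exact: Hk'. apply: G1 => //; first by case: (FFfn _ (proj1 (zu n nw)) d (Hk' d dH)).
    by move=> E2; move: (K n nw d dH td); rewrite E2 => /in_empty.
  have Dv : DTerm (fun e : nat -> M => app v (e 0)) by def.
  (* The new set is the image of [H] under [v]: to evaluate [g xi] on it is to evaluate [cmp xi v]
     on [H], which by minimality does not tend to [k] and hence becomes constant. A threshold below
     [app v d] is also below [d], because [app v d] is contained in [d]. *)
  case: (uv) => Fv uv'; exists (img H (app v)); split.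
    split=> [y /(in_img _ Dv) [d [dH ->]]|th tk]; first by case: (FFfn v Fv d (Hk' d dH)).
    case: (uv' th tk) => th' [tk' K]; case: (uH th' tk') => d [dH td]; exists (app v d).
    by split; [apply/(in_img _ Dv); exists d|exact: K].
  move=> xi xk; case: (alt (cmp xi v) (FFc xi v xk Fv)) => [/(mv xi xk) //|[a [th [tk K]]]]; exists th, a; split=> //.
  move=> al /(in_img _ Dv) [d [dH ->]] ta; case: (FFfn v Fv d (Hk' d dH)) => _ S.
  by rewrite -cmpE; [exact: Hk'|apply: K => //; exact: S].
Qed.
End WeaklyCompact.

Lemma inacc_square (M : zf) (k : M) : inacc k -> injs (prod k k) k.
Proof.
  move=> Hk; case: (Hk) => -[ck wk] [_ sk]; have ok : ord k by case: ck.
  have sc x : x ε k -> suc x ε k by exact: card_limit.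
  have D : DTerm (fun e : nat -> M => prod (e 0) (e 0)) by def.
  apply: (injs_trans (b := union (img k (fun mu => prod mu mu)))).
    apply: injs_sub => z /in_prod [x [y [xk [yk ->]]]]; case: (max_in ok (sc _ xk) (sc _ yk)) => c [ck' [S1 S2]].
    rewrite in_union; exists (prod c c); split; first by apply/(in_img _ D); exists c.
    by apply/pair_prod; split; [apply: S1|apply: S2]; exact: suc_self.
  by apply: (union_injs Hk D) => mu mk; apply: small_prod => //; exact: small_elem.
Qed.

(** * Regressive functions converging on a set of inaccessibles *)

Section Normal.
Variable M : zf.
Implicit Types (a b c f h l m x y z X I H D : M).

Definition cofmap al a m : Prop := into m a al /\ forall b, b ε al -> exists x, x ε a /\ ~ app m x ε b.
Definition bigpow al a : Prop := ~ exists b : M, b ε al /\ injs (pow a) b.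

(** Failing to be a cardinal is an instance of having a cofinal map: the inverse of an injection of
    [al] into [a] takes every value below [al]. *)
Lemma not_inacc al : ord al -> omega ε al -> ~ inacc al ->
  exists a, a ε al /\ ((exists m, cofmap al a m) \/ bigpow al a).
Proof.
  move=> oal wal N; apply: NNPP => K; apply: N.
  have rl : reg al.
    move=> a aal g ig; apply: NNPP => N; apply: K; exists a; split=> //; left; exists g; split=> // b bal.
    apply: NNPP => L; apply: N; exists b; split=> // x xa; apply: NNPP => N; apply: L; by exists x.
  split; last first.
    by split=> // a aal; apply: NNPP => N; apply: K; exists a; split=> //; right.
  split=> //; split=> // a aal [f [[ff fi] ij]]; apply: K; exists a; split=> //; left.
  pose F i := iota (fun x => x ε al /\ app f x = i).
  have DF : DTerm (fun e => F (e 0)) by rewrite /F; def.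
  exists (lam a F); split.
    split; first exact: lam_fun. move=> i ia; rewrite (app_lam DF ia) /F.
    case: (iota_alt (fun x => x ε al /\ app f x = i)) => [[[H _] _] //|[_ ->]].
    by apply: ord_trans oal wal _; exact: omega0.
  move=> b bal; exists (app f b); split; first exact: fi. rewrite (app_lam DF (fi b bal)).
  have -> : F (app f b) = b by apply: iota_eq => // y [yal E1]; exact: ij.
  exact: mem_irr.
Qed.

Variable k : M.
Hypothesis Hk : wcomp k.

Lemma wc_square : injs (prod k k) k.
Proof. exact: inacc_square (wc_inacc Hk). Qed.

(** To the given functions are added two kinds of regressive ones: [app f], which chooses a witness
    against inaccessibility, and [h ze], the value at [ze] of a chosen cofinal map. Once [app f] is
    constant with value [a] and all [h ze] with [ze < a] are constant, a large point [al] that is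
    not inaccessible would either have a cofinal map with values below an earlier point [al0], or a
    power set of [a] that cannot be injected below [al], although it injects into a fixed
    [b < al]. *)
Lemma wc_normal I (g : M -> M -> M) : DTerm (fun e => g (e 0) (e 1)) -> injs I k ->
  (forall i al, i ε I -> al ε k -> al <> empty -> g i al ε al) ->
  exists D, unbdd k D /\ (forall al, al ε D -> inacc al) /\
    forall i, i ε I -> exists th a, th ε k /\ forall al, al ε D -> th ε al -> g i al = a.
Proof.
  move=> Dg [j [[fj jk] jj]] Hg; have ok := wc_ord Hk; have wk := wc_omega Hk.
  case: wc_square => q [[fq qk] qj].
  have e0 : (empty : M) ε k by apply: ord_trans ok wk _; exact: omega0.
  pose n1 : M := suc empty; pose n2 : M := suc n1.
  have n1k : n1 ε k by exact: wc_suc. have n2k : n2 ε k by exact: wc_suc.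
  have S0 y : suc y <> (empty : M) by move=> K; move: (suc_self y); rewrite K => /in_empty.
  have n01 : empty <> n1 by move=> K; case: (S0 empty).
  have n02 : empty <> n2 by move=> K; case: (S0 n1).
  have n12 : n1 <> n2 by move=> /suc_inj.
  have Dcof : Def (fun e : nat -> M => cofmap (e 0) (e 1) (e 2)) by rewrite /cofmap /into /isfun; def.
  have Dbig : Def (fun e : nat -> M => bigpow (e 0) (e 1)) by rewrite /bigpow /injs /into /isfun /inj; def.
  pose bad (al : M) := omega ε al /\ ~ inacc al.
  have Dbad : Def (fun e : nat -> M => bad (e 0)).
    by rewrite /bad /inacc /card /reg /slim /injs /into /isfun /inj /ord /trans; def.
  case: (@choice_map _ (fun al a => (bad al -> a ε al /\ ((exists m, cofmap al a m) \/ bigpow al a)) /\ (~ bad al -> a = empty)) k) => [|al alk|f [_ Hf]]; first def.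
    case: (classic (bad al)) => [[B1 B2]|N]; last by exists empty; split.
    case: (not_inacc (ord_in ok alk) B1 B2) => a Ha; exists a; split=> // N; by case: N.
  case: (@choice_map _ (fun al m => (exists m', cofmap al (app f al) m') -> cofmap al (app f al) m) k) => [|al alk|mm [_ Hm]]; first def.
    by case: (classic (exists m', cofmap al (app f al) m')) => [[m Hm]|N]; [exists m|exists al].
  pose hc ze al := cofmap al (app f al) (app mm al) /\ ze ε app f al.
  have Dhc : Def (fun e : nat -> M => hc (e 0) (e 1)) by rewrite /hc; def.
  pose h ze al := iota (fun y => (hc ze al /\ y = app (app mm al) ze) \/ (~ hc ze al /\ y = empty)).
  have Dh : DTerm (fun e => h (e 0) (e 1)) by rewrite /h; def.
  have h1 ze al : hc ze al -> h ze al = app (app mm al) ze by move=> K; apply: iota_eq => [|y [[]|[]]] //; left.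
  have h2 ze al : ~ hc ze al -> h ze al = empty by move=> K; apply: iota_eq => [|y [[]|[]]] //; right.
  have el al : al ε k -> al <> empty -> empty ε al.
    move=> alk N; case: (ord_tot (ord_empty M) (ord_in ok alk)) => [//|[E1|/in_empty //]]; by case: N.
  have hin ze al : al ε k -> al <> empty -> h ze al ε al.
    move=> alk N; case: (classic (hc ze al)) => K; last by rewrite h2 //; exact: el.
    by rewrite h1 //; case: K => -[[_ K] _]; exact: K.
  have fin al : al ε k -> al <> empty -> app f al ε al.
    by move=> alk N; case: (Hf al alk) => F1 F2; case: (classic (bad al)) => [/F1 []//|/F2 ->]; exact: el.
  (* The three families are merged into one indexed by [k], using the pairing [q] and the tags 0, 1
     and 2. *)
  pose g' xi al := iota (fun y => al <> empty /\ ((exists i, i ε I /\ xi = app q (pair (app j i) empty) /\ y = g i al) \/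
     (exists ze, ze ε k /\ xi = app q (pair ze n1) /\ y = h ze al) \/ (xi = app q (pair empty n2) /\ y = app f al))).
  have Dg' : DTerm (fun e => g' (e 0) (e 1)) by rewrite /g'; def.
  have qI x y x' y' : x ε k -> y ε k -> x' ε k -> y' ε k -> app q (pair x y) = app q (pair x' y') -> x = x' /\ y = y'.
    by move=> A1 A2 A3 A4 E1; apply: pair_inj; apply: qj => //; apply/pair_prod.
  have gA i al : i ε I -> al <> empty -> g' (app q (pair (app j i) empty)) al = g i al.
    move=> iI N; apply: iota_eq => [|y [_ [[i' [iI' [E1 ->]]]|[[ze [zk [E1 _]]]|[E1 _]]]]]; first by split=> //; left; exists i.
    - by case: (qI _ _ _ _ (jk _ iI) e0 (jk _ iI') e0 E1) => /(jj _ _ iI iI') ->.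
    - by case: (qI _ _ _ _ (jk _ iI) e0 zk n1k E1) => _ /n01.
    - by case: (qI _ _ _ _ (jk _ iI) e0 e0 n2k E1) => _ /n02.
  have gB ze al : ze ε k -> al <> empty -> g' (app q (pair ze n1)) al = h ze al.
    move=> zk N; apply: iota_eq => [|y [_ [[i' [iI' [E1 _]]]|[[ze' [zk' [E1 ->]]]|[E1 _]]]]]; first by split=> //; right; left; exists ze.
    - by case: (qI _ _ _ _ zk n1k (jk _ iI') e0 E1) => _ K; case: n01.
    - by case: (qI _ _ _ _ zk n1k zk' n1k E1) => ->.
    - by case: (qI _ _ _ _ zk n1k e0 n2k E1) => _ /n12.
  have gC al : al <> empty -> g' (app q (pair empty n2)) al = app f al.
    move=> N; apply: iota_eq => [|y [_ [[i' [iI' [E1 _]]]|[[ze' [zk' [E1 _]]]|[_ ->]]]]] //; first by split=> //; right; right.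
    - by case: (qI _ _ _ _ e0 n2k (jk _ iI') e0 E1) => _ K; case: n02.
    - by case: (qI _ _ _ _ e0 n2k zk' n1k E1) => _ K; case: n12.
  have gd xi : g' xi empty = empty.
    rewrite /g'; match goal with |- iota ?Q = _ => case: (iota_alt Q) => [[[K _] _]|[_ //]] end; by case: K.
  case: (wc_normal0 Hk Dg') => // [xi al xk alk N|D0 [[Dk uD] KD]].
    case: (iota_alt (fun y => al <> empty /\ ((exists i, i ε I /\ xi = app q (pair (app j i) empty) /\ y = g i al) \/
     (exists ze, ze ε k /\ xi = app q (pair ze n1) /\ y = h ze al) \/ (xi = app q (pair empty n2) /\ y = app f al)))) => [[[_ K] _]|[_ E1]].
      rewrite -/(g' xi al) in K; case: K => [[i [iI [_ ->]]]|[[ze [zk [_ ->]]]|[_ ->]]]; [exact: Hg|exact: hin|exact: fin].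
    by rewrite /g' E1; exact: el.
  have Dne (al th : M) : th ε al -> al <> empty by move=> K E1; move: K; rewrite E1 => /in_empty.
  have Dt al th th' : al ε D0 -> th' ε al -> th ε th' -> th ε al by move=> aD; exact: ord_trans (ord_in ok (Dk al aD)).
  have [th1 [a [tk1 K1]]] := KD _ (qk _ (proj2 (pair_prod k k empty n2) (conj e0 n2k))).
  have K1' al : al ε D0 -> th1 ε al -> app f al = a.
    by move=> aD ta; rewrite -gC; [exact: Dne ta|exact: K1].
  have ak : a ε k.
    case: (uD th1 tk1) => al [aD ta]; rewrite -(K1' al aD ta).
    exact: (ord_trans ok (Dk al aD) (fin al (Dk al aD) (Dne al th1 ta))).
  case: (wc_slim Hk ak) => b [bk ib].
  have [th2 [tk2 K2]] : exists th, th ε k /\ forall ze, ze ε a -> forall al al', al ε D0 -> al' ε D0 -> th ε al -> th ε al' -> h ze al = h ze al'.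
    apply: (wc_uniform Hk) => //; first def.
      move=> ze za; have zk := ord_trans ok ak za.
      case: (KD _ (qk _ (proj2 (pair_prod k k ze n1) (conj zk n1k)))) => th [c [tk Kc]]; exists th; split=> //.
      by move=> al al' aD aD' ta ta'; rewrite -(gB ze al zk (Dne _ _ ta)) -(gB ze al' zk (Dne _ _ ta')) Kc // Kc.
    by move=> ze t t' K tt tk al al' aD aD' ta ta'; apply: K => //; [exact: Dt tt|exact: Dt tt].
  case: (uD th2 tk2) => al0 [aD0 ta0].
  have [th3 [tk3 [S1 [S2 [S3 S4]]]]] : exists th, th ε k /\ al0 ⊆ th /\ suc b ⊆ th /\ suc omega ⊆ th /\ suc th1 ⊆ th.
    case: (max_in ok (Dk _ aD0) (wc_suc Hk bk)) => c [ck [C1 C2]]; case: (max_in ok (wc_suc Hk wk) (wc_suc Hk tk1)) => d [dk [D1 D2]].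
    case: (max_in ok ck dk) => e [ek [E1 E2]]; exists e; split=> //; split; first by move=> y /C1 /E1.
    by split; [move=> y /C2 /E1|split; [move=> y /D1 /E2|move=> y /D2 /E2]].
  have IN al : al ε D0 -> th3 ε al -> inacc al.
    move=> aD ta; apply: NNPP => N; have alk := Dk al aD; have oal := ord_in ok alk.
    have wal : omega ε al by apply: ord_trans oal ta _; apply: S3; exact: suc_self.
    case: (Hf al alk) => /(_ (conj wal N)) [fal Kf] _.
    have E1 : app f al = a by apply: K1' => //; apply: ord_trans oal ta _; apply: S4; exact: suc_self.
    case: Kf => [Cf|Bf]; last first.
      by apply: Bf; rewrite E1; exists b; split=> //; apply: ord_trans oal ta _; apply: S2; exact: suc_self.
    have a0 : al0 ε al.
      case: (ord_tot (ord_in ok (Dk _ aD0)) oal) => [//|[E2|L]]; first by case: (mem_irr (S1 _ _)); rewrite E2.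
      by case: (mem_asym ta (S1 _ L)).
    have Cm := Hm al alk Cf; case: (Cm) => _ /(_ al0 a0) [x [xf]]; apply.
    rewrite -(h1 x al) //; rewrite (K2 x _ al al0) //; first by rewrite -E1.
      exact: ord_trans a0 ta0.
    by apply: hin; [exact: Dk|exact: Dne ta0].
  have DI : Def (fun e : nat -> M => th3 ε e 0) by def.
  have inD al : al ε sep D0 (fun al => th3 ε al) <-> al ε D0 /\ th3 ε al by exact: (in_sep _ DI).
  exists (sep D0 (fun al => th3 ε al)); split; [split|split].
  - by move=> al /inD [/Dk].
  - move=> th tk; case: (max_in ok (wc_suc Hk tk) (wc_suc Hk tk3)) => c [ck [C1 C2]]; case: (uD c ck) => al [aD ca]; exists al.
    rewrite inD; split; [split=> //|]; (apply: ord_trans (ord_in ok (Dk al aD)) ca _).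
      by apply: C2; exact: suc_self. by apply: C1; exact: suc_self.
  - by move=> al /inD [aD ta]; exact: IN.
  - move=> i iI; case: (KD _ (qk _ (proj2 (pair_prod k k (app j i) empty) (conj (jk _ iI) e0)))) => th [c [tk Kc]].
    by exists th, c; split=> // al /inD [aD _] ta; rewrite -gA //; [exact: Dne ta|exact: Kc].
Qed.

(** Where an inaccessible [al] is not closed under [h], the function is redefined as the least
    [x < al] with [h x] outside [al], which is regressive. Convergence to some [a0] by such values
    is impossible, since [al] eventually exceeds [h a0]; hence all large points are closed. The
    given functions have to be regressive only at closed inaccessibles. *)
Lemma wc_normal_closed I (g : M -> M -> M) (h : M -> M) : DTerm (fun e => g (e 0) (e 1)) -> DTerm (fun e => h (e 0)) ->
  injs I k -> (exists i, i ε I) -> (forall x, x ε k -> h x ε k) ->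
  (forall i al, i ε I -> al ε k -> inacc al -> (forall x, x ε al -> h x ε al) -> g i al ε al) ->
  exists D, unbdd k D /\ (forall al, al ε D -> inacc al /\ forall x, x ε al -> h x ε al) /\
    forall i, i ε I -> exists th a, th ε k /\ forall al, al ε D -> th ε al -> g i al = a.
Proof.
  move=> Dg Dh II [i0 i0I] hk Hg; have ok := wc_ord Hk.
  pose cl (al : M) := forall x, x ε al -> h x ε al.
  have Dcl : Def (fun e : nat -> M => cl (e 0)) by rewrite /cl; def.
  have Din : Def (fun e : nat -> M => inacc (e 0)) by rewrite /inacc /card /reg /slim /injs /into /isfun /inj /ord /trans; def.
  pose B (al x : M) := x ε al /\ ~ h x ε al /\ forall z, z ε x -> h z ε al.
  have DB : Def (fun e : nat -> M => B (e 0) (e 1)) by rewrite /B; def.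
  have Bex al : ord al -> ~ cl al -> exists x, B al x.
    move=> oal N; case: (@ord_least _ (fun x => x ε al /\ ~ h x ε al)) => [||x [ox [[xa nx] mx]]]; first def.
      apply: NNPP => K; apply: N => x xa; apply: NNPP => nx; apply: K; exists x; split=> //; exact: ord_in xa.
    exists x; split=> //; split=> // z zx; apply: NNPP => nz; case: (mx z zx); split=> //; exact: ord_trans xa zx.
  have Bun al x y : ord al -> B al x -> B al y -> x = y.
    move=> oal [xa [nx mx]] [ya [ny my]]; case: (ord_tot (ord_in oal xa) (ord_in oal ya)) => [/my //|[//|/mx //]].
  pose g' i al := iota (fun y => (inacc al /\ cl al /\ y = g i al) \/ (inacc al /\ ~ cl al /\ B al y) \/ (~ inacc al /\ y = empty)).
  have Dg' : DTerm (fun e => g' (e 0) (e 1)) by rewrite /g'; def.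
  have g1 i al : inacc al -> cl al -> g' i al = g i al.
    by move=> A1 A2; apply: iota_eq => [|y [[_ []]|[[_ []]|[]]]] //; left.
  have g2 i al : inacc al -> ~ cl al -> B al (g' i al).
    move=> A1 A2; have oal : ord al by case: A1 => -[[]].
    case: (Bex al oal A2) => x Bx; rewrite (_ : g' i al = x) //; apply: iota_eq => [|y [[_ []]|[[_ [_ K]]|[]]]] //; first by right; left.
    exact: Bun oal K Bx.
  have g3 i al : ~ inacc al -> g' i al = empty by move=> A1; apply: iota_eq => [|y [[]|[[]|[]]]] //; right; right.
  case: (wc_normal Dg' II) => [i al iI alk N|D0 [[Dk uD] [Di KD]]].
    case: (classic (inacc al)) => A1; last first.
      rewrite g3 //; case: (ord_tot (ord_empty M) (ord_in ok alk)) => [//|[E1|/in_empty //]]; by case: N.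
    case: (classic (cl al)) => A2; first by rewrite g1 //; exact: Hg.
    by case: (g2 i al A1 A2).
  case: (KD i0 i0I) => th0 [a0 [tk0 K0]].
  have [th [tk Kth]] : exists th, th ε k /\ forall al, al ε D0 -> th ε al -> cl al.
    case: (classic (a0 ε k)) => ak; last first.
      exists th0; split=> // al aD ta; apply: NNPP => N; case: (g2 i0 al (Di al aD) N); rewrite (K0 al aD ta) => a0al.
      by case: ak; exact: ord_trans (Dk al aD) a0al.
    case: (max_in ok (wc_suc Hk tk0) (wc_suc Hk (hk a0 ak))) => c [ck [C1 C2]]; exists c; split=> // al aD ca.
    have oal := ord_in ok (Dk al aD); apply: NNPP => N; case: (g2 i0 al (Di al aD) N); rewrite K0 //.
      by apply: ord_trans oal ca _; apply: C1; exact: suc_self.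
    by move=> _ [K _]; apply: K; apply: ord_trans oal ca _; apply: C2; exact: suc_self.
  have DI : Def (fun e : nat -> M => th ε e 0) by def.
  have inD al : al ε sep D0 (fun al => th ε al) <-> al ε D0 /\ th ε al by exact: (in_sep _ DI).
  exists (sep D0 (fun al => th ε al)); split; [split|split].
  - by move=> al /inD [/Dk].
  - move=> x xk; case: (max_in ok (wc_suc Hk xk) (wc_suc Hk tk)) => c [ck [C1 C2]]; case: (uD c ck) => al [aD ca]; exists al.
    rewrite inD; split; [split=> //|]; (apply: ord_trans (ord_in ok (Dk al aD)) ca _).
      by apply: C2; exact: suc_self. by apply: C1; exact: suc_self.
  - by move=> al /inD [aD ta]; split; [exact: Di|exact: Kth].
  - move=> i iI; case: (KD i iI) => t1 [a [tk1 Ka]]; exists t1, a; split=> // al /inD [aD ta] ta1.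
    by rewrite -(g1 i al (Di al aD) (Kth al aD ta)); exact: Ka.
Qed.
End Normal.

(** * Lottery sums *)

Section LotterySum.
Variable M : zf.
Implicit Types (a b c d q A r p s t x y z w E sg S R : M).

Lemma pair_ne x y : pair x y <> (empty : M).
Proof. by move=> K; case: (@in_empty _ (sing x)); rewrite -K; exact: sing_in_pair. Qed.

Definition poset A r : Prop := (forall z, z ε r -> exists x y, x ε A /\ y ε A /\ z = pair x y) /\
  (forall x, x ε A -> pair x x ε r) /\ (forall x y z, pair x y ε r -> pair y z ε r -> pair x z ε r) /\
  (forall x y, pair x y ε r -> pair y x ε r -> x = y).

Lemma poset_l A r x y : poset A r -> pair x y ε r -> x ε A /\ y ε A.
Proof. by move=> [H _] /H [x' [y' [xA [yA /pair_inj [-> ->]]]]]. Qed.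

Definition turns E d : Prop := forall a, a ε d -> (a = empty -> ~ a ε E) /\ (limO a -> a ε E) /\
  (forall b, b ε a -> a = suc b -> (a ε E <-> ~ b ε E)).
Definition func s : Prop := forall x y y', pair x y ε s -> pair x y' ε s -> y = y'.
Definition playP A r E sg s a : Prop := into s a A /\
  (forall b, b ε a -> forall c, c ε a -> c ε b -> pair (app s b) (app s c) ε r) /\
  (forall b, b ε a -> b ε E -> pair (restr s b) (app s b) ε sg).
Definition SC A r d : Prop := exists E sg, turns E d /\ func sg /\ forall a, a ε d -> a ε E -> forall s, playP A r E sg s a ->
  exists p, p ε A /\ pair s p ε sg /\ forall b, b ε a -> pair p (app s b) ε r.

Lemma func_app s x y : func s -> pair x y ε s -> app s x = y.
Proof. by move=> F H; apply: iota_eq => // y' /F; apply. Qed.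

Notation satM := (sat (@E M) eq).

Lemma turnsE E d : satM (second_player_turns E d) <-> turns E d.
Proof.
  rewrite /second_player_turns /turns sat_all; split=> H a.
    move=> ad; move: (H a) => /sat_imp /(_ ad) /sat_and [/sat_imp H1 /sat_and [/sat_imp H2 /sat_all H3]].
    split; [by move=> /is_emptyE /H1 /sat_neg|split; first by move=> /limitE /H2].
    by move=> b ba E1; move: (H3 b) => /sat_imp /(_ ba) /sat_imp; rewrite is_succE => /(_ E1) /sat_iff; rewrite sat_neg.
  apply/sat_imp => ad; case: (H a ad) => H1 [H2 H3]; apply/sat_and; split; first by apply/sat_imp => /is_emptyE /H1; rewrite sat_neg.
  apply/sat_and; split; first by apply/sat_imp => /limitE /H2.
  by apply/sat_all => b; apply/sat_imp => ba; apply/sat_imp => /is_succE E1; apply/sat_iff; rewrite sat_neg; exact: H3.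
Qed.

Lemma playE A r E sg s a : satM (play A r E sg s a) <-> playP A r E sg s a.
Proof.
  rewrite /play /playP sat_and mapsE sat_and; split=> -[[fs sA] [H1 H2]]; split=> //.
    split.
      move=> b ba c ca cb; move: H1 => /sat_all /(_ b) /sat_imp /(_ ba) /sat_all /(_ c) /sat_imp /(_ cb) /sat_all /(_ (app s b)) /sat_all /(_ (app s c)).
      by move=> /sat_imp; rewrite pair_inE => /(_ (app_in fs ba)) /sat_imp; rewrite !pair_inE; apply; exact: (app_in fs).
    move=> b ba bE; move: H2 => /sat_all /(_ b) /sat_imp /(_ ba) /sat_imp /(_ bE) /sat_ex [t /sat_ex [x /sat_and [/is_restrictionE -> /sat_and [/pair_inE bx /pair_inE K]]]].
    by rewrite (app_eq fs bx).
  split.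
    apply/sat_all => b; apply/sat_imp => ba; apply/sat_all => c; apply/sat_imp => cb; apply/sat_all => x; apply/sat_all => y.
    apply/sat_imp => /pair_inE /(fun_in _ _ fs) [_ ->]; apply/sat_imp => /pair_inE /(fun_in _ _ fs) [ca ->]; apply/pair_inE; exact: H1.
  apply/sat_all => b; apply/sat_imp => ba; apply/sat_imp => bE; apply/sat_ex; exists (restr s b); apply/sat_ex; exists (app s b).
  rewrite !sat_and !pair_inE is_restrictionE; split=> //; split; [exact: (app_in fs)|exact: H2].
Qed.

Lemma strategically_closedE A r d : satM (strategically_closed A r d) <-> SC A r d.
Proof.
  rewrite /strategically_closed /SC; split.
    move=> /sat_ex [E /sat_ex [sg /sat_and [/turnsE H1 /sat_and [/functionalE H2 H3]]]]; exists E, sg; split=> //; split=> // a ad aE s Hs.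
    move: H3 => /sat_all /(_ a) /sat_imp /(_ ad) /sat_imp /(_ aE) /sat_all /(_ s) /sat_imp; rewrite playE => /(_ Hs) /sat_ex [p /sat_and [pA /sat_and [/pair_inE K1 K2]]].
    exists p; split=> //; split=> // b ba; move: K2 => /sat_all /(_ b) /sat_all /(_ (app s b)) /sat_imp; rewrite !pair_inE; apply.
    by case: Hs => -[fs _] _; exact: (app_in fs).
  move=> [E [sg [H1 [H2 H3]]]]; apply/sat_ex; exists E; apply/sat_ex; exists sg; apply/sat_and; split; first exact/turnsE.
  apply/sat_and; split; first exact/functionalE.
  apply/sat_all => a; apply/sat_imp => ad; apply/sat_imp => aE; apply/sat_all => s; apply/sat_imp => /playE Hs; case: (H3 a ad aE s Hs) => p [pA [K1 K2]].
  apply/sat_ex; exists p; apply/sat_and; split=> //; apply/sat_and; split; first exact/pair_inE.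
  apply/sat_all => b; apply/sat_all => y; apply/sat_imp => /pair_inE; case: Hs => -[fs _] _ /(fun_in _ _ fs) [ba ->]; apply/pair_inE; exact: K2.
Qed.

Variable Col : M -> M -> M -> Prop.
Hypothesis DCol : Def (fun e => Col (e 0) (e 1) (e 2)).
Hypothesis HCol : forall q A r, Col q A r -> q = pair A r /\ poset A r.
Variables S R : M.
Hypothesis HS : forall z, z ε S <-> z = empty \/ exists q A r p, Col q A r /\ p ε A /\ z = pair q p.
Hypothesis HR : forall w, w ε R <-> exists x y, x ε S /\ y ε S /\ w = pair x y /\
  (y = empty \/ exists q A r p p', Col q A r /\ x = pair q p /\ y = pair q p' /\ pair p p' ε r).

Lemma lot_R x y : pair x y ε R <-> x ε S /\ y ε S /\ (y = empty \/ exists q A r p p', Col q A r /\ x = pair q p /\ y = pair q p' /\ pair p p' ε r).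
Proof. by rewrite HR; split=> [[x' [y' [H1 [H2 [/pair_inj [-> ->] H]]]]]|[H1 [H2 H]]] //; exists x, y. Qed.
Lemma lot_top : empty ε S. Proof. by apply/HS; left. Qed.
Lemma lot_le_top x : x ε S -> pair x empty ε R.
Proof. by move=> H; apply/lot_R; split=> //; split; [exact: lot_top|left]. Qed.
Lemma lot_refl x : x ε S -> pair x x ε R.
Proof.
  move=> H; apply/lot_R; split=> //; split=> //; move: H => /HS [->|[q [A [r [p [C1 [pA ->]]]]]]]; [by left|right].
  by exists q, A, r, p, p; split=> //; split=> //; split=> //; case: (HCol C1) => _ [_ [K _]]; exact: K.
Qed.
Lemma lot_inv q A r p x : Col q A r -> pair x (pair q p) ε R -> exists p', x = pair q p' /\ pair p' p ε r.
Proof.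
  move=> C1 /lot_R [_ [_ [/pair_ne //|[q' [A' [r' [p1 [p2 [C2 [-> [/pair_inj [Eq ->] K]]]]]]]]]]]; subst q'; exists p1; split=> //.
  by case: (HCol C1) (HCol C2) => -> _ [/pair_inj [_ ->]].
Qed.
Lemma lot_intro q A r p p' : Col q A r -> pair p p' ε r -> pair (pair q p) (pair q p') ε R.
Proof.
  move=> C1 K; case: (HCol C1) => _ Pr; case: (poset_l Pr K) => pA pA'; apply/lot_R.
  split; [by apply/HS; right; exists q, A, r, p|split; [by apply/HS; right; exists q, A, r, p'|right]].
  by exists q, A, r, p, p'.
Qed.
Lemma lot_trans x y z : pair x y ε R -> pair y z ε R -> pair x z ε R.
Proof.
  move=> H1 /lot_R [_ [zS [->|[q [A [r [p [p' [C1 [Ey [-> K]]]]]]]]]]]; first by apply: lot_le_top; case/lot_R: H1.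
  subst y; case: (lot_inv C1 H1) => p1 [-> K1]; apply: lot_intro (C1) _.
  by case: (HCol C1) => _ [_ [_ [T _]]]; exact: T K1 K.
Qed.

(* Merging the moves of the two players: [g] proposes a condition before each move of the first player. *)
Definition legit g s a : Prop := forall c, c ε a -> exists y, pair (restr s c) y ε g /\ pair (app s c) y ε R.
(** The clause on [empty] lets a coordinate at which nobody has moved stay at 1; the support
    condition of the iteration depends on it. *)
Definition NS d g : Prop := forall a, a ε d -> forall s, isfun s a -> exists x, x ε S /\ ((forall c, c ε a -> app s c = empty) -> x = empty) /\
  (legit g s a -> pair s x ε g /\ forall c, c ε a -> pair x (app s c) ε R).

Lemma dom_isfun t l : isfun t l -> dom t = l.
Proof.
  move=> ft; apply: sext => x; rewrite in_dom; split=> [[y /(fun_in _ _ ft) [] //]|xl].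
  by exists (app t x); exact: (app_in ft).
Qed.
Lemma isfun_ne t l : isfun t l -> l <> empty -> t <> empty.
Proof.
  move=> ft N E1; apply: N; apply: sext => x; split=> [xl|/in_empty //]; move: (app_in ft xl); by rewrite E1 => /in_empty.
Qed.

Lemma limO_suc m x : limO m -> x ε m -> suc x ε m.
Proof. by move=> [om [_ H]] xm; case: (suc_in om xm) => // E1; case: (H x xm). Qed.
Lemma turns_suc E d x : turns E d -> suc x ε d -> (suc x ε E <-> ~ x ε E).
Proof. by move=> Tu xd; case: (Tu _ xd) => _ [_ K]; apply: K => //; exact: suc_self. Qed.

Lemma play_ext A r E sg t l p : playP A r E sg t l -> ord l -> p ε A -> (forall j, j ε l -> pair p (app t j) ε r) ->
  (l ε E -> pair t p ε sg) -> playP A r E sg (cup t (sing (pair l p))) (suc l).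
Proof.
  move=> [[ft tA] [H1 H2]] ol pA pr pE; set t' := cup _ _.
  have in_t' x y : pair x y ε t' <-> (x ε l /\ y = app t x) \/ (x = l /\ y = p).
    rewrite in_cup in_sing (fun_in _ _ ft); split=> -[K|K]; [by left|by right; apply: pair_inj|by left|by right; case: K => -> ->].
  have ft' : isfun t' (suc l).
    split.
      move=> z /in_cup [zt|/in_sing ->]; last by exists l, p; rewrite in_suc; split=> //; right.
      by case: ft => [K _]; case: (K z zt) => x [y [xl ->]]; exists x, y; rewrite in_suc; split=> //; left.
    split; first by move=> x /in_suc [xl|->]; [exists (app t x)|exists p]; apply/in_t'; [left|right].
    move=> x y y' /in_t' [[xl ->]|[-> ->]] /in_t' [[xl' ->]|[E1 ->]] //; first by move: xl; rewrite E1 => /mem_irr.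
    by case: (mem_irr xl').
  have a1 x : x ε l -> app t' x = app t x by move=> xl; apply: (app_eq ft'); apply/in_t'; left.
  have a2 : app t' l = p by apply: (app_eq ft'); apply/in_t'; right.
  have rs x : x ε suc l -> restr t' x = restr t x.
    move=> xl; have sx : x ⊆ l by move: xl => /in_suc [/(ord_subs ol)|->].
    apply: sext => z; rewrite !in_restr; split=> -[zt [u [y [ux Ez]]]]; (split; last by exists u, y).
      by move: zt => /in_cup [//|/in_sing E1]; move: E1; rewrite Ez => /pair_inj [E1 _]; case: (@mem_irr _ l); apply: sx; rewrite -E1.
    by apply/in_cup; left.
  split; [split=> // x /in_suc [xl|->]; [rewrite a1 //; exact: tA|by rewrite a2]|split].
    move=> b /in_suc [bl|->] c /in_suc [cl|->] cb.
    - rewrite !a1 //; exact: H1.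
    - by case: (mem_asym bl cb).
    - rewrite a2 a1 //; exact: pr.
    - by case: (mem_irr cb).
  move=> b bs bE; rewrite rs //; move: bs => /in_suc [bl|Eb]; first by rewrite a1 //; exact: H2.
  by subst b; rewrite a2 restr_all //; exact: pE.
Qed.

(** * Expanding a run in the lottery sum to a play in the chosen poset *)

Section Expand.
Variables (de SG : M).
Hypothesis limde : limO de.

(** One move in the lottery sum stands for two moves in the chosen poset: the reply of the strategy
    [app SG q] at position [dom t], then the condition [p] played below it. Moves equal to 1 leave
    no trace, and the first move other than 1 opens the play. Closed with [Qed], so that only
    definability and the equation are visible. *)
Fact stp_sig : {f : M -> M -> M -> M | DTerm (fun e => f (e 0) (e 1) (e 2)) /\ forall s b t, f s b t = iota (fun u => (app s b = empty /\ u = empty) \/ exists q p, app s b = pair q p /\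
  ((t = empty /\ u = sing (pair empty p)) \/ (t <> empty /\ u = cup t (upair (pair (dom t) (app (app SG q) t)) (pair (suc (dom t)) p)))))}.
Proof. by eexists (fun s b t => iota (fun u => (app s b = empty /\ u = empty) \/ exists q p, app s b = pair q p /\
  ((t = empty /\ u = sing (pair empty p)) \/ (t <> empty /\ u = cup t (upair (pair (dom t) (app (app SG q) t)) (pair (suc (dom t)) p)))))); split=> //; def. Qed.
Definition stp := proj1_sig stp_sig.
Lemma stpE s b t : stp s b t = iota (fun u => (app s b = empty /\ u = empty) \/ exists q p, app s b = pair q p /\
  ((t = empty /\ u = sing (pair empty p)) \/ (t <> empty /\ u = cup t (upair (pair (dom t) (app (app SG q) t)) (pair (suc (dom t)) p))))).
Proof. exact: (proj2 (proj2_sig stp_sig)). Qed.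
Lemma D_stp : DTerm (fun e => stp (e 0) (e 1) (e 2)).
Proof. exact: (proj1 (proj2_sig stp_sig)). Qed.
Lemma stp0 s b t : app s b = empty -> stp s b t = empty.
Proof. by move=> H; rewrite stpE; apply: iota_eq => [|y [[]|[q [p [K _]]]]] //; [left|move: K; rewrite H => K; case: (pair_ne (eq_sym K))]. Qed.
Lemma stp1 s b q p : app s b = pair q p -> stp s b empty = sing (pair empty p).
Proof.
  move=> H; rewrite stpE; apply: iota_eq => [|y [[K _]|[q' [p' [K [[_ ->]|[] //]]]]]]; first by right; exists q, p; split=> //; left.
    by move: K; rewrite H => /pair_ne.
  by move: K; rewrite H => /pair_inj [_ ->].
Qed.
Lemma stp2 s b q p t : app s b = pair q p -> t <> empty -> stp s b t = cup t (upair (pair (dom t) (app (app SG q) t)) (pair (suc (dom t)) p)).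
Proof.
  move=> H N; rewrite stpE; apply: iota_eq => [|y [[K _]|[q' [p' [K [[//]|[_ ->]]]]]]]; first by right; exists q, p; split=> //; right.
    by move: K; rewrite H => /pair_ne.
  by move: K; rewrite H => /pair_inj [-> ->].
Qed.
Lemma stp_eq s s' b t : app s b = app s' b -> stp s b t = stp s' b t.
Proof. by rewrite !stpE => ->. Qed.
Fact TT_sig : {f : M -> M -> M | DTerm (fun e => f (e 0) (e 1)) /\ forall s c, f s c = union (img c (fun b => stp s b (app (lam c (f s)) b)))}.
Proof.
  exists (fun s => rec (fun c h => union (img c (fun b => stp s b (app h b))))); split.
    apply: (@D_rec _ (fun e c h => union (img c (fun b => stp (e 0) b (app h b)))) (fun e => e 1)); last exact: DTerm_var.
    by apply: D_union; apply: DTerm_img; [exact: DTerm_var|apply: (DTerm_3 D_stp); def].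
  move=> s c; apply: rec_eq; apply: D_union; apply: DTerm_img; [exact: DTerm_var|apply: (DTerm_3 D_stp); def].
Qed.
Definition TT := proj1_sig TT_sig.
Lemma D_TT : DTerm (fun e => TT (e 0) (e 1)).
Proof. exact: (proj1 (proj2_sig TT_sig)). Qed.
Lemma TT_in s c z : z ε TT s c <-> exists b, b ε c /\ z ε stp s b (TT s b).
Proof.
  have D4 : DTerm (fun e => TT s (e 0)) by apply: (DTerm_2 D_TT); def.
  have D3 : DTerm (fun e => stp s (e 0) (app (lam c (TT s)) (e 0))).
    by apply: (DTerm_3 D_stp); [def|def|apply: D_app; [exact: DTerm_const|def]].
  have -> : TT s c = union (img c (fun b => stp s b (app (lam c (TT s)) b))) by exact: (proj2 (proj2_sig TT_sig)).
  have L b : b ε c -> app (lam c (TT s)) b = TT s b by exact: app_lam.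
  have I := @in_img _ c (fun b => stp s b (app (lam c (TT s)) b)) D3.
  rewrite in_union; split=> [[y [/I [b [bc Ey]] zy]]|[b [bc zb]]].
    by exists b; split=> //; move: zy; rewrite Ey (L b bc).
  by exists (stp s b (TT s b)); split=> //; apply/I; exists b; split=> //; rewrite (L b bc).
Qed.
Lemma TT0 s c : (forall b, b ε c -> app s b = empty) -> TT s c = empty.
Proof. by move=> H; apply: sext => z; rewrite TT_in; split=> [[b [bc]]|/in_empty //]; rewrite (stp0 _ (H b bc)). Qed.
Lemma TT_restr s a c : isfun s a -> ord a -> c ε a \/ c = a -> forall b, b ε c \/ b = c -> TT (restr s c) b = TT s b.
Proof.
  move=> fs oa ca; have oc : ord c by case: ca => [/(ord_in oa)|->].
  have cs : c ⊆ a by case: ca => [/(ord_subs oa)|-> //].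
  apply: (@ind _ (fun b => b ε c \/ b = c -> TT (restr s c) b = TT s b)) => [|b IH bc].
    by apply: Def_imp; [def|apply: Def_eq; apply: (DTerm_2 D_TT); def].
  have Hb b' : b' ε b -> b' ε c by case: bc => [bc|->] //; exact: ord_trans bc.
  have st b' : b' ε b -> stp (restr s c) b' (TT (restr s c) b') = stp s b' (TT s b').
    by move=> bb; rewrite (IH b' bb); [by left; exact: Hb|]; apply: stp_eq; exact: (app_restr fs cs (Hb _ bb)).
  by apply: sext => z; rewrite !TT_in; split=> -[b' [bb]]; [rewrite st|rewrite -st] => // zz; exists b'.
Qed.

(** The proposal after the run [s]: 1 as long as no poset is chosen, afterwards the answer of the
    strategy of that poset to the expanded play. *)
Definition Yv s a : M := iota (fun y => (TT s a = empty /\ y = empty) \/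
  (TT s a <> empty /\ exists q p b, b ε a /\ app s b = pair q p /\ y = pair q (app (app SG q) (TT s a)))).
Lemma D_Yv : DTerm (fun e => Yv (e 0) (e 1)). Proof. have D := D_TT; rewrite /Yv; def. Qed.

Variables (a s g : M).
Hypothesis oa : ord a.
Hypothesis ade : a ε suc de.
Hypothesis fs : isfun s a.
Hypothesis Hg : forall c y, c ε a -> pair (restr s c) y ε g -> y = Yv (restr s c) c.
Hypothesis Leg : legit g s a.
Variables (b0 q A r E sg p0 : M).
Hypothesis b0a : b0 ε a.
Hypothesis b0min : forall b, b ε b0 -> app s b = empty.
Hypothesis sb0 : app s b0 = pair q p0.
Hypothesis p0A : p0 ε A.
Hypothesis Cq : Col q A r.
Hypothesis sgE : app SG q = sg.
Hypothesis Tu : turns E (suc de).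
Hypothesis Fsg : func sg.
Hypothesis Hsg : forall a, a ε suc de -> a ε E -> forall s, playP A r E sg s a ->
  exists p, p ε A /\ pair s p ε sg /\ forall b, b ε a -> pair p (app s b) ε r.
Notation T := (TT s).

(** The invariant of the expansion. Its length [l] is a turn of the second player, being reached
    after the opening move, after two further moves, or at a limit. It stays below every limit above
    [c], so that the play fits into length [suc de], and it grows strictly, so that the lengths
    reached at limits are limits. *)
Definition PL c : Prop := exists l, playP A r E sg (T c) l /\ ord l /\ l ε suc de /\ l ε E /\ l <> empty /\
  (forall b, b ε c -> b ε b0 \/ exists j p, j ε l /\ app s b = pair q p /\ app (T c) j = p) /\
  (forall m, limO m -> c ε m -> l ε m) /\ (forall b, b ε c -> b0 ε b -> dom (T b) ε l).

Lemma PL_Yv c : c ε suc a -> b0 ε c -> PL c -> exists v, v ε A /\ pair (T c) v ε sg /\ Yv (restr s c) c = pair q v /\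
   forall j, j ε dom (T c) -> pair v (app (T c) j) ε r.
Proof.
  move=> ca b0c [l [Pl [ol [lde [lE [ln [Kb [_ _]]]]]]]].
  case: (Hsg lde lE Pl) => v [vA [vs vr]]; have Ev : app sg (T c) = v by exact: func_app.
  have ft : isfun (T c) l by case: Pl => -[].
  have TE := @TT_restr s a c fs oa (proj1 (in_suc _ _) ca) c (or_intror (eq_refl c)).
  have cs : c ⊆ a by move: ca => /in_suc [/(ord_subs oa)|->].
  exists v; split=> //; split=> //; split; last by move=> j; rewrite (dom_isfun ft); exact: vr.
  apply: iota_eq; rewrite TE.
    right; split; first exact: isfun_ne ft ln. by exists q, p0, b0; split=> //; rewrite (app_restr fs cs b0c) sgE Ev.
  move=> y' [[K _]|[_ [q' [p' [b [bc [K ->]]]]]]]; first by case: (isfun_ne ft ln).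
  move: K; rewrite (app_restr fs cs bc); case: (Kb b bc) => [/b0min ->|[j [p [_ [-> _]]]]]; first by move=> K; case: (pair_ne (eq_sym K)).
  by move=> /pair_inj [<- _]; rewrite sgE Ev.
Qed.
Lemma PL_value c : c ε a -> b0 ε c -> PL c -> exists p v, app s c = pair q p /\ v ε A /\ pair (T c) v ε sg /\
   pair p v ε r /\ forall j, j ε dom (T c) -> pair v (app (T c) j) ε r.
Proof.
  move=> ca b0c Pc; case: (PL_Yv (proj2 (in_suc _ _) (or_introl ca)) b0c Pc) => v [vA [vs [Y vr]]].
  case: (Leg ca) => y [/(Hg ca) Ey]; rewrite Ey Y => /(lot_inv Cq) [p [-> pv]]; by exists p, v.
Qed.
Lemma TT_mono x y : x ⊆ y -> T x ⊆ T y.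
Proof. by move=> xy z /TT_in [b [bx zb]]; apply/TT_in; exists b; split=> //; exact: xy. Qed.
Lemma de_suc c : c ε suc a -> c ⊆ de.
Proof.
  have ode : ord de by case: limde.
  have ad : a ⊆ de by move: ade => /in_suc [/(ord_subs ode)|->].
  by move=> /in_suc [/(ord_subs oa) K x /K /ad|->].
Qed.

Lemma PL_first : PL (suc b0).
Proof.
  have ode : ord de by case: limde.
  have T0 : T b0 = empty by exact: TT0.
  have e0 : (empty : M) ε de by case: (ord_tot (ord_empty M) ode) => [//|[K|/in_empty //]]; case: limde => _ [N _]; case: N.
  have e1 : suc empty ε suc de by apply: suc_mono.
  have E0 : ~ (empty : M) ε E by case: (Tu (proj2 (in_suc _ _) (or_introl e0))) => + _; apply.
  have TE : T (suc b0) = cup empty (sing (pair empty p0)).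
    apply: sext => z; rewrite TT_in in_cup; split.
      move=> [b [/in_suc [bb|->]]]; first by rewrite (stp0 _ (b0min bb)) => /in_empty.
      by rewrite T0 (stp1 sb0); right.
    by move=> [/in_empty //|zz]; exists b0; rewrite T0 (stp1 sb0); split=> //; exact: suc_self.
  have fe : isfun (empty : M) empty by split=> [z /in_empty //|]; split=> [x /in_empty //|x y y' /in_empty].
  exists (suc empty); rewrite TE; split; last split; last split; last split; last split; last split; last split.
  - apply: play_ext; [|exact: ord_empty|exact: p0A|by move=> j /in_empty|by move=> /E0].
    by split; [split=> // x /in_empty|split=> b /in_empty].
  - exact: ord_suc (ord_empty M).
  - exact: e1.
  - by apply/(turns_suc Tu e1).
  - by move=> K; move: (suc_self (empty : M)); rewrite K => /in_empty.
  - move=> b /in_suc [bb|->]; [by left|right; exists empty, p0; split; first exact: suc_self].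
    split=> //; apply: func_app; last by apply/in_cup; right; apply/in_sing.
    by move=> x y y' /in_cup [/in_empty //|/in_sing /pair_inj [-> ->]] /in_cup [/in_empty //|/in_sing /pair_inj [_ ->]].
  - move=> m lm bm; apply: limO_suc => //; case: (lm) => om [N _].
    by case: (ord_tot (ord_empty M) om) => [//|[K|/in_empty //]]; case: N.
  - by move=> b /in_suc [bb b0b|->]; [case: (mem_asym bb b0b)|move=> /mem_irr].
Qed.

Lemma PL_suc b : b ε a -> b0 ε b -> PL b -> PL (suc b).
Proof.
  move=> ba b0b Pb; case: (PL_value ba b0b Pb) => p [v [sb [vA [vs [pv vr]]]]].
  have ob : ord b := ord_in oa ba; have ode : ord de by case: limde.
  case: (Pb) => l [Pl [ol [lde' [lE [ln [Kb [Bd Ch]]]]]]].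
  have ft : isfun (T b) l by case: Pl => -[].
  have Ev : app sg (T b) = v by exact: func_app.
  rewrite (dom_isfun ft) in vr.
  have bde : b ε de by apply: (de_suc (c := a)) => //; exact: suc_self.
  have lde : l ε de by exact: Bd.
  have l1 : suc l ε de by exact: limO_suc. have l2 : suc (suc l) ε de by exact: limO_suc.
  have in_d x : x ε de -> x ε suc de by rewrite in_suc; left.
  have n1 : ~ suc l ε E by move=> /(turns_suc Tu (in_d _ l1)).
  have [rA Pr] : True /\ poset A r by case: (HCol Cq).
  have pA : p ε A by case: (poset_l Pr pv).
  have P1 : playP A r E sg (cup (T b) (sing (pair l v))) (suc l) by exact: play_ext.
  have ft1 : isfun (cup (T b) (sing (pair l v))) (suc l) by case: P1 => -[].
  have P2 : playP A r E sg (cup (cup (T b) (sing (pair l v))) (sing (pair (suc l) p))) (suc (suc l)).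
    apply: play_ext => //; first exact: ord_suc.
    move=> j /in_suc [jl|->].
      rewrite (_ : app _ j = app (T b) j); first by apply: (app_eq ft1); apply/in_cup; left; exact: (app_in ft).
      by case: Pr => _ [_ [Tr _]]; exact: Tr pv (vr j jl).
    by rewrite (_ : app _ l = v) //; apply: (app_eq ft1); apply/in_cup; right; apply/in_sing.
  have ST : stp s b (T b) = cup (cup (T b) (sing (pair l v))) (sing (pair (suc l) p)).
    rewrite (stp2 sb (isfun_ne ft ln)) (dom_isfun ft) sgE Ev; apply: sext => z; rewrite !in_cup in_upair !in_sing; tauto.
  have TE : T (suc b) = cup (cup (T b) (sing (pair l v))) (sing (pair (suc l) p)).
    apply: sext => z; rewrite -ST TT_in; split=> [[b' [/in_suc [bb|->] //] zz]|zz].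
      by rewrite ST; apply/in_cup; left; apply/in_cup; left; apply/TT_in; exists b'.
    by exists b; split=> //; exact: suc_self.
  rewrite -TE in P2; have ft2 : isfun (T (suc b)) (suc (suc l)) by case: P2 => -[].
  exists (suc (suc l)); split=> //; split; first by do 2 apply: ord_suc.
  split; first exact: in_d. split; first by apply/(turns_suc Tu (in_d _ l2)).
  split; first by move=> K; move: (suc_self (suc l)); rewrite K => /in_empty.
  split; last split.
  - move=> b' /in_suc [bb|->].
      case: (Kb b' bb) => [|[j [p' [jl [E1 E2]]]]]; [by left|right; exists j, p'; split; first by rewrite !in_suc; left; left].
      by split=> //; apply: (app_eq ft2); rewrite TE -E2; apply/in_cup; left; apply/in_cup; left; exact: (app_in ft).
    right; exists (suc l), p; split; first exact: suc_self.
    by split=> //; apply: (app_eq ft2); rewrite TE; apply/in_cup; right; apply/in_sing.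
  - move=> m lm bm; do 2 apply: limO_suc => //; apply: Bd => //.
    by case: lm => om _; apply: ord_trans om bm _; exact: suc_self.
  - move=> b' /in_suc [bb b0b'|-> _]; first by rewrite !in_suc; left; left; exact: Ch.
    by rewrite (dom_isfun ft) !in_suc; left; right.
Qed.

Lemma PL_lim c : c ε suc a -> b0 ε c -> limO c -> (forall b, b ε c -> b0 ε b -> PL b) -> PL c.
Proof.
  move=> ca b0c lc IH; case: (lc) => oc [cn _]; have ode : ord de by case: limde.
  have DT := D_TT.
  have up b : b ε c -> exists b', b' ε c /\ b0 ε b' /\ b ε b'.
    move=> bc; case: (max_in oc (limO_suc lc bc) (limO_suc lc b0c)) => m [mc [M1 M2]]; exists m; split=> //.
    by split; [apply: M2|apply: M1]; exact: suc_self.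
  have Pf b : b ε c -> b0 ε b -> exists l, isfun (T b) l /\ ord l /\ l ε c /\ l <> empty /\ dom (T b) = l /\ playP A r E sg (T b) l.
    move=> bc b0b; case: (IH b bc b0b) => l [Pl [ol [_ [_ [ln [_ [Bd _]]]]]]]; have ft : isfun (T b) l by case: Pl => -[].
    by exists l; split=> //; split=> //; split; [exact: Bd|split=> //; split=> //; exact: dom_isfun].
  have TE z : z ε T c <-> exists b, b ε c /\ b0 ε b /\ z ε T b.
    split=> [/TT_in [b [bc zb]]|[b [bc [_ zb]]]]; last exact: (TT_mono (ord_subs oc bc) zb).
    by case: (up b bc) => b' [bc' [b0b' bb']]; exists b'; split=> //; split=> //; apply/TT_in; exists b.
  have cmp b b' : b ε c -> b' ε c -> T b ⊆ T b' \/ T b' ⊆ T b.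
    move=> bc bc'; case: (ord_tot (ord_in oc bc) (ord_in oc bc')) => [K|[->|K]]; [left|by left|right]; apply: TT_mono; exact: ord_subs (ord_in oc _) K.
  (* The length of the union of the earlier plays is the supremum of their lengths. Since these
     increase strictly, it is a limit and therefore a turn of the second player. *)
  pose l := sep c (fun j => exists b, b ε c /\ b0 ε b /\ j ε dom (T b)).
  have inl j : j ε l <-> j ε c /\ exists b, b ε c /\ b0 ε b /\ j ε dom (T b) by apply: in_sep; def.
  have inl' b j : b ε c -> b0 ε b -> j ε dom (T b) -> j ε l.
    move=> bc b0b jb; apply/inl; split; last by exists b.
    by case: (Pf b bc b0b) => lb [_ [_ [lc' [_ [E1 _]]]]]; rewrite E1 in jb; exact: ord_trans oc lc' jb.
  have fT : func (T c).
    move=> x y y' /TE [b [bc [b0b H1]]] /TE [b' [bc' [b0b' H2]]].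
    have key b1 : b1 ε c -> b0 ε b1 -> pair x y ε T b1 -> pair x y' ε T b1 -> y = y'.
      by move=> bc1 b01; case: (Pf b1 bc1 b01) => lb [ft _] K1 K2; rewrite -(app_eq ft K1) -(app_eq ft K2).
    by case: (cmp b b' bc bc') => K; [apply: (key b') => //; exact: K|apply: (key b) => //; exact: K].
  have ag b j : b ε c -> b0 ε b -> j ε dom (T b) -> app (T c) j = app (T b) j.
    move=> bc b0b; case: (Pf b bc b0b) => lb [ft [_ [_ [_ [-> _]]]]] jl; apply: (func_app fT); apply/TE; exists b.
    by split=> //; split=> //; exact: (app_in ft).
  have fl : isfun (T c) l.
    split.
      move=> z /TE [b [bc [b0b zb]]]; case: (Pf b bc b0b) => lb [ft [_ [_ [_ [E1 _]]]]]; case: (ft) => [K _]; case: (K z zb) => x [y [xl Ez]].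
      by exists x, y; split=> //; apply: (inl' b) => //; rewrite E1.
    split=> // x /inl [_ [b [bc [b0b xb]]]]; exists (app (T b) x); apply/TE; exists b; split=> //; split=> //.
    by case: (Pf b bc b0b) => lb [ft [_ [_ [_ [E1 _]]]]]; rewrite E1 in xb; exact: (app_in ft).
  have rs b j : b ε c -> b0 ε b -> j ε dom (T b) -> restr (T c) j = restr (T b) j.
    move=> bc b0b; case: (Pf b bc b0b) => lb [ft [olb [_ [_ [E1 _]]]]] jb; apply: sext => z; rewrite !in_restr; split=> -[zt [x [y [xj Ez]]]]; (split; last by exists x, y).
      have xl : x ε lb by rewrite E1 in jb; exact: ord_trans olb jb xj.
      rewrite Ez; rewrite (fun_in _ _ ft); split=> //; rewrite Ez in zt; apply: (fT x) => //; apply/TE; exists b; split=> //; split=> //; exact: (app_in ft).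
    by apply/TE; exists b.
  have ol : ord l.
    split; last by move=> x /inl [xc _]; case: (ord_in oc xc).
    move=> x /inl [_ [b [bc [b0b xb]]]] y yx; apply: (inl' b) => //; case: (Pf b bc b0b) => lb [_ [olb [_ [_ [E1 _]]]]].
    by rewrite E1 in xb *; exact: ord_trans olb xb yx.
  have lsc : l ε c \/ l = c by apply: ord_sub => // x /inl [].
  have Ch b : b ε c -> b0 ε b -> dom (T b) ε l.
    move=> bc b0b; have sc := limO_suc lc bc; have b0s : b0 ε suc b by rewrite in_suc; left.
    case: (IH (suc b) sc b0s) => l' [Pl [_ [_ [_ [_ [_ [_ K]]]]]]]; apply: (inl' (suc b)) => //.
    rewrite (@dom_isfun (T (suc b)) l'); first by case: Pl => -[]. by apply: K => //; exact: suc_self.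
  have cde := de_suc ca.
  have lde : l ε suc de by rewrite in_suc; apply: ord_sub => // x /inl [/cde].
  have ll : limO l.
    split=> //; split.
      case: (up b0 b0c) => b [bc [b0b _]] E1; move: (Ch b bc b0b); by rewrite E1 => /in_empty.
    move=> y /inl [_ [b [bc [b0b yb]]]] E1; move: (Ch b bc b0b); rewrite E1 => /in_suc [K|K]; first by case: (mem_asym yb K).
    by rewrite K in yb; case: (mem_irr yb).
  exists l; split; last split=> //; last split=> //; last split; last split; last split; last split=> //.
  - split; [split=> // j /inl [_ [b [bc [b0b jb]]]]|split].
    + by rewrite (ag b) //; case: (Pf b bc b0b) => lb [_ [_ [_ [_ [E1 [[_ K] _]]]]]]; apply: K; rewrite -E1.
    + move=> j /inl [_ [b [bc [b0b jb]]]] i il ij; case: (Pf b bc b0b) => lb [_ [olb [_ [_ [E1 [_ [K _]]]]]]].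
      have ib : i ε dom (T b) by rewrite E1 in jb *; exact: ord_trans olb jb ij.
      by rewrite (ag b) // (ag b) //; rewrite E1 in jb ib; exact: K.
    + move=> j /inl [_ [b [bc [b0b jb]]]] jE; case: (Pf b bc b0b) => lb [_ [olb [_ [_ [E1 [_ [_ K]]]]]]].
      by rewrite (ag b) // (rs b) //; apply: K => //; rewrite -E1.
  - by case: (Tu lde) => _ [K _]; exact: K.
  - by case: ll => _ [].
  - move=> b bc; case: (up b bc) => b' [bc' [b0b' bb']]; case: (IH b' bc' b0b') => l' [Pl [_ [_ [_ [_ [K _]]]]]].
    case: (K b bb') => [|[j [p [jl [E1 E2]]]]]; [by left|right; exists j, p].
    have jb : j ε dom (T b') by rewrite (@dom_isfun _ l') //; case: Pl => -[].
    by split; [exact: (inl' b')|split=> //; rewrite (ag b')].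
  - by move=> m [om _] cm; case: lsc => [K|->] //; exact: ord_trans om cm K.
Qed.

Lemma PL_all c : c ε suc a -> b0 ε c -> PL c.
Proof.
  have DT := D_TT.
  move: c; apply: (@ind _ (fun c => c ε suc a -> b0 ε c -> PL c)) => [|c IH ca b0c]; first by rewrite /PL /playP /into /isfun /ord /trans /limO; def.
  have oc : ord c by move: ca => /in_suc [/(ord_in oa)|->].
  have sub x : x ε c -> x ε suc a by move=> xc; exact: ord_trans (ord_suc oa) ca xc.
  case: (classic (limO c)) => lc; first by apply: PL_lim => // b bc b0b; apply: IH => //; exact: sub.
  have [b [bc Eb]] : exists b, b ε c /\ c = suc b.
    apply: NNPP => K; apply: lc; split=> //; split; first by move=> E1; move: b0c; rewrite E1 => /in_empty.
    by move=> y yc E1; apply: K; exists y.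
  have ba : b ε a by move: ca; rewrite Eb => /in_suc [K|<-]; [exact: (ord_trans oa K (suc_self b))|exact: suc_self].
  move: (b0c); rewrite Eb => /in_suc [b0b|<-]; last exact: PL_first.
  by apply: PL_suc => //; apply: IH => //; exact: sub.
Qed.

Lemma expand : exists v, v ε A /\ Yv s a = pair q v /\ forall c, c ε a -> pair (pair q v) (app s c) ε R.
Proof.
  have Pa : PL a by apply: PL_all => //; exact: suc_self.
  case: (PL_Yv (suc_self a) b0a Pa) => v [vA [vs [Y vr]]]; exists v; split=> //.
  rewrite restr_all // in Y; split=> // c ca.
  have vS : pair q v ε S by apply/HS; right; exists q, A, r, v.
  case: Pa => l [Pl [_ [_ [_ [_ [Kb _]]]]]]; case: (Kb c ca) => [/b0min ->|[j [p [jl [-> Ep]]]]]; first exact: lot_le_top.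
  by apply: (lot_intro Cq); rewrite -Ep; apply: vr; rewrite (@dom_isfun _ l) //; case: Pl => -[].
Qed.
End Expand.

(** Length [suc de] is used so that a run is still answered at the limit [de] itself. Strategies for
    all posets of the collection are chosen in advance; which one is followed depends on the first
    move different from 1. *)
Lemma lot_strategy de : limO de -> (forall q A r, Col q A r -> SC A r (suc de)) -> exists g, NS (suc de) g.
Proof.
  move=> lde HC; have ode : ord de by case: lde.
  have DSC : Def (fun e => turns (e 0) (e 1)) by rewrite /turns /limO /ord /trans; def.
  have Dfu : Def (fun e => func (e 0)) by rewrite /func; def.
  have DP : Def (fun e : nat -> M => forall a, a ε suc de -> a ε e 2 -> forall s, playP (e 0) (e 1) (e 2) (e 3) s a ->
     exists p, p ε e 0 /\ pair s p ε e 3 /\ forall b, b ε a -> pair p (app s b) ε e 1).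
    by rewrite /playP /into /isfun; def.
  pose Q A r E sg := forall a, a ε suc de -> a ε E -> forall s, playP A r E sg s a -> exists p, p ε A /\ pair s p ε sg /\ forall b, b ε a -> pair p (app s b) ε r.
  change (Def (fun e : nat -> M => Q (e 0) (e 1) (e 2) (e 3))) in DP.
  case: (@choice_map _ (fun q E => forall A r, Col q A r -> turns E (suc de) /\ exists sg, func sg /\ Q A r E sg) (union (union S))) => [|q qS|EE [_ HE]]; first def.
    case: (classic (exists A r, Col q A r)) => [[A [r C1]]|N]; last by exists empty => A r C1; case: N; exists A, r.
    case: (HC q A r C1) => E [sg [H1 [H2 H3]]]; exists E => A' r' C2.
    by case: (HCol C1) (HCol C2) => E1 _ [E2 _]; move: E2; rewrite E1 => /pair_inj [<- <-]; split=> //; exists sg.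
  case: (@choice_map _ (fun q sg => forall A r, Col q A r -> func sg /\ Q A r (app EE q) sg) (union (union S))) => [|q qS|SG [_ HSG]]; first def.
    case: (classic (exists A r, Col q A r)) => [[A [r C1]]|N]; last by exists empty => A r C1; case: N; exists A, r.
    case: (HE q qS A r C1) => _ [sg [H2 H3]]; exists sg => A' r' C2.
    by case: (HCol C1) (HCol C2) => E1 _ [E2 _]; move: E2; rewrite {1}E1 => /pair_inj [<- <-].
  pose X := sep (pow (prod (suc de) S)) (fun s => exists a, a ε suc de /\ isfun s a).
  have inX s : s ε X <-> s ε pow (prod (suc de) S) /\ exists a, a ε suc de /\ isfun s a by apply: in_sep; rewrite /isfun; def.
  have DY : DTerm (fun e => Yv SG (e 0) (dom (e 0))) by apply: (DTerm_2 (D_Yv SG)); def.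
  pose g := lam X (fun s => Yv SG s (dom s)).
  have ing s y : pair s y ε g <-> s ε X /\ y = Yv SG s (dom s) by exact: (pair_lam _ _ _ DY).
  exists g => a ad s fs; case: (classic (legit g s a)) => Leg; last first.
    by exists empty; split; [exact: lot_top|split].
  have oa : ord a := ord_in (ord_suc ode) ad.
  have sS c : c ε a -> app s c ε S by move=> /Leg [y [_ /lot_R []]].
  have sX : s ε X.
    apply/inX; split; last by exists a. apply/in_pow => z zs; case: (fs) => [K _]; case: (K z zs) => x [y [xa Ez]].
    rewrite Ez in zs *; apply/pair_prod; split; first exact: (ord_trans (ord_suc ode) ad xa).
    by rewrite -(app_eq fs zs); exact: sS.
  have gs : pair s (Yv SG s a) ε g by apply/ing; rewrite (dom_isfun fs).
  case: (classic (exists b, b ε a /\ app s b <> empty)) => [[b1 [b1a b1n]]|N]; last first.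
    have al c : c ε a -> app s c = empty by move=> ca; apply: NNPP => K; apply: N; exists c.
    have Y : Yv SG s a = empty by apply: iota_eq => [|y [[_ ->]|[K _]]] //; [left; split=> //; exact: TT0|case: K; exact: TT0].
    rewrite Y in gs; exists empty; split; [exact: lot_top|split=> // _; split=> // c ca]; rewrite al //; exact: lot_refl lot_top.
  (* [b0] is the first move different from 1; it fixes the poset for the rest of the run. *)
  case: (@ord_least _ (fun b => b ε a /\ app s b <> empty)) => [||b0 [ob0 [[b0a b0n] b0m]]]; first def.
    by exists b1; split=> //; exact: ord_in b1a.
  have b0min b : b ε b0 -> app s b = empty by move=> bb; apply: NNPP => K; case: (b0m b bb); split=> //; exact: ord_trans b0a bb.
  move: (sS b0 b0a) => /HS [//|[q [A [r [p0 [C1 [p0A Es]]]]]]].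
  have qS : q ε union (union S).
    rewrite in_union; exists (sing q); split; last by apply/in_sing. rewrite in_union; exists (pair q p0); split; last exact: sing_in_pair.
    by rewrite -Es; exact: sS.
  have [Tu _] := HE q qS A r C1; have [Fs Hs] := HSG q qS A r C1.
  have Hg c y : c ε a -> pair (restr s c) y ε g -> y = Yv SG (restr s c) c.
    move=> ca /ing [_ ->]; rewrite (@dom_isfun _ c) //; apply: restr_fun (fs) _; exact: ord_subs.
  have [v [vA [Yq K]]] := @expand de SG lde a s g oa ad fs Hg Leg b0 q A r (app EE q) (app SG q) p0 b0a b0min Es p0A C1 (eq_refl _) Tu Fs Hs.
  rewrite Yq in gs; exists (pair q v); split; first by apply/HS; right; exists q, A, r, v.
  by split=> // al; move: b0n; rewrite al.
Qed.
End LotterySum.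

(** * Order, strategies and size of a lottery sum, in an arbitrary model *)

Local Open Scope fml_scope.

(** The property [NS] as a formula, so that it can be forced. *)
Definition strategy_reply X (S R d h : X) : fml X :=
  ∀[a ∈ d] ∀ s, function_on s a ⇒ ∃ x, x ∈ S ∧ ((∀[c ∈ a] ∃ y, pair_in c y s ∧ is_empty y) ⇒ is_empty x) ∧
   ((∀[c ∈ a] ∃ y t u, pair_in c y s ∧ is_restriction t s c ∧ pair_in t u h ∧ pair_in y u R) ⇒
     pair_in s x h ∧ ∀[c ∈ a] ∀ y, pair_in c y s ⇒ pair_in x y R).
(** The last conjunct asks for a minimal condition. It is provided by a one-point poset if the
    collection contains a nonempty poset, and by 1 otherwise. *)
Definition stage_order_ok X (S R : X) : fml X :=
  (∀[x ∈ S] pair_in x x R) ∧ (∀ x y z, pair_in x y R ⇒ pair_in y z R ⇒ pair_in x z R) ∧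
  (∀ x y, pair_in x y R ⇒ x ∈ S ∧ y ∈ S) ∧ (∀ x, is_empty x ⇒ x ∈ S ∧ ∀[y ∈ S] pair_in y x R) ∧
  (∃[m ∈ S] ∀[x ∈ S] pair_in x m R ⇒ pair_in m x R).
(** [T] is only required to contain the pairs of elements of [L], so no exact product has to be
    named. [L] has the elements [l] and its successor besides those of [l]; they serve as markers in
    the codes. *)
Definition squares X (l L T : X) : fml X :=
  l ∈ L ∧ subset l L ∧ (∃[m ∈ L] is_succ m l) ∧ ∀[x ∈ L] ∀[y ∈ L] ∃[z ∈ T] is_pair z x y.
Definition stage_ok X (g l S R : X) : fml X :=
  stage_order_ok S R ∧ (∀ e d, limit e ⇒ is_succ d e ⇒ d ∈ g ⇒ ∃ h, strategy_reply S R d h) ∧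
  (∀ L T, squares l L T ⇒ ∃ y, is_power y T ∧ injects S y).

Section StageFacts.
Variable M : zf.
Implicit Types (a b c d q A r p s t x y z w E sg S R g l : M).
Notation satM := (sat (@E M) eq).

Lemma is_posetE q A r : satM (is_poset q A r) <-> q = pair A r /\ poset A r.
Proof.
  rewrite /is_poset /poset !sat_and is_pairE; split=> -[-> [H1 [H2 [H3 H4]]]]; split=> //.
    split; last split; last split.
    - move=> z zr; move: H1 => /sat_all /(_ z) /sat_imp /(_ zr) /sat_ex [x /sat_and [xA /sat_ex [y /sat_and [yA /is_pairE ->]]]]; by exists x, y.
    - by move=> x xA; move: H2 => /sat_all /(_ x) /sat_imp /(_ xA) /pair_inE.
    - by move=> x y z K1 K2; move: H3 => /sat_all /(_ x) /sat_all /(_ y) /sat_all /(_ z) /sat_imp; rewrite pair_inE => /(_ K1) /sat_imp; rewrite !pair_inE; apply.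
    - by move=> x y K1 K2; move: H4 => /sat_all /(_ x) /sat_all /(_ y) /sat_imp; rewrite pair_inE => /(_ K1) /sat_imp; rewrite !pair_inE; apply.
  split; last split; last split.
  - apply/sat_all => z; apply/sat_imp => zr; case: (H1 z zr) => x [y [xA [yA ->]]]; apply/sat_ex; exists x; apply/sat_and; split=> //.
    by apply/sat_ex; exists y; apply/sat_and; split=> //; apply/is_pairE.
  - by apply/sat_all => x; apply/sat_imp => xA; apply/pair_inE; exact: H2.
  - by apply/sat_all => x; apply/sat_all => y; apply/sat_all => z; apply/sat_imp => /pair_inE K1; apply/sat_imp => /pair_inE K2; apply/pair_inE; exact: H3 K1 K2.
  - by apply/sat_all => x; apply/sat_all => y; apply/sat_imp => /pair_inE K1; apply/sat_imp => /pair_inE K2; exact: H4 K1 K2.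
Qed.

Definition succcard th l : Prop := card th /\ l ε th /\ forall n, card n -> l ε n -> th ⊆ n.
Definition inH x th : Prop := exists t, trans t /\ x ⊆ t /\ exists a, a ε th /\ injs t a.
Definition StC g l q A r : Prop := (q = pair A r /\ poset A r) /\ (exists th, succcard th l /\ inH q th) /\ forall d, d ε g -> SC A r d.

Lemma stage_collectionE g l q A r : satM (stage_collection g l q A r) <-> StC g l q A r.
Proof.
  have H1 th : satM (is_succ_cardinal th l) <-> succcard th l.
    rewrite /is_succ_cardinal /succcard sat_and cardinalE sat_and; split=> -[K1 [K2 K3]]; split=> //; split=> //.
      by move=> n c1 l1; move: K3 => /sat_all /(_ n) /sat_imp; rewrite sat_and cardinalE => /(_ (conj c1 l1)) /sat_all K x xt; move: (K x) => /sat_imp; apply.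
    apply/sat_all => n; apply/sat_imp => /sat_and [/cardinalE c1 l1]; apply/sat_all => x; apply/sat_imp; exact: K3.
  have H2 x th : satM (in_H x th) <-> inH x th.
    rewrite /in_H /inH sat_ex; split=> -[t H]; exists t.
      move: H => /sat_and [/sat_all K1 /sat_and [/sat_all K2 /sat_ex [a /sat_and [aT /injectsE K3]]]]; split; last split; last by exists a.
        by move=> y yt z zy; move: (K1 y) => /sat_imp /(_ yt) /sat_all /(_ z) /sat_imp; apply.
      by move=> y yx; move: (K2 y) => /sat_imp; apply.
    case: H => K1 [K2 [a [aT K3]]]; apply/sat_and; split.
      by apply/sat_all => y; apply/sat_imp => yt; apply/sat_all => z; apply/sat_imp; exact: K1.
    apply/sat_and; split; first by apply/sat_all => y; apply/sat_imp; exact: K2.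
    by apply/sat_ex; exists a; apply/sat_and; split=> //; apply/injectsE.
  rewrite /stage_collection /StC sat_and is_posetE sat_and sat_ex /allowed sat_all.
  split=> -[K1 [[th K2] K3]]; split=> //; split.
  - by exists th; move: K2 => /sat_and [/H1 ? /H2].
  - by move=> d dg; move: (K3 d) => /sat_imp /(_ dg) /strategically_closedE.
  - by exists th; apply/sat_and; rewrite H1 H2.
  - by move=> d; apply/sat_imp => dg; apply/strategically_closedE; exact: K3.
Qed.

Lemma Def_StC : Def (fun e : nat -> M => StC (e 0) (e 1) (e 2) (e 3) (e 4)).
Proof.
  have D1 : Def (fun e : nat -> M => SC (e 0) (e 1) (e 2)) by rewrite /SC /turns /limO /func /playP /into /isfun /ord /trans; def.
  have D2 : Def (fun e : nat -> M => poset (e 0) (e 1)) by rewrite /poset; def.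
  have D3 : Def (fun e : nat -> M => injs (e 0) (e 1)) by rewrite /injs /into /isfun /inj; def.
  have D4 : Def (fun e : nat -> M => card (e 0)) by rewrite /card /ord /trans; def.
  have D5 : Def (fun e : nat -> M => succcard (e 0) (e 1)) by rewrite /succcard /ssub; def.
  have D6 : Def (fun e : nat -> M => inH (e 0) (e 1)) by rewrite /inH /trans /ssub; def.
  by rewrite /StC; def.
Qed.

Lemma lottery_sumE (C : M -> M -> M -> fml M) (Col : M -> M -> M -> Prop) S R : (forall q A r, satM (C q A r) <-> Col q A r) ->
  satM (lottery_sum C S R) ->
  (forall z, z ε S <-> z = empty \/ exists q A r p, Col q A r /\ p ε A /\ z = pair q p) /\
  (forall w, w ε R <-> exists x y, x ε S /\ y ε S /\ w = pair x y /\
    (y = empty \/ exists q A r p p', Col q A r /\ x = pair q p /\ y = pair q p' /\ pair p p' ε r)).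
Proof.
  move=> HC /sat_and [H1 H2]; split=> z.
    move: H1 => /sat_all /(_ z) /sat_iff K0; have K1 : z ε S <-> _ := K0; rewrite K1 sat_or is_emptyE; split=> -[->|K]; [by left|right|by left|right].
      move: K => /sat_ex [q /sat_ex [A /sat_ex [r /sat_and [/HC K2 /sat_ex [p /sat_and [pA /is_pairE ->]]]]]]; by exists q, A, r, p.
    case: K => q [A [r [p [K2 [pA ->]]]]]; apply/sat_ex; exists q; apply/sat_ex; exists A; apply/sat_ex; exists r.
    by apply/sat_and; split; [exact/HC|apply/sat_ex; exists p; apply/sat_and; split=> //; apply/is_pairE].
  move: H2 => /sat_all /(_ z) /sat_iff K0; have K1 : z ε R <-> _ := K0; rewrite K1; split.
    move=> /sat_ex [x /sat_and [xS /sat_ex [y /sat_and [yS /sat_and [/is_pairE -> K]]]]]; exists x, y; split=> //; split=> //; split=> //.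
    move: K => /sat_or [/is_emptyE ->|K]; [by left|right].
    move: K => /sat_ex [q /sat_ex [A /sat_ex [r /sat_ex [p /sat_ex [p' /sat_and [/HC K3 /sat_and [/is_pairE -> /sat_and [/is_pairE -> /pair_inE K2]]]]]]]].
    by exists q, A, r, p, p'.
  move=> [x [y [xS [yS [-> K]]]]]; apply/sat_ex; exists x; apply/sat_and; split=> //; apply/sat_ex; exists y; apply/sat_and; split=> //.
  apply/sat_and; split; first exact/is_pairE. apply/sat_or; case: K => [->|[q [A [r [p [p' [K3 [-> [-> K2]]]]]]]]]; [by left; apply/is_emptyE|right].
  do 5 (apply/sat_ex; eexists); apply/sat_and; split; first by apply/HC; exact: K3.
  by apply/sat_and; split; [exact/is_pairE|apply/sat_and; split; [exact/is_pairE|exact/pair_inE]].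
Qed.

Transparent pair.
Lemma in_pair x y w : w ε pair x y <-> w = sing x \/ w = upair x y.
Proof. exact: in_upair. Qed.
Opaque pair.

Definition A0 : M := sing empty.
Definition r0 : M := sing (pair empty empty).

Lemma chain_ne x y z : x ε y -> y ε tcl z -> x <> z.
Proof. by move=> xy yz E1; subst z; case: (tcl_nin xy yz). Qed.
Lemma tcl_step x y z : x ε y -> y ε tcl z -> x ε tcl z.
Proof. by move=> xy yz; exact: (tcl_trans yz). Qed.
Lemma chain5 x0 x1 x2 x3 x4 : x0 ε x1 -> x1 ε x2 -> x2 ε x3 -> x3 ε x4 ->
  (x0 <> x1 /\ x0 <> x2 /\ x0 <> x3 /\ x0 <> x4) /\ (x1 <> x2 /\ x1 <> x3 /\ x1 <> x4) /\ (x2 <> x3 /\ x2 <> x4) /\ x3 <> x4.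
Proof.
  move=> H0 H1 H2 H3; have S x := @tcl_self _ x.
  repeat split; eapply chain_ne; try eassumption; repeat (first [exact: S | eapply tcl_step; first eassumption]).
Qed.

(** Since [l] may be very small, the one-point poset has to be measured against a given poset with a
    condition [p]. Its transitive closure has five members, which form an ∈-chain and are matched
    with the ∈-chain from [p] through [{p}], [(p, p)] and [r] to [{A, r}]; a chain has no
    repetitions, so the matching is injective. *)
Lemma one_point_H q A r p th : poset A r -> p ε A -> q = pair A r -> inH q th -> inH (pair A0 r0) th.
Proof.
  move=> Pr pA Eq [t [Tt [qt [a [ath it]]]]].
  pose n1 : M := sing (sing empty); pose v0 : M := upair A0 r0.
  have C0 : (empty : M) ε A0 by apply/in_sing.
  have C1 : A0 ε n1 by apply/in_sing.
  have C2 : n1 ε r0 by apply/in_sing.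
  have pn : n1 = pair empty empty by [].
  have C3 : r0 ε v0 by apply/in_upair; right.
  have pp : pair p p ε r by case: Pr => _ [K _]; exact: K.
  have D0 : p ε sing p by apply/in_sing. have D1 : sing p ε pair p p by exact: sing_in_pair.
  have D3 : r ε upair A r by apply/in_upair; right.
  have vt : upair A r ε t by apply: qt; rewrite Eq; apply/in_pair; right.
  have rt : r ε t := Tt _ vt _ D3. have ppt : pair p p ε t := Tt _ rt _ pp. have spt : sing p ε t := Tt _ ppt _ D1. have pt : p ε t := Tt _ spt _ D0.
  pose P x y := (x = empty /\ y = p) \/ (x = A0 /\ y = sing p) \/ (x = n1 /\ y = pair p p) \/ (x = r0 /\ y = r) \/ (x = v0 /\ y = upair A r).
  pose F x := iota (P x); have DF : DTerm (fun e => F (e 0)) by rewrite /F /P; def.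
  pose T0 := cup (cup (upair empty A0) (upair n1 r0)) (sing v0).
  have inT0 x : x ε T0 <-> x = empty \/ x = A0 \/ x = n1 \/ x = r0 \/ x = v0.
    rewrite !in_cup !in_upair; clear; tauto.
  have inT x : x ε T0 -> exists y, P x y /\ y ε t.
    move=> /inT0 [->|[->|[->|[->|->]]]].
    - by exists p; split; [left|].
    - by exists (sing p); split; [right; left|].
    - by exists (pair p p); split; [right; right; left|].
    - by exists r; split; [right; right; right; left|].
    - by exists (upair A r); split; [right; right; right; right|].
  have [N1 N2] : (forall x y y', P x y -> P x y' -> y = y') /\ (forall x x' y, P x y -> P x' y -> x = x').
    have [[? [? [? ?]]] [[? [? ?]] [[? ?] ?]]] := chain5 C0 C1 C2 C3.
    have [[? [? [? ?]]] [[? [? ?]] [[? ?] ?]]] := chain5 D0 D1 pp D3.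
    split; [move=> x y y'|move=> x x' y]; (move=> [[E1 E2]|[[E1 E2]|[[E1 E2]|[[E1 E2]|[E1 E2]]]]] [[E3 E4]|[[E3 E4]|[[E3 E4]|[[E3 E4]|[E3 E4]]]]]; congruence).
  have FE x y : P x y -> F x = y by move=> K; apply: iota_eq => // y' K'; exact: N1 K' K.
  exists T0; split; last split; last (exists a; split=> //; apply: injs_trans it; apply: (injs_lam DF)).
  - move=> x /inT0 [E1|[E1|[E1|[E1|E1]]]] y yx; apply/inT0; rewrite E1 in yx.
    + by case: (in_empty yx).
    + by move: yx => /in_sing ->; left.
    + by move: yx => /in_sing ->; right; left.
    + by move: yx => /in_sing ->; rewrite -pn; right; right; left.
    + by move: yx => /in_upair [->|->]; [right; left|right; right; right; left].
  - by move=> x /in_pair [->|->]; apply/inT0; [right; right; left|right; right; right; right].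
  - by move=> x /inT [y [K yt]]; rewrite (FE _ _ K).
  - by move=> x x' /inT [y [K _]] /inT [y' [K' _]]; rewrite (FE _ _ K) (FE _ _ K') => E1; subst y'; exact: N2 K K'.
Qed.

Lemma one_point_SC A r d : SC A r d -> SC A0 r0 d.
Proof.
  move=> [E [_ [Tu _]]]; have D : DTerm (fun _ : nat -> M => (empty : M)) by def.
  pose sg := lam (pow (prod (union d) A0)) (fun _ => empty).
  have insg s y : pair s y ε sg <-> s ε pow (prod (union d) A0) /\ y = empty by exact: (pair_lam _ _ _ D).
  exists E, sg; split=> //; split; first by move=> x y y' /insg [_ ->] /insg [_ ->].
  move=> a ad aE s [[fs sA] _]; exists empty; split; first by apply/in_sing. split.
    apply/insg; split=> //; apply/in_pow => z zs; case: (fs) => [K _]; case: (K z zs) => x [y [xa Ez]]; rewrite Ez in zs *.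
    apply/pair_prod; split; first by rewrite in_union; exists a. by rewrite -(app_eq fs zs); exact: sA.
  by move=> b ba; move: (sA b ba) => /in_sing ->; apply/in_sing.
Qed.

Lemma one_point g l q A r p : StC g l q A r -> p ε A -> StC g l (pair A0 r0) A0 r0.
Proof.
  move=> [[Eq Pr] [[th [H1 H2]] H3]] pA; split; [split=> //|split].
  - split; last split; last split.
    + by move=> z /in_sing ->; exists empty, empty; split; [apply/in_sing|split=> //; apply/in_sing].
    + by move=> x /in_sing ->; apply/in_sing.
    + by move=> x y z /in_sing /pair_inj [-> ->] /in_sing /pair_inj [_ ->]; apply/in_sing.
    + by move=> x y /in_sing /pair_inj [-> ->].
  - by exists th; split=> //; exact: one_point_H pA Eq H2.
  - by move=> d /H3; exact: one_point_SC.
Qed.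

(** A set of size less than the successor cardinal of [l] injects into [l], because no cardinal lies
    strictly between. *)
Lemma in_H_injs g l q A r : StC g l q A r -> exists t, trans t /\ q ⊆ t /\ injs t l.
Proof.
  move=> [_ [[th [[cth [lth mth]] [t [Tt [qt [a [ath ita]]]]]]] _]]; exists t; split=> //; split=> //; apply: injs_trans ita _.
  have oth : ord th by case: cth. have oa := ord_in oth ath; have ol := ord_in oth lth.
  case: (@ord_least _ (fun m => injs a m)) => [||m [om [am mm]]]; first by rewrite /injs /into /isfun /inj; def.
    by exists a; split=> //; exact: injs_refl.
  have cm : card m by split=> // b bm K; case: (mm b bm); exact: injs_trans am K.
  case: (classic (l ε m)) => lm; last by apply: injs_trans am _; apply: injs_sub; exact: ord_nin.
  by case: (mm a); [exact: (mth m cm lm)|exact: injs_refl].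
Qed.

(** * The size of a lottery sum *)

Section Codes.
Variables (Col : M -> M -> M -> Prop) (S l : M).
Hypothesis HS : forall z, z ε S <-> z = empty \/ exists q A r p, Col q A r /\ p ε A /\ z = pair q p.
Hypothesis HC : forall q A r, Col q A r -> q = pair A r /\ exists t, trans t /\ q ⊆ t /\ injs t l.
Variables (L T : M).
Hypothesis lL : l ε L.
Hypothesis sL : l ⊆ L.
Hypothesis s2L : suc l ε L.
Hypothesis LT : forall x y, x ε L -> y ε L -> pair x y ε T.

(* The membership relation of a transitive set [t], transported to [l], with three extra pairs marking [A], [r] and [p]. *)
Definition code t j A r p u v : Prop := (exists y z, y ε z /\ z ε t /\ u = app j y /\ v = app j z) \/
  (u = app j A /\ v = l) \/ (u = app j r /\ v = suc l) \/ (u = l /\ v = app j p).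
Definition coded x c : Prop := (x = empty /\ c = empty) \/ exists t j A r p, x = pair (pair A r) p /\ trans t /\
  (A ε t /\ r ε t /\ p ε t) /\ into j t l /\ inj j t /\ c ⊆ T /\ forall u v, pair u v ε c <-> code t j A r p u v.

Lemma suc_l : suc l <> l /\ ~ suc l ε l.
Proof. by split=> [K|K]; [move: (suc_self l); rewrite K => /mem_irr|case: (mem_asym K (suc_self l))]. Qed.

(** As in the uniqueness of the Mostowski collapse, ∈-induction shows that elements of [t] and [t']
    with the same position in [l] are equal. The marked pairs cannot be confused with the others, as
    [l] and [suc l] are not values of the injections. *)
Lemma code_inj t j A r p c t' j' A' r' p' : trans t -> (A ε t /\ r ε t /\ p ε t) -> into j t l -> inj j t -> trans t' -> (A' ε t' /\ r' ε t' /\ p' ε t') -> into j' t' l -> inj j' t' ->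
  (forall u v, pair u v ε c <-> code t j A r p u v) -> (forall u v, pair u v ε c <-> code t' j' A' r' p' u v) -> A = A' /\ r = r' /\ p = p'.
Proof.
  move=> Tt [At [rt pt]] [_ jl] ji Tt' [At' [rt' pt']] [_ jl'] ji' H H'; have [s1 s2] := suc_l; have nl := @mem_irr _ l.
  have l1 y : y ε t -> app j y <> l by move=> yt E1; apply: nl; rewrite -{1}E1; exact: jl.
  have l1' y : y ε t' -> app j' y <> l by move=> yt E1; apply: nl; rewrite -{1}E1; exact: jl'.
  have l2 y : y ε t -> app j y <> suc l by move=> yt E1; apply: s2; rewrite -E1; exact: jl.
  have l2' y : y ε t' -> app j' y <> suc l by move=> yt E1; apply: s2; rewrite -E1; exact: jl'.
  have key : forall y, y ε t -> forall y', y' ε t' -> app j y = app j' y' -> y = y'.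
    apply: (@ind _ (fun y => y ε t -> forall y', y' ε t' -> app j y = app j' y' -> y = y')) => [|y IH yt y' yt' E1]; first def.
    apply: sext => z; split=> [zy|zy'].
      have zt : z ε t := Tt _ yt _ zy.
      have : pair (app j z) (app j y) ε c by apply/H; left; exists z, y.
      move=> /H' [[z' [w' [zw [wt' [E2 E3]]]]]|[[_ E2]|[[_ E2]|[E2 _]]]]; [|by case: (l1 y yt)|by case: (l2 y yt)|by case: (l1 z zt)].
      have ? : w' = y' by apply: ji' => //; rewrite -E3. subst w'.
      by rewrite (IH z zy zt z' (Tt' _ yt' _ zw) E2).
    have zt' : z ε t' := Tt' _ yt' _ zy'.
    have : pair (app j' z) (app j' y') ε c by apply/H'; left; exists z, y'.
    move=> /H [[z1 [w [zw [wt [E2 E3]]]]]|[[_ E2]|[[_ E2]|[E2 _]]]]; [|by case: (l1' y' yt')|by case: (l2' y' yt')|by case: (l1' z zt')].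
    have ? : w = y by apply: ji => //; rewrite -E3. subst w.
    by rewrite -(IH z1 zw (Tt _ yt _ zw) z zt' (eq_sym E2)).
  split; last split.
  - have : pair (app j A) l ε c by apply/H; right; left.
    move=> /H' [[z' [w' [zw [wt' [E2 E3]]]]]|[[E2 _]|[[_ E2]|[E2 _]]]]; [by case: (l1' w' wt')|exact: key|by case: s1|by case: (l1 A At)].
  - have : pair (app j r) (suc l) ε c by apply/H; right; right; left.
    move=> /H' [[z' [w' [zw [wt' [E2 E3]]]]]|[[_ E2]|[[E2 _]|[E2 _]]]]; [by case: (l2' w' wt')|by case: s1|exact: key|by case: (l1 r rt)].
  - have : pair l (app j p) ε c by apply/H; right; right; right.
    move=> /H' [[z' [w' [zw [wt' [E2 E3]]]]]|[[E2 _]|[[E2 _]|[_ E2]]]]; [by case: (l1' z' (Tt' _ wt' _ zw))|by case: (l1' A' At')|by case: (l1' r' rt')|exact: key].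
Qed.

Lemma coded_inj x x' c : coded x c -> coded x' c -> x = x'.
Proof.
  have ne t j A r p : (forall u v, pair u v ε c <-> code t j A r p u v) -> c <> empty.
    by move=> H E1; case: (@in_empty _ (pair (app j A) l)); rewrite -E1; apply/H; right; left.
  move=> [[-> Ec]|[t [j [A [r [p [-> [Tt [Ht [Hj [Ij [_ H]]]]]]]]]]]] [[-> Ec']|[t' [j' [A' [r' [p' [-> [Tt' [Ht' [Hj' [Ij' [_ H']]]]]]]]]]]] //.
  - by case: (ne _ _ _ _ _ H').
  - by case: (ne _ _ _ _ _ H).
  - by case: (code_inj Tt Ht Hj Ij Tt' Ht' Hj' Ij' H H') => -> [-> ->].
Qed.

Lemma coded_ex x : x ε S -> exists c, coded x c /\ c ⊆ T.
Proof.
  move=> /HS [->|[q [A [r [p [C1 [pA ->]]]]]]]; first by exists empty; split; [left|move=> z /in_empty].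
  case: (HC C1) => -> [t [Tt [qt [j [[fj jl] ij]]]]].
  have At : A ε t.
    by apply: (Tt (sing A)); [apply: qt; apply/in_pair; left|apply/in_sing].
  have rt : r ε t.
    by apply: (Tt (upair A r)); [apply: qt; apply/in_pair; right|apply/in_upair; right].
  have pt : p ε t by exact: Tt At _ pA.
  pose c := sep T (fun z => exists u v, z = pair u v /\ code t j A r p u v).
  have inc z : z ε c <-> z ε T /\ exists u v, z = pair u v /\ code t j A r p u v by apply: in_sep; rewrite /code; def.
  have cT : c ⊆ T by move=> z /inc [].
  exists c; split=> //; right; exists t, j, A, r, p; split=> //; split=> //; split=> //; split=> //; split=> //; split=> // u v.
  split=> [/inc [_ [u' [v' [/pair_inj [-> ->]]]]] //|K]; apply/inc; split; last by exists u, v.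
  have jL y : y ε t -> app j y ε L by move=> yt; apply: sL; exact: jl.
  move: K => [[y [z [yz [zt [-> ->]]]]]|[[-> ->]|[[-> ->]|[-> ->]]]]; apply: LT => //; try exact: jL.
  by apply: jL; exact: Tt zt _ yz.
Qed.

Lemma lottery_injs : injs S (pow T).
Proof.
  have DC : Def (fun e : nat -> M => coded (e 0) (e 1)) by rewrite /coded /code /trans /into /isfun /inj /ssub; def.
  case: (@choice_map _ (fun x c => coded x c /\ c ⊆ T) S) => [||g [fg Hg]]; first by rewrite /ssub; def.
    exact: coded_ex.
  exists g; split; [split=> // x xS; apply/in_pow; by case: (Hg x xS)|move=> x x' xS xS' E1].
  by case: (Hg x xS) (Hg x' xS') => K _ [K' _]; rewrite E1 in K; exact: coded_inj K K'.
Qed.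
End Codes.

(** Covers active and trivial stages together; the empty collection satisfies the hypotheses
    vacuously. *)
Lemma stage_ok_gen (Col : M -> M -> M -> Prop) g l S R : Def (fun e => Col (e 0) (e 1) (e 2)) -> ord g ->
  (forall q A r, Col q A r -> StC g l q A r) ->
  (forall q A r p, Col q A r -> p ε A -> Col (pair A0 r0) A0 r0) ->
  (forall z, z ε S <-> z = empty \/ exists q A r p, Col q A r /\ p ε A /\ z = pair q p) ->
  (forall w, w ε R <-> exists x y, x ε S /\ y ε S /\ w = pair x y /\
    (y = empty \/ exists q A r p p', Col q A r /\ x = pair q p /\ y = pair q p' /\ pair p p' ε r)) ->
  satM (stage_ok g l S R).
Proof.
  move=> DC og HC Hone HS HR.
  have HP q A r : Col q A r -> q = pair A r /\ poset A r by move=> /HC [].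
  apply/sat_and; split; last (apply/sat_and; split).
  - apply/sat_and; split; last (apply/sat_and; split); last (apply/sat_and; split); last (apply/sat_and; split).
    + by apply/sat_all => x; apply/sat_imp => xS; apply/pair_inE; exact: (lot_refl HP HS HR).
    + apply/sat_all => x; apply/sat_all => y; apply/sat_all => z; apply/sat_imp => /pair_inE K1; apply/sat_imp => /pair_inE K2; apply/pair_inE.
      exact: (lot_trans HP HS HR K1 K2).
    + by apply/sat_all => x; apply/sat_all => y; apply/sat_imp => /pair_inE /(lot_R HR) [K1 [K2 _]]; apply/sat_and.
    + apply/sat_all => x; apply/sat_imp => /is_emptyE ->; apply/sat_and; split; first exact: (lot_top HS).
      by apply/sat_all => y; apply/sat_imp => yS; apply/pair_inE; exact: (lot_le_top HS HR).
    + apply/sat_ex; case: (classic (exists q A r p, Col q A r /\ p ε A)) => [[q [A [r [p [C1 pA]]]]]|N].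
        have C0 := Hone _ _ _ _ C1 pA; have mS : pair (pair A0 r0) empty ε S by apply/HS; right; exists (pair A0 r0), A0, r0, empty; split=> //; split=> //; apply/in_sing.
        exists (pair (pair A0 r0) empty); apply/sat_and; split=> //; apply/sat_all => x; apply/sat_imp => xS; apply/sat_imp => /pair_inE.
        move=> /(lot_inv HP HR C0) [p' [-> K]]; have [K1 _] := poset_l (proj2 (HP _ _ _ C0)) K; move: K1 => /in_sing ->.
        by apply/pair_inE; exact: (lot_refl HP HS HR).
      exists empty; apply/sat_and; split; first exact: (lot_top HS).
      apply/sat_all => x; apply/sat_imp => /HS [->|[q [A [r [p [C1 [pA _]]]]]]]; last by case: N; exists q, A, r, p.
      by apply/sat_imp.
  - apply/sat_all => e; apply/sat_all => d; apply/sat_imp => /limitE le; apply/sat_imp => /is_succE Ed; apply/sat_imp => dg.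
    rewrite Ed in dg *; case: (@lot_strategy _ Col DC HP S R HS HR e le) => [q A r /HC [_ [_ K]]|h Hh]; first exact: K.
    apply/sat_ex; exists h; apply/sat_all => a; apply/sat_imp => ad; apply/sat_all => s; apply/sat_imp => /function_onE fs.
    case: (Hh a ad s fs) => x [xS [K1 K2]]; apply/sat_ex; exists x; apply/sat_and; split=> //; apply/sat_and; split.
      apply/sat_imp => H; apply/is_emptyE; apply: K1 => c ca; move: H => /sat_all /(_ c) /sat_imp /(_ ca) /sat_ex [y /sat_and [/pair_inE cy /is_emptyE Ey]].
      by rewrite (app_eq fs cy).
    apply/sat_imp => H; case: K2 => [c ca|K2 K3].
      move: H => /sat_all /(_ c) /sat_imp /(_ ca) /sat_ex [y /sat_ex [t /sat_ex [u /sat_and [/pair_inE cy /sat_and [/is_restrictionE -> /sat_and [/pair_inE H1 /pair_inE H2]]]]]].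
      by exists u; split=> //; rewrite (app_eq fs cy).
    apply/sat_and; split; first exact/pair_inE.
    by apply/sat_all => c; apply/sat_imp => ca; apply/sat_all => y; apply/sat_imp => /pair_inE cy; apply/pair_inE; rewrite -(app_eq fs cy); exact: K3.
  - apply/sat_all => L; apply/sat_all => T; apply/sat_imp => /sat_and [lL /sat_and [sL /sat_and [/sat_ex [m /sat_and [mL /is_succE Em]] H]]].
    apply/sat_ex; exists (pow T); apply/sat_and; split; first exact/is_powerE.
    apply/injectsE; apply: (@lottery_injs Col S l HS _ L T) => //.
    + by move=> q A r C1; split; [case: (HP _ _ _ C1)|exact: (in_H_injs (HC _ _ _ C1))].
    + by rewrite -Em.
    + by move=> x y xL yL; move: H => /sat_all /(_ x) /sat_imp /(_ xL) /sat_all /(_ y) /sat_imp /(_ yL) /sat_ex [z /sat_and [zT /is_pairE <-]].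
Qed.

Lemma stage_ok_active g l S R : satM (ordinal g) -> satM (lottery_sum (stage_collection g l) S R) -> satM (stage_ok g l S R).
Proof.
  move=> /ordinalE og /(lottery_sumE (@stage_collectionE g l)) [HS HR]; apply: (@stage_ok_gen (StC g l)) => //.
    have H := Def_StC; apply: (Def_subst (R := fun e x => StC g x (e 0) (e 1) (e 2)) (t := fun _ => l)); first exact: DTerm_const.
    apply: (Def_subst (R := fun e x => StC x (e 0) (e 1) (e 2) (e 3)) (t := fun _ => g)); first exact: DTerm_const.
    exact: H.
  by move=> q A r p; exact: one_point.
Qed.
Lemma stage_ok_trivial g l S R : satM (ordinal g) -> satM (lottery_sum (fun _ _ _ => Bot) S R) -> satM (stage_ok g l S R).
Proof.
  move=> /ordinalE og H; have [|HS HR] := @lottery_sumE (fun _ _ _ => Bot) (fun _ _ _ => False) S R _ H; first by move=> q A r.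
  by apply: (@stage_ok_gen (fun _ _ _ => False)) => //; exact: Def_bot.
Qed.
End StageFacts.

(** * The iteration *)

(** The preparation in terms of definable class functions and semantic notions. [it_stage]
    presupposes that [P_g] is a preorder because the transfer theorem does; the preorder property is
    obtained later, by induction, from the facts about earlier stages. *)
Record iter_ok (V : zfc_model) (k : V) (C O N S R : V -> V) : Prop := IterOk {
  it_DC : DTerm (fun e => C (e 0)); it_DO : DTerm (fun e => O (e 0)); it_DN : DTerm (fun e => N (e 0));
  it_DS : DTerm (fun e => S (e 0)); it_DR : DTerm (fun e => R (e 0));
  it_stage : forall g, g ε k -> preorder (C g) (O g) -> exists l, l ε k /\ forall p, p ε C g ->
    forces (C g) (O g) p (stage_ok (chk (C g) g) (chk (C g) l) (S g) (R g));
  it_names : forall g s p, g ε k -> s ε N g -> p ε C g -> forces (C g) (O g) p (s ∈ S g);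
  it_full : forall g t, g ε k -> (forall p, p ε C g -> forces (C g) (O g) p (t ∈ S g)) ->
    exists s, s ε N g /\ forall p, p ε C g -> forces_eq (C g) (O g) p s t;
  it_cond : forall g p, g ε suc k -> (p ε C g <-> isfun p g /\
    (forall b, b ε g -> restr p b ε C b /\ app p b ε N b) /\
    (inacc g -> exists a, a ε g /\ forall b, b ε g -> ~ b ε a -> forall q, q ε C b -> forces (C b) (O b) q (is_empty (app p b))));
  it_order : forall g p q, g ε suc k -> p ε C g -> q ε C g -> (pair p q ε O g <->
    forall b, b ε g -> forces (C b) (O b) (restr p b) (pair_in (app p b) (app q b) (R b)))
}.

Section Setup.
Variables (V : zfc_model) (k f : V) (P : iteration V).
Hypothesis ok : ord k.
Hypothesis pf : partial_function f k.
Hypothesis LP : lottery_preparation k f P.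

(** Internality covers the arguments below [k]; the value at [k] is added as a parameter, so that
    [P_k] itself is treated uniformly with the earlier [P_g]. *)
Lemma internal_term (h : V -> V) : internal k h -> exists F : V -> V, DTerm (fun e => F (e 0)) /\ forall x, x ε suc k -> F x = h x.
Proof.
  move=> [s Hs]; exists (fun x => iota (fun y => (x = k /\ y = h k) \/ (x <> k /\ y = app s x))); split; first def.
  move=> x xk; apply: iota_eq.
    case: (classic (x = k)) => [->|N]; [by left|right; split=> //].
    move: xk => /in_suc [xk|//]; rewrite (_ : app s x = h x) //; apply: iota_eq; first by apply/pair_inE; apply/(Hs x xk).
    by move=> y /pair_inE /(Hs x xk).
  move=> y [[-> ->] //|[N ->]]; move: xk => /in_suc [xk|//]; apply: iota_eq; first by apply/pair_inE; apply/(Hs x xk).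
  by move=> y' /pair_inE /(Hs x xk).
Qed.

Lemma stage_forced (g A L S R l p : V) : preorder A L -> p ε A -> forces A L p (lottery_sum (stage_collection (chk A g) l) S R) -> ord g ->
  forces A L p (stage_ok (chk A g) l S R).
Proof.
  move=> PO pA H og; pose Phi : fml nat := And (ordinal 0) (lottery_sum (stage_collection 0 1) 2 3).
  have HW (W : zf) (e : nat -> W) : sat (@E W) eq (emb (deep 4 0 Phi) e) -> sat (@E W) eq (emb (deep 4 0 (stage_ok 0 1 2 3)) e).
    move=> /sat_and [H1 H2]; exact: (@stage_ok_active W (e 0) (e 1) (e 2) (e 3) H1 H2).
  apply: (@transfer (deep 4 0 Phi) (deep 4 0 (stage_ok 0 1 2 3)) HW V A L PO p (lenv g (cons (chk A g) (cons l (cons S (cons R nil))))) pA).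
  apply/forces_and; split; last exact: H.
  have [K _] := @bdd_abs V A L PO (deep 1 0 (ordinal 0)) ltac:(by []) (fun _ => g).
  exact: (K (proj2 (ordinalE g) og) p pA).
Qed.
Lemma stage_forced0 (g A L S R l p : V) : preorder A L -> p ε A -> forces A L p (lottery_sum (fun _ _ _ => Bot) S R) -> ord g ->
  forces A L p (stage_ok (chk A g) l S R).
Proof.
  move=> PO pA H og; pose Phi : fml nat := And (ordinal 0) (lottery_sum (fun _ _ _ => Bot) 2 3).
  have HW (W : zf) (e : nat -> W) : sat (@E W) eq (emb (deep 4 0 Phi) e) -> sat (@E W) eq (emb (deep 4 0 (stage_ok 0 1 2 3)) e).
    move=> /sat_and [H1 H2]; exact: (@stage_ok_trivial W (e 0) (e 1) (e 2) (e 3) H1 H2).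
  apply: (@transfer (deep 4 0 Phi) (deep 4 0 (stage_ok 0 1 2 3)) HW V A L PO p (lenv g (cons (chk A g) (cons l (cons S (cons R nil))))) pA).
  apply/forces_and; split; last exact: H.
  have [K _] := @bdd_abs V A L PO (deep 1 0 (ordinal 0)) ltac:(by []) (fun _ => g).
  exact: (K (proj2 (ordinalE g) og) p pA).
Qed.

Lemma iter_of : exists C O N S R, iter_ok k C O N S R /\ C k = cond P k /\ O k = order P k.
Proof.
  case: LP => -[/internal_term [C [DC HC]] [/internal_term [O [DO HO]] [/internal_term [N [DN HN]] [/internal_term [S [DS HS]] /internal_term [R [DR HR]]]]]].
  move=> Hact Htriv Hnames Hfull Hcond Hord; exists C, O, N, S, R; split; last by rewrite HC ?HO //; exact: suc_self.
  have kk b : b ε k -> b ε suc k by rewrite in_suc; left.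
  have gk g : g ε suc k -> (g ∊ k) \/ g = k by move=> /in_suc.
  split=> //.
  - move=> g gk' PO; have og := ord_in ok gk'; have gs := kk _ gk'; case: (classic (exists l, active f g l)) => [[l Hl]|Nl].
      exists l; split.
        case: pf Hl => K _ [/pair_inE gl _]; case: (K _ gl) => x [y [_ [yk /is_pairE /pair_inj [_ ->]]]]; exact: yk.
      move=> p pA; apply: stage_forced => //; rewrite !HC // ?HO // ?HS // ?HR //; apply: (Hact g l) => //; [exact: chk_check|exact: chk_check|by rewrite -HC].
    (* At a trivial stage the size clause holds for every [l]; [g] is a convenient element of
       [k]. *)
    exists g; split=> // p pA; apply: stage_forced0 => //; rewrite HC // HO // HS // HR //; apply: (Htriv g) => //; by rewrite -HC.
  - by move=> g s p gk' sN pC; rewrite HC // ?HO // ?HS //; auto; apply: (Hnames g s) => //; [rewrite -HN //; auto|rewrite -HC //; auto].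
  - move=> g t gk' H; have gs := kk _ gk'; case: (Hfull g t gk') => [p pC|s [sN Hs]].
      by move: H; rewrite HC // HO // HS //; apply.
    exists s; rewrite HN //; split=> // p; rewrite HC // HO // => pC; exact/forces_eqE/Hs.
  - move=> g p gs; have Hc := Hcond g p (gk _ gs).
    have bs b : b ε g -> b ε suc k by move=> bg; exact: ord_trans (ord_suc ok) gs bg.
    rewrite HC //; split=> [/Hc [/function_onE fp [H1 H2]]|[fp [H1 H2]]]; last apply/Hc; (split; first by [] || exact/function_onE); split.
    + move=> b bg; case: (H1 b bg) => -[t [/is_restrictionE -> tC]] [s [/pair_inE sp sN]].
      by rewrite HC ?HN; auto; rewrite (app_eq fp sp).
    + move=> /inaccessibleE /H2 [a [ag K]]; exists a; split=> // b bg nb q; rewrite HC ?HO; auto => qC.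
      by apply: (K b (app p b)) => //; apply/pair_inE; exact: (app_in fp).
    + move=> b bg; case: (H1 b bg) => K1 K2; split; [exists (restr p b)|exists (app p b)]; (split; first by (exact/is_restrictionE) || (apply/pair_inE; exact: (app_in fp))).
        by rewrite -HC; auto. by rewrite -HN; auto.
    + move=> /inaccessibleE /H2 [a [ag K]]; exists a; split=> // b s bg nb /pair_inE sp q qC.
      by rewrite -(app_eq fp sp) -HC -?HO; auto; apply: K => //; rewrite HC; auto.
  - move=> g p q gs; rewrite HC // HO // => pC qC; have Ho := Hord g p q (gk _ gs) pC qC; rewrite -pair_inE; apply: (iff_trans Ho).
    have bs b : b ε g -> b ε suc k by move=> bg; exact: ord_trans (ord_suc ok) gs bg.
    have fp : isfun p g by move: pC => /(Hcond g p (gk _ gs)) [/function_onE].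
    have fq : isfun q g by move: qC => /(Hcond g q (gk _ gs)) [/function_onE].
    split=> H b.
      move=> bg; rewrite HC ?HO ?HR; auto; apply: (H b (restr p b) (app p b) (app q b)) => //; [exact/is_restrictionE|apply/pair_inE; exact: (app_in fp)|apply/pair_inE; exact: (app_in fq)].
    move=> t s u bg /is_restrictionE -> /pair_inE sp /pair_inE uq; rewrite -(app_eq fp sp) -(app_eq fq uq).
    by move: (H b bg); rewrite HC ?HO ?HR; auto.
Qed.
End Setup.

Section ForcedCongruence.
Variables (V : zfc_model) (A L : V).
Hypothesis PO : preorder A L.

Lemma pin_subst (p s u r s' u' : V) : forces_eq A L p s s' -> forces_eq A L p u u' ->
  forces A L p (pair_in s u r) -> forces A L p (pair_in s' u' r).
Proof.
  move=> H1 H2 H; apply: (@forces_subst V A L PO (deep 3 0 (pair_in 0 1 2)) (lenv p (cons s (cons u (cons r nil)))) (lenv p (cons s' (cons u' (cons r nil)))) p).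
    by case=> [|[|[|n]]] //=; exact: feq_refl.
  exact: H.
Qed.
Lemma emp_subst (p s s' : V) : forces_eq A L p s s' -> forces A L p (is_empty s) -> forces A L p (is_empty s').
Proof.
  move=> H1 H; apply: (@forces_subst V A L PO (deep 1 0 (is_empty 0)) (lenv p (cons s nil)) (lenv p (cons s' nil)) p).
    by case=> [|n] //=; exact: feq_refl.
  exact: H.
Qed.
Lemma emp_empty (p : V) : forces A L p (is_empty (empty : V)).
Proof. by apply/forces_all => z; apply/forces_neg => q qp /memE /(_ q (le_ll PO qp)) [r [t [b [_ [/in_empty]]]]]. Qed.
End ForcedCongruence.

(** * Conditions, supports and concatenation *)

Section Iter.
Variables (V : zfc_model) (k : V) (C O N S R : V -> V).
Hypothesis IT : iter_ok k C O N S R.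
Hypothesis Ik : inacc k.
Implicit Types (g b d h p q r s t x y a u : V).
Notation le g := (below (C g) (O g)).
Notation "p ⊩[ g ] a" := (forces (C g) (O g) p a%fml) (at level 100, g at level 10).

Lemma okk : ord k. Proof. by case: Ik => -[[]]. Qed.
Lemma k_suc b : b ε k -> b ε suc k. Proof. by rewrite in_suc; left. Qed.
Lemma k_sub g b : g ε suc k -> b ε g -> b ε k.
Proof. by move=> /in_suc [gk|->] // bg; exact: ord_trans okk gk bg. Qed.
Lemma ord_sk g : g ε suc k -> ord g. Proof. exact: ord_in (ord_suc okk). Qed.

Lemma DTC (t : (nat -> V) -> V) : DTerm t -> DTerm (fun e => C (t e)). Proof. exact: (DTerm_1 (it_DC IT)). Qed.
Lemma DTO (t : (nat -> V) -> V) : DTerm t -> DTerm (fun e => O (t e)). Proof. exact: (DTerm_1 (it_DO IT)). Qed.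

Definition Em b s : Prop := forall q, q ε C b -> q ⊩[b] is_empty s.
Lemma Def_Em : Def (fun e => Em (e 0) (e 1)).
Proof.
  rewrite /Em; apply: Def_all; apply: Def_imp; first by apply: Def_mem; [exact: DTerm_var|apply: DTC; exact: DTerm_var].
  apply: (@Def_forces V (deep 1 0 (is_empty 0)) (fun e => C (e 1)) (fun e => O (e 1)) (fun e => e 0) (fun e => lenv (e 0) (cons (e 2) nil))); [apply: DTC; def|apply: DTO; def|def|].
  by case=> [|n] /=; def.
Qed.

Section Stage.
Variable b : V.
Hypothesis bk : b ε k.
Hypothesis PO : preorder (C b) (O b).

Lemma st_ok p : p ε C b -> p ⊩[b] stage_order_ok (S b) (R b).
Proof. by move=> pC; case: (it_stage IT bk PO) => l [_ /(_ p pC) /forces_and []]. Qed.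
Lemma st_refl p s : p ε C b -> (p ⊩[b] s ∈ S b) -> p ⊩[b] pair_in s s (R b).
Proof.
  move=> pC Hs; move: (st_ok pC) => /forces_and [H _]; move: H => /forces_all /(_ s) /forces_imp; apply=> //; exact: le_refl.
Qed.
Lemma st_trans p s t u : p ε C b -> (p ⊩[b] pair_in s t (R b)) -> (p ⊩[b] pair_in t u (R b)) -> p ⊩[b] pair_in s u (R b).
Proof.
  move=> pC H1 H2; move: (st_ok pC) => /forces_and [_ /forces_and [H _]]; have pp := le_refl PO pC.
  by move: H => /forces_all /(_ s) /forces_all /(_ t) /forces_all /(_ u) /forces_imp /(_ p pp H1) /forces_imp /(_ p pp H2).
Qed.
Lemma st_dom p s t : p ε C b -> (p ⊩[b] pair_in s t (R b)) -> (p ⊩[b] s ∈ S b) /\ (p ⊩[b] t ∈ S b).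
Proof.
  move=> pC H1; move: (st_ok pC) => /forces_and [_ /forces_and [_ /forces_and [H _]]]; have pp := le_refl PO pC.
  by move: H => /forces_all /(_ s) /forces_all /(_ t) /forces_imp /(_ p pp H1) /forces_and.
Qed.
Lemma st_empty p s : p ε C b -> (p ⊩[b] is_empty s) -> (p ⊩[b] s ∈ S b).
Proof.
  move=> pC H1; move: (st_ok pC) => /forces_and [_ /forces_and [_ /forces_and [_ /forces_and [H _]]]]; have pp := le_refl PO pC.
  by move: H => /forces_all /(_ s) /forces_imp /(_ p pp H1) /forces_and [].
Qed.
Lemma st_top p s t : p ε C b -> (p ⊩[b] is_empty s) -> (p ⊩[b] t ∈ S b) -> p ⊩[b] pair_in t s (R b).
Proof.
  move=> pC H1 H2; move: (st_ok pC) => /forces_and [_ /forces_and [_ /forces_and [_ /forces_and [H _]]]]; have pp := le_refl PO pC.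
  by move: H => /forces_all /(_ s) /forces_imp /(_ p pp H1) /forces_and [_ /forces_all /(_ t) /forces_imp /(_ p pp H2)].
Qed.
End Stage.

Lemma cond_fun g p : g ε suc k -> p ε C g -> isfun p g.
Proof. by move=> gk /(it_cond IT _ gk) []. Qed.
Lemma cond_names g p b : g ε suc k -> p ε C g -> b ε g -> app p b ε N b.
Proof. by move=> gk /(it_cond IT _ gk) [_ [H _]] /H []. Qed.
Lemma cond_restr g p b : g ε suc k -> p ε C g -> b ε g -> restr p b ε C b.
Proof. by move=> gk /(it_cond IT _ gk) [_ [H _]] /H []. Qed.
Lemma leE g p q : g ε suc k -> (le g p q <-> p ε C g /\ q ε C g /\
  forall b, b ε g -> restr p b ⊩[b] pair_in (app p b) (app q b) (R b)).
Proof.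
  move=> gk; rewrite belowE; split=> -[pC [qC H]]; (split=> //; split=> //); exact/(it_order IT gk pC qC).
Qed.
Lemma le_restr g p q b : g ε suc k -> le g p q -> b ε g -> le b (restr p b) (restr q b).
Proof.
  move=> gk /(leE _ _ gk) [pC [qC H]] bg; have og := ord_sk gk; have bk := k_suc (k_sub gk bg).
  apply/(leE _ _ bk); split; [exact: cond_restr gk pC bg|split; first exact: cond_restr gk qC bg].
  move=> c cb; have cg := ord_trans og bg cb; have bs := ord_subs og bg; have cs := ord_subs (ord_in og bg) cb.
  rewrite (restr_restr _ cs) (app_restr (cond_fun gk pC) bs cb) (app_restr (cond_fun gk qC) bs cb); exact: H.
Qed.

Lemma it_PO g : g ε suc k -> preorder (C g) (O g).
Proof.
  elim/(well_founded_ind (zfc_wf (z := V))): g => g IH gk; have Pb b : b ε g -> preorder (C b) (O b).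
    by move=> bg; apply: IH => //; exact: k_suc (k_sub gk bg).
  split=> [p pC|p q r H1 H2].
    apply/(leE _ _ gk); split=> //; split=> // b bg; have bk := k_sub gk bg; have rC := cond_restr gk pC bg.
    by apply: (st_refl bk (Pb b bg) rC); apply: (it_names IT bk _ rC); exact: cond_names gk pC bg.
  move: (H1) (H2) => /(leE _ _ gk) [pC [qC K1]] /(leE _ _ gk) [_ [rC K2]].
  apply/(leE _ _ gk); split=> //; split=> // b bg; have bk := k_sub gk bg.
  apply: (st_trans bk (Pb b bg) (cond_restr gk pC bg) (K1 b bg)).
  exact: (forces_mono (Pb b bg) (le_restr gk H1 bg) (K2 b bg)).
Qed.
Lemma it_POk b : b ε k -> preorder (C b) (O b). Proof. by move=> /k_suc /it_PO. Qed.

Definition bsup p h : Prop := exists a, a ε h /\ forall b, b ε h -> ~ b ε a -> Em b (app p b).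

Lemma cond_flat g p : g ε suc k -> (p ε C g <-> isfun p g /\ (forall b, b ε g -> app p b ε N b) /\
  forall h, h ε suc g -> inacc h -> bsup p h).
Proof.
  elim/(well_founded_ind (zfc_wf (z := V))): g p => g IH p gk; have og := ord_sk gk; split.
    move=> pC; have fp := cond_fun gk pC; split=> //; split; first by move=> b; exact: cond_names.
    move=> h /in_suc [hg|->] Ih; last by move: pC => /(it_cond IT _ gk) [_ [_ K]]; case: (K Ih) => a [ag Ka]; exists a.
    have hk := k_suc (k_sub gk hg); move: (cond_restr gk pC hg) => /(IH h hg _ hk) [_ [_ /(_ h (suc_self h) Ih) [a [ah K]]]].
    by exists a; split=> // b bh nb; rewrite -(app_restr fp (ord_subs og hg) bh); exact: K.
  move=> [fp [H1 H2]]; apply/(it_cond IT _ gk); split=> //; split; last by move=> Ig; case: (H2 g (suc_self g) Ig) => a [ag K]; exists a.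
  move=> b bg; split; last exact: H1.
  have bs := ord_subs og bg; have bk := k_suc (k_sub gk bg); apply/(IH b bg _ bk).
  split; first exact: restr_fun fp bs. split; first by move=> c cb; rewrite (app_restr fp bs cb); apply: H1; exact: bs.
  move=> h hb Ih; have hg : h ε g by move: hb => /in_suc [/bs|->].
  case: (H2 h (proj2 (in_suc _ _) (or_introl hg)) Ih) => a [ah K]; exists a; split=> // c ch nc.
  have cb : c ε b by move: hb => /in_suc [hb|<- //]; exact: ord_trans (ord_in og bg) hb ch.
  by rewrite (app_restr fp bs cb); exact: K.
Qed.

(** The empty set itself need not be in [N b], but by fullness some name forced to be empty is; one
    of these is fixed at every coordinate. *)
Lemma top_ex : exists u, isfun u k /\ forall b, b ε k -> app u b ε N b /\ Em b (app u b).
Proof.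
  case: (@choice_map _ (fun b s => s ε N b /\ Em b s) k) => [|b bk|u [fu Hu]]; last by exists u.
    by have D := Def_Em; have D2 := it_DN IT; def.
  have PO := it_POk bk; case: (it_full IT (t := empty) bk) => [p pC|s [sN Hs]].
    by apply: (st_empty bk PO pC); exact: emp_empty.
  by exists s; split=> // q qC; apply: (emp_subst PO (feq_sym (Hs q qC))); exact: emp_empty.
Qed.

Fact cb_sig : {F : V -> V -> V -> V -> V | (forall t1 t2 t3 t4 : (nat -> V) -> V, DTerm t1 -> DTerm t2 -> DTerm t3 -> DTerm t4 -> DTerm (fun e => F (t1 e) (t2 e) (t3 e) (t4 e))) /\
  (forall q r d b, b ε d -> F q r d b = app q b) /\ (forall q r d b, ~ b ε d -> F q r d b = app r b)}.
Proof.
  exists (fun q r d b => iota (fun y => (b ε d /\ y = app q b) \/ (~ b ε d /\ y = app r b))); split; last split.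
  - move=> t1 t2 t3 t4 D1 D2 D3 D4.
    have L1 := DTerm_lift D1; have L2 := DTerm_lift D2; have L3 := DTerm_lift D3; have L4 := DTerm_lift D4.
    apply: DTerm_iota; apply: Def_or; apply: Def_and; repeat first [assumption | apply: DTerm_var | apply: D_app | apply: Def_not | apply: Def_mem | apply: Def_eq].
  - by move=> q r d b bd; apply: iota_eq => [|y [[]|[]]] //; left.
  - by move=> q r d b bd; apply: iota_eq => [|y [[]|[]]] //; right.
Qed.
Definition cb := proj1_sig cb_sig.
Lemma D_cb (t1 t2 t3 t4 : (nat -> V) -> V) : DTerm t1 -> DTerm t2 -> DTerm t3 -> DTerm t4 -> DTerm (fun e => cb (t1 e) (t2 e) (t3 e) (t4 e)).
Proof. exact: (proj1 (proj2_sig cb_sig)). Qed.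
Lemma D_cb1 q r d : DTerm (fun e => cb q r d (e 0)).
Proof. by apply: D_cb; def. Qed.
Definition cat q r d g : V := lam g (cb q r d).
Lemma D_cat (t1 t2 t3 t4 : (nat -> V) -> V) : DTerm t1 -> DTerm t2 -> DTerm t3 -> DTerm t4 -> DTerm (fun e => cat (t1 e) (t2 e) (t3 e) (t4 e)).
Proof. by move=> D1 D2 D3 D4; apply: D_lam => //; apply: D_cb; try exact: DTerm_lift; exact: DTerm_var. Qed.
Lemma cat_fun q r d g : isfun (cat q r d g) g. Proof. exact: lam_fun (D_cb1 q r d). Qed.
Lemma cat_l q r d g b : b ε g -> b ε d -> app (cat q r d g) b = app q b.
Proof. by move=> bg bd; rewrite /cat (app_lam (D_cb1 q r d) bg); exact: (proj1 (proj2 (proj2_sig cb_sig))). Qed.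
Lemma cat_r q r d g b : b ε g -> ~ b ε d -> app (cat q r d g) b = app r b.
Proof. by move=> bg bd; rewrite /cat (app_lam (D_cb1 q r d) bg); exact: (proj2 (proj2 (proj2_sig cb_sig))). Qed.

(** What concatenation requires of a tail: nothing is asked below [d], and bounded support only at
    inaccessibles above [d]. *)
Definition tl r d g : Prop := (forall b, b ε g -> ~ b ε d -> app r b ε N b) /\ (forall h, h ε suc g -> inacc h -> d ε h -> bsup r h).
Lemma tl_cond r d g : g ε suc k -> r ε C g -> tl r d g.
Proof. by move=> gk /(cond_flat _ gk) [_ [H1 H2]]; split=> [b bg _|h hg Ih _]; [exact: H1|exact: H2]. Qed.

Lemma cat_cond q r d g : g ε suc k -> d ε suc g -> q ε C d -> tl r d g -> cat q r d g ε C g.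
Proof.
  move=> gk dg qC [T1 T2]; have og := ord_sk gk; have od := ord_in (ord_suc og) dg.
  have dk : d ε suc k by move: dg => /in_suc [/(k_sub gk) /k_suc|->].
  have ds : d ⊆ g by move: dg => /in_suc [/(ord_subs og)|->].
  move: qC => /(cond_flat _ dk) [fq [Q1 Q2]]; apply/(cond_flat _ gk); split; first exact: cat_fun; split.
    by move=> b bg; case: (classic (b ε d)) => bd; [rewrite cat_l //; exact: Q1|rewrite cat_r //; exact: T1].
  move=> h hg Ih; have oh := ord_in (ord_suc og) hg; have hs : h ⊆ g by move: hg => /in_suc [/(ord_subs og)|->].
  case: (classic (d ε h)) => dh.
    case: (T2 h hg Ih dh) => a [ah K]; case: (max_in oh ah dh) => m [mh [M1 M2]]; exists m; split=> // b bh nb.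
    by rewrite cat_r //; [exact: hs|by move=> /M2|apply: K => // /M1].
  have hd : h ε suc d.
    by rewrite in_suc; case: (ord_tot oh od) => [|[|]] //; [left|right].
  case: (Q2 h hd Ih) => a [ah K]; exists a; split=> // b bh nb.
  have bd : b ε d by move: hd => /in_suc [hd|<- //]; exact: ord_trans od hd bh.
  by rewrite cat_l //; [exact: ds|exact: K].
Qed.

Lemma restr_cat_l q r d g b : isfun q d -> d ⊆ g -> b ⊆ d -> restr (cat q r d g) b = restr q b.
Proof.
  move=> fq dg bd; have bg : b ⊆ g by move=> x /bd /dg.
  apply: (@fun_ext _ _ _ b); [exact: restr_fun (cat_fun _ _ _ _) bg|exact: restr_fun fq bd|move=> x xb].
  by rewrite (app_restr (cat_fun _ _ _ _) bg xb) (app_restr fq bd xb) cat_l //; [exact: bg|exact: bd].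
Qed.
Lemma restr_cat q r d g : isfun q d -> d ⊆ g -> restr (cat q r d g) d = q.
Proof. by move=> fq dg; rewrite restr_cat_l // restr_all. Qed.

Lemma le_cat q r d g t : g ε suc k -> d ε suc g -> le d (restr t d) q -> t ε C g -> tl r d g ->
  (forall b, b ε g -> ~ b ε d -> restr t b ⊩[b] pair_in (app t b) (app r b) (R b)) -> le g t (cat q r d g).
Proof.
  move=> gk dg tq tC Tr H; have og := ord_sk gk.
  have ds : d ⊆ g by move: dg => /in_suc [/(ord_subs og)|->].
  have dk : d ε suc k by move: dg => /in_suc [/(k_sub gk) /k_suc|->].
  apply/(leE _ _ gk); split=> //; split; first by apply: cat_cond => //; exact: le_r tq.
  move=> b bg; case: (classic (b ε d)) => bd; last by rewrite cat_r //; exact: H.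
  rewrite cat_l //; move: tq => /(leE _ _ dk) [_ [_ /(_ b bd)]].
  have od := ord_sk dk; by rewrite (restr_restr _ (ord_subs od bd)) (app_restr (cond_fun gk tC) ds bd).
Qed.
Lemma cat_le q q' r d g : g ε suc k -> d ε suc g -> le d q q' -> tl r d g -> le g (cat q r d g) (cat q' r d g).
Proof.
  move=> gk dg qq Tr; have qC := le_l qq; have og := ord_sk gk.
  have ds : d ⊆ g by move: dg => /in_suc [/(ord_subs og)|->].
  have dk : d ε suc k by move: dg => /in_suc [/(k_sub gk) /k_suc|->].
  have cC := cat_cond gk dg qC Tr; apply: le_cat => //; first by rewrite restr_cat //; exact: cond_fun dk qC.
  move=> b bg nb; have bk := k_sub gk bg; have rC := cond_restr gk cC bg; rewrite cat_r //; apply: (st_refl bk (it_POk bk) rC).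
  by apply: (it_names IT bk _ rC); case: Tr => + _; apply.
Qed.
Lemma le_tail q r d g t b : g ε suc k -> d ε suc g -> le g t (cat q r d g) -> b ε g -> ~ b ε d -> restr t b ⊩[b] pair_in (app t b) (app r b) (R b).
Proof. by move=> gk dg /(leE _ _ gk) [_ [_ H]] bg nb; move: (H b bg); rewrite cat_r. Qed.
Lemma le_head q r d g t : g ε suc k -> d ε suc g -> q ε C d -> le g t (cat q r d g) -> le d (restr t d) q.
Proof.
  move=> gk dg qC tc; have og := ord_sk gk; have ds : d ⊆ g by move: dg => /in_suc [/(ord_subs og)|->].
  have dk : d ε suc k by move: dg => /in_suc [/(k_sub gk) /k_suc|->].
  have fq := cond_fun dk qC; move: (dg) => /in_suc [dg'|E1].
    by move: (le_restr gk tc dg'); rewrite restr_cat.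
  subst g; have tC := le_l tc; rewrite (restr_all (cond_fun gk tC)); by move: tc; rewrite -(restr_all (cat_fun q r d d)) restr_cat.
Qed.

Variable u : V.
Hypothesis Hu : isfun u k /\ forall b, b ε k -> app u b ε N b /\ Em b (app u b).
Lemma tl_u d g : g ε suc k -> d ε suc g -> tl u d g.
Proof.
  move=> gk dg; case: Hu => _ H; split; first by move=> b bg _; case: (H b (k_sub gk bg)).
  move=> h hg Ih dh; exists d; split=> // b bh _; have hk : h ε suc k by move: hg => /in_suc [/(k_sub gk) /k_suc|->].
  by case: (H b (k_sub hk bh)).
Qed.
Definition one g : V := restr u g.
Lemma one_cond g : g ε suc k -> one g ε C g.
Proof.
  move=> gk; case: Hu => fu H; have gs : g ⊆ k by move=> b; exact: k_sub.
  apply/(cond_flat _ gk); split; first exact: restr_fun fu gs. split; first by move=> b bg; rewrite (app_restr fu gs bg); case: (H b (gs _ bg)).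
  move=> h hg Ih; have hs : h ⊆ g by move: hg => /in_suc [/(ord_subs (ord_sk gk))|->].
  exists omega; split; first by case: Ih => -[].
  by move=> b bh _; rewrite (app_restr fu gs (hs _ bh)); case: (H b (gs _ (hs _ bh))).
Qed.
Lemma le_empty b p s t : b ε k -> p ε C b -> (p ⊩[b] t ∈ S b) -> Em b s -> p ⊩[b] pair_in t s (R b).
Proof. by move=> bk pC Ht Es; apply: (st_top bk (it_POk bk) pC) => //; exact: Es. Qed.

Definition supported p a : Prop := forall b, b ε k -> ~ b ε a -> Em b (app p b).
Lemma supp_ex p : p ε C k -> exists a, a ε k /\ supported p a.
Proof. by move=> /(cond_flat _ (suc_self k)) [_ [_ /(_ k (suc_self k) Ik) [a [ak K]]]]; exists a. Qed.
Lemma le_cat_supp p t a : a ε k -> p ε C k -> supported p a -> t ε C k -> le a (restr t a) (restr p a) -> le k t p.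
Proof.
  move=> ak pC sp tC H; have kk := suc_self k; apply/(leE _ _ kk); split=> //; split=> // b bk.
  case: (classic (b ε a)) => ba.
    have oa := ord_in okk ak; have as_ := ord_subs okk ak; move: H => /(leE _ _ (k_suc ak)) [_ [_ /(_ b ba)]].
    by rewrite (restr_restr _ (ord_subs oa ba)) (app_restr (cond_fun kk tC) as_ ba) (app_restr (cond_fun kk pC) as_ ba).
  apply: le_empty => //; [exact: cond_restr kk tC bk| |exact: sp].
  by apply: (it_names IT bk); [exact: cond_names kk tC bk|exact: cond_restr kk tC bk].
Qed.
End Iter.

(** * Size and chain condition *)

(** An injection of [S] into the subsets of [T], phrased without the power set so that the code of a
    single element can be examined by [code_mem]. *)
Definition codes_by X (h S T : X) : fml X := function_on h S ∧ (∀ x y, pair_in x y h ⇒ subset y T) ∧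
  (∀ x x' y, pair_in x y h ⇒ pair_in x' y h ⇒ x ≈ x').
Definition code_mem X (z s h : X) : fml X := ∃ y, pair_in s y h ∧ z ∈ y.

Lemma codes_by_ex (W : zf) (S T : W) : sat (@E W) eq (∃ y, is_power y T ∧ injects S y) -> sat (@E W) eq (∃ h, codes_by h S T).
Proof.
  move=> /sat_ex [y /sat_and [/is_powerE -> /injectsE [h [[fh hT] ih]]]]; apply/sat_ex; exists h; apply/sat_and; split; first exact/function_onE.
  apply/sat_and; split.
    apply/sat_all => x; apply/sat_all => y'; apply/sat_imp => /pair_inE /(fun_in _ _ fh) [xS ->]; apply/sat_all => z; apply/sat_imp.
    by move: (hT x xS) => /in_pow; apply.
  apply/sat_all => x; apply/sat_all => x'; apply/sat_all => y'; apply/sat_imp => /pair_inE /(fun_in _ _ fh) [xS E1]; apply/sat_imp => /pair_inE /(fun_in _ _ fh) [xS' E2].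
  by apply: ih => //; rewrite -E1.
Qed.
Lemma codes_by_inj (W : zf) (h S T s s' : W) : sat (@E W) eq (codes_by h S T ∧ s ∈ S ∧ s' ∈ S ∧ ∀[z ∈ T] code_mem z s h ⇔ code_mem z s' h) -> s = s'.
Proof.
  move=> /sat_and [/sat_and [/function_onE fh /sat_and [hT ih]] /sat_and [sS /sat_and [sS' H]]].
  have cm z x : x ε S -> (sat (@E W) eq (code_mem z x h) <-> z ε app h x).
    move=> xS; rewrite /code_mem sat_ex; split=> [[y /sat_and [/pair_inE /(fun_in _ _ fh) [_ ->]]] //|zh].
    by exists (app h x); apply/sat_and; split=> //; apply/pair_inE; exact: (app_in fh).
  have sub x : x ε S -> app h x ⊆ T.
    move=> xS z zh; move: hT => /sat_all /(_ x) /sat_all /(_ (app h x)) /sat_imp; rewrite pair_inE => /(_ (app_in fh xS)) /sat_all /(_ z) /sat_imp; exact.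
  have E1 : app h s = app h s'.
    apply: sext => z; split=> zh; [have zT := sub s sS z zh|have zT := sub s' sS' z zh]; move: H => /sat_all /(_ z) /sat_imp /(_ zT) /sat_iff; rewrite !cm // => K; exact/K.
  move: ih => /sat_all /(_ s) /sat_all /(_ s') /sat_all /(_ (app h s)) /sat_imp; rewrite pair_inE => /(_ (app_in fh sS)) /sat_imp.
  by rewrite pair_inE E1 => /(_ (app_in fh sS')).
Qed.

Lemma codes_by_exW (W : zf) (e : nat -> W) : sat (@E W) eq (emb (deep 2 0 (∃ y, is_power y 1 ∧ injects 0 y)) e) ->
  sat (@E W) eq (emb (deep 2 0 (∃ h, codes_by h 0 1)) e).
Proof. exact: (@codes_by_ex W (e 0) (e 1)). Qed.
Lemma codes_by_injW (W : zf) (e : nat -> W) :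
  sat (@E W) eq (emb (deep 5 0 (codes_by 0 1 2 ∧ 3 ∈ 1 ∧ 4 ∈ 1 ∧ ∀[z ∈ 2] code_mem z 3 0 ⇔ code_mem z 4 0)) e) -> sat (@E W) eq (emb (deep 5 0 (Eq 3 4)) e).
Proof. exact: (@codes_by_inj W (e 0) (e 1) (e 2) (e 3) (e 4)). Qed.

(** * Fewer than [k] names and conditions at each stage below [k] *)

Section Size.
Variables (V : zfc_model) (k : V) (C O N S R : V -> V).
Hypothesis IT : iter_ok k C O N S R.
Hypothesis Hk : wcomp k.
Implicit Types (g b d h p q r s t x y a u : V).
Notation le g := (below (C g) (O g)).
Notation "p ⊩[ g ] a" := (forces (C g) (O g) p a%fml) (at level 100, g at level 10).
Let Ik := wc_inacc Hk.
Let ok := wc_ord Hk.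

Section Names.
Variables (b l : V).
Hypothesis bk : b ε k.
Hypothesis lk : l ε k.
Hypothesis Sok : forall p, p ε C b -> p ⊩[b] stage_ok (chk (C b) b) (chk (C b) l) (S b) (R b).
Let PO := it_POk IT Ik bk.
Let A := C b.
Let mu := suc (suc l).
Definition sqn m n : V := opn A (chk A m) (chk A n).
Definition sqX : V := union (img mu (fun m => img mu (fun n => sqn m n))).
Lemma D_sqn (t1 t2 : (nat -> V) -> V) : DTerm t1 -> DTerm t2 -> DTerm (fun e => sqn (t1 e) (t2 e)).
Proof. by move=> D1 D2; rewrite /sqn; apply: D_opn; [def|apply: D_chk => //; def|apply: D_chk => //; def]. Qed.
Lemma in_sqX x : x ε sqX <-> exists m n, m ε mu /\ n ε mu /\ x = sqn m n.
Proof.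
  have D1 : DTerm (fun e => sqn (e 0) (e 1)) by apply: D_sqn; def.
  have D2 m : DTerm (fun e => sqn m (e 0)) by apply: D_sqn; def.
  have D3 : DTerm (fun e : nat -> V => img mu (fun n => sqn (e 0) n)) by def.
  rewrite in_union; split=> [[y [/(@in_img _ mu _ D3) [m [mm ->]] /(@in_img _ mu _ (D2 m)) [n [nm ->]]]]|[m [n [mm [nm ->]]]]]; first by exists m, n.
  by exists (img mu (fun n => sqn m n)); split; [apply/(@in_img _ mu _ D3); exists m|apply/(@in_img _ mu _ (D2 m)); exists n].
Qed.
Definition sqT : V := prod sqX A.
Lemma mem_sqT p w : (p ⊩[b] w ∈ sqT) -> forall q, le b q p -> exists r m n, le b r q /\ m ε mu /\ n ε mu /\ forces_eq A (O b) r w (sqn m n).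
Proof.
  move=> /memE H q qp; case: (H q qp) => r [t [c [rq [/pair_prod [/in_sqX [m [n [mm [nm ->]]]] _] [_ K]]]]]; by exists r, m, n.
Qed.
Lemma is_pair_subst p z x y x' y' : forces_eq A (O b) p x x' -> forces_eq A (O b) p y y' -> (p ⊩[b] is_pair z x y) -> p ⊩[b] is_pair z x' y'.
Proof.
  move=> H1 H2 H; apply: (@forces_subst V A (O b) PO (deep 3 0 (is_pair 0 1 2)) (lenv p (cons z (cons x (cons y nil)))) (lenv p (cons z (cons x' (cons y' nil)))) p).
    by case=> [|[|[|n]]] //=; exact: feq_refl.
  exact: H.
Qed.
Lemma F_squares p : p ε A -> p ⊩[b] squares (chk A l) (chk A mu) sqT.
Proof.
  move=> pA; apply/forces_and; split; first by apply: chk_in => //; rewrite !in_suc; left; right.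
  apply/forces_and; split.
    apply/forces_all => z; apply/forces_imp => q qp /(mem_chk PO) H; apply/(mem_chk PO) => q' qq; case: (H q' qq) => r [y [rq [yl K]]].
    by exists r, y; split=> //; split=> //; rewrite !in_suc; left; left.
  apply/forces_and; split.
    apply/forces_ex => q qp; exists q, (chk A (suc l)); split; first exact: (le_ll PO qp).
    have qA := le_l qp; apply/forces_and; split; [apply: chk_in => //; exact: suc_self|exact: F_succ].
  apply/forces_all => x; apply/forces_imp => q qp /(mem_chk PO) Hx; apply/forces_all => y; apply/forces_imp => q' qq' /(mem_chk PO) Hy.
  apply/forces_ex => q1 qq1; case: (Hx q1 (le_trans PO qq1 qq')) => r [m [rq [mm K1]]]; case: (Hy r (le_trans PO rq qq1)) => r' [n [rr [nm K2]]].
  have rA := le_l rr; exists r', (sqn m n); split; first exact: (le_trans PO rr rq).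
  apply/forces_and; split; first by apply: (mem_intro PO (b := r')); [apply/pair_prod; split=> //; apply/in_sqX; exists m, n|exact: le_refl].
  apply: (@is_pair_subst _ _ (chk A m) (chk A n)); [apply: feq_sym; exact: (feq_mono PO rr K1)|exact: feq_sym|exact: F_opn].
Qed.
Lemma code_name : exists h, forall p, p ε A -> p ⊩[b] codes_by h (S b) sqT.
Proof.
  have [h Hh] := @F_max V A (O b) PO (deep 3 0 (codes_by 0 1 2)) (lenv b (cons (S b) (cons sqT nil))).
  exists h => p pA; apply: (Hh p pA).
  apply: (@transfer _ _ codes_by_exW V A (O b) PO p (lenv b (cons (S b) (cons sqT nil))) pA).
  have pp := le_refl PO pA.
  by move: (Sok pA) => /forces_and [_ /forces_and [_ /forces_all /(_ (chk A mu)) /forces_all /(_ sqT) /forces_imp /(_ p pp (F_squares pA))]].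
Qed.

(** An element of stage [b] is coded by a set of pairs from [suc (suc l)]. Up to forced equality a
    name [s] is therefore determined by the triples [(m, n, q)] with [q] in [Q] forcing the pair of
    [m] and [n] into the code of [s], and there are fewer than [k] sets of such triples. *)
Lemma names_small Q : small k Q -> Q ⊆ A -> (forall p, p ε A -> exists q, q ε Q /\ le b p q /\ le b q p) ->
  exists M, M ⊆ N b /\ small k M /\ forall s, s ε N b -> exists s', s' ε M /\ forall p, p ε A -> forces_eq A (O b) p s s'.
Proof.
  move=> sQ QA rQ; case: code_name => h Hh.
  pose cm z s : fml V := code_mem z s h.
  pose R4 q m n s := q ⊩[b] cm (sqn m n) s.
  have Dcm : Def (fun e : nat -> V => R4 (e 0) (e 1) (e 2) (e 3)).
    apply: (@Def_forces V (deep 3 0 (code_mem 0 1 2)) (fun _ => C b) (fun _ => O b) (fun e => e 0) (fun e => lenv (e 0) (cons (sqn (e 1) (e 2)) (cons (e 3) (cons h nil))))); [def|def|def|].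
    by case=> [|[|[|n]]] /=; try def; apply: D_sqn; def.
  pose Z := prod (prod mu mu) Q.
  pose kp s := sep Z (fun z => exists m n q, z = pair (pair m n) q /\ (q ⊩[b] cm (sqn m n) s)).
  have Dk0 : Def (fun e : nat -> V => exists m n q, e 0 = pair (pair m n) q /\ (q ⊩[b] cm (sqn m n) (e 1))).
    do 3 apply: Def_ex; apply: Def_and; [def|apply: (@Def_4 _ R4 _ _ _ _ Dcm); def].
  have Dkp : DTerm (fun e => kp (e 0)) by apply: DTerm_sep; [def|exact: Dk0].
  have inkp s z : z ε kp s <-> z ε Z /\ exists m n q, z = pair (pair m n) q /\ (q ⊩[b] cm (sqn m n) s).
    by apply: in_sep; do 3 apply: Def_ex; apply: Def_and; [def|apply: (@Def_4 _ R4 _ _ _ _ Dcm); def].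
  have inkp' s m n q : m ε mu -> n ε mu -> q ε Q -> (pair (pair m n) q ε kp s <-> (q ⊩[b] cm (sqn m n) s)).
    move=> mm nm qQ; rewrite inkp; split=> [[_ [m' [n' [q' [/pair_inj [/pair_inj [-> ->] ->] K]]]]] //|K].
    by split; [apply/pair_prod; split=> //; apply/pair_prod|exists m, n, q].
  have muk : mu ε k by do 2 apply: (wc_suc Hk).
  have sZ : small k (pow Z).
    by apply: small_pow; [exact: wc_slim|apply: small_prod => //; [exact: wc_slim|apply: small_prod => //; [exact: wc_slim|exact: small_elem|exact: small_elem]]].
  have key s s' : s ε N b -> s' ε N b -> kp s = kp s' -> forall p, p ε A -> forces_eq A (O b) p s s'.
    move=> sN sN' E1 p pA.
    apply/forces_eqE; apply: (@transfer _ _ codes_by_injW V A (O b) PO p (lenv b (cons h (cons (S b) (cons sqT (cons s (cons s' nil)))))) pA).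
    apply/forces_and; split; first exact: Hh. apply/forces_and; split; first exact: (it_names IT bk).
    apply/forces_and; split; first exact: (it_names IT bk).
    have half s1 s2 : kp s1 = kp s2 -> forall q z, q ε A -> (q ⊩[b] z ∈ sqT) -> (q ⊩[b] cm z s1) -> q ⊩[b] cm z s2.
      move=> Ek q z qA Hz H1; apply: (forces_dense PO qA) => q' qq; case: (mem_sqT Hz qq) => r [m [n [rq [mm [nm K]]]]]; exists r; split=> //.
      have rA := le_l rq; case: (rQ r rA) => q0 [q0Q [rq0 q0r]].
      have tr x w w' s0 : forces_eq A (O b) x w w' -> (x ⊩[b] cm w s0) -> x ⊩[b] cm w' s0.
        move=> Kw Kc; apply: (@forces_subst V A (O b) PO (deep 3 0 (code_mem 0 1 2)) (lenv b (cons w (cons s0 (cons h nil)))) (lenv b (cons w' (cons s0 (cons h nil)))) x); last exact: Kc.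
        by case=> [|[|[|i]]] //=; exact: feq_refl.
      apply: (tr _ (sqn m n) z s2 (feq_sym K)); apply: (forces_mono PO rq0); apply/(inkp' s2 m n q0 mm nm q0Q); rewrite -Ek; apply/(inkp' s1 m n q0 mm nm q0Q).
      by apply: (forces_mono PO q0r); apply: (tr _ _ _ _ K); apply: (forces_mono PO (le_trans PO rq qq)).
    apply/forces_all => z; apply/forces_imp => q qp Hz; apply/forces_iff => q' qq; have Hz' := forces_mono PO qq Hz.
    by split; apply: half => //; exact: le_l qq.
  case: (@choice_map _ (fun c s => (exists s', s' ε N b /\ c = kp s') -> s ε N b /\ c = kp s) (pow Z)) => [|c cZ|rep [_ Hrep]]; first def.
    by case: (classic (exists s', s' ε N b /\ c = kp s')) => [[s K]|K]; [exists s|exists c].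
  have Dr : DTerm (fun e => app rep (e 0)) by def.
  pose M0 := sep (img (pow Z) (app rep)) (fun s => s ε N b).
  have inM s : s ε M0 <-> s ε img (pow Z) (app rep) /\ s ε N b by apply: in_sep; def.
  exists M0; split; [by move=> s /inM []|split].
    by apply: small_sub (small_img Dr sZ) => s /inM [].
  have kpZ s : kp s ε pow Z by apply/in_pow => z /inkp [].
  move=> s sN; case: (Hrep (kp s) (kpZ s)) => [|sN' E1]; first by exists s.
  exists (app rep (kp s)); split; last exact: key.
  by apply/inM; split=> //; apply/(in_img _ Dr); exists (kp s).
Qed.
End Names.

Definition goodM b M : Prop := M ⊆ N b /\ small k M /\ forall s, s ε N b -> exists s', s' ε M /\ forall p, p ε C b -> forces_eq (C b) (O b) p s s'.
Definition goodQ g Q : Prop := Q ⊆ C g /\ small k Q /\ forall p, p ε C g -> exists q, q ε Q /\ le g p q /\ le g q p.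
Lemma Def_goodM : Def (fun e => goodM (e 0) (e 1)).
Proof.
  have D1 := it_DC IT; have D2 := it_DO IT; have D3 := it_DN IT.
  by rewrite /goodM /small /injs /into /isfun /inj /ssub; def.
Qed.
Lemma Def_goodQ : Def (fun e => goodQ (e 0) (e 1)).
Proof.
  have D1 := it_DC IT; have D2 := it_DO IT.
  by rewrite /goodQ /small /injs /into /isfun /inj /ssub; def.
Qed.

(** Replacing each coordinate by a representative from a small set gives an equivalent condition,
    because supports and the order respect forced equality; the sequences of representatives form a
    small set. *)
Lemma cond_small0 g : g ε k -> (forall b, b ε g -> exists M, goodM b M) -> exists Q, goodQ g Q.
Proof.
  move=> gk HM; have gs := k_suc gk; have DM := Def_goodM; case: (@choice_map _ goodM g DM HM) => Mf [fM HMf].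
  have D : DTerm (fun e => app Mf (e 0)) by def.
  pose U := union (img g (app Mf)).
  have inU b s : b ε g -> s ε app Mf b -> s ε U by move=> bg sb; rewrite in_union; exists (app Mf b); split=> //; apply/(in_img _ D); exists b.
  pose Q := sep (pow (prod g U)) (fun p => p ε C g).
  have inQ p : p ε Q <-> p ε pow (prod g U) /\ p ε C g by apply: in_sep; def.
  exists Q; split; [by move=> p /inQ []|split].
    apply: (small_sub (Y := pow (prod g U))); first by move=> p /inQ [].
    apply: small_pow; first exact: wc_slim. apply: small_prod => //; [exact: wc_slim|exact: small_elem|].
    apply: small_union => //; [exact: wc_reg|exact: wc_slim|exact: small_elem|exact: wc_ne|].
    by move=> b bg; case: (HMf b bg) => _ [].
  move=> p pC; have D1 := it_DC IT; have D2 := it_DO IT.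
  case: (@choice_map _ (fun b s => s ε app Mf b /\ forall q, q ε C b -> forces_eq (C b) (O b) q (app p b) s) g) => [|b bg|p' [fp' Hp']]; first def.
    by case: (HMf b bg) => _ [_ K]; apply: K; exact: (cond_names IT gs pC bg).
  have p'C : p' ε C g.
    move: (pC) => /(cond_flat IT Ik _ gs) [_ [_ H2]]; apply/(cond_flat IT Ik _ gs); split=> //; split.
      by move=> b bg; case: (Hp' b bg) => K _; case: (HMf b bg) => + _; apply.
    move=> h hg Ih; case: (H2 h hg Ih) => a [ah K]; exists a; split=> // b bh nb q qC.
    have bg : b ε g by move: hg => /in_suc [hg|<- //]; exact: ord_trans (ord_in ok gk) hg bh.
    apply: (emp_subst (it_POk IT Ik (k_sub Ik gs bg))); last exact: K. by case: (Hp' b bg) => _; apply.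
  have R1 x : x ε C g -> forall b, b ε g -> restr x b ⊩[b] app x b ∈ S b.
    move=> xC b bg; apply: (it_names IT (k_sub Ik gs bg)); [exact: (cond_names IT gs xC bg)|exact: (cond_restr IT gs xC bg)].
  exists p'; split; first (apply/inQ; split=> //); last split.
  - apply/in_pow => z zp; case: (fp') => [K _]; case: (K z zp) => x [y [xg Ez]]; rewrite Ez in zp *; apply/pair_prod; split=> //.
    by rewrite -(app_eq fp' zp); apply: (inU x) => //; case: (Hp' x xg).
  - apply/(leE IT _ _ gs); split=> //; split=> // b bg; have bk := k_sub Ik gs bg; have PO := it_POk IT Ik bk; have rC := cond_restr IT gs pC bg.
    apply: (pin_subst PO (feq_refl PO _ _) _ (st_refl IT bk PO rC (R1 p pC b bg))); by case: (Hp' b bg) => _; apply.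
  - apply/(leE IT _ _ gs); split=> //; split=> // b bg; have bk := k_sub Ik gs bg; have PO := it_POk IT Ik bk; have rC := cond_restr IT gs p'C bg.
    apply: (pin_subst PO (feq_refl PO _ _) _ (st_refl IT bk PO rC (R1 p' p'C b bg))); apply: feq_sym; by case: (Hp' b bg) => _; apply.
Qed.
(** Names at stage [b] are counted through the conditions of [P_b], and these through the names at
    earlier stages, all in one induction. *)
Lemma names_all b : b ε k -> exists M, goodM b M.
Proof.
  elim/(well_founded_ind (zfc_wf (z := V))): b => b IH bk; have PO := it_POk IT Ik bk.
  case: (cond_small0 bk) => [c cb|Q [Q1 [Q2 Q3]]]; first by apply: IH => //; exact: ord_trans ok bk cb.
  case: (it_stage IT bk PO) => l [lk Sok]; exact: (names_small bk lk Sok Q2 Q1 Q3).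
Qed.
Lemma cond_small g : g ε k -> exists Q, goodQ g Q.
Proof. by move=> gk; apply: cond_small0 => // b bg; apply: names_all; exact: ord_trans ok gk bg. Qed.
End Size.

Lemma cup_in (M : zf) (k a b : M) : ord k -> a ε k -> b ε k -> cup a b ε k.
Proof.
  move=> ok ak bk; case: (max_in ok ak bk) => m [mk [M1 M2]].
  have : cup a b ε m \/ cup a b = m; last by move=> [K|->] //; exact: ord_trans ok mk K.
  apply: ord_sub; [|exact: (ord_in ok mk)|by move=> z /in_cup [/M1|/M2]].
  by apply: ord_union => z /in_upair [->|->]; [exact: (ord_in ok ak)|exact: (ord_in ok bk)].
Qed.

(** * An enumeration of the conditions and the chain condition *)

Section Enumeration.
Variables (V : zfc_model) (k : V) (C O N S R : V -> V).
Hypothesis IT : iter_ok k C O N S R.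
Hypothesis Hk : wcomp k.
Variable u : V.
Hypothesis Hu : isfun u k /\ forall b, b ε k -> app u b ε N b /\ Em C O b (app u b).
Implicit Types (g b d h p q r s t x y a : V).
Notation le g := (below (C g) (O g)).
Notation supp := (supported k C O).
Notation "p ⊩[ g ] a" := (forces (C g) (O g) p a%fml) (at level 100, g at level 10).
Let Ik := wc_inacc Hk.
Let ok := wc_ord Hk.
Let kk : k ε suc k := suc_self k.

Lemma Def_supp : Def (fun e => supp (e 0) (e 1)).
Proof.
  rewrite /supported; apply: Def_all; apply: Def_imp; first def. apply: Def_imp; first def.
  by apply: (@Def_2 _ (Em C O) _ _ (Def_Em IT)); def.
Qed.
Lemma supp_cat q g : supp (cat q u g k) g.
Proof. by move=> b bk nb; rewrite cat_r //; case: Hu => _ /(_ b bk) []. Qed.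
Lemma cat_u_cond q g : g ε suc k -> q ε C g -> cat q u g k ε C k.
Proof. by move=> gk qC; apply: (cat_cond IT Ik) => //; exact: (tl_u Ik Hu kk gk). Qed.
Lemma restr_cat_u q g : g ε suc k -> q ε C g -> restr (cat q u g k) g = q.
Proof. by move=> gk qC; apply: restr_cat; [exact: (cond_fun IT gk qC)|move=> x; exact: (k_sub Ik gk)]. Qed.

(** Since every condition has support bounded in [k], representatives of the smaller [P_g], extended
    by 1, represent all of [P_k]. The function [h] bounds the support of the [x]-th condition and
    the indices needed for [P_x]. At an inaccessible [d] closed under [h], the conditions listed
    before [d] are thus, up to equivalence, those supported below [d]. *)
Lemma enum_ex : exists e h, (forall i, i ε k -> app e i ε C k) /\ (forall x, x ε k -> app h x ε k) /\
  forall d, d ε k -> inacc d -> (forall x, x ε d -> app h x ε d) ->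
    (forall i, i ε d -> exists a, a ε d /\ supp (app e i) a) /\
    (forall p a, p ε C k -> a ε d -> supp p a -> exists i, i ε d /\ le k (app e i) p /\ le k p (app e i)).
Proof.
  case: (@choice_map _ (goodQ k C O) k (Def_goodQ IT)) => [g gk|Qf [_ HQ]]; first exact: (cond_small IT Hk gk).
  have D1 : DTerm (fun e => img (app Qf (e 0)) (fun q => cat q u (e 0) k)).
    by apply: DTerm_img; [def|apply: D_cat; def].
  have D2 g : DTerm (fun e => cat (e 0) u g k) by apply: D_cat; def.
  pose U := union (img k (fun g => img (app Qf g) (fun q => cat q u g k))).
  have inU x : x ε U <-> exists g q, g ε k /\ q ε app Qf g /\ x = cat q u g k.
    rewrite in_union; split=> [[y [/(@in_img _ k _ D1) [g [gk ->]] /(@in_img _ _ _ (D2 g)) [q [qQ ->]]]]|[g [q [gk [qQ ->]]]]]; first by exists g, q.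
    by exists (img (app Qf g) (fun q => cat q u g k)); split; [apply/(@in_img _ k _ D1); exists g|apply/(@in_img _ _ _ (D2 g)); exists q].
  have UC x : x ε U -> x ε C k.
    by move=> /inU [g [q [gk [qQ ->]]]]; apply: cat_u_cond; [exact: k_suc|case: (HQ g gk) => + _; apply].
  have iU : injs U k by apply: (union_injs Ik D1) => g gk; apply: small_img => //; case: (HQ g gk) => _ [].
  case: (injs_inverse iU) => rr Hrr.
  have oC : one u k ε C k by exact: (one_cond IT Ik Hu kk).
  case: (@choice_map _ (fun i y => y ε C k /\ (app rr i ε C k -> y = app rr i)) k) => [|i ik|e [_ He]]; first def.
    by case: (classic (app rr i ε C k)) => K; [exists (app rr i)|exists (one u k)].
  have eU x : x ε U -> exists i, i ε k /\ app e i = x.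
    move=> xU; case: (Hrr x xU) => i [ik E1]; exists i; split=> //; case: (He i ik) => _ ->; rewrite E1 //; exact: UC.
  have DS := Def_supp.
  case: (@choice_map _ (fun i a => a ε k /\ supp (app e i) a) k) => [|i ik|h1 [_ Hh1]].
    by apply: Def_and; [def|apply: (@Def_2 _ supp _ _ DS); def].
    by apply: (supp_ex IT Ik); case: (He i ik).
  have DC0 : Def (fun e0 : nat -> V => exists i, i ε e0 0 /\ app e i = e0 1) by def.
  case: (@choice_map _ (fun g z => z ε k /\ forall q, q ε app Qf g -> exists i, i ε z /\ app e i = cat q u g k) k) => [|g gk|h0 [_ Hh0]].
    apply: Def_and; first def. apply: Def_all; apply: Def_imp; first def. apply: Def_ex; apply: Def_and; first def.
    by apply: Def_eq; [def|apply: D_cat; def].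
    case: (@choice_map _ (fun q i => i ε k /\ app e i = cat q u g k) (app Qf g)) => [|q qQ|ix [_ Hix]].
      by apply: Def_and; [def|apply: Def_eq; [def|apply: D_cat; def]].
      by apply: eU; apply/inU; exists g, q.
    have Dx : DTerm (fun e => app ix (e 0)) by def.
    case: (@small_bound _ k (app Qf g) (app ix) (wc_reg Hk) Dx ok) => [||q qQ|z [zk Hz]]; [by case: (HQ g gk) => _ []|exact: wc_ne|by case: (Hix q qQ)|].
    by exists z; split=> // q qQ; exists (app ix q); split; [exact: Hz|case: (Hix q qQ)].
  have Dh : DTerm (fun e => cup (app h0 (e 0)) (app h1 (e 0))) by def.
  have hk x : x ε k -> cup (app h0 x) (app h1 x) ε k.
    by move=> xk; case: (Hh0 x xk) (Hh1 x xk) => K0 _ [K1 _]; exact: cup_in.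
  exists e, (lam k (fun x => cup (app h0 x) (app h1 x))); split; first by move=> i ik; case: (He i ik).
  split; first by move=> x xk; rewrite (app_lam Dh xk); exact: hk.
  move=> d dk Id Hd; have od := ord_in ok dk.
  have dn x y : x ε d -> ord y -> y ⊆ cup (app h0 x) (app h1 x) -> y ε d.
    move=> xd oy ys; move: (Hd x xd); rewrite (app_lam Dh (ord_trans ok dk xd)) => cd.
    by case: (ord_sub oy (ord_in od cd) ys) => [K|->] //; exact: ord_trans od cd K.
  split=> [i id|p a pC ad sp].
    have ik := ord_trans ok dk id; case: (Hh1 i ik) => K1 K2; exists (app h1 i); split=> //.
    by apply: (dn i) => //; [exact: (ord_in ok K1)|move=> z; rewrite in_cup; right].
  have ak := ord_trans ok dk ad; case: (HQ a ak) => Q1 [_ Q3]; case: (Q3 (restr p a)) => [|q [qQ [pq qp]]]; first exact: (cond_restr IT kk pC ak).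
  case: (Hh0 a ak) => K0 /(_ q qQ) [i [ih E1]].
  have h0d : app h0 a ε d by apply: (dn a) => //; [exact: (ord_in ok K0)|move=> z; rewrite in_cup; left].
  have cC : cat q u a k ε C k by apply: cat_u_cond; [exact: k_suc|exact: Q1].
  have rc : restr (cat q u a k) a = q by apply: restr_cat_u; [exact: k_suc|exact: Q1].
  exists i; split; first exact: ord_trans od h0d ih. rewrite E1; split; apply: (le_cat_supp IT Ik ak) => //; try rewrite rc //.
  exact: supp_cat.
Qed.

Lemma compat_cat p t d : d ε k -> p ε C k -> t ε C k -> le d (restr p d) (restr t d) ->
  exists r, r ε C k /\ le k r (cat (restr p d) t d k) /\ le k r t.
Proof.
  move=> dk pC tC H; have ds := k_suc dk; have rC := cond_restr IT kk pC dk; have T := tl_cond IT Ik d kk tC.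
  have cC := cat_cond IT Ik kk ds rC T; exists (cat (restr p d) t d k); split=> //; have POk := it_PO IT Ik kk.
  split; first exact: le_refl. apply/(leE IT _ _ kk); split=> //; split=> // b bk; case: (classic (b ε d)) => bd.
    have od := ord_in ok dk; have dks := ord_subs ok dk; rewrite cat_l //.
    rewrite restr_cat_l //; [exact: (cond_fun IT ds rC)|exact: (ord_subs od bd)|].
    move: H => /(leE IT _ _ ds) [_ [_ /(_ b bd)]]; by rewrite (app_restr (cond_fun IT kk tC) dks bd).
  rewrite cat_r //; have PO := it_POk IT Ik bk; have xC := cond_restr IT kk cC bk; apply: (st_refl IT bk PO xC).
  by apply: (it_names IT bk _ xC); exact: (cond_names IT kk tC bk).
Qed.

Section CC.
Variables e hc : V.
Hypothesis eC : forall i, i ε k -> app e i ε C k.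
Hypothesis hk : forall x, x ε k -> app hc x ε k.
Hypothesis He : forall d, d ε k -> inacc d -> (forall x, x ε d -> app hc x ε d) ->
    (forall i, i ε d -> exists a, a ε d /\ supp (app e i) a) /\
    (forall p a, p ε C k -> a ε d -> supp p a -> exists i, i ε d /\ le k (app e i) p /\ le k p (app e i)).

(** [wc_normal_closed] is applied to a constant function, as a supply of inaccessibles closed under
    both functions. *)
Lemma inacc_closed h1 : (forall x, x ε k -> app h1 x ε k) -> forall th, th ε k ->
  exists d, d ε k /\ th ε d /\ inacc d /\ (forall x, x ε d -> app hc x ε d) /\ (forall x, x ε d -> app h1 x ε d).
Proof.
  move=> h1k th tk.
  pose hh x := cup (app hc x) (app h1 x).
  have Dh : DTerm (fun e => hh (e 0)) by rewrite /hh; def.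
  have hhk x : x ε k -> hh x ε k.
    by move=> xk; apply: cup_in => //; [exact: hk|exact: h1k].
  have D0 : DTerm (fun e : nat -> V => (fun _ _ => empty) (e 0) (e 1)) by def.
  case: (@wc_normal_closed _ k Hk k (fun _ _ => empty) hh D0 Dh (injs_refl k) (wc_ne Hk) hhk) => [i al _ _ Ial _|D [[Dk uD] [HD _]]].
    by case: Ial => -[[oal _] wal] _; apply: ord_trans oal wal _; exact: omega0.
  case: (uD th tk) => d [dD td]; case: (HD d dD) => Id cl; exists d; split; first exact: Dk. split=> //; split=> //.
  have od := ord_in ok (Dk d dD).
  have dn x y : x ε d -> ord y -> y ⊆ hh x -> y ε d.
    by move=> xd oy ys; case: (ord_sub oy (ord_in od (cl x xd)) ys) => [K|->]; [exact: ord_trans od (cl x xd) K|exact: cl].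
  by split=> x xd; have xk := ord_trans ok (Dk d dD) xd; (apply: (dn x) => //; [by apply: (ord_in ok); auto|move=> z zz; apply/in_cup; (by left) || by right]).
Qed.

(** At an inaccessible [d] the iteration takes a direct limit, so the restriction of [p] to [d] has
    support bounded below [d], and its extension by 1 is equivalent to a condition listed before
    [d]. *)
Lemma head_in_enum d p : d ε k -> inacc d -> (forall x, x ε d -> app hc x ε d) -> p ε C k ->
  exists i, i ε d /\ le k p (app e i) /\ le d (restr (app e i) d) (restr p d).
Proof.
  move=> dk Id cl pC; have ds := k_suc dk; case: (He dk Id cl) => E1 E2; have rC := cond_restr IT kk pC dk.
  have [a [ad sa]] : exists a, a ε d /\ supp (cat (restr p d) u d k) a.
    move: (rC) => /(cond_flat IT Ik _ ds) [_ [_ /(_ d (suc_self d) Id) [a [ad K]]]]; exists a; split=> // b bk nb.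
    case: (classic (b ε d)) => bd; first by rewrite cat_l //; exact: K.
    by rewrite cat_r //; case: Hu => _ /(_ b bk) [].
  have cC : cat (restr p d) u d k ε C k by exact: cat_u_cond.
  case: (E2 _ a cC ad sa) => i [id [le1 le2]]; exists i; split=> //; split.
    apply: (le_trans (it_PO IT Ik kk)) le2; apply: (le_cat IT Ik kk ds) => //; [exact: (le_refl (it_PO IT Ik ds))|exact: (tl_u Ik Hu kk ds)|].
    move=> b bk nb; apply: (le_empty IT Ik bk); [exact: (cond_restr IT kk pC bk)| |by case: Hu => _ /(_ b bk) []].
    by apply: (it_names IT bk); [exact: (cond_names IT kk pC bk)|exact: (cond_restr IT kk pC bk)].
  by move: (le_restr IT Ik kk le1 dk); rewrite restr_cat_u.
Qed.

(* The head of any condition at a closed inaccessible [d] is enumerated below [d], hence refined by a member of the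
   family with index below [d]; this is all that is needed of the chain condition. *)
Lemma predense h1 : (forall x, x ε k -> app h1 x ε k /\ le k (app e (app h1 x)) (app e x)) ->
  exists g, g ε k /\ forall p, p ε C k -> exists x r, x ε g /\ le k r p /\ le k r (app e (app h1 x)).
Proof.
  move=> H; case: (inacc_closed (fun x xk => proj1 (H x xk)) (wc_omega Hk)) => d [dk [_ [Id [cl1 cl2]]]]; exists d; split=> // p pC.
  case: (head_in_enum dk Id cl1 pC) => i [id [_ H1]]; have ik := ord_trans ok dk id; case: (H i ik) => jk jl.
  have jd := cl2 i id; set j := app h1 i in jd jk jl; have ds := k_suc dk.
  have H2 : le d (restr (app e j) d) (restr p d) by apply: (le_trans (it_PO IT Ik ds)) H1; exact: (le_restr IT Ik kk jl dk).
  case: (compat_cat dk (eC jk) pC H2) => r [rC [r1 r2]]; exists i, r; split=> //; split=> //.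
  case: (He dk Id cl1) => E1 _; case: (E1 j jd) => a [ad sa]; have ak := ord_trans ok dk ad.
  apply: (le_cat_supp IT Ik ak (eC jk) sa rC).
  have od := ord_in ok dk; have := le_head IT Ik kk ds (cond_restr IT kk (eC jk) dk) r1 => K; move: (le_restr IT Ik ds K ad).
  by rewrite !(restr_restr _ (ord_subs od ad)).
Qed.
End CC.
End Enumeration.

(** * Distributivity of the tail *)

Lemma mixW (W : zf) (e : nat -> W) : sat (@E W) eq (emb (deep 5 0 (1 ∈ 0 ∧ 2 ∈ 0)) e) ->
  sat (@E W) eq (emb (deep 5 0 (∃ x, x ∈ 0 ∧ (3 ∈ 4 ⇒ x ≈ 1) ∧ (¬ 3 ∈ 4 ⇒ x ≈ 2))) e).
Proof.
  move=> /sat_and [H1 H2]; have G : sat (@E W) eq (∃ x, x ∈ e 0 ∧ (e 3 ∈ e 4 ⇒ x ≈ e 1) ∧ (¬ e 3 ∈ e 4 ⇒ x ≈ e 2)); last exact: G.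
  apply/sat_ex; case: (classic (e 3 ε e 4)) => K; [exists (e 1)|exists (e 2)]; apply/sat_and; split=> //; apply/sat_and; split; apply/sat_imp => //.
    by move=> /sat_neg K'.
Qed.
Lemma is_pair_injW (W : zf) (e : nat -> W) : sat (@E W) eq (emb (deep 5 0 (is_pair 0 1 2 ∧ is_pair 0 3 4)) e) -> sat (@E W) eq (emb (deep 5 0 (1 ≈ 3 ∧ 2 ≈ 4)) e).
Proof.
  move=> /sat_and [/(@is_pairE W (e 0) (e 1) (e 2)) E1 /(@is_pairE W (e 0) (e 3) (e 4)) E2]; apply/sat_and.
  by apply: pair_inj; rewrite -E1 -E2.
Qed.
(** [limit] speaks of successors through an unbounded quantifier. This version has bounded
    quantifiers only, so it passes from [d] to its canonical name. *)
Definition lim_bdd X (x : X) : fml X := ordinal x ∧ (¬ ∀[y ∈ x] Bot) ∧ ∀[y ∈ x] ¬ ∀[z ∈ x] ¬ y ∈ z.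
Lemma lim_bddE (W : zf) (x : W) : sat (@E W) eq (lim_bdd x) <-> limO x.
Proof.
  rewrite /lim_bdd sat_and sat_and ordinalE sat_neg !sat_all; split=> -[ox [H1 H2]]; split=> //; split.
  - by move=> E1; apply: H1 => y; apply/sat_imp; rewrite E1 => /in_empty.
  - move=> y yx E1; move: (H2 y) => /sat_imp /(_ yx) /sat_neg; apply; apply/sat_all => z; apply/sat_imp; rewrite E1 => zx; apply/sat_neg => yz.
    by move: zx => /in_suc [zy|E2]; [case: (mem_asym yz zy)|move: yz; rewrite E2 => /mem_irr].
  - by move=> K; apply: H1; apply: sext => y; split=> [yx|/in_empty //]; move: (K y) => /sat_imp /(_ yx).
  - move=> y; apply/sat_imp => yx; apply/sat_neg => K; case: (suc_in ox yx) => [K1|K1]; last by case: (H2 y yx).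
    by move: K => /sat_all /(_ (suc y)) /sat_imp /(_ K1) /sat_neg; apply; exact: suc_self.
Qed.
Lemma lim_bddW (W : zf) (e : nat -> W) : sat (@E W) eq (emb (deep 1 0 (lim_bdd 0)) e) -> sat (@E W) eq (emb (deep 1 0 (limit 0)) e).
Proof. by move=> /(@lim_bddE W (e 0)) H; apply: (proj2 (@limitE W (e 0)) H). Qed.

Definition all_empty X (s a : X) : fml X := ∀[c ∈ a] ∃ y, pair_in c y s ∧ is_empty y.
Definition follows X (R s a h : X) : fml X := ∀[c ∈ a] ∃ y t v, pair_in c y s ∧ is_restriction t s c ∧ pair_in t v h ∧ pair_in y v R.
Definition reply X (S R s a h x : X) : fml X := x ∈ S ∧ (all_empty s a ⇒ is_empty x) ∧
  (follows R s a h ⇒ pair_in s x h ∧ ∀[c ∈ a] ∀ y, pair_in c y s ⇒ pair_in x y R).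

(** * Mixing, minimal conditions, strategies and sequences at one stage *)

Section NamesAt.
Variables (V : zfc_model) (k : V) (C O N S R : V -> V).
Hypothesis IT : iter_ok k C O N S R.
Hypothesis Ik : inacc k.
Variable b : V.
Hypothesis bk : b ε k.
Let PO := it_POk IT Ik bk.
Notation A := (C b).
Notation leb := (below (C b) (O b)).
Notation feq := (forces_eq (C b) (O b)).
Notation "p ⊩ a" := (forces (C b) (O b) p a%fml) (at level 100).

Lemma mixing (X s0 s1 : V) : (forall p, p ε A -> p ⊩ s0 ∈ S b) -> (forall p, p ε A -> p ⊩ s1 ∈ S b) ->
  exists s, s ε N b /\ (forall x, x ε X -> x ε A -> feq x s s0) /\
    (forall x, x ε A -> (forall y z, leb y x -> z ε X -> ~ leb y z) -> feq x s s1).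
Proof.
  (* [d0] names a set that contains [z0] exactly when the generic filter meets [X]; this membership
     is the switch between [s0] and [s1]. *)
  move=> H0 H1; pose z0 := chk A empty; pose d0 := prod (sing z0) X; pose en := lenv b (cons (S b) (cons s0 (cons s1 (cons z0 (cons d0 nil))))).
  have [t Ht] := @F_max V A (O b) PO (deep 6 0 (0 ∈ 1 ∧ (4 ∈ 5 ⇒ 0 ≈ 2) ∧ (¬ 4 ∈ 5 ⇒ 0 ≈ 3))) en.
  have Kt p : p ε A -> p ⊩ t ∈ S b ∧ (z0 ∈ d0 ⇒ t ≈ s0) ∧ (¬ z0 ∈ d0 ⇒ t ≈ s1).
    move=> pA; apply: (Ht p pA); apply: (@transfer _ _ mixW V A (O b) PO p en pA); apply/forces_and; split; [exact: H0|exact: H1].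
  case: (it_full IT (t := t) bk) => [p /Kt /forces_and [] //|s [sN Hs]].
  exists s; split=> //; split=> x.
    move=> xX xA; apply: (feq_trans PO (Hs x xA)); move: (Kt x xA) => /forces_and [_ /forces_and [/forces_imp K _]].
    apply/forces_eqE; apply: (K x (le_refl PO xA)); apply: (mem_intro PO (b := x)); last exact: (le_refl PO xA).
    by apply/pair_prod; split=> //; apply/in_sing.
  move=> xA Hx; apply: (feq_trans PO (Hs x xA)); move: (Kt x xA) => /forces_and [_ /forces_and [_ /forces_imp K]].
  apply/forces_eqE; apply: (K x (le_refl PO xA)); apply/forces_neg => q qx /memE /(_ q (le_ll PO qx)) [r [t' [c [rq [/pair_prod [_ cX] [rc _]]]]]].
  by apply: (Hx r c) => //; exact: (le_trans PO rq qx).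
Qed.

Lemma min_name : exists m, m ε N b /\ forall p x, p ε A -> (p ⊩ pair_in x m (R b)) -> p ⊩ pair_in m x (R b).
Proof.
  pose en := lenv b (cons (S b) (cons (R b) nil)).
  have [t Ht] := @F_max V A (O b) PO (deep 3 0 (0 ∈ 1 ∧ ∀[x ∈ 1] pair_in x 0 2 ⇒ pair_in 0 x 2)) en.
  have Kt p : p ε A -> p ⊩ t ∈ S b ∧ ∀[x ∈ S b] pair_in x t (R b) ⇒ pair_in t x (R b).
    move=> pA; apply: (Ht p pA); by move: (st_ok IT bk PO pA) => /forces_and [_ /forces_and [_ /forces_and [_ /forces_and [_ H]]]].
  case: (it_full IT (t := t) bk) => [p /Kt /forces_and [] //|s [sN Hs]].
  exists s; split=> // p x pA H; have pp := le_refl PO pA; have [xS _] := st_dom IT bk PO pA H.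
  apply: (pin_subst PO (feq_sym (Hs p pA)) (feq_refl PO _ _)).
  have H' := pin_subst PO (feq_refl PO _ _) (Hs p pA) H.
  by move: (Kt p pA) => /forces_and [_ /forces_all /(_ x) /forces_imp /(_ p pp xS) /forces_imp /(_ p pp H')].
Qed.

Lemma strategy_name d : limO d -> suc d ε b -> exists h, forall p, p ε A -> p ⊩ strategy_reply (S b) (R b) (chk A (suc d)) h.
Proof.
  move=> ld db; pose en := lenv b (cons (S b) (cons (R b) (cons (chk A (suc d)) nil))).
  have [h Hh] := @F_max V A (O b) PO (deep 4 0 (strategy_reply 1 2 3 0)) en; exists h => p pA; apply: (Hh p pA); have pp := le_refl PO pA.
  have L : p ⊩ limit (chk A d).
    apply: (@transfer _ _ lim_bddW V A (O b) PO p (fun _ => chk A d) pA).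
    have [K _] := @bdd_abs V A (O b) PO (deep 1 0 (lim_bdd 0)) ltac:(repeat split) (fun _ => d).
    exact: (K (proj2 (lim_bddE d) ld) p pA).
  case: (it_stage IT bk PO) => l [_ /(_ p pA) /forces_and [_ /forces_and [H _]]].
  by move: H => /forces_all /(_ (chk A d)) /forces_all /(_ (chk A (suc d))) /forces_imp /(_ p pp L) /forces_imp /(_ p pp (F_succ PO d pA)) /forces_imp /(_ p pp (chk_in PO pA db)).
Qed.

Lemma is_pair_inj p z x y x' y' : p ε A -> (p ⊩ is_pair z x y) -> (p ⊩ is_pair z x' y') -> feq p x x' /\ feq p y y'.
Proof.
  move=> pA H1 H2; have : p ⊩ x ≈ x' ∧ y ≈ y'; last by move=> /forces_and [/forces_eqE ? /forces_eqE].
  apply: (@transfer _ _ is_pair_injW V A (O b) PO p (lenv b (cons z (cons x (cons y (cons x' (cons y' nil)))))) pA).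
  by apply/forces_and.
Qed.
Lemma is_pair_congr p z x y z' : feq p z z' -> (p ⊩ is_pair z x y) -> p ⊩ is_pair z' x y.
Proof.
  move=> H1 H; apply: (@forces_subst V A (O b) PO (deep 3 0 (is_pair 0 1 2)) (lenv b (cons z (cons x (cons y nil)))) (lenv b (cons z' (cons x (cons y nil)))) p).
    by case=> [|[|[|n]]] //=; exact: (feq_refl PO).
  exact: H.
Qed.

(* The name of the sequence of the [b]-th coordinates of the conditions [h s], [s < a]. *)
Definition seqn (h a : V) : V := prod (img a (fun s => opn A (chk A s) (app (app h s) b))) A.
Lemma D_pt (h : V) : DTerm (fun e => opn A (chk A (e 0)) (app (app h (e 0)) b)).
Proof. def. Qed.
Lemma in_seqn h a w p : pair w p ε seqn h a <-> p ε A /\ exists s, s ε a /\ w = opn A (chk A s) (app (app h s) b).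
Proof.
  rewrite /seqn; split=> [/pair_prod [/(@in_img _ _ _ (D_pt h)) K pA] //|[pA K]]; apply/pair_prod; split=> //; exact/(@in_img _ _ _ (D_pt h)).
Qed.
Lemma mem_seqn h a p w : (p ⊩ w ∈ seqn h a) -> forall q, leb q p -> exists r s, leb r q /\ s ε a /\ feq r w (opn A (chk A s) (app (app h s) b)).
Proof. move=> /memE H q qp; case: (H q qp) => r [t [c [rq [/in_seqn [_ [s [sa ->]]] [_ K]]]]]; by exists r, s. Qed.
Lemma seqn_in h a p s : p ε A -> s ε a -> p ⊩ opn A (chk A s) (app (app h s) b) ∈ seqn h a.
Proof. by move=> pA sa; apply: (mem_intro PO (b := p)); [apply/in_seqn; split=> //; exists s|exact: (le_refl PO)]. Qed.
Lemma seqn_pair h a p s : p ε A -> s ε a -> p ⊩ pair_in (chk A s) (app (app h s) b) (seqn h a).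
Proof.
  move=> pA sa; apply/forces_ex => q qp; have qA := le_l qp; exists q, (opn A (chk A s) (app (app h s) b)); split; first exact: (le_ll PO qp).
  by apply/forces_and; split; [exact: seqn_in|exact: (F_opn PO)].
Qed.
Lemma seqn_inv h a p x y : (p ⊩ pair_in x y (seqn h a)) -> forall q, leb q p -> exists r s, leb r q /\ s ε a /\ feq r x (chk A s) /\ feq r y (app (app h s) b).
Proof.
  move=> /forces_ex H q qp; case: (H q qp) => r [z [rq /forces_and [Hz Hp]]]; have rr := le_ll PO rq.
  case: (mem_seqn Hz rr) => r' [s [rr' [sa K]]]; have r'A := le_l rr'; exists r', s; split; first exact: (le_trans PO rr' rq). split=> //.
  by apply: (is_pair_inj r'A (is_pair_congr K (forces_mono PO rr' Hp))); exact: (F_opn PO).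
Qed.
Lemma seqn_fun h a p : p ε A -> p ⊩ function_on (seqn h a) (chk A a).
Proof.
  move=> pA; apply/forces_and; split; last (apply/forces_and; split).
  - apply/forces_all => z; apply/forces_imp => q qp Hz; apply/forces_ex => q' qq; case: (mem_seqn Hz qq) => r [s [rq [sa K]]]; have rA := le_l rq.
    exists r, (chk A s); split=> //; apply/forces_and; split; first exact: (chk_in PO).
    apply/forces_ex => r' rr; exists r', (app (app h s) b); split; first exact: (le_ll PO rr).
    by apply: (is_pair_congr (feq_sym (feq_mono PO rr K))); apply: (F_opn PO); exact: le_l rr.
  - apply/forces_all => x; apply/forces_imp => q qp /(mem_chk PO) Hx; apply/forces_ex => q' qq; case: (Hx q' qq) => r [s [rq [sa K]]]; have rA := le_l rq.
    exists r, (app (app h s) b); split=> //; apply: (pin_subst PO (feq_sym K) (feq_refl PO _ _)); exact: seqn_pair.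
  - apply/forces_all => x; apply/forces_all => y; apply/forces_all => y'; apply/forces_imp => q qp H1; apply/forces_imp => q' qq H2; apply/forces_eqE.
    apply: (feq_dense PO) => q1 qq1; case: (seqn_inv H1 (le_trans PO qq1 qq)) => r [s [rq [sa [K1 K2]]]].
    case: (seqn_inv H2 (le_trans PO rq qq1)) => r' [s' [rr [sa' [K3 K4]]]]; exists r'; split; first exact: (le_trans PO rr rq).
    have E1 : s = s' by apply: (chk_inj PO (le_l rr)); apply: (feq_trans PO (feq_sym (feq_mono PO rr K1)) K3).
    by subst s'; apply: (feq_trans PO (feq_mono PO rr K2) (feq_sym K4)).
Qed.
Lemma seqn_restr h a s p : p ε A -> isfun h a -> s ⊆ a -> p ⊩ is_restriction (seqn (restr h s) s) (seqn h a) (chk A s).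
Proof.
  move=> pA fh sa; apply/forces_all => z; apply/forces_iff => q qp; have qA := le_l qp; split=> H.
    apply/forces_and; split; apply: (forces_dense PO qA) => q' qq; case: (mem_seqn H qq) => r [c [rq [cs K]]]; have rA := le_l rq; rewrite (app_restr fh sa cs) in K; exists r; split=> //.
      by apply: (mem_congr_l PO (feq_sym K)); apply: seqn_in => //; exact: sa.
    apply/forces_ex => r' rr; have r'A := le_l rr; exists r', (chk A c); split; first exact: (le_ll PO rr). apply/forces_and; split; first exact: (chk_in PO).
    apply/forces_ex => r2 rr2; exists r2, (app (app h c) b); split; first exact: (le_ll PO rr2).
    by apply: (is_pair_congr (feq_sym (feq_mono PO (le_trans PO rr2 rr) K))); apply: (F_opn PO); exact: le_l rr2.
  move: H => /forces_and [H1 /forces_ex H2]; apply: (forces_dense PO qA) => q' qq; case: (H2 q' qq) => r [x [rq /forces_and [/(mem_chk PO) Hx /forces_ex Hy]]].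
  case: (Hx r (le_ll PO rq)) => r1 [c [r1r [cs K]]]; case: (Hy r1 r1r) => r2 [y [r21 Hp]].
  have r2q := le_trans PO r21 (le_trans PO r1r (le_trans PO rq qq)).
  case: (mem_seqn H1 r2q) => r3 [c' [r32 [ca K3]]]; have r3A := le_l r32; exists r3.
  split; first exact: (le_trans PO r32 (le_trans PO r21 (le_trans PO r1r rq))).
  have Fo : r3 ⊩ is_pair (opn A (chk A c') (app (app h c') b)) (chk A c') (app (app h c') b) by exact: (F_opn PO).
  have [K4 _] := is_pair_inj r3A (is_pair_congr K3 (forces_mono PO r32 Hp)) Fo.
  have E1 : c = c'.
    apply: (chk_inj PO r3A); apply: (feq_trans PO _ K4); apply: feq_sym; exact: (feq_mono PO (le_trans PO r32 r21) K).
  subst c'; apply: (mem_congr_l PO (feq_sym K3)); rewrite -(app_restr fh sa cs); exact: seqn_in.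
Qed.
End NamesAt.

Lemma fex (V : zfc_model) (A L : V) p (F : V -> fml V) x : preorder A L -> forces A L p (F x) -> forces A L p (Ex F).
Proof. by move=> PO H; apply/forces_ex => q qp; exists q, x; split; [exact: (le_ll PO qp)|exact: (forces_mono PO qp H)]. Qed.

(** * A descending sequence of tails meeting [d] many dense sets *)

Section Distributive.
Variables (V : zfc_model) (k : V) (C O N S R : V -> V).
Hypothesis IT : iter_ok k C O N S R.
Hypothesis Hk : wcomp k.
Variable u : V.
Hypothesis Hu : isfun u k /\ forall b, b ε k -> app u b ε N b /\ Em C O b (app u b).
Implicit Types (g b p q r s t x y a h : V).
Notation le g := (below (C g) (O g)).
Notation "p ⊩[ g ] a" := (forces (C g) (O g) p a%fml) (at level 100, g at level 10).
Let Ik := wc_inacc Hk.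
Let ok := wc_ord Hk.
Let kk : k ε suc k := suc_self k.
Let fu : isfun u k := proj1 Hu.

Variable d : V.
Hypothesis dk : d ε k.
Hypothesis Id : inacc d.
Let od : ord d := ord_in ok dk.
Let ds : d ε suc k := k_suc dk.
Let dsub : d ⊆ k := ord_subs ok dk.

Lemma lim_d : limO d.
Proof.
  case: Id => -[cd wd] _; split=> //; split; first by move=> E1; move: wd; rewrite E1 => /in_empty.
  by move=> y yd E1; move: (card_limit cd wd yd); rewrite -E1 => /mem_irr.
Qed.

Definition Pin b p s t : Prop := p ⊩[b] pair_in s t (R b).
Lemma Def_Pin : Def (fun e => Pin (e 0) (e 1) (e 2) (e 3)).
Proof.
  apply: (@Def_forces V (deep 3 0 (pair_in 0 1 2)) (fun e => C (e 0)) (fun e => O (e 0)) (fun e => e 1) (fun e => lenv (e 0) (cons (e 2) (cons (e 3) (cons (R (e 0)) nil))))); [exact: (it_DC IT)|exact: (it_DO IT)|def|].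
  by case=> [|[|[|n]]] /=; try def; exact: (it_DR IT).
Qed.

Variables gs ms : V.
Hypothesis Hms : forall b, b ε k -> app ms b ε N b /\ forall p x, p ε C b -> Pin b p x (app ms b) -> Pin b p (app ms b) x.
Hypothesis Hgs : forall b, b ε k -> suc d ε b -> forall p, p ε C b -> p ⊩[b] strategy_reply (S b) (R b) (chk (C b) (suc d)) (app gs b).
Variables X j qf : V.
Hypothesis jX : into j X d.
Hypothesis jinj : inj j X.
Hypothesis qX : forall i, i ε X -> app qf i ε C d.
Variable Dp : V -> V -> Prop.
Hypothesis DDp : Def (fun e => Dp (e 0) (e 1)).
Hypothesis Dp_dense : forall i t, i ε X -> t ε C k -> exists t', le k t' t /\ Dp i t'.
Hypothesis Dp_down : forall i t t', le k t' t -> Dp i t -> Dp i t'.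

(** One step of a legitimate run in the sense of [legit]: the move [y] is below what the strategy
    proposes after [s]. *)
Definition Gf b x s y : Prop := x ⊩[b] ∃ v, pair_in s v (app gs b) ∧ pair_in y v (R b).
Lemma Def_Gf : Def (fun e => Gf (e 0) (e 1) (e 2) (e 3)).
Proof.
  apply: (@Def_forces V (deep 4 0 (∃ v : nat, pair_in 0 v 1 ∧ pair_in 2 v 3)) (fun e => C (e 0)) (fun e => O (e 0)) (fun e => e 1) (fun e => lenv (e 0) (cons (e 2) (cons (app gs (e 0)) (cons (e 3) (cons (R (e 0)) nil)))))); [exact: (it_DC IT)|exact: (it_DO IT)|def|].
  by case=> [|[|[|[|n]]]] /=; try def; exact: (it_DR IT).
Qed.
Definition sq b h a : V := seqn C b h a.
Lemma D_sq : DTerm (fun e => sq (e 0) (e 1) (e 2)).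
Proof. by have D := it_DC IT; rewrite /sq /seqn; def. Qed.
Definition cat2 q r : V := cat q r d k.
Lemma D_cat2 : DTerm (fun e => cat2 (e 0) (e 1)).
Proof. by apply: D_cat; def. Qed.

(** [r] may continue the descending sequence [h] of length [a]: it is trivial below [d], at or below
    the minimal condition at [d] and [suc d], and obeys the strategies at all later coordinates, so
    that the run can be prolonged again. *)
Definition tail_ok h a r : Prop := r ε C k /\ restr r d = one u d /\ (forall s, s ε a -> le k r (app h s)) /\
  (forall b, b = d \/ b = suc d -> Pin b (restr r b) (app r b) (app ms b)) /\
  (forall b, b ε k -> suc d ε b -> forall x, le b x (restr r b) -> Gf b x (sq b h a) (app r b)).
(** At step [a] at most one index has to be served, because [j] is injective: some [q'] below its
    head must enter the dense set together with the tail. *)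
Definition task a r : Prop := forall i, i ε X -> app j i = a -> exists q', le d q' (app qf i) /\ Dp i (cat2 q' r).
Definition Step h a r : Prop := tail_ok h a r /\ task a r.
Definition Good h a : Prop := isfun h a /\ forall s, s ε a -> Step (restr h s) s (app h s).
Lemma Def_Step : Def (fun e => Step (e 0) (e 1) (e 2)).
Proof.
  have D1 := Def_Pin; have D2 := Def_Gf; have D3 := D_sq; have D4 := D_cat2; have D5 := it_DC IT; have D6 := it_DO IT.
  rewrite /Step /tail_ok /task /one; apply: Def_and; last first.
    apply: Def_all; do 2 (apply: Def_imp; first def). apply: Def_ex; apply: Def_and; first def.
    by apply: (@Def_2 _ Dp _ _ DDp); [def|apply: (@DTerm_2 _ cat2 _ _ D4); def].
  apply: Def_and; first def. apply: Def_and; first def. apply: Def_and; first def. apply: Def_and; apply: Def_all; (apply: Def_imp; first def).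
    by apply: (@Def_4 _ Pin _ _ _ _ D1); def.
  apply: Def_imp; first def. apply: Def_all; apply: Def_imp; first def. by apply: (@Def_4 _ Gf _ _ _ _ D2); [def|def|apply: (@DTerm_3 _ sq _ _ _ D3); def|def].
Qed.

Section Extend.
Variables h a : V.
Hypothesis ad : a ε suc d.
Hypothesis Hh : Good h a.
Let oa : ord a := ord_in (ord_suc od) ad.
Let fh : isfun h a := proj1 Hh.
Lemma hC s : s ε a -> app h s ε C k. Proof. by case: Hh => _ H /H [[]]. Qed.

(** Every earlier step satisfied [Gf], so at conditions below all earlier restrictions the [b]-th
    coordinates form a legitimate run. *)
Lemma follows_forced b x : b ε k -> suc d ε b -> x ε C b -> (forall s, s ε a -> le b x (restr (app h s) b)) ->
  x ⊩[b] follows (R b) (sq b h a) (chk (C b) a) (app gs b).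
Proof.
  move=> bk db xC Hx; have PO := it_POk IT Ik bk; apply/forces_all => c; apply/forces_imp => q qx /(mem_chk PO) Hc; have qC := le_l qx.
  apply: (forces_dense PO qC) => q' qq; case: (Hc q' qq) => r [s [rq [sa K]]]; exists r; split=> //; have rC := le_l rq.
  apply: (fex (x := app (app h s) b) PO); apply: (fex (x := sq b (restr h s) s) PO).
  have rx : le b r (restr (app h s) b) by apply: (le_trans PO (le_trans PO rq qq)); apply: (le_trans PO qx); exact: Hx.
  case: Hh => _ /(_ s sa) [[_ [_ [_ [_ /(_ b bk db r rx) G]]]] _].
  apply/forces_ex => r' rr.
  have [r2 [v [r2r G2]]] := proj1 (@forces_ex _ (C b) (O b) r (fun v => pair_in (sq b (restr h s) s) v (app gs b) ∧ pair_in (app (app h s) b) v (R b))) G r' rr.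
  exists r2, v; split; first exact: r2r.
  have r2C := le_l r2r; have K2 := feq_mono PO (le_trans PO r2r rr) K.
  apply/forces_and; split; first by apply: (pin_subst PO (feq_sym K2) (feq_refl PO _ _)); exact: (seqn_pair IT Ik bk).
  apply/forces_and; split; last exact: G2.
  apply: (@forces_subst V (C b) (O b) PO (deep 3 0 (is_restriction 0 1 2)) (lenv b (cons (sq b (restr h s) s) (cons (sq b h a) (cons (chk (C b) s) nil)))) (lenv b (cons (sq b (restr h s) s) (cons (sq b h a) (cons c nil)))) r2).
    by case=> [|[|[|n]]] /=; try exact: (feq_refl PO); exact: feq_sym.
  exact: (seqn_restr IT Ik bk r2C fh (ord_subs oa sa)).
Qed.
Lemma all_empty_forced b p : b ε k -> p ε C b -> (forall s, s ε a -> Em C O b (app (app h s) b)) -> p ⊩[b] all_empty (sq b h a) (chk (C b) a).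
Proof.
  move=> bk pC He; have PO := it_POk IT Ik bk; apply/forces_all => c; apply/forces_imp => q qx /(mem_chk PO) Hc; have qC := le_l qx.
  apply: (forces_dense PO qC) => q' qq; case: (Hc q' qq) => r [s [rq [sa K]]]; exists r; split=> //; have rC := le_l rq.
  apply: (fex (x := app (app h s) b) PO); apply/forces_and; split; last exact: (He s sa r rC).
  by apply: (pin_subst PO (feq_sym K) (feq_refl PO _ _)); exact: (seqn_pair IT Ik bk).
Qed.
Definition Rp b s : Prop := forall p, p ε C b -> p ⊩[b] reply (S b) (R b) (sq b h a) (chk (C b) a) (app gs b) s.
Lemma coord_ex b : b ε k -> suc d ε b -> exists s, s ε N b /\ Rp b s.
Proof.
  move=> bk db; have PO := it_POk IT Ik bk.
  pose l := (cons (S b) (cons (R b) (cons (sq b h a) (cons (chk (C b) a) (cons (app gs b) nil))))).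
  have [t Ht] := @F_max V (C b) (O b) PO (deep 6 0 (reply 1 2 3 4 5 0)) (lenv b l).
  have Kt p : p ε C b -> p ⊩[b] reply (S b) (R b) (sq b h a) (chk (C b) a) (app gs b) t.
    move=> pC; apply: (Ht p pC); have pp := le_refl PO pC; have F := seqn_fun IT Ik bk h a pC; have M := chk_in PO pC ad.
    by move: (Hgs bk db pC) => /forces_all /(_ (chk (C b) a)) /forces_imp /(_ p pp M) /forces_all /(_ (sq b h a)) /forces_imp /(_ p pp F).
  case: (it_full IT (t := t) bk) => [p /Kt /forces_and [] //|s [sN Hs]]; exists s; split=> // p pC.
  apply: (@forces_subst V (C b) (O b) PO (deep 6 0 (reply 1 2 3 4 5 0)) (scons t (lenv b l)) (scons s (lenv b l)) p); last exact: Kt.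
  by case=> [|n] /=; [apply: feq_sym; exact: Hs|exact: (feq_refl PO)].
Qed.
Lemma Def_Rp : Def (fun e => Rp (e 0) (e 1)).
Proof.
  have D := D_sq; have D1 := it_DC IT; have D2 := it_DS IT; have D3 := it_DR IT; have D4 := it_DO IT.
  rewrite /Rp; apply: Def_all; apply: Def_imp; first def.
  apply: (@Def_forces V (deep 6 0 (reply 0 1 2 3 4 5)) (fun e => C (e 1)) (fun e => O (e 1)) (fun e => e 0) (fun e => lenv (e 0) (cons (S (e 1)) (cons (R (e 1)) (cons (sq (e 1) h a) (cons (chk (C (e 1)) a) (cons (app gs (e 1)) (cons (e 2) nil)))))))); [def|def|def|].
  by case=> [|[|[|[|[|[|n]]]]]] /=; def.
Qed.

Lemma cases_b b : b ε k -> b ε d \/ (b = d \/ b = suc d) \/ suc d ε b.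
Proof.
  move=> bk; have ob := ord_in ok bk; case: (ord_tot ob od) => [|[->|db]]; [by left|by right; left; left|right].
  by case: (suc_in ob db) => [|<-]; [right|left; right].
Qed.

(** The coordinates can be chosen independently of each other. That [r] is below the earlier
    conditions follows by induction on the coordinate [c]: the answer of a strategy is known to be
    below the earlier moves only at conditions below their restrictions to [c], and [restr r c] is
    one by the induction hypothesis. *)
Lemma tail_ex : exists r, tail_ok h a r.
Proof.
  have [oh Hst] := Hh.
  have DR := Def_Rp; have DN := it_DN IT.
  case: (@choice_map _ (fun b s => s ε N b /\ (b ε d -> s = app u b) /\ (b = d \/ b = suc d -> s = app ms b) /\ (suc d ε b -> Rp b s)) k) => [|b bk|r [fr Hr]].
  - apply: Def_and; first def. apply: Def_and; first def. apply: Def_and; first def. apply: Def_imp; first def. by apply: (@Def_2 _ Rp _ _ DR); def.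
  - have n1 : d <> suc d by move=> E1; move: (suc_self d); rewrite -E1 => /mem_irr.
    case: (cases_b bk) => [bd|[Eb|db]].
    + exists (app u b); split; first by case: Hu => _ /(_ b bk) []. split=> //; split.
        by move=> [Eb|Eb]; move: bd; rewrite Eb; [move=> /mem_irr|move=> K; case: (mem_asym K (suc_self d))].
      by move=> K; case: (mem_asym (ord_trans od bd K) (suc_self d)).
    + exists (app ms b); split; first by case: (Hms bk). split; last split=> //.
        by move=> bd; case: Eb => Eb; move: bd; rewrite Eb; [move=> /mem_irr|move=> K; case: (mem_asym K (suc_self d))].
      by move=> K; case: Eb => Eb; move: K; rewrite Eb; [move=> K; case: (mem_asym K (suc_self d))|move=> /mem_irr].
    + case: (coord_ex bk db) => s [sN Hs]; exists s; split=> //; split; last split=> //.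
        by move=> bd; case: (mem_asym (ord_trans od bd db) (suc_self d)).
      by move=> Eb; case: Eb => Eb; move: db; rewrite Eb; [move=> K; case: (mem_asym K (suc_self d))|move=> /mem_irr].
  have rN b : b ε k -> app r b ε N b by move=> /Hr [].
  have r1 b : b ε d -> app r b = app u b by move=> bd; case: (Hr b (dsub bd)) => _ [K _]; exact: K.
  have sdk : suc d ε k by exact: (wc_suc Hk).
  have r2 b : b = d \/ b = suc d -> app r b = app ms b.
    by move=> Eb; have bk : b ε k by [case: Eb => ->]; case: (Hr b bk) => _ [_ [K _]]; exact: K.
  have r3 b : b ε k -> suc d ε b -> Rp b (app r b) by move=> bk; case: (Hr b bk) => _ [_ [_ K]].
  have rC : r ε C k.
    (* At an inaccessible [h'] above [d], the earlier supports, at most [d] of them, have a common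
       bound by regularity. Beyond it all earlier moves are 1, and then the strategy answers 1. *)
    apply/(cond_flat IT Ik _ kk); split=> //; split=> // h' hk' Ih'; have oh' := ord_in (ord_suc ok) hk'.
    have wh : omega ε h' by case: Ih' => -[].
    case: (classic (d ε h')) => dh; last first.
      exists omega; split=> // b bh _; have bd : b ε d by exact: (ord_nin od oh' dh).
      by rewrite r1 //; case: Hu => _ /(_ b (dsub bd)) [].
    have DE := Def_Em IT.
    case: (@choice_map _ (fun s c => c ε h' /\ forall b, b ε h' -> ~ b ε c -> Em C O b (app (app h s) b)) a) => [|s sa|bd [_ Hbd]].
      apply: Def_and; first def. do 3 (apply: Def_all || apply: Def_imp; try by def). by apply: (@Def_2 _ (Em C O) _ _ DE); def.
      by move: (hC sa) => /(cond_flat IT Ik _ kk) [_ [_ /(_ h' hk' Ih')]].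
    have Db : DTerm (fun e => app bd (e 0)) by def.
    have ah : a ε h' by move: ad => /in_suc [K|->] //; exact: ord_trans oh' dh K.
    case: (Ih') => -[ch _] [rh _]; case: (reg_bound rh Db ah (fun s sa => proj1 (Hbd s sa))) => c [ch' Hc].
    have s2h : suc (suc d) ε h' by do 2 apply: (card_limit ch wh).
    case: (max_in oh' ch' s2h) => m [mh [M1 M2]]; exists m; split=> // b bh nb; have ob := ord_in oh' bh.
    have bk := k_sub Ik hk' bh.
    have db : suc d ε b.
      case: (cases_b bk) => [bd'|[Eb|//]]; case: nb; apply: M2; rewrite !in_suc; [by left; left|by case: Eb; auto].
    have He s : s ε a -> Em C O b (app (app h s) b).
      move=> sa; case: (Hbd s sa) => K1 K2; apply: K2 => // K3; apply: nb.
      have om := ord_in oh' mh; exact: (ord_trans om (M1 _ (Hc s sa)) K3).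
    move=> p pC; have PO := it_POk IT Ik bk; move: (r3 b bk db p pC) => /forces_and [_ /forces_and [/forces_imp K _]].
    by apply: (K p (le_refl PO pC)); exact: all_empty_forced.
  have key b x : b ε k -> suc d ε b -> x ε C b -> (forall s, s ε a -> le b x (restr (app h s) b)) ->
    (x ⊩[b] pair_in (sq b h a) (app r b) (app gs b)) /\ forall s, s ε a -> Pin b x (app r b) (app (app h s) b).
    move=> bk db xC Hx; have PO := it_POk IT Ik bk; have xx := le_refl PO xC; have F := follows_forced bk db xC Hx.
    move: (r3 b bk db x xC) => /forces_and [_ /forces_and [_ /forces_imp /(_ x xx F) /forces_and [K1 K2]]]; split=> // s sa.
    move: K2 => /forces_all /(_ (chk (C b) s)) /forces_imp /(_ x xx (chk_in PO xC sa)) /forces_all /(_ (app (app h s) b)) /forces_imp.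
    by apply=> //; exact: (seqn_pair IT Ik bk).
  have Cl : forall c, c ε k -> forall s, s ε a -> Pin c (restr r c) (app r c) (app (app h s) c).
    elim/(well_founded_ind (zfc_wf (z := V))) => c IH ck s sa; have cs := k_suc ck; have PO := it_POk IT Ik ck.
    have lec s' : s' ε a -> le c (restr r c) (restr (app h s') c).
      move=> sa'; apply/(leE IT _ _ cs); split; first exact: (cond_restr IT kk rC ck). split; first exact: (cond_restr IT kk (hC sa') ck).
      move=> c' cc; have ck' := ord_trans ok ck cc; have csub := ord_subs ok ck; rewrite (restr_restr _ (ord_subs (ord_in ok ck) cc)).
      rewrite (app_restr fr csub cc) (app_restr (cond_fun IT kk (hC sa')) csub cc); exact: (IH c' cc ck' s' sa').
    have rcC := cond_restr IT kk rC ck.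
    case: (cases_b ck) => [cd|[Ec|dc]].
    - have E1 : app (app h s) c = app u c.
        rewrite -(app_restr (cond_fun IT kk (hC sa)) dsub cd); case: (Hst s sa) => -[_ [-> _]] _; exact: (app_restr fu dsub cd).
      by rewrite /Pin E1 r1 //; apply: (st_refl IT ck PO rcC); apply: (it_names IT ck _ rcC); case: Hu => _ /(_ c ck) [].
    - rewrite (r2 c Ec); case: (Hms ck) => _; apply=> //; case: (Hst s sa) => -[_ [_ [_ [/(_ c Ec) K _]]]] _.
      exact: (forces_mono PO (lec s sa) K).
    - by case: (key c (restr r c) ck dc rcC lec) => _; apply.
  have lek s : s ε a -> le k r (app h s).
    by move=> sa; apply/(leE IT _ _ kk); split=> //; split; [exact: hC|move=> b bk; exact: Cl].
  exists r; split=> //; split; last split=> //; last split.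
  - apply: (@fun_ext _ _ _ d); [exact: restr_fun fr dsub|exact: restr_fun fu dsub|move=> x xd].
    by rewrite (app_restr fr dsub xd) (app_restr fu dsub xd) r1.
  - move=> b Eb; have bk : b ε k by [case: Eb => ->]; have PO := it_POk IT Ik bk; have xC := cond_restr IT kk rC bk; rewrite /Pin -(r2 b Eb).
    by apply: (st_refl IT bk PO xC); exact: (it_names IT bk (rN b bk) xC).
  - move=> b bk db x xr; have PO := it_POk IT Ik bk; have xC := le_l xr; apply: (fex (x := app r b) PO); apply/forces_and; split.
      by case: (key b x bk db xC) => [s sa|//]; apply: (le_trans PO xr); exact: (le_restr IT Ik kk (lek s sa) bk).
    by apply: (st_refl IT bk PO xC); exact: (it_names IT bk (rN b bk) xC).
Qed.

(** Let [t] in the dense set be below the head [app qf i] joined with [r0]. The tail of [t] is only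
    meaningful below its own head [q1], so each coordinate is mixed: that of [t] at conditions whose
    restriction to [d] is below [q1], that of [r0] at conditions incompatible with all of these. The
    result is below [r0] everywhere, and joined with [q1] it is below [t]. *)
Lemma task_ex r0 : tail_ok h a r0 -> exists r, Step h a r.
Proof.
  move=> T0; case: (T0) => r0C [r0d [r0h [r0m r0g]]]; case: (classic (exists i, i ε X /\ app j i = a)) => [[i [iX Ei]]|Ni]; last first.
    by exists r0; split=> // i iX Ei; case: Ni; exists i.
  have qC := qX iX; set q := app qf i in qC; have PDd := it_PO IT Ik ds; have POk := it_PO IT Ik kk.
  have Tr0 := tl_cond IT Ik d kk r0C; have c0C := cat_cond IT Ik kk ds qC Tr0.
  case: (Dp_dense iX c0C) => t [tc Dt]; have tC := le_l tc; pose q1 := restr t d; have q1C : q1 ε C d := cond_restr IT kk tC dk.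
  have q1q : le d q1 q := le_head IT Ik kk ds qC tc.
  have tS b p : b ε k -> p ε C b -> p ⊩[b] app t b ∈ S b by move=> bk pC; apply: (it_names IT bk _ pC); exact: (cond_names IT kk tC bk).
  have r0S b p : b ε k -> p ε C b -> p ⊩[b] app r0 b ∈ S b by move=> bk pC; apply: (it_names IT bk _ pC); exact: (cond_names IT kk r0C bk).
  pose Xb b := sep (C b) (fun x => le d (restr x d) q1).
  have DX : DTerm (fun e => Xb (e 0)) by have D := it_DC IT; have D' := it_DO IT; rewrite /Xb; apply: DTerm_sep; [def|def].
  have inX b x : x ε Xb b <-> x ε C b /\ le d (restr x d) q1 by apply: in_sep; def.
  pose Mx b s := (forall x, x ε Xb b -> forces_eq (C b) (O b) x s (app t b)) /\
    (forall x, x ε C b -> (forall y z, le b y x -> z ε Xb b -> ~ le b y z) -> forces_eq (C b) (O b) x s (app r0 b)).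
  have DM : Def (fun e => Mx (e 0) (e 1)) by have D := it_DC IT; have D' := it_DO IT; rewrite /Mx; def.
  have DN := it_DN IT.
  case: (@choice_map _ (fun b s => s ε N b /\ (b ε d -> s = app u b) /\ (~ b ε d -> Mx b s)) k) => [|b bk|r [fr Hr]].
  - apply: Def_and; first def. apply: Def_and; first def. apply: Def_imp; first def. by apply: (@Def_2 _ Mx _ _ DM); def.
  - case: (classic (b ε d)) => bd; first by exists (app u b); split=> //; case: Hu => _ /(_ b bk) [].
    have [s [sN [K1 K2]]] := @mixing _ _ _ _ _ _ _ IT Ik b bk (Xb b) (app t b) (app r0 b) (fun p => tS b p bk) (fun p => r0S b p bk).
    by exists s; split=> //; split=> // _; split=> // x xX; apply: K1 => //; case/inX: xX.
  have rN b : b ε k -> app r b ε N b by move=> /Hr [].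
  have r1 b : b ε d -> app r b = app u b by move=> bd; case: (Hr b (dsub bd)) => _ [K _]; exact: K.
  (* One of the two cases of the mixture applies densely often, which is enough for statements about
     forcing. *)
  have dich b p : b ε k -> ~ b ε d -> p ε C b -> exists p', le b p' p /\ ((p' ε Xb b /\ forces_eq (C b) (O b) p' (app r b) (app t b)) \/ forces_eq (C b) (O b) p' (app r b) (app r0 b)).
    move=> bk nb pC; have PO := it_POk IT Ik bk; case: (Hr b bk) => _ [_ /(_ nb) [M1 M2]].
    case: (classic (exists y z, le b y p /\ z ε Xb b /\ le b y z)) => [[y [z [yp [zX yz]]]]|K]; last first.
      by exists p; split; [exact: (le_refl PO)|right; apply: M2 => // y z yp zX yz; apply: K; exists y, z].
    have yX : y ε Xb b.
      apply/inX; split; first exact: le_l yp. move: zX => /inX [_ zq]; apply: (le_trans PDd _ zq).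
      have [db|E1] : d ε b \/ d = b by case: (ord_tot (ord_in ok bk) od) => [//|[->|db]]; [right|left].
        exact: (le_restr IT Ik (k_suc bk) yz db).
      subst b; rewrite (restr_all (cond_fun IT ds (le_l yz))) (restr_all (cond_fun IT ds (le_r yz))); exact: yz.
    by exists y; split=> //; left; split=> //; exact: M1.
  have rC : r ε C k.
    apply/(cond_flat IT Ik _ kk); split=> //; split=> // h' hk' Ih'; have oh' := ord_in (ord_suc ok) hk'.
    case: (classic (d ε h')) => dh; last first.
      exists omega; split; first by case: Ih' => -[]. move=> b bh _; have bd : b ε d by exact: (ord_nin od oh' dh).
      by rewrite r1 //; case: Hu => _ /(_ b (dsub bd)) [].
    move: (tC) (r0C) => /(cond_flat IT Ik _ kk) [_ [_ /(_ h' hk' Ih') [c1 [ch1 Kt]]]] /(cond_flat IT Ik _ kk) [_ [_ /(_ h' hk' Ih') [c2 [ch2 K0]]]].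
    case: (max_in oh' ch1 ch2) => m1 [mh1 [M1 M2]]; case: (max_in oh' mh1 dh) => m [mh [M3 M4]]; exists m; split=> // b bh nb p pC.
    have bk := k_sub Ik hk' bh; have PO := it_POk IT Ik bk; apply: (forces_dense PO pC) => p1 pp.
    have nd : ~ b ε d by move=> /M4. have p1C := le_l pp.
    case: (dich b p1 bk nd p1C) => p2 [p21 [[_ K]|K]]; exists p2; split=> //; apply: (emp_subst PO (feq_sym K)).
      by apply: Kt => //; [move=> /M1 /M3|exact: le_l p21].
    by apply: K0 => //; [move=> /M2 /M3|exact: le_l p21].
  have rd : restr r d = one u d.
    apply: (@fun_ext _ _ _ d); [exact: restr_fun fr dsub|exact: restr_fun fu dsub|move=> x xd].
    by rewrite (app_restr fr dsub xd) (app_restr fu dsub xd) r1.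
  have Xr b x : b ε k -> ~ b ε d -> x ε C b -> le d (restr x d) q1 -> forces_eq (C b) (O b) x (app r b) (app t b).
    by move=> bk nb xC xq; case: (Hr b bk) => _ [_ /(_ nb) [M1 _]]; apply: M1; apply/inX.
  have dle b : b ε k -> ~ b ε d -> d ε b \/ d = b by move=> bk nb; case: (ord_tot (ord_in ok bk) od) => [//|[->|db]]; [right|left].
  have Plow c : c ε k -> ~ c ε d -> Pin c (restr r c) (app r c) (app r0 c).
    move=> ck nc; have PO := it_POk IT Ik ck; have xC := cond_restr IT kk rC ck; have cs := k_suc ck; apply: (forces_dense PO xC) => x xr; have xC' := le_l xr.
    case: (dich c x ck nc xC') => p [px [[/inX [pC pq] K]|K]]; exists p; split=> //; last first.
      have pC := le_l px; apply: (pin_subst PO (feq_sym K) (feq_refl PO _ _)); exact: (st_refl IT ck PO pC (r0S c p ck pC)).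
    apply: (pin_subst PO (feq_sym K) (feq_refl PO _ _)).
    (* Below [d] this is the choice of [p] under [q1]. From [d] on, [p] is below [restr r c], whose
       coordinates agree with those of [t] at such conditions. *)
    have pt : le c p (restr t c).
      apply/(leE IT _ _ cs); split=> //; split; first exact: (cond_restr IT kk tC ck). move=> c' cc; have ck' := ord_trans ok ck cc; have csub := ord_subs ok ck.
      have oc := ord_in ok ck; have PO' := it_POk IT Ik ck'; have p'C := cond_restr IT cs pC cc.
      rewrite (app_restr (cond_fun IT kk tC) csub cc); case: (classic (c' ε d)) => cd.
        move: pq => /(leE IT _ _ ds) [_ [_ /(_ c' cd)]]; rewrite (restr_restr _ (ord_subs od cd)) /q1 (app_restr (cond_fun IT kk tC) dsub cd).
        by rewrite (app_restr (cond_fun IT cs pC)) //; case: (dle c ck nc) => [dc|<- //]; exact: (ord_subs oc).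
      have pr : le c p (restr r c) := le_trans PO px xr.
      move: pr => /(leE IT _ _ cs) [_ [_ /(_ c' cc)]]; rewrite (app_restr fr csub cc); apply: (pin_subst PO' (feq_refl PO' _ _)).
      apply: (Xr c' _ ck' cd p'C); rewrite restr_restr //; case: (dle c' ck' cd) => [dc|<- //]; exact: (ord_subs (ord_in oc cc)).
    exact: (forces_mono PO pt (le_tail IT kk ds tc ck nc)).
  have rr0 : le k r r0.
    apply/(leE IT _ _ kk); split=> //; split=> // c ck; case: (classic (c ε d)) => cd; last exact: Plow.
    have E1 : app r0 c = app u c by rewrite -(app_restr (cond_fun IT kk r0C) dsub cd) r0d; exact: (app_restr fu dsub cd).
    have PO := it_POk IT Ik ck; have xC := cond_restr IT kk rC ck; rewrite E1 -r1 //; apply: (st_refl IT ck PO xC); exact: (it_names IT ck (rN c ck) xC).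
  exists r; split; [split=> //; split=> //; split; last split|].
  - by move=> s sa; apply: (le_trans POk rr0); exact: r0h.
  - move=> b Eb; have nb : ~ b ε d by case: Eb => ->; [move=> /mem_irr|move=> K; case: (mem_asym K (suc_self d))].
    have bk : b ε k by case: Eb => -> //; exact: (wc_suc Hk).
    have PO := it_POk IT Ik bk; apply: (st_trans IT bk PO (cond_restr IT kk rC bk) (Plow b bk nb)).
    exact: (forces_mono PO (le_restr IT Ik kk rr0 bk) (r0m b Eb)).
  - move=> b bk db x xr; have PO := it_POk IT Ik bk; have x0 := le_trans PO xr (le_restr IT Ik kk rr0 bk).
    have nb : ~ b ε d by move=> bd; case: (mem_asym (ord_trans od bd db) (suc_self d)).
    have P1 := forces_mono PO xr (Plow b bk nb).
    have H := proj1 (@forces_ex _ (C b) (O b) x (fun v => pair_in (sq b h a) v (app gs b) ∧ pair_in (app r0 b) v (R b))) (r0g b bk db x x0).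
    apply: (proj2 (@forces_ex _ (C b) (O b) x (fun v => pair_in (sq b h a) v (app gs b) ∧ pair_in (app r b) v (R b)))) => y yx; case: (H y yx) => z [v [zy K]]; move: K => /forces_and [K1 K2].
    exists z, v; split; first exact: zy. apply/forces_and; split; first exact: K1. apply: (st_trans IT bk PO (le_l zy) _ K2).
    exact: (forces_mono PO (le_trans PO zy yx) P1).
  - move=> i' iX' Ei'; have ? : i' = i by apply: jinj => //; rewrite Ei. subst i'; exists q1; split=> //.
    have Tr := tl_cond IT Ik d kk rC; have cC := cat_cond IT Ik kk ds q1C Tr; apply: (Dp_down (t := t)) => //.
    apply/(leE IT _ _ kk); split=> //; split=> // c ck; have PO := it_POk IT Ik ck; have xC := cond_restr IT kk cC ck.
    case: (classic (c ε d)) => cd.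
      rewrite cat_l // /q1 (app_restr (cond_fun IT kk tC) dsub cd); apply: (st_refl IT ck PO xC); exact: tS.
    rewrite cat_r //; apply: (pin_subst PO (feq_sym (Xr c _ ck cd xC _)) (feq_refl PO _ _) (st_refl IT ck PO xC (tS c _ ck xC))).
    have -> : restr (restr (cat q1 r d k) c) d = q1; last exact: (le_refl PDd).
    rewrite restr_restr; first by case: (dle c ck cd) => [dc|<- //]; exact: (ord_subs (ord_in ok ck)).
    exact: (restr_cat _ (cond_fun IT ds q1C) dsub).
Qed.
Lemma step_ex : exists r, Step h a r.
Proof. by case: tail_ex => r /task_ex. Qed.
End Extend.

(** As [r] is trivial below [d], putting a head in front of it gives a condition below [r] itself,
    and the comparison with [r'] carries over. *)
Lemma cat_tail_le q r r' : q ε C d -> restr r d = one u d -> le k r r' -> le k (cat2 q r) (cat2 q r').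
Proof.
  move=> qC rd rr; have rC := le_l rr; have rC' := le_r rr; have Tr := tl_cond IT Ik d kk rC; have Tr' := tl_cond IT Ik d kk rC'.
  have cC : cat2 q r ε C k := cat_cond IT Ik kk ds qC Tr.
  have cr : le k (cat2 q r) r.
    apply/(leE IT _ _ kk); split=> //; split=> // b bk; have PO := it_POk IT Ik bk; have xC := cond_restr IT kk cC bk; case: (classic (b ε d)) => bd.
      have -> : app r b = app u b by rewrite -(app_restr (cond_fun IT kk rC) dsub bd) rd; exact: (app_restr fu dsub bd).
      apply: (le_empty IT Ik bk xC); last by case: Hu => _ /(_ b bk) [].
      exact: (it_names IT bk (cond_names IT kk cC bk) xC).
    rewrite /cat2 cat_r //; apply: (st_refl IT bk PO xC); exact: (it_names IT bk (cond_names IT kk rC bk) xC).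
  apply: (le_cat IT Ik kk ds) => //.
    rewrite /cat2 (restr_cat _ (cond_fun IT ds qC) dsub); exact: (le_refl (it_PO IT Ik ds) qC).
  move=> b bk nb; rewrite /cat2 cat_r //; move: rr => /(leE IT _ _ kk) [_ [_ /(_ b bk) K]].
  exact: (forces_mono (it_POk IT Ik bk) (le_restr IT Ik kk cr bk) K).
Qed.

(** Steps are indexed by [a] in [suc d]; the tail of the last step [d] is below all earlier ones,
    and by downward closure of the dense sets it inherits what each step achieved for its task. *)
Lemma distributive0 : exists r, r ε C k /\ restr r d = one u d /\ forall i, i ε X -> exists q', le d q' (app qf i) /\ Dp i (cat2 q' r).
Proof.
  have DSt := Def_Step.
  pose Zs := sep (pow (prod (suc d) (C k))) (fun h => exists a, a ε suc d /\ isfun h a).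
  have inZ h : h ε Zs <-> h ε pow (prod (suc d) (C k)) /\ exists a, a ε suc d /\ isfun h a by apply: in_sep; rewrite /isfun; def.
  (* The length [a] is the domain of [h], so a choice depending on [h] alone is enough. *)
  case: (@choice_map _ (fun h r => forall a, a ε suc d -> Good h a -> Step h a r) Zs) => [|h _|ch [_ Hch]].
  - rewrite /Good /isfun; apply: Def_all; apply: Def_imp; first def. apply: Def_imp; last by apply: (@Def_3 _ Step _ _ _ DSt); def.
    apply: Def_and; first def. apply: Def_all; apply: Def_imp; first def. by apply: (@Def_3 _ Step _ _ _ DSt); def.
  - case: (classic (exists a, a ε suc d /\ Good h a)) => [[a [ad Ga]]|K]; last by exists h => a ad Ga; case: K; exists a.
    case: (step_ex ad Ga) => r Hr; exists r => a' ad' Ga'; have -> // : a' = a.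
    by rewrite -(dom_isfun (proj1 Ga)) -(dom_isfun (proj1 Ga')).
  have [rr [Drr Err]] : exists rr : V -> V, DTerm (fun e => rr (e 0)) /\ forall a, rr a = app ch (lam a rr).
    have DG : DTerm (fun e : nat -> V => (fun _ hh => app ch hh) (e 0) (e 1)) by def.
    exists (rec (fun _ hh => app ch hh)); split; [exact: (D_rec0 DG)|move=> a; exact: (rec_eq DG)].
  have Cl : forall a, a ε suc d -> Step (lam a rr) a (rr a).
    elim/(well_founded_ind (zfc_wf (z := V))) => a IH ad; have oa := ord_in (ord_suc od) ad.
    have sad s : s ε a -> s ε suc d by move=> sa; exact: ord_trans (ord_suc od) ad sa.
    have Ga : Good (lam a rr) a.
      split; first exact: lam_fun. move=> s sa; rewrite (restr_lam Drr (ord_subs oa sa)) (app_lam Drr sa); exact: (IH s sa (sad s sa)).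
    rewrite Err; apply: Hch => //; apply/inZ; split; last by exists a; split=> //; exact: lam_fun.
    apply/in_pow => z /(in_lam _ Drr) [s [sa ->]]; apply/pair_prod; split; first exact: sad. by case: (IH s sa (sad s sa)) => -[].
  case: (Cl d (suc_self d)) => -[rC [rd [rl _]]] _; exists (rr d); split=> //; split=> // i iX.
  have jd : app j i ε d by case: jX => _; apply.
  have js : app j i ε suc d by rewrite in_suc; left.
  case: (Cl (app j i) js) => _ /(_ i iX (eq_refl _)) [q' [qq Dq]]; exists q'; split=> //; apply: Dp_down Dq.
  apply: cat_tail_le => //; first exact: le_l qq. by move: (rl (app j i) jd); rewrite (app_lam Drr jd).
Qed.
End Distributive.

Section DistributiveMain.
Variables (V : zfc_model) (k : V) (C O N S R : V -> V).
Hypothesis IT : iter_ok k C O N S R.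
Hypothesis Hk : wcomp k.
Variable u : V.
Hypothesis Hu : isfun u k /\ forall b, b ε k -> app u b ε N b /\ Em C O b (app u b).
Variable d : V.
Hypothesis dk : d ε k.
Hypothesis Id : inacc d.

Lemma distributive (X j qf : V) (Dp : V -> V -> Prop) : into j X d -> inj j X -> (forall i, i ε X -> app qf i ε C d) ->
  Def (fun e => Dp (e 0) (e 1)) -> (forall i t, i ε X -> t ε C k -> exists t', below (C k) (O k) t' t /\ Dp i t') ->
  (forall i t t', below (C k) (O k) t' t -> Dp i t -> Dp i t') ->
  exists r, r ε C k /\ restr r d = one u d /\ forall i, i ε X -> exists q', below (C d) (O d) q' (app qf i) /\ Dp i (cat q' r d k).
Proof.
  move=> H1 H2 H3 H4 H5 H6; have Ik := wc_inacc Hk; have DP := Def_Pin IT; have D1 := it_DC IT; have D2 := it_DN IT; have D3 := it_DO IT; have D4 := it_DS IT; have D5 := it_DR IT.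
  case: (@choice_map _ (fun b m => m ε N b /\ forall p x, p ε C b -> Pin C O R b p x m -> Pin C O R b p m x) k) => [|b bk|ms [_ Hms]].
  - apply: Def_and; first def. do 2 apply: Def_all; apply: Def_imp; first def. apply: Def_imp; apply: (@Def_4 _ (Pin C O R) _ _ _ _ DP); def.
  - exact: (min_name IT Ik bk).
  pose Sg b h := forall p, p ε C b -> forces (C b) (O b) p (strategy_reply (S b) (R b) (chk (C b) (suc d)) h).
  have DSg : Def (fun e => Sg (e 0) (e 1)).
    rewrite /Sg; apply: Def_all; apply: Def_imp; first def.
    apply: (@Def_forces V (deep 4 0 (strategy_reply 0 1 2 3)) (fun e => C (e 1)) (fun e => O (e 1)) (fun e => e 0) (fun e => lenv (e 0) (cons (S (e 1)) (cons (R (e 1)) (cons (chk (C (e 1)) (suc d)) (cons (e 2) nil)))))); [def|def|def|].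
    by case=> [|[|[|[|n]]]] /=; def.
  case: (@choice_map _ (fun b h => suc d ε b -> Sg b h) k) => [|b bk|gs [_ Hgs]].
  - by apply: Def_imp; [def|apply: (@Def_2 _ Sg _ _ DSg); def].
  - case: (classic (suc d ε b)) => db; last by exists b.
    by case: (strategy_name IT Ik bk (lim_d Hk dk Id) db) => h Hh; exists h.
  have [r [rC [rd Hr]]] := @distributive0 V k C O N S R IT Hk u Hu d dk gs ms Hms Hgs X j qf H1 H2 H3 Dp H4 H5 H6.
  by exists r; split; [exact rC|split; [exact rd|exact Hr]].
Qed.
End DistributiveMain.

(** * Weak compactness in the extension *)

(** View [c] as a sequence of sets, the [d]-th one consisting of the [b] with [(b, d)] in [c]. Then
    [A] is a cluster point: each of its initial segments agrees with that of cofinally many members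
    of the sequence. *)
Definition star X (k : X) : fml X := ∀ c, ∃ A, ∀[a ∈ k] ∀[t ∈ k] ∃[d ∈ k] (t ∈ d ∧ ∀[b ∈ a] b ∈ A ⇔ pair_in b d c).
Definition omega_bdd X (w : X) : fml X := lim_bdd w ∧ ∀[y ∈ w] ¬ lim_bdd y.

(** * Existence of cluster points implies weak compactness *)

Section Final.
Variable M : zf.
Implicit Types (a b c d k x y z g h A : M).

Lemma unbdd_injs k h : ord k -> reg k -> unbdd k h -> injs k h.
Proof.
  move=> ok rk [hk uh]; have oh x : x ε h -> ord x by move=> /hk; exact: ord_in.
  pose Q i f x := x ε h /\ (forall j, j ε i -> app f j ε x).
  have DQ : Def (fun e => Q (e 0) (e 1) (e 2)) by rewrite /Q; def.
  pose G i f := iota (fun x => Q i f x /\ forall y, y ε x -> ~ Q i f y).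
  have DG : DTerm (fun e => G (e 0) (e 1)) by rewrite /G; def.
  have [F [DF EF]] : exists F : M -> M, DTerm (fun e => F (e 0)) /\ forall i, F i = G i (lam i F).
    by exists (rec G); split; [exact: (D_rec0 DG)|move=> i; exact: (rec_eq DG)].
  have H i : i ε k -> F i ε h /\ forall j, j ε i -> F j ε F i.
    move: i; apply: (@ind _ (fun i => i ε k -> F i ε h /\ forall j, j ε i -> F j ε F i)) => [|i IH ik]; first def.
    have Fk j : j ε i -> F j ε k by move=> ji; case: (IH j ji (ord_trans ok ik ji)) => /hk.
    have aF j : j ε i -> app (lam i F) j = F j by exact: app_lam.
    have [x Hx] : exists x, Q i (lam i F) x.
      case: (reg_bound rk DF ik Fk) => b [bk Hb]; case: (uh b bk) => x [xh bx]; exists x; split=> // j ji; rewrite aF //.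
      exact: ord_trans (oh x xh) bx (Hb j ji).
    case: (@ord_least _ (Q i (lam i F))) => [||x0 [ox [Qx mx]]]; first def.
      by exists x; split=> //; case: Hx => /oh.
    have E1 : F i = x0.
      rewrite EF; apply: iota_eq => // y [Qy my]; have oy : ord y by case: Qy => /oh.
      by case: (ord_tot oy ox) => [/mx //|[//|/my //]].
    by rewrite E1; case: Qx => K1 K2; split=> // j ji; rewrite -aF //; exact: K2.
  apply: (injs_lam DF) => [x xk|x x' xk xk' E1]; first by case: (H x xk).
  case: (ord_tot (ord_in ok xk) (ord_in ok xk')) => [K|[//|K]].
    by case: (H x' xk') => _ /(_ x K); rewrite E1 => /mem_irr.
  by case: (H x xk) => _ /(_ x' K); rewrite E1 => /mem_irr.
Qed.

Lemma star_wcomp k : ord k -> omega ε k ->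
  (forall c, exists A, forall a, a ε k -> forall t, t ε k -> exists d, d ε k /\ t ε d /\ forall b, b ε a -> (b ε A <-> pair b d ε c)) -> wcomp k.
Proof.
  move=> ok wk H; have e0 : (empty : M) ε k by apply: ord_trans ok wk _; exact: omega0.
  have rk : reg k.
    move=> a ak g [fg gk]; apply: NNPP => N; have oa := ord_in ok ak.
    have N' b : b ε k -> exists x, x ε a /\ ~ app g x ε b.
      move=> bk; apply: NNPP => K; apply: N; exists b; split=> // x xa; apply: NNPP => K'; apply: K; by exists x.
    (* Each [d] is paired with the first [x] at which the unbounded [g] is not below [d]. Some such
       [x] belongs to the cluster point, and then some [d'] above [app g x] is paired with [x] too,
       a contradiction. *)
    pose Q x d := ~ app g x ε d /\ forall y, y ε x -> app g y ε d.
    have DQ : Def (fun e => Q (e 0) (e 1)) by rewrite /Q; def.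
    pose c := sep (prod a k) (fun z => exists x d, z = pair x d /\ Q x d).
    have inc x d : x ε a -> d ε k -> (pair x d ε c <-> Q x d).
      have K z : z ε c <-> z ε prod a k /\ exists x d, z = pair x d /\ Q x d by apply: in_sep; def.
      move=> xa dk; rewrite K; split=> [[_ [x' [d' [/pair_inj [-> ->]]]]] //|Kq]; split; [exact/pair_prod|by exists x, d].
    case: (H c) => A HA; case: (HA a ak empty e0) => d [dk [_ Kd]].
    case: (@ord_least _ (fun x => x ε a /\ ~ app g x ε d)) => [||x [ox [[xa nx] mx]]]; first def.
      by case: (N' d dk) => x [xa K]; exists x; split=> //; exact: ord_in xa.
    have xA : x ε A.
      apply/(Kd x xa); apply/(inc x d xa dk); split=> // y yx; apply: NNPP => K; apply: (mx y yx); split=> //; exact: ord_trans xa yx.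
    case: (HA a ak (app g x) (gk x xa)) => d' [dk' [gd Kd']]; move: xA => /(Kd' x xa) /(inc x d' xa dk') [] //.
  have ck : card k.
    split=> // a ak K; case: (injs_inverse K) => r Hr; pose F i := iota (fun y => (app r i ε k /\ y = app r i) \/ (~ app r i ε k /\ y = empty)).
    have DF : DTerm (fun e => F (e 0)) by rewrite /F; def.
    have F1 i : app r i ε k -> F i = app r i by move=> K1; apply: iota_eq => [|y [[]|[]]] //; left.
    have F2 i : ~ app r i ε k -> F i = empty by move=> K1; apply: iota_eq => [|y [[]|[]]] //; right.
    case: (reg_bound rk DF ak) => [i ia|b [bk Hb]]; first by case: (classic (app r i ε k)) => K1; [rewrite F1|rewrite F2].
    case: (Hr b bk) => i [ia E1]; move: (Hb i ia); rewrite F1 E1 //; exact: mem_irr.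
  split=> // c; case: (H c) => A HA.
  pose n1 : M := suc empty; have n1e : n1 <> empty by move=> E1; move: (suc_self (empty : M)); rewrite -/n1 E1 => /in_empty.
  pose T d f := forall b, b ε d -> app f b = n1 -> (b ε A <-> pair b d ε c).
  have DT : Def (fun e => T (e 0) (e 1)) by rewrite /T; def.
  pose G d f := iota (fun y => (T d f /\ y = n1) \/ (~ T d f /\ y = empty)).
  have DG : DTerm (fun e => G (e 0) (e 1)) by rewrite /G; def.
  have [F [DF EF]] : exists F : M -> M, DTerm (fun e => F (e 0)) /\ forall i, F i = G i (lam i F).
    by exists (rec G); split; [exact: (D_rec0 DG)|move=> i; exact: (rec_eq DG)].
  have G1 d f : T d f -> G d f = n1 by move=> K1; apply: iota_eq => [|y [[]|[]]] //; left.
  have G2 d f : ~ T d f -> G d f = empty by move=> K1; apply: iota_eq => [|y [[]|[]]] //; right.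
  have FE d : F d = n1 <-> forall b, b ε d -> F b = n1 -> (b ε A <-> pair b d ε c).
    have aF b : b ε d -> app (lam d F) b = F b by exact: app_lam.
    rewrite EF; case: (classic (T d (lam d F))) => K; [rewrite G1 //|rewrite G2 //]; split=> //.
      by move=> _ b bd Fb; apply: K => //; rewrite aF.
      by move=> E1; case: n1e.
    by move=> K'; case: K => b bd; rewrite aF //; exact: K'.
  have ubd (P : M -> Prop) (DP : Def (fun e => P (e 0))) : (forall t, t ε k -> exists d, d ε k /\ P d /\ t ε d) -> unbdd k (sep k P).
    move=> K; have inS x : x ε sep k P <-> x ε k /\ P x by exact: in_sep.
    split=> [x /inS [] //|t tk]; case: (K t tk) => d [dk [Pd td]]; exists d; split=> //; exact/inS.
  have uE t : t ε k -> exists d, d ε k /\ F d = n1 /\ t ε d.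
    move=> tk; apply: NNPP => N; have tk1 := card_limit ck wk tk; case: (HA (suc t) tk1 t tk) => d [dk [td Kd]].
    apply: N; case: (@ord_least _ (fun x => x ε k /\ t ε x /\ forall b, b ε suc t -> (b ε A <-> pair b x ε c))) => [||x [ox [[xk [tx Kx]] mx]]]; first def.
      by exists d; split; [exact: (ord_in ok dk)|].
    case: (classic (exists y, y ε x /\ t ε y /\ F y = n1)) => [[y [yx [ty Fy]]]|K]; first by exists y; split=> //; exact: ord_trans ok xk yx.
    exists x; split=> //; split=> //; apply/FE => b bx Fb; apply: Kx; rewrite in_suc.
    case: (ord_tot (ord_in ox bx) (ord_in ok tk)) => [|[|tb]]; [by left|by right|by case: K; exists b].
  have D1 : Def (fun e => F (e 0) = n1 /\ e 0 ε A) by def.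
  have D2 : Def (fun e => F (e 0) = n1 /\ ~ e 0 ε A) by def.
  have hom (P : M -> Prop) (DP : Def (fun e => P (e 0))) : unbdd k (sep k P) -> sep k P ⊆ k /\ injs k (sep k P).
    by move=> K; split; [case: K|exact: unbdd_injs].
  case: (classic (forall t, t ε k -> exists d, d ε k /\ (F d = n1 /\ d ε A) /\ t ε d)) => K.
    have inS x : x ε sep k (fun x => F x = n1 /\ x ε A) <-> x ε k /\ F x = n1 /\ x ε A by exact: (in_sep _ D1).
    case: (hom _ D1 (ubd _ D1 K)) => K1 K2; exists (sep k (fun x => F x = n1 /\ x ε A)); split=> //; split=> //; left.
    by move=> b /inS [_ [Fb _]] a /inS [_ [Fa aA]] ab; move: Fb => /FE /(_ a ab Fa) <-.
  have [t [tk Kt]] : exists t, t ε k /\ forall d, d ε k -> F d = n1 -> t ε d -> ~ d ε A.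
    apply: NNPP => N; apply: K => t tk; apply: NNPP => N'; apply: N; exists t; split=> // d dk Fd td dA; apply: N'; by exists d.
  have K' t' : t' ε k -> exists d, d ε k /\ (F d = n1 /\ ~ d ε A) /\ t' ε d.
    move=> tk'; case: (max_in ok (card_limit ck wk tk) (card_limit ck wk tk')) => m [mk [M1 M2]]; case: (uE m mk) => d [dk [Fd md]]; have od := ord_in ok dk.
    exists d; split=> //; split; [split=> //; apply: Kt => //|]; apply: ord_trans od md _; [apply: M1|apply: M2]; exact: suc_self.
  have inS x : x ε sep k (fun x => F x = n1 /\ ~ x ε A) <-> x ε k /\ F x = n1 /\ ~ x ε A by exact: (in_sep _ D2).
  case: (hom _ D2 (ubd _ D2 K')) => K1 K2; exists (sep k (fun x => F x = n1 /\ ~ x ε A)); split=> //; split=> //; right.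
  by move=> b /inS [_ [Fb _]] a /inS [_ [Fa aA]] ab; move: Fb => /FE /(_ a ab Fa) <-.
Qed.
End Final.

Lemma star_wcompW (W : zf) (e : nat -> W) : sat (@E W) eq (emb (deep 2 0 (ordinal 0 ∧ (1 ∈ 0 ∧ omega_bdd 1) ∧ star 0)) e) ->
  sat (@E W) eq (emb (deep 2 0 (weakly_compact 0)) e).
Proof.
  move=> /sat_and [H1 /sat_and [/sat_and [H2 H3] H4]]; apply: (proj2 (@weakly_compactE W (e 0))).
  have H3' : sat (@E W) eq (omega_bdd (e 1)) := H3; have H4' : sat (@E W) eq (star (e 0)) := H4.
  have Ew : e 1 = omega.
    move: H3' => /sat_and [/lim_bddE K1 /sat_all K2]; apply/is_omegaE; apply/sat_and; split; first exact/limitE.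
    apply/sat_all => y; apply/sat_imp => yw; apply/sat_neg => /limitE K; move: (K2 y) => /sat_imp /(_ yw) /sat_neg; apply; exact/lim_bddE.
  apply: star_wcomp; [exact: (proj1 (@ordinalE W (e 0)) H1)|rewrite -Ew; exact: H2|move=> c].
  move: H4' => /sat_all /(_ c) /sat_ex [A HA]; exists A => a ak t tk.
  move: HA => /sat_all /(_ a) /sat_imp /(_ ak) /sat_all /(_ t) /sat_imp /(_ tk) /sat_ex [d /sat_and [dk /sat_and [td K]]].
  exists d; split=> //; split=> // b ba; move: K => /sat_all /(_ b) /sat_imp /(_ ba) /sat_iff; rewrite pair_inE; exact.
Qed.

(** * The limiting decisions and the name of a cluster point *)

Section Main.
Variables (V : zfc_model) (k : V) (C O N S R : V -> V).
Hypothesis IT : iter_ok k C O N S R.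
Hypothesis Hk : wcomp k.
Variable u : V.
Hypothesis Hu : isfun u k /\ forall b, b ε k -> app u b ε N b /\ Em C O b (app u b).
Implicit Types (g b p q r s t x y a h : V).
Notation le g := (below (C g) (O g)).
Notation supp := (supported k C O).
Notation "p ⊩ a" := (forces (C k) (O k) p a%fml) (at level 100).
Notation ck := (chk (C k)).
Let Ik := wc_inacc Hk.
Let ok := wc_ord Hk.
Let kk : k ε suc k := suc_self k.
Let POk := it_PO IT Ik kk.

Variables e hc : V.
Hypothesis eC : forall i, i ε k -> app e i ε C k.
Hypothesis hk : forall x, x ε k -> app hc x ε k.
Hypothesis He : forall d, d ε k -> inacc d -> (forall x, x ε d -> app hc x ε d) ->
    (forall i, i ε d -> exists a, a ε d /\ supp (app e i) a) /\
    (forall p a, p ε C k -> a ε d -> supp p a -> exists i, i ε d /\ le k (app e i) p /\ le k p (app e i)).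
Variable c : V.

Definition Fp p b d : Prop := p ⊩ pair_in (ck b) (ck d) c.
Definition Fn p b d : Prop := p ⊩ ¬ pair_in (ck b) (ck d) c.
Lemma Def_Fp : Def (fun e => Fp (e 0) (e 1) (e 2)).
Proof.
  apply: (@Def_forces V (deep 3 0 (pair_in 0 1 2)) (fun _ => C k) (fun _ => O k) (fun e => e 0) (fun e => lenv (e 0) (cons (ck (e 1)) (cons (ck (e 2)) (cons c nil))))); [def|def|def|].
  by case=> [|[|[|n]]] /=; def.
Qed.
Lemma Def_Fn : Def (fun e => Fn (e 0) (e 1) (e 2)).
Proof.
  apply: (@Def_forces V (deep 3 0 (¬ pair_in 0 1 2)) (fun _ => C k) (fun _ => O k) (fun e => e 0) (fun e => lenv (e 0) (cons (ck (e 1)) (cons (ck (e 2)) (cons c nil))))); [def|def|def|].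
  by case=> [|[|[|n]]] /=; def.
Qed.
Lemma Fp_mono p q b d : le k q p -> Fp p b d -> Fp q b d. Proof. exact: forces_mono. Qed.
Lemma Fn_mono p q b d : le k q p -> Fn p b d -> Fn q b d. Proof. exact: forces_mono. Qed.
Lemma Fp_Fn p b d : p ε C k -> Fp p b d -> ~ Fn p b d. Proof. exact: forces_con. Qed.

Definition good d : Prop := inacc d /\ forall x, x ε d -> app hc x ε d.
Definition cat3 q r d : V := cat q r d k.
Lemma D_cat3 : DTerm (fun e => cat3 (e 0) (e 1) (e 2)). Proof. by apply: D_cat; def. Qed.
(** The tail [r] reduces the statements about column [d] to [P_d]: heads deciding them together with
    [r] are dense. It suffices to ask for them below the restrictions of the first [d] listed
    conditions, since these are dense in [P_d] for [good] points [d]. *)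
Definition rgood d r : Prop := r ε C k /\ restr r d = one u d /\ forall b x, b ε d -> x ε d ->
  exists q, le d q (restr (app e x) d) /\ (Fp (cat3 q r d) b d \/ Fn (cat3 q r d) b d).

(** The tasks are the pairs [(b, x)] in [d × d]; inaccessibility of [d] indexes them by [d]. *)
Lemma rgood_ex d : d ε k -> good d -> exists r, rgood d r.
Proof.
  move=> dk [Id cl]; have od := ord_in ok dk; case: (inacc_square Id) => j [Hj ij].
  pose Dp i t := exists b x, i = pair b x /\ (Fp t b d \/ Fn t b d).
  have DDp : Def (fun e => Dp (e 0) (e 1)).
    by have D1 := Def_Fp; have D2 := Def_Fn; rewrite /Dp; do 2 apply: Def_ex; apply: Def_and; [def|apply: Def_or; [apply: (@Def_3 _ Fp _ _ _ D1)|apply: (@Def_3 _ Fn _ _ _ D2)]; def].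
  case: (@choice_map _ (fun i q => forall b x, i = pair b x -> q = restr (app e x) d) (prod d d)) => [|i /in_prod [b [x [bd [xd ->]]]]|qf [_ Hqf]]; first def.
    by exists (restr (app e x) d) => b' x' /pair_inj [_ ->].
  case: (@distributive V k C O N S R IT Hk u Hu d dk Id (prod d d) j qf Dp Hj ij) => //.
  - move=> i iX; move: (iX) => /in_prod [b [x [bd [xd Ei]]]]; rewrite (Hqf i iX b x Ei); apply: (cond_restr IT kk _ dk); apply: eC; exact: ord_trans ok dk xd.
  - move=> i t /in_prod [b [x [bd [xd Ei]]]] tC; case: (forces_decide POk (pair_in (ck b) (ck d) c) tC) => t' [tt K]; exists t'; split=> //; by exists b, x.
  - move=> i t t' tt [b [x [Ei [K|K]]]]; exists b, x; split=> //; [left; exact: Fp_mono K|right; exact: Fn_mono K].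
  move=> r [rC [rd Hr]]; exists r; split=> //; split=> // b x bd xd; have iX : pair b x ε prod d d by apply/pair_prod.
  case: (Hr _ iX) => q []; rewrite (Hqf _ iX b x (eq_refl _)) => qq [b' [x' [/pair_inj [<- _] K]]]; by exists q.
Qed.

Variable rd : V.
Hypothesis Hrd : forall d, d ε k -> good d -> rgood d (app rd d).

Definition rcat q d : V := cat3 q (app rd d) d.
Definition posi b x d z : Prop := z ε d /\ le k (app e z) (app e x) /\ Fp (rcat (restr (app e z) d) d) b d.
Lemma D_rcat : DTerm (fun e => rcat (e 0) (e 1)).
Proof. by apply: (@DTerm_3 _ cat3 _ _ _ D_cat3); def. Qed.
Lemma Def_posi : Def (fun e => posi (e 0) (e 1) (e 2) (e 3)).
Proof.
  rewrite /posi; apply: Def_and; first def. apply: Def_and; first def.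
  by apply: (@Def_3 _ Fp _ _ _ Def_Fp); [apply: (@DTerm_2 _ rcat _ _ D_rcat); def|def|def].
Qed.
(** The least index of a positive decision, shifted by one so that 0 can mean that there is none.
    With [z] also [suc z] is below the limit [d], so the value is regressive in [d]. *)
Definition Fv i d : V := iota (fun y => exists b x, i = pair b x /\
  ((exists z, posi b x d z /\ (forall z', z' ε z -> ~ posi b x d z') /\ y = suc z) \/ ((forall z, ~ posi b x d z) /\ y = empty))).
Lemma D_Fv : DTerm (fun e => Fv (e 0) (e 1)).
Proof.
  have D := Def_posi; rewrite /Fv; apply: DTerm_iota; do 2 apply: Def_ex; apply: Def_and; first def. apply: Def_or; last first.
    by apply: Def_and; [apply: Def_all; apply: Def_not; apply: (@Def_4 _ posi _ _ _ _ D); def|def].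
  apply: Def_ex; apply: Def_and; first by apply: (@Def_4 _ posi _ _ _ _ D); def.
  by apply: Def_and; [apply: Def_all; apply: Def_imp; [def|apply: Def_not; apply: (@Def_4 _ posi _ _ _ _ D); def]|def].
Qed.
Lemma Fv_cases b x d : ord d -> (exists z, posi b x d z /\ Fv (pair b x) d = suc z) \/ ((forall z, ~ posi b x d z) /\ Fv (pair b x) d = empty).
Proof.
  move=> od; case: (classic (exists z, posi b x d z)) => [[z0 Hz0]|K]; last first.
    have K' z : ~ posi b x d z by move=> Hz; apply: K; exists z.
    right; split=> //; apply: iota_eq; first by exists b, x; split=> //; right.
    by move=> y [b' [x' [/pair_inj [<- <-] [[z [/K' //]]|[_ ->]]]]].
  case: (@ord_least _ (posi b x d)) => [||z [oz [Hz mz]]].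
  - by apply: (@Def_4 _ posi _ _ _ _ Def_posi); def.
  - by exists z0; split=> //; case: Hz0 => zd _; exact: ord_in od zd.
  left; exists z; split=> //; apply: iota_eq; first by exists b, x; split=> //; left; exists z.
  move=> y [b' [x' [/pair_inj [<- <-] [[z' [Hz' [mz' ->]]]|[K _]]]]]; last by case: (K z).
  have oz' : ord z' by case: Hz' => zd _; exact: ord_in od zd.
  by case: (ord_tot oz oz') => [K|[->|K]] //; [case: (mz' _ K Hz)|case: (mz _ K Hz')].
Qed.

Lemma rcat_cond q d : d ε k -> good d -> q ε C d -> rcat q d ε C k.
Proof. by move=> dk gd qC; case: (Hrd dk gd) => rC _; exact: (cat_cond IT Ik kk (k_suc dk) qC (tl_cond IT Ik d kk rC)). Qed.
Lemma le_rcat q q' d t : d ε k -> good d -> q' ε C d -> le k t (rcat q' d) -> le d (restr t d) q -> le k t (rcat q d).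
Proof.
  move=> dk gd qC' tq tq'; case: (Hrd dk gd) => rC _; apply: (le_cat IT Ik kk (k_suc dk) tq' (le_l tq) (tl_cond IT Ik d kk rC)).
  by move=> b bk nb; exact: (le_tail IT kk (k_suc dk) tq bk nb).
Qed.

(** Suppose some [t] below forces [(b, d)] into [c]. Its head is refined by a listed one, below
    which some [q] decides together with the tail; compatibility with [t] makes this decision
    positive, and a listed refinement of [q] then has a positive index. *)
Lemma no_posi b x d : d ε k -> good d -> b ε d -> x ε d -> (forall z, ~ posi b x d z) -> Fn (rcat (restr (app e x) d) d) b d.
Proof.
  move=> dk gd bd xd Np; case: (gd) => Id cl; have ds := k_suc dk; have od := ord_in ok dk; have xk := ord_trans ok dk xd.
  have xC := cond_restr IT kk (eC xk) dk; have POd := it_PO IT Ik ds; case: (Hrd dk gd) => rC [rdd Hr].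
  apply/forces_neg => t tx Ft; have tC := le_l tx.
  case: (head_in_enum IT Hk Hu He dk Id cl tC) => i [id [_ it]]; case: (Hr b i bd id) => q [qi Hq].
  have qt : le d q (restr t d) := le_trans POd qi it; have qC := le_l qi.
  have wC : cat q u d k ε C k := cat_u_cond IT Hk Hu ds qC; have rw : restr (cat q u d k) d = q := restr_cat u (cond_fun IT ds qC) (ord_subs ok dk).
  have H1 : le d (restr (cat q u d k) d) (restr t d) by rewrite rw.
  case: (compat_cat IT Hk dk wC tC H1) => r1 [r1C [r1c r1t]]; rewrite rw in r1c.
  have r1q : le k r1 (rcat q d).
    apply: (le_rcat dk gd xC (le_trans POk r1t tx)); exact: (le_head IT Ik kk ds qC r1c).
  have Fq : Fp (rcat q d) b d.
    by case: Hq => // Hn; case: (Fp_Fn r1C (Fp_mono r1t Ft)); exact: (Fn_mono r1q Hn).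
  case: (head_in_enum IT Hk Hu He dk Id cl wC) => z [zd [_ zw]]; rewrite rw in zw.
  have zk := ord_trans ok dk zd; apply: (Np z); split=> //; split; last first.
    apply: (Fp_mono _ Fq); exact: (cat_le IT Ik kk ds zw (tl_cond IT Ik d kk rC)).
  case: (He dk Id cl) => E1 _; case: (E1 x xd) => a [ad sa]; have ak := ord_trans ok dk ad.
  apply: (le_cat_supp IT Ik ak (eC xk) sa (eC zk)).
  have H2 : le d (restr (app e z) d) (restr (app e x) d).
    apply: (le_trans POd zw); apply: (le_trans POd qt); exact: (le_head IT Ik kk ds xC tx).
  by move: (le_restr IT Ik ds H2 ad); rewrite !(restr_restr _ (ord_subs od ad)).
Qed.

Variables D lm tm : V.
Hypothesis HD : unbdd k D.
Hypothesis gD : forall d, d ε D -> good d.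
Hypothesis Hlm : forall b x, b ε k -> x ε k -> app tm (pair b x) ε k /\
  forall d, d ε D -> app tm (pair b x) ε d -> Fv (pair b x) d = app lm (pair b x).

Fixpoint all_in (l : list V) d : Prop := match l with nil => True | cons x l => x ε d /\ all_in l d end.
Lemma D_above l : all_in l k -> exists d, d ε k /\ d ε D /\ good d /\ all_in l d.
Proof.
  move=> H; have [m [mk Hm]] : exists m, m ε k /\ forall d, ord d -> m ε d -> all_in l d.
    elim: l H => [_|x l IH [xk /IH [m [mk Hm]]]]; first by exists omega; split=> //; exact: wc_omega.
    case: (max_in ok (wc_suc Hk xk) (wc_suc Hk mk)) => m' [mk' [M1 M2]]; exists m'; split=> // d od md.
    split; last apply: Hm => //; apply: ord_trans od md _; [apply: M1|apply: M2]; exact: suc_self.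
  case: HD => Dk uD; case: (uD m mk) => d [dD md]; exists d; split; first exact: Dk. split=> //; split; first exact: gD.
  by apply: Hm => //; exact: (ord_in ok (Dk d dD)).
Qed.

Lemma lm_cases b x : b ε k -> x ε k -> (exists z, z ε k /\ app lm (pair b x) = suc z /\ le k (app e z) (app e x)) \/ app lm (pair b x) = empty.
Proof.
  move=> bk xk; case: (Hlm bk xk) => tk Ht; case: (@D_above (cons (app tm (pair b x)) nil)) => // d [dk [dD [_ [td _]]]].
  rewrite -(Ht d dD td); case: (Fv_cases b x (ord_in ok dk)) => [[z [[zd [zx _]] ->]]|[_ ->]]; [left|by right].
  by exists z; split=> //; exact: ord_trans ok dk zd.
Qed.
(** The index of the condition at which the limiting decision about [b] below the [x]-th condition
    takes effect: the coded one if positive, [x] itself if negative. *)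
Definition hv b x : V := iota (fun y => app lm (pair b x) = suc y \/ (app lm (pair b x) = empty /\ y = x)).
Lemma D_hv : DTerm (fun e => hv (e 0) (e 1)). Proof. rewrite /hv; def. Qed.
Lemma suc_ne z : suc z <> (empty : V). Proof. by move=> E1; move: (suc_self z); rewrite E1 => /in_empty. Qed.
Lemma hv1 b x z : app lm (pair b x) = suc z -> hv b x = z.
Proof. by move=> E1; apply: iota_eq => [|y [|[]]]; [left|rewrite E1 => /suc_inj|rewrite E1 => /suc_ne]. Qed.
Lemma hv2 b x : app lm (pair b x) = empty -> hv b x = x.
Proof. by move=> E1; apply: iota_eq => [|y [|[]]] //; [right|rewrite E1 => K; case: (suc_ne (eq_sym K))]. Qed.
Lemma hv_le b x : b ε k -> x ε k -> hv b x ε k /\ le k (app e (hv b x)) (app e x).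
Proof.
  move=> bk xk; case: (lm_cases bk xk) => [[z [zk [E1 zx]]]|E1]; first by rewrite (hv1 E1).
  by rewrite (hv2 E1); split=> //; apply: (le_refl POk); exact: eC.
Qed.
Lemma hv_predense b : b ε k -> exists g, g ε k /\ forall p, p ε C k -> exists x r, x ε g /\ le k r p /\ le k r (app e (hv b x)).
Proof.
  move=> bk; have Dh : DTerm (fun e => hv b (e 0)) by apply: (DTerm_2 D_hv); def.
  case: (@predense V k C O N S R IT Hk u Hu e hc eC hk He (lam k (hv b))) => [x xk|g [gk Hg]].
    by rewrite (app_lam Dh xk); exact: hv_le.
  exists g; split=> // p pC; case: (Hg p pC) => x [r [xg [rp rx]]]; exists x, r; split=> //; split=> //.
  by move: rx; rewrite (app_lam Dh (ord_trans ok gk xg)).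
Qed.

Definition An : V := sep (prod (img k ck) (C k)) (fun z => exists b x y, b ε k /\ x ε k /\ y ε k /\ app lm (pair b x) = suc y /\ z = pair (ck b) (app e y)).
Lemma in_An w q : pair w q ε An <-> exists b x y, b ε k /\ x ε k /\ y ε k /\ app lm (pair b x) = suc y /\ w = ck b /\ q = app e y.
Proof.
  have Dc : DTerm (fun e => ck (e 0)) by def.
  have K z : z ε An <-> z ε prod (img k ck) (C k) /\ exists b x y, b ε k /\ x ε k /\ y ε k /\ app lm (pair b x) = suc y /\ z = pair (ck b) (app e y) by apply: in_sep; def.
  rewrite K; split=> [[_ [b [x [y [bk [xk [yk [E1 /pair_inj [-> ->]]]]]]]]]|[b [x [y [bk [xk [yk [E1 [-> ->]]]]]]]]]; first by exists b, x, y.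
  split; last by exists b, x, y. by apply/pair_prod; split; [apply/(in_img _ Dc); exists b|exact: eC].
Qed.

Lemma lm_above b x d : b ε k -> x ε k -> d ε D -> app tm (pair b x) ε d -> d ε k -> b ε d -> x ε d ->
  (exists z, z ε k /\ app lm (pair b x) = suc z /\ Fp (rcat (restr (app e z) d) d) b d) \/ (app lm (pair b x) = empty /\ Fn (rcat (restr (app e x) d) d) b d).
Proof.
  move=> bk xk dD td dk bd xd; case: (Hlm bk xk) => _ /(_ d dD td) <-; case: (Fv_cases b x (ord_in ok dk)) => [[z [[zd [_ K]] ->]]|[K ->]]; [left|right].
    by exists z; split=> //; exact: ord_trans ok dk zd.
  by split=> //; exact: (no_posi dk (gD dD) bd xd K).
Qed.

(** A negative decision at [x] excludes a positive one at a compatible [x']: for large [d] in [D]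
    both are actual decisions about [(b, d)], and a common extension joined with the tail of [d]
    would force both. *)
Lemma not_in_An b x r : b ε k -> x ε k -> app lm (pair b x) = empty -> le k r (app e x) -> r ⊩ ¬ ck b ∈ An.
Proof.
  move=> bk xk E0 rx; apply/forces_neg => s sr /memE /(_ s (le_ll POk sr)) [s1 [t' [q [s1s [tq [s1q K]]]]]].
  move: tq => /in_An [b' [x' [y [bk' [xk' [yk [E1 [Et Eq]]]]]]]]; subst t' q; have ? := chk_inj POk (le_l s1s) K; subst b'.
  case: (Hlm bk xk) (Hlm bk xk') => t1 _ [t2 _].
  case: (@D_above (cons (app tm (pair b x)) (cons (app tm (pair b x')) (cons b (cons x (cons x' nil)))))) => // d [dk [dD [gd [h1 [h2 [bd [xd [xd' _]]]]]]]].
  have s1C := le_l s1s; have ds := k_suc dk; have sC := cond_restr IT kk s1C dk; have wC := rcat_cond dk gd sC.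
  have T := tl_cond IT Ik d kk (proj1 (Hrd dk gd)).
  have up z : z ε k -> le k s1 (app e z) -> le k (rcat (restr s1 d) d) (rcat (restr (app e z) d) d).
    by move=> zk sz; exact: (cat_le IT Ik kk ds (le_restr IT Ik kk sz dk) T).
  have l1 := le_trans POk s1s (le_trans POk sr rx).
  case: (lm_above bk xk dD h1 dk bd xd) => [[z [_ [E2 _]]]|[_ Kn]]; first by move: E2; rewrite E0 => E2; case: (suc_ne (eq_sym E2)).
  case: (lm_above bk xk' dD h2 dk bd xd') => [[z [zk [E2 Kp]]]|[E2 _]]; last by move: E2; rewrite E1 => /suc_ne.
  move: E2; rewrite E1 => /suc_inj E2; subst z.
  exact: (Fp_Fn wC (Fp_mono (up y yk s1q) Kp) (Fn_mono (up x xk l1) Kn)).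
Qed.

Lemma decide b x d r q : b ε k -> x ε k -> d ε D -> app tm (pair b x) ε d -> d ε k -> b ε d -> x ε d -> q ε C d ->
  le k r (rcat q d) -> le k r (app e (hv b x)) -> ((r ⊩ ck b ∈ An) /\ Fp r b d) \/ ((r ⊩ ¬ ck b ∈ An) /\ Fn r b d).
Proof.
  move=> bk xk dD td dk bd xd qC rq rx; have gd := gD dD; have rC := le_l rq.
  case: (lm_above bk xk dD td dk bd xd) => [[z [zk [E1 K]]]|[E1 K]]; [left|right].
    rewrite (hv1 E1) in rx; split; first by apply: (mem_intro POk (b := app e z)) => //; apply/in_An; exists b, x, z.
    apply: (Fp_mono _ K); apply: (le_rcat dk gd qC rq); exact: (le_restr IT Ik kk rx dk).
  rewrite (hv2 E1) in rx; split; first exact: (not_in_An bk xk E1 rx).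
  apply: (Fn_mono _ K); apply: (le_rcat dk gd qC rq); exact: (le_restr IT Ik kk rx dk).
Qed.

(** For each [b < a] the chain condition leaves boundedly many indices [x] whose decisions are
    predense, and by regularity one bound [G] serves all [b < a]. Some [d] in [D] exceeds all
    convergence thresholds for [a × G]. Below [p] extended by the tail of this [d], the limiting
    decisions and column [d] agree on [a]. *)
Lemma homogeneous p a t : p ε C k -> a ε k -> t ε k -> exists p' d, le k p' p /\ d ε k /\ t ε d /\
  forall b, b ε a -> forall q, le k q p' -> exists r, le k r q /\ (((r ⊩ ck b ∈ An) /\ Fp r b d) \/ ((r ⊩ ¬ ck b ∈ An) /\ Fn r b d)).
Proof.
  move=> pC ak tk; have oa := ord_in ok ak.
  case: (@choice_map _ (fun b g => g ε k /\ forall p, p ε C k -> exists x r, x ε g /\ le k r p /\ le k r (app e (hv b x))) a) => [|b ba|gm [_ Hgm]].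
  - by have D1 := D_hv; def.
  - by apply: hv_predense; exact: ord_trans ok ak ba.
  have Dg : DTerm (fun e => app gm (e 0)) by def.
  case: (reg_bound (wc_reg Hk) Dg ak (fun b ba => proj1 (Hgm b ba))) => G [Gk HG].
  have Dt : DTerm (fun e => app tm (e 0)) by def.
  have sm : small k (prod a G) by apply: small_prod => //; [exact: wc_slim|exact: small_elem|exact: small_elem].
  case: (@small_bound _ k (prod a G) (app tm) (wc_reg Hk) Dt ok sm (wc_ne Hk)) => [i /in_prod [b [x [ba [xG ->]]]]|T [Tk HT]].
    by case: (@Hlm b x) => //; [exact: ord_trans ok ak ba|exact: ord_trans ok Gk xG].
  case: (supp_ex IT Ik pC) => a0 [a0k sp].
  case: (@D_above (cons T (cons G (cons a (cons t (cons a0 nil)))))) => // d [dk [dD [gd [Td [Gd [ad [td [a0d _]]]]]]]].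
  have ds := k_suc dk; have od := ord_in ok dk; have rC := cond_restr IT kk pC dk; have wC := rcat_cond dk gd rC.
  exists (rcat (restr p d) d), d; split; last split=> //; last split=> //.
    (* Since [d] is beyond the support bound [a0], replacing the coordinates of [p] from [d] on by
       the tail strengthens [p]. *)
    apply: (le_cat_supp IT Ik a0k pC sp wC).
    have -> : restr (rcat (restr p d) d) a0 = restr p a0.
      rewrite /rcat /cat3 restr_cat_l; [exact: (cond_fun IT ds rC)|exact: (ord_subs ok dk)|exact: (ord_subs od a0d)|].
      by rewrite (restr_restr _ (ord_subs od a0d)).
    exact: (le_refl (it_PO IT Ik (k_suc a0k)) (cond_restr IT kk pC a0k)).
  move=> b ba q qp; have bk := ord_trans ok ak ba; case: (Hgm b ba) => gk Hg; case: (Hg q (le_l qp)) => x [r [xg [rq rx]]]; exists r; split=> //.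
  have xG : x ε G by exact: (ord_trans (ord_in ok Gk) (HG b ba) xg).
  apply: (@decide b x d r (restr p d)) => //.
  - exact: ord_trans ok Gk xG.
  - by apply: ord_trans od Td _; apply: HT; apply/pair_prod.
  - exact: ord_trans od ad ba.
  - exact: ord_trans od Gd xG.
  - exact: (le_trans POk rq qp).
Qed.
End Main.

(** * Weak compactness is forced *)

Section Conclusion.
Variables (V : zfc_model) (k : V) (C O N S R : V -> V).
Hypothesis IT : iter_ok k C O N S R.
Hypothesis Hk : wcomp k.
Notation le g := (below (C g) (O g)).
Notation "p ⊩ a" := (forces (C k) (O k) p a%fml) (at level 100).
Notation ck := (chk (C k)).

Lemma star_forced p : p ε C k -> p ⊩ star (ck k).
Proof.
  have Ik := wc_inacc Hk; have ok := wc_ord Hk; have kk := suc_self k; have POk := it_PO IT Ik kk.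
  case: (top_ex IT Ik) => u Hu; case: (enum_ex IT Hk Hu) => e [hc [eC [hk He]]] pC; apply/forces_all => c.
  have Dgood : Def (fun e => good hc (e 0)) by rewrite /good /inacc /card /reg /slim /injs /into /isfun /inj /ord /trans; def.
  have D1 := Def_Fp k C O c; have D2 := Def_Fn k C O c; have D3 := D_cat3 k.
  case: (@choice_map _ (fun d r => good hc d -> rgood k C O u e c d r) k) => [|d dk|rd [_ Hrd]].
  - have D4 := it_DC IT; have D5 := it_DO IT; apply: Def_imp; first by apply: (@Def_1 _ (good hc) _ Dgood); def.
    rewrite /rgood /one; apply: Def_and; first def. apply: Def_and; first def. do 2 apply: Def_all; do 2 (apply: Def_imp; first def).
    apply: Def_ex; apply: Def_and; first def.
    by apply: Def_or; [apply: (@Def_3 _ (Fp k C O c) _ _ _ D1)|apply: (@Def_3 _ (Fn k C O c) _ _ _ D2)]; try (apply: (@DTerm_3 _ (cat3 k) _ _ _ D3)); def.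
  - by case: (classic (good hc d)) => [gd|N0]; [case: (rgood_ex IT Hk Hu eC c dk gd) => r Hr; exists r|exists d].
  have DF := D_Fv k C O e c rd.
  (* One function of [d] for each pair [(b, x)], hence [k] many; all converge along one unbounded
     set [D] of inaccessibles closed under the bounds of the enumeration. *)
  case: (@wc_normal_closed _ k Hk (prod k k) (Fv k C O e c rd) (app hc)) => //; first by def.
  - exact: wc_square.
  - by exists (pair omega omega); apply/pair_prod; split; exact: wc_omega.
  - move=> i al /in_prod [b [x [bk [xk ->]]]] alk Ial cl; case: (Ial) => -[[oal _] wal] _.
    case: (Fv_cases k C O e c rd b x oal) => [[z [[zd _] ->]]|[_ ->]]; last by apply: ord_trans oal wal _; exact: omega0.
    by apply: card_limit => //; case: Ial => -[].
  move=> D [HD [gD KD]].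
  case: (@choice_map _ (fun i a => exists th, th ε k /\ forall al, al ε D -> th ε al -> Fv k C O e c rd i al = a) (prod k k)) => [|i iX|lm [_ Hlm]].
  - apply: Def_ex; apply: Def_and; first def. apply: Def_all; do 2 (apply: Def_imp; first def). by apply: Def_eq; [apply: (@DTerm_2 _ (Fv k C O e c rd) _ _ DF); def|def].
  - by case: (KD i iX) => th [a K]; exists a, th.
  case: (@choice_map _ (fun i th => th ε k /\ forall al, al ε D -> th ε al -> Fv k C O e c rd i al = app lm i) (prod k k)) => [|i iX|tm [_ Htm]].
  - apply: Def_and; first def. apply: Def_all; do 2 (apply: Def_imp; first def). by apply: Def_eq; [apply: (@DTerm_2 _ (Fv k C O e c rd) _ _ DF); def|def].
  - exact: Hlm.
  have Hl b x : b ε k -> x ε k -> app tm (pair b x) ε k /\ forall d, d ε D -> app tm (pair b x) ε d -> Fv k C O e c rd (pair b x) d = app lm (pair b x).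
    by move=> bk xk; apply: Htm; apply/pair_prod.
  set A := An k C e lm.
  have key := @homogeneous V k C O N S R IT Hk u Hu e hc eC hk He c rd Hrd D lm tm HD gD Hl.
  apply: (fex (x := A) POk); apply/forces_all => a; apply/forces_imp => q qp /(mem_chk POk) Ha.
  apply/forces_all => t; apply/forces_imp => q' qq /(mem_chk POk) Ht; apply/forces_ex => q1 q1q.
  case: (Ha q1 (le_trans POk q1q qq)) => r1 [al [r1q [alk Ka]]]; case: (Ht r1 (le_trans POk r1q q1q)) => r2 [th [r21 [thk Kt]]].
  case: (key r2 al th (le_l r21) alk thk) => r3 [d [r32 [dk [td Hd]]]]; have r3C := le_l r32.
  exists r3, (ck d); split; first exact: (le_trans POk r32 (le_trans POk r21 r1q)).
  apply/forces_and; split; first exact: (chk_in POk).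
  apply/forces_and; split.
    by apply: (mem_congr_l POk (feq_sym (feq_mono POk r32 Kt))); exact: (chk_in POk).
  apply/forces_all => b; apply/forces_imp => s sr Hb.
  have {}Hb := mem_congr_r POk (feq_mono POk (le_trans POk sr (le_trans POk r32 r21)) Ka) Hb; move: Hb => /(mem_chk POk) Hb.
  (* [homogeneous] is about canonical names, whereas [b] is any name of an element of [a]; it is
     decided first, and the statements are then carried over by substitution. *)
  have dec s1 : le k s1 s -> exists s2, le k s2 s1 /\ (((s2 ⊩ b ∈ A) /\ (s2 ⊩ pair_in b (ck d) c)) \/ ((s2 ⊩ ¬ b ∈ A) /\ (s2 ⊩ ¬ pair_in b (ck d) c))).
    move=> s1s; case: (Hb s1 s1s) => s2 [be [s21 [bal Kb]]].
    case: (Hd be bal s2 (le_trans POk s21 (le_trans POk s1s sr))) => s3 [s32 K]; have s3C := le_l s32; have Kb3 := feq_sym (feq_mono POk s32 Kb).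
    have nsub (phi : fml nat) : (s3 ⊩ emb (deep 4 0 phi) (lenv k (cons (ck be) (cons A (cons (ck d) (cons c nil)))))) -> s3 ⊩ emb (deep 4 0 phi) (lenv k (cons b (cons A (cons (ck d) (cons c nil))))).
      by apply: (forces_subst POk); case=> [|n] /=; [exact: Kb3|exact: (feq_refl POk)].
    exists s3; split; first exact: (le_trans POk s32 s21). case: K => -[K1 K2]; [left|right]; split.
    - exact: (nsub (0 ∈ 1) K1).
    - exact: (nsub (pair_in 0 2 3) K2).
    - exact: (nsub (¬ 0 ∈ 1) K1).
    - exact: (nsub (¬ pair_in 0 2 3) K2).
  apply/forces_iff => s1 s1s; have s1C := le_l s1s; split=> H; apply: (forces_dense POk s1C) => s2 s21; case: (dec s2 (le_trans POk s21 s1s)) => s3 [s32 [[K1 K2]|[K1 K2]]].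
  - by exists s3.
  - by case: (forces_con POk (le_l s32) (forces_mono POk (le_trans POk s32 s21) H) K1).
  - by exists s3.
  - by case: (forces_con POk (le_l s32) (forces_mono POk (le_trans POk s32 s21) H) K2).
Qed.

Lemma weakly_compact_forced p : p ε C k -> p ⊩ weakly_compact (ck k).
Proof.
  move=> pC; have Ik := wc_inacc Hk; have POk := it_PO IT Ik (suc_self k).
  (* The canonical name of ω is carried along as a parameter: that it is an element of [k] and is ω
     are bounded facts, and so remain true of the canonical names. *)
  apply: (@transfer _ _ star_wcompW V (C k) (O k) POk p (lenv k (cons (ck k) (cons (ck omega) nil))) pC).
  apply/forces_and; split; last (apply/forces_and; split; last exact: star_forced).
    have [K _] := @bdd_abs V (C k) (O k) POk (deep 1 0 (ordinal 0)) ltac:(by []) (fun _ => k).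
    exact: (K (proj2 (ordinalE k) (wc_ord Hk)) p pC).
  apply/forces_and; split; first by apply: (chk_in POk) => //; exact: wc_omega.
  have [K _] := @bdd_abs V (C k) (O k) POk (deep 1 0 (omega_bdd 0)) ltac:(by repeat split) (fun _ => omega).
  apply: (K _ p pC); have Ho := proj2 (is_omegaE (omega : V)) (eq_refl _).
  move: Ho => /sat_and [/limitE H1 /sat_all H2]; have G : sat (@mem V) eq (omega_bdd (omega : V)); last exact: G.
  apply/sat_and; split; first exact/lim_bddE. apply/sat_all => y; apply/sat_imp => yw; apply/sat_neg => /lim_bddE Hy.
  by move: (H2 y) => /sat_imp /(_ yw) /sat_neg; apply; exact/limitE.
Qed.
End Conclusion.

Theorem theorem3p4 (V : zfc_model) (k f : V)
    (k_wc : models (weakly_compact k))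
    (f_fun : partial_function f k)
    (f_unb : unbounded_domain f k)
    (P : iteration V) (P_lottery : lottery_preparation k f P)
    (G : V -> Prop) (G_generic : generic (cond P k) (order P k) G)
    (k' : V) (k'_name : check_name (cond P k) k' k) :
  ext_models G (weakly_compact k').
Proof.
  have Hk : wcomp k := proj1 (weakly_compactE k) k_wc.
  case: (iter_of (wc_ord Hk) f_fun P_lottery) => C [O [N [S [R [IT [EC EO]]]]]].
  have PO : preorder (cond P k) (order P k) by rewrite -EC -EO; exact: (it_PO IT (wc_inacc Hk) (suc_self k)).
  apply: (proj2 (truth PO G_generic (deep 1 0 (weakly_compact 0)) (lenv k (cons k' nil)))).
  case: (generic_nonempty G_generic) => p Gp; exists p; split=> //.
  have pC : p ε C k by rewrite EC; exact: (generic_sub G_generic Gp).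
  move: (weakly_compact_forced IT Hk pC); rewrite EC EO -(check_chk k'_name); exact.
Qed.
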